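(* Let $n\ge2$ be an integer. For any $\gamma\in(0,1)$ and any $a<\frac12$, $$\|\psi_n^\varepsilon-\psi_n^0\|_{C^{2,\gamma}(\overline{\Pi})}=\mathcal{O}\big(\varepsilon^{(1-\gamma)a}\big)\qquad\text{as }\varepsilon\to0,$$ i.e. there is an $\varepsilon$-independent constant $C_{\gamma,a}$ such that $\|\psi_n^\varepsilon-\psi_n^0\|_{C^{2,\gamma}(\overline{\Pi})}\le C_{\gamma,a}\,\varepsilon^{(1-\gamma)a}$ for all sufficiently small $\varepsilon>0$.
   Context: Let $\mathcal{A}$ be a smooth ($C^\infty$) two-dimensional oriented Riemannian manifold with Gauss curvature $K$. Let $L>0$ and let $\Gamma:[0,L]\to\mathcal{A}$ be a smooth embedded curve parametrised by arc length, $T:=\Gamma'$ its unit tangent field, $\mathbf{N}$ the smooth unit normal field along $\Gamma$ such that $\{T,\mathbf{N}\}$ is positively oriented, and $\kappa$ the curvature of $\Gamma$ defined by $T'=\kappa\mathbf{N}$ (covariant derivative along $\Gamma$). Put $\Pi:=(0,L)\times(-1,1)$ and $\mathscr{L}_\varepsilon(s,t):=\exp_{\Gamma(s)}\big(\varepsilon\,t\,\mathbf{N}(s)\big)$. Let $K_\varepsilon:=K\circ\mathscr{L}_\varepsilon$ and let $f_\varepsilon$ be the solution, for each fixed $s\in[0,L]$ and $t\in[-1,1]$, of $\partial_t^2f_\varepsilon+\varepsilon^2K_\varepsilon f_\varepsilon=0$, $f_\varepsilon(s,0)=1$, $\partial_tf_\varepsilon(s,0)=-\varepsilon\kappa(s)$.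 Only $\varepsilon>0$ so small that $f_\varepsilon$ is bounded from below by a positive constant on $\Pi$ are considered. $H_\varepsilon$ is the self-adjoint operator in $L^2(\Pi,f_\varepsilon\,\mathrm{d}s\,\mathrm{d}t)$ associated with the closed quadratic form $h_\varepsilon[\psi]:=\int_\Pi f_\varepsilon^{-1}|\partial_s\psi|^2+\varepsilon^{-2}\int_\Pi f_\varepsilon|\partial_t\psi|^2$, with domain $W^{1,2}(\Pi)$. Its eigenvalues, in non-decreasing order and repeated according to multiplicity, are $\lambda_1^\varepsilon\le\lambda_2^\varepsilon\le\dots$; for fixed $n$ and all sufficiently small $\varepsilon$, $\lambda_n^\varepsilon$ is simple and $|\lambda_n^\varepsilon-\lambda_n^0|=\mathcal{O}(\varepsilon)$ with $\lambda_n^0=\big(\frac{(n-1)\pi}{L}\big)^2$. For $n\ge2$ put $\psi_n^0(s,t):=\frac{1}{\sqrt L}\cos\frac{(n-1)\pi s}{L}$, which is normalised in $L^2(\Pi)$. $\psi_n^\varepsilon$ denotes a real-valued eigenfunction of $H_\varepsilon$ corresponding to $\lambda_n^\varepsilon$, chosen (in sign and normalisation) so that $\|\psi_n^\varepsilon-\psi_n^0\|_{L^2(\Pi)}=\mathcal{O}(\varepsilon)$ as $\varepsilon\to0$ (such a choice is possible). *)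

(* Defs.v *)
From HB Require Import structures.
From mathcomp Require Import all_boot all_order all_algebra.
From mathcomp Require Import all_classical all_reals all_analysis.

Set Implicit Arguments.
Unset Strict Implicit.
Unset Printing Implicit Defensive.
Import Order.TTheory GRing.Theory Num.Theory numFieldNormedType.Exports.
Local Open Scope classical_set_scope.
Local Open Scope ring_scope.

(* Differentiability classes on an open set.  All directions v are allowed;
   in finite dimension this is the usual C^k defined by partial derivatives. *)
Fixpoint Ck (R : realType) (V : normedModType R) (k : nat) (U : set V)
    (f : V -> R) : Prop :=
  (forall x, U x -> {for x, continuous f}) /\
  (if k is k'.+1 then
     forall v, (forall x, U x -> derivable f x v) /\ Ck k' U ('D_v f)
   else True).

Definition smooth (R : realType) (V : normedModType R) (U : set V)
    (f : V -> R) : Prop := forall k, Ck k U f.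

(* Coordinate expressions: x is a point of R^2 and g the matrix (g_ij). *)
Section Coordinates.
Variable R : realType.
Implicit Types (x : 'rV[R]_2) (g : 'rV[R]_2 -> 'M[R]_2).

Definition pd (i : 'I_2) (f : 'rV[R]_2 -> R) : 'rV[R]_2 -> R :=
  'D_(delta_mx 0 i) f.

(* Row convention: a tangent vector v is pushed forward to v *m jac phi x. *)
Definition jac (phi : 'rV[R]_2 -> 'rV[R]_2) x : 'M[R]_2 :=
  \matrix_(a, b) pd a (fun y => phi y 0 b) x.

(* Gamma^k_{ij} *)
Definition christoffel g (k i j : 'I_2) x : R :=
  2^-1 * \sum_l invmx (g x) k l *
    (pd i (fun y => g y j l) x + pd j (fun y => g y i l) x
     - pd l (fun y => g y i j) x).

(* K = <R(d_0, d_1) d_1, d_0> / det g, with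
   R(X, Y) Z = D_X D_Y Z - D_Y D_X Z - D_[X,Y] Z; positive on round spheres. *)
Definition gauss_coord g x : R :=
  (\sum_l g x 0 l *
     (pd 0 (christoffel g l 1 1) x - pd 1 (christoffel g l 0 1) x
      + \sum_m (christoffel g m 1 1 x * christoffel g l 0 m x
                - christoffel g m 0 1 x * christoffel g l 1 m x)))
  / \det (g x).

End Coordinates.

(* A smooth oriented Riemannian surface, presented by an oriented atlas (not
   necessarily maximal) and the metric coefficients in each chart. *)
Record riemSurface (R : realType) := RiemSurface {
  points :> topologicalType ;
  points_hausdorff : hausdorff_space points ;
  points_second_countable : @second_countable points ;
  chartIndex : Type ;
  dom : chartIndex -> set points ;
  chart : chartIndex -> points -> 'rV[R]_2 ;
  chartV : chartIndex -> 'rV[R]_2 -> points ;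
  gram : chartIndex -> 'rV[R]_2 -> 'M[R]_2 ;
  dom_cover : forall p, exists i, dom i p ;
  dom_open : forall i, open (dom i) ;
  codom_open : forall i, open (chart i @` dom i) ;
  chartK : forall i p, dom i p -> chartV i (chart i p) = p ;
  chart_continuous : forall i p, dom i p -> {for p, continuous (chart i)} ;
  chartV_continuous : forall i x, (chart i @` dom i) x ->
    {for x, continuous (chartV i)} ;
  transition_smooth : forall i j (b : 'I_2),
    smooth (chart i @` (dom i `&` dom j))
           (fun x => chart j (chartV i x) 0 b) ;
  transition_oriented : forall i j x, (chart i @` (dom i `&` dom j)) x ->
    0 < \det (jac (chart j \o chartV i) x) ;
  gram_smooth : forall i (a b : 'I_2),
    smooth (chart i @` dom i) (fun x => gram i x a b) ;
  gram_sym : forall i x, (chart i @` dom i) x ->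
    (gram i x)^T = gram i x ;
  gram_pos : forall i x (v : 'rV[R]_2), (chart i @` dom i) x -> v != 0 ->
    0 < (v *m gram i x *m v^T) 0 0 ;
  gram_transition : forall i j x, (chart i @` (dom i `&` dom j)) x ->
    gram i x = jac (chart j \o chartV i) x
                 *m gram j (chart j (chartV i x))
                 *m (jac (chart j \o chartV i) x)^T
}.

Section SurfaceGeometry.
Variables (R : realType) (A : riemSurface R).
Implicit Types (p : A) (c : R -> A) (s : R) (i : chartIndex A).

(* Components of a tangent vector in the charts; only those in charts around
   the base point are meaningful. *)
Definition tvec : Type := chartIndex A -> 'rV[R]_2.

Definition inner p i (v w : 'rV[R]_2) : R :=
  (v *m gram i (chart i p) *m w^T) 0 0.

(* The value does not depend on the chart selected around p. *)
Definition gaussK p : R :=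
  let i := projT1 (cid (dom_cover p)) in gauss_coord (gram i) (chart i p).

Definition curve_coord c i (k : 'I_2) : R -> R := fun s => chart i (c s) 0 k.

Definition velocity c s : tvec := fun i => \row_k derive1 (curve_coord c i k) s.

(* covariant derivative of the velocity along the curve *)
Definition acceleration c s : tvec := fun i =>
  \row_k (derive1n 2 (curve_coord c i k) s
          + \sum_a \sum_b christoffel (gram i) k a b (chart i (c s))
                          * velocity c s i 0 a * velocity c s i 0 b).

(* Smoothness on [a, b] up to the end points: c is smooth on a larger open
   interval. *)
Definition smooth_curve c (a b : R) : Prop :=
  exists2 d : R, 0 < d &
    let J : set R := [set s | a - d < s < b + d] in
    (forall s, J s -> {for s, continuous c}) /\
    (forall i k, @smooth R R (J `&` c @^-1` dom i) (curve_coord c i k)).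

Definition geodesic c (a b : R) : Prop :=
  smooth_curve c a b /\
  forall s i, a <= s <= b -> dom i (c s) -> acceleration c s i = 0.

(* Exponential map; it has the junk value p when the geodesic with initial
   velocity v does not exist up to time 1. *)
Definition expmap p (v : tvec) : A :=
  xget p [set q | exists c, [/\ geodesic c 0 1, c 0 = p,
    (forall i, dom i p -> velocity c 0 i = v i) & c 1 = q]].

(* By compactness of [a, b], injectivity and unit speed make the curve an
   embedding. *)
Definition embedded_arclength_curve c (a b : R) : Prop :=
  [/\ smooth_curve c a b,
      (forall s s', a <= s <= b -> a <= s' <= b -> c s = c s' -> s = s') &
      (forall s i, a <= s <= b -> dom i (c s) ->
         inner (c s) i (velocity c s i) (velocity c s i) = 1)].

Definition unit_normal_field c (a b : R) (N : R -> tvec) : Prop :=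
  forall s i, a <= s <= b -> dom i (c s) ->
    let T := velocity c s i in
    [/\ inner (c s) i (N s i) (N s i) = 1, inner (c s) i T (N s i) = 0 &
        0 < T 0 0 * N s i 0 1 - T 0 1 * N s i 0 0].

Definition curvature_along c (a b : R) (N : R -> tvec) (kappa : R -> R) :
    Prop :=
  forall s i, a <= s <= b -> dom i (c s) ->
    acceleration c s i = kappa s *: N s i.

Definition strip_map c (N : R -> tvec) (eps : R) (st : R * R) : A :=
  expmap (c st.1) (fun i => (eps * st.2) *: N st.1 i).

Definition Keps c N eps (st : R * R) : R := gaussK (strip_map c N eps st).

(* The equation on the open interval and continuity on [-1, 1] determine the
   solution on [-1, 1]; it is then C^2 up to the end points. *)
Definition is_jacobi_density c (L : R) N (kappa : R -> R) (eps : R)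
    (f : R * R -> R) : Prop :=
  forall s, 0 <= s <= L ->
    let y : R -> R := fun t => f (s, t) in
    [/\ {within `[-1, 1], continuous y},
        (forall t : R, -1 < t < 1 ->
           [/\ derivable y t 1, derivable (derive1 y) t 1 &
               derive1n 2 y t + eps ^+ 2 * Keps c N eps (s, t) * y t = 0]),
        y 0 = 1 & derive1 y 0 = - (eps * kappa s)].

End SurfaceGeometry.

Section Strip.
Variables (R : realType) (L : R).

Definition strip : set (R * R) := [set p | 0 < p.1 < L /\ -1 < p.2 < 1].

Definition leb2 := ((@lebesgue_measure R) \x (@lebesgue_measure R))%E.

Definition e1 : R * R := (1, 0).
Definition e2 : R * R := (0, 1).

(* L^2(strip, w ds dt); functions are representatives, compared almost
   everywhere on the strip. *)
Definition L2w (w u : R * R -> R) : Prop :=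
  measurable_fun strip u /\
  leb2.-integrable strip (fun p => (w p * u p ^+ 2)%:E).

Definition L2 : (R * R -> R) -> Prop := L2w (cst 1).

Definition ae_eq_strip (u v : R * R -> R) : Prop :=
  {ae leb2, forall p, strip p -> u p = v p}.

Definition L2norm (u : R * R -> R) : R :=
  Num.sqrt (\int[leb2]_(p in strip) u p ^+ 2).

Definition test_function (phi : R * R -> R) : Prop :=
  smooth setT phi /\
  exists2 C : set (R * R), compact C /\ C `<=` strip &
    forall p, ~ C p -> phi p = 0.

Definition is_weak_derivative (v : R * R) (u w : R * R -> R) : Prop :=
  L2 w /\ forall phi, test_function phi ->
    \int[leb2]_(p in strip) (u p * 'D_v phi p)
    = - \int[leb2]_(p in strip) (w p * phi p).

Definition W12 (u : R * R -> R) : Prop :=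
  [/\ L2 u, exists w, is_weak_derivative e1 u w
          & exists w, is_weak_derivative e2 u w].

(* a representative of the weak derivative in the direction v *)
Definition weakD (v : R * R) (u : R * R -> R) : R * R -> R :=
  xget (cst 0) [set w | is_weak_derivative v u w].

(* The symmetric form whose diagonal is the quadratic form h_eps. *)
Definition hform (f : R * R -> R) (eps : R) (u v : R * R -> R) : R :=
  \int[leb2]_(p in strip) ((f p)^-1 * (weakD e1 u p * weakD e1 v p))
  + eps ^- 2 * \int[leb2]_(p in strip) (f p * (weakD e2 u p * weakD e2 v p)).

(* Graph of the self-adjoint operator associated with the form (first
   representation theorem): u is in its domain and is mapped to eta. *)
Definition Hgraph (f : R * R -> R) (eps : R) (u eta : R * R -> R) : Prop :=
  [/\ W12 u, L2w f eta &
      forall v, W12 v ->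
        hform f eps v u = \int[leb2]_(p in strip) (f p * (v p * eta p))].

Definition eigenspace_H f eps (mu : R) : set (R * R -> R) :=
  [set u | Hgraph f eps u (fun p => mu * u p)].

Definition eigenfunction f eps (mu : R) (u : R * R -> R) : Prop :=
  eigenspace_H f eps mu u /\ ~ ae_eq_strip u (cst 0).

(* mu has multiplicity m, i.e. its eigenspace has a basis with m elements;
   m = 0 when mu is not an eigenvalue. *)
Definition multiplicity f eps (mu : R) (m : nat) : Prop :=
  exists b : 'I_m -> (R * R -> R),
    [/\ forall k, eigenspace_H f eps mu (b k),
        (forall a : 'I_m -> R,
           ae_eq_strip (fun p => \sum_k a k * b k p) (cst 0) ->
           forall k, a k = 0) &
        (forall u, eigenspace_H f eps mu u ->
           exists a : 'I_m -> R, ae_eq_strip u (fun p => \sum_k a k * b k p))].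

(* lam 0 <= lam 1 <= ... lists all eigenvalues, repeated according to
   multiplicity. *)
Definition eigenvalue_sequence f eps (lam : nat -> R) : Prop :=
  (forall j k, (j <= k)%N -> lam j <= lam k) /\
  (forall mu, exists2 m, multiplicity f eps mu m &
                         ([set k | lam k = mu] #= `I_m)%card).

Definition psi0 (n : nat) : R * R -> R := fun p =>
  (Num.sqrt L)^-1 * cos ((n.-1)%:R * pi * p.1 / L).

Definition partials1 (u : R * R -> R) : seq (R * R -> R) :=
  [:: 'D_e1 u; 'D_e2 u].
Definition partials2 (u : R * R -> R) : seq (R * R -> R) :=
  [:: 'D_e1 ('D_e1 u); 'D_e1 ('D_e2 u); 'D_e2 ('D_e2 u)].

(* C^2 on the open strip, with all derivatives of order at most 2 extending
   continuously to its closure *)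
Definition C2_closure (u : R * R -> R) : Prop :=
  Ck 2 strip u /\
  forall w, w \in u :: partials1 u ++ partials2 u ->
    exists g : R * R -> R,
      {within closure strip, continuous g} /\ (forall p, strip p -> g p = w p).

Definition sup_norm (w : R * R -> R) : \bar R :=
  ereal_sup [set `|w p|%:E | p in strip].

Definition holder_seminorm (gamma : R) (w : R * R -> R) : \bar R :=
  ereal_sup [set x | exists p q, [/\ strip p, strip q, p <> q &
    x = (`|w p - w q|
         / Num.sqrt ((p.1 - q.1) ^+ 2 + (p.2 - q.2) ^+ 2) `^ gamma)%:E]].

Definition C2holder_norm (gamma : R) (u : R * R -> R) : \bar R :=
  (\sum_(w <- u :: partials1 u ++ partials2 u) sup_norm w
   + \sum_(w <- partials2 u) holder_seminorm gamma w)%E.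

End Strip.

(* Main.v *)
(* In Fermi coordinates f_eps(s, t) = G(s, eps t) with a single smooth density G
   such that G(s, 0) = 1.  Hence f_eps - 1, 1 / f_eps - 1, d_s (1 / f_eps) and
   d_t f_eps are O(eps) in the algebra of absolutely convergent cosine series
   sum c_jk cos (j pi s / L) cos (k pi (t + 1) / 2) with the weights (1 + j + k)^gamma.
   These cosines are the eigenfunctions for f = 1, with the eigenvalues
   D_jk = (j pi / L)^2 + (k pi / (2 eps))^2, and on the series the difference of the
   two operators is O(eps) relative to 1 + D.  The eigenvalue D_(n-1, 0) is separated
   from the others by a multiple of 1 + D_jk, so a Neumann series gives an
   approximate eigenfunction psi_n^0 + x with sum (1 + D_jk) (1 + j + k)^gamma |x_jk|
   = O(eps); by symmetry psi_n^eps has, up to a factor, the same coefficients.  This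
   weighted sum controls the C^{2,gamma} norm of psi_n^eps - psi_n^0, which is
   therefore even O(eps). *)
Require Import Defs.
From HB Require Import structures.
From mathcomp Require Import all_boot all_order all_algebra.
From mathcomp Require Import all_classical all_reals all_analysis.
Import Order.TTheory GRing.Theory Num.Theory numFieldNormedType.Exports.
Local Open Scope classical_set_scope.
Local Open Scope ring_scope.
From mathcomp Require Import measurable_realfun.
From mathcomp Require Import ring lra zify.

Set Implicit Arguments.
Unset Strict Implicit.
Unset Printing Implicit Defensive.

(** * Directional derivatives, mean values and the chain rule *)

Section DirectionalDerivatives.
Context {R : realType}.
Implicit Types (V : normedModType R).

(** The eigenfunction is only a weak solution of an equation that degenerates as eps tends to 0, so
    regularity must come from estimates uniform in eps. The cosines have zero normal derivative:
    tested with them, the eigenvalue equation integrates by parts without boundary terms, and all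
    regularity is read off from relations between coefficients. The obstacle is that first-order
    terms turn cosines into sines. On an interval sin (j x) has a cosine series of norm at most C j
    times the weight, as gamma < 1; differentiation brings a second factor j, and j^2 is still of
    the size of D_jk. The density G is a component of the flow of an autonomous system in R^6, the
    geodesic and Jacobi equations in a chart. This calls for flows depending smoothly on initial
    values, for uniqueness of geodesics, since [expmap] is a choice, and for invariance of the
    curvature, since [gaussK] picks a chart. Membership in the algebra means uniform approximation
    by finite lists of bounded norm, and psi_n^eps is compared with the approximate eigenvector by
    duality, through its integrals against the modes. *)

Lemma nbhs0P (P : R -> Prop) :
  (\forall h \near (0 : R), P h) <->
  exists2 d : R, 0 < d & forall h, `|h| < d -> P h.
Proof.
split=> [/nbhs_ballP[d /= d0 H]|[d d0 H]].
  by exists d => // h hd; apply: H; rewrite /ball /= sub0r normrN.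
by apply/nbhs_ballP; exists d => //= h; rewrite /ball /= sub0r normrN => /H.
Qed.

Lemma nbhs_ball_norm V (x : V) (P : V -> Prop) :
  (\forall y \near x, P y) <->
  exists2 d : R, 0 < d & forall y, `|y - x| < d -> P y.
Proof.
split=> [/nbhs_normP[d /= d0 H]|[d d0 H]].
  by exists d => // h hd; apply: H; rewrite /ball_ /= distrC.
by apply/nbhs_normP; exists d => //= h; rewrite /ball_ /= distrC => /H.
Qed.

(** The limit of quotients is traded for an estimate of increments, so that [h = 0] is no exception
    and error terms can simply be added. *)
Lemma is_derive_epsP V (f : V -> R) x v (d : R) :
  is_derive x v f d <->
  forall e : R, 0 < e -> exists2 r : R, 0 < r &
    forall h : R, `|h| < r -> `|f (h *: v + x) - f x - h * d| <= e * `|h|.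
Proof.
split=> [fd e e0|H].
  have /@derivable_nbhs := @ex_derive _ _ _ _ _ _ _ fd.
  rewrite derive_val => /eqaddoP /(_ e e0) /nbhs0P[r r0 H].
  exists r => // h /H /=.
  by rewrite -!/((_ + _) _) /= opprD addrA.
have df : (fun h => h^-1 *: ((f \o shift x) (h *: v) - f x)) @ 0^' --> d.
  apply/cvgrPdist_le => e e0; have [r r0 {}H] := H _ e0.
  rewrite near_withinE; apply/nbhs0P; exists r => // h hr h0.
  have := H _ hr; rewrite distrC => Hh.
  rewrite -(ler_pM2r (_ : 0 < `|h|)) ?normr_gt0// -normrM mulrBl.
  rewrite [_ *: _]mulrC mulfVK//= distrC [X in _ - X]mulrC.
  by rewrite distrC.
apply: DeriveDef; first exact: (cvgP d).
exact: (cvg_lim (@norm_hausdorff _ _) df).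
Qed.

Lemma is_derive_ex V (f : V -> R) x v (d : R) : is_derive x v f d -> derivable f x v.
Proof. by case. Qed.

Lemma is_derive_val V (f : V -> R) x v (d : R) : is_derive x v f d -> 'D_v f x = d.
Proof. by case. Qed.

Lemma is_deriveZdir V (f : V -> R) x v (a d : R) :
  is_derive x v f d -> is_derive x (a *: v) f (a * d).
Proof.
move=> /is_derive_epsP H; apply/is_derive_epsP => e e0.
have a1 : 0 < `|a| + 1 by rewrite ltr_wpDl.
have [r r0 {}H] := H (e / (`|a| + 1)) (divr_gt0 e0 a1).
exists (r / (`|a| + 1)); first exact: divr_gt0.
move=> h; rewrite ltr_pdivlMr// => hr.
rewrite scalerA mulrA; apply: le_trans (H _ _) _.
  by rewrite normrM (le_lt_trans _ hr)// ler_wpM2l// lerDl.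
rewrite normrM -mulrA ler_wpM2l ?(ltW e0)// ler_pdivrMl// mulrC.
by rewrite ler_wpM2r// lerDl.
Qed.

Lemma is_derive_line V (f : V -> R) x v t d :
  is_derive (t *: v + x) v f d ->
  is_derive t 1 (fun h : R => f (h *: v + x)) d.
Proof.
move=> /is_derive_epsP H; apply/is_derive_epsP => e /H[r r0 {}H].
by exists r => // h /H; rewrite addrA -scalerDl [h%:A]mulr1.
Qed.

Lemma is_derive_continuous_line V (f : V -> R) x v d (e : R) : 0 < e ->
  is_derive x v f d ->
  exists2 r : R, 0 < r & forall h : R, `|h| < r -> `|f (h *: v + x) - f x| <= e.
Proof.
move=> e0 /is_derive_epsP /(_ 1 ltr01)[r r0 H].
have d1 : 0 < `|d| + 1 by rewrite ltr_wpDl.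
exists (Num.min r (e / (`|d| + 1))); first by rewrite lt_min r0 divr_gt0.
move=> h; rewrite lt_min => /andP[/H {}H].
rewrite ltr_pdivlMr// => he.
rewrite -(subrK (h * d) (f _ - f x)); apply: le_trans (ler_normD _ _) _.
rewrite normrM; nra.
Qed.

Definition e_ n (i : 'I_n) : 'rV[R]_n := delta_mx 0 i.

Lemma mx_norm_coord n (y : 'rV[R]_n) i : `|y 0 i| <= `|y|.
Proof.
rewrite [leRHS]/Num.Def.normr/= mx_normrE.
exact: (le_bigmax _ (fun ij : 'I_1 * 'I_n => `|y ij.1 ij.2|) (0, i)).
Qed.

Lemma mx_norm_le n (y : 'rV[R]_n) (d : R) : 0 <= d ->
  (forall i, `|y 0 i| <= d) -> `|y| <= d.
Proof.
move=> d0 H; rewrite [leLHS]/Num.Def.normr/= mx_normrE bigmax_le//.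
by move=> [i j] _ /=; rewrite ord1.
Qed.

Lemma mx_norm_lt n (y : 'rV[R]_n) (d : R) : 0 < d ->
  (forall i, `|y 0 i| < d) -> `|y| < d.
Proof.
move=> d0 H; rewrite [ltLHS]/Num.Def.normr/= mx_normrE bigmax_lt//.
by move=> [i j] _ /=; rewrite ord1.
Qed.

Lemma mvt_line V (f : V -> R) (df : V -> R) (x v : V) :
  (forall t : R, 0 <= t <= 1 -> is_derive (t *: v + x) v f (df (t *: v + x))) ->
  exists2 t : R, 0 <= t <= 1 & f (v + x) - f x = df (t *: v + x).
Proof.
move=> H.
have D (t : R) : t \in `]0, 1[ ->
    is_derive t 1 (fun h : R => f (h *: v + x)) (df (t *: v + x)).
  rewrite in_itv/= => /andP[t0 t1].
  by apply: is_derive_line; apply: H; rewrite !ltW.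
have C : {within `[0, 1], continuous (fun h : R => f (h *: v + x))}.
  apply: derivable_within_continuous => t; rewrite in_itv /= => t01.
  exact: is_derive_ex (is_derive_line (H t t01)).
have [t] := MVT_segment ler01 D C.
by rewrite in_itv/= scale1r scale0r add0r subr0 mulr1; exists t.
Qed.

Lemma conv_lt (t A B d : R) : 0 <= t <= 1 -> A < d -> B < d ->
  t * A + (1 - t) * B < d.
Proof.
move=> /andP[t0 t1] Ad Bd; have [AB|/ltW AB] := leP A B.
  by apply: le_lt_trans Bd; nra.
by apply: le_lt_trans Ad; nra.
Qed.

(* The increment is split along the coordinates; the intermediate points stay
   in every sup-norm ball containing both end points. *)
Lemma mvt_box n (f : 'rV[R]_n -> R) c d y y' :
  (forall z i, `|z - c| < d -> derivable f z (e_ i)) ->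
  `|y - c| < d -> `|y' - c| < d ->
  exists2 xi : 'I_n -> 'rV[R]_n, (forall i, `|xi i - c| < d) &
    f y - f y' = \sum_i 'D_(e_ i) f (xi i) * (y 0 i - y' 0 i).
Proof.
move=> df yd y'd.
have d0 : 0 < d by apply: le_lt_trans yd.
pose z k : 'rV[R]_n := \row_i (if (i < k)%N then y 0 i else y' 0 i).
have step (i : 'I_n) (t : R) : 0 <= t <= 1 ->
    `|t *: ((y 0 i - y' 0 i) *: e_ i) + z i - c| < d.
  move=> /andP[t0 t1]; apply: mx_norm_lt => // j; rewrite !mxE.
  have yj := le_lt_trans (mx_norm_coord (y - c) j) yd.
  have y'j := le_lt_trans (mx_norm_coord (y' - c) j) y'd.
  rewrite !mxE in yj y'j.
  rewrite eqxx /=; case: (eqVneq j i) => [ji|_].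
    rewrite ji in yj y'j *; rewrite ltnn /= mulr1.
    move: yj y'j; rewrite !ltr_norml => /andP[a1 a2] /andP[b1 b2].
    have := conv_lt (t := t) _ a2 b2; rewrite t0 t1 => /(_ isT) ?.
    have := conv_lt (t := t) (A := - (y 0 i - c 0 i)) (B := - (y' 0 i - c 0 i)) (d := d).
    by rewrite t0 t1 ![in _ < d -> _]ltrNl => /(_ isT a1 b1) ?; apply/andP; split; lra.
  by rewrite !mulr0 add0r; case: ifP.
have ex (i : 'I_n) : {xi | `|xi - c| < d &
    f (z i.+1) - f (z i) = 'D_(e_ i) f xi * (y 0 i - y' 0 i)}.
  apply/cid2.
  have [|t t01 E] := @mvt_line _ f (fun w => (y 0 i - y' 0 i) * 'D_(e_ i) f w)
     (z i) ((y 0 i - y' 0 i) *: e_ i).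
    by move=> t t01; apply/is_deriveZdir/derivableP/df/step.
  exists (t *: ((y 0 i - y' 0 i) *: e_ i) + z i); first exact: step.
  rewrite mulrC -E; congr (f _ - _); apply/rowP => j; rewrite !mxE eqxx /=.
  rewrite ltnS leq_eqVlt; case: (eqVneq j i) => [->|ji].
    by rewrite eqxx /= ltnn mulr1 subrK.
  by rewrite (negbTE (_ : val j != val i))// mulr0 add0r.
exists (fun i => s2val (ex i)) => [i|]; first exact: (s2valP (ex i)).
transitivity (\sum_(i < n) (f (z i.+1) - f (z i))).
  rewrite -(big_mkord xpredT (fun k => f (z k.+1) - f (z k))) telescope_sumr//.
  congr (f _ - f _); apply/rowP => j; rewrite !mxE ?ltn_ord//.
by apply: eq_bigr => i _; exact: (s2valP' (ex i)).
Qed.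

Lemma ball_sub_open V (U : set V) x : open U -> U x ->
  exists2 d : R, 0 < d & forall y, `|y - x| < d -> U y.
Proof.
by move=> oU Ux; apply/nbhs_ball_norm; exact: open_nbhs_nbhs (conj oU Ux).
Qed.

(** [g] is differentiable only at [x] and only in the direction [v]. Continuity of the partials of
    [f] compensates: [mvt_box] writes the increment of [f] with partials at points near [g x], and
    these are then replaced by the partials at [g x]. *)
Lemma chain_rule n V (f : 'rV[R]_n -> R) (U : set 'rV[R]_n) (g : V -> 'rV[R]_n)
  x v (dg : 'I_n -> R) : open U -> U (g x) ->
  (forall y i, U y -> derivable f y (e_ i)) ->
  (forall i, {for g x, continuous ('D_(e_ i) f)}) ->
  (forall i, is_derive x v (fun y => g y 0 i) (dg i)) ->
  is_derive x v (f \o g) (\sum_i 'D_(e_ i) f (g x) * dg i).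
Proof.
move=> oU Ugx df cf dgx; apply/is_derive_epsP => e e0.
(* [K] bounds the derivatives of [g] and, with a reserve of 1, the partials of [f] near [g x]. Each
   coordinate then contributes at most [2 * K * e' * |h|], which dictates [e']. *)
pose K : R := 1 + \sum_i (`|dg i| + `|'D_(e_ i) f (g x)|).
have Ki i : `|dg i| + `|'D_(e_ i) f (g x)| + 1 <= K.
  rewrite /K (bigD1 i)//= [leLHS]addrC lerD2l lerDl; apply: sumr_ge0 => j _; exact: addr_ge0.
have K1 : 1 <= K by rewrite lerDl; apply: sumr_ge0 => j _; exact: addr_ge0.
have n0 : 0 < n%:R + 1 :> R by rewrite ltr_wpDl.
pose e' := Num.min 1 (e / (2 * K * (n%:R + 1))).
have e'0 : 0 < e' by rewrite lt_min ltr01 divr_gt0// !mulr_gt0// (lt_le_trans _ K1).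
have [d0 d00 Ud0] := ball_sub_open oU Ugx.
have [d1 d10 Hd1] : exists2 d : R, 0 < d & forall y i, `|y - g x| < d ->
    `|'D_(e_ i) f y - 'D_(e_ i) f (g x)| <= e'.
  have : \forall y \near g x, forall i, `|'D_(e_ i) f y - 'D_(e_ i) f (g x)| <= e'.
    apply: (@filter_forall _ _ _ (nbhs (g x))) => i.
    have /cvgrPdist_le /(_ e' e'0) := cf i.
    by apply: filterS => y; rewrite distrC.
  by move=> /nbhs_ball_norm[d ? H]; exists d => // y i /H.
pose dd := Num.min d0 d1.
have dd0 : 0 < dd by rewrite lt_min d00.
have [r r0 Hr] : exists2 r : R, 0 < r & forall h i, `|h| < r ->
    `|g (h *: v + x) 0 i - g x 0 i - h * dg i| <= e' * `|h| /\
    `|g (h *: v + x) 0 i - g x 0 i| <= dd / 2.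
  have : \forall h \near (0 : R), forall i,
     `|g (h *: v + x) 0 i - g x 0 i - h * dg i| <= e' * `|h| /\
    `|g (h *: v + x) 0 i - g x 0 i| <= dd / 2.
    apply: (@filter_forall _ _ _ (nbhs (0 : R))) => i; apply/nbhs0P.
    have [r1 r10 H1] := (is_derive_epsP _ _ _ _).1 (dgx i) _ e'0.
    have dd2 : 0 < dd / 2 by rewrite divr_gt0.
    have [r2 r20 H2] := is_derive_continuous_line dd2 (dgx i).
    exists (Num.min r1 r2); first by rewrite lt_min r10.
    by move=> h; rewrite lt_min => /andP[/H1 ? /H2 ?]; split.
  by move=> /nbhs0P[r ? H]; exists r => // h i /H.
exists r => // h hr /=.
have gh : `|g (h *: v + x) - g x| < dd.
  apply: mx_norm_lt => // i; rewrite !mxE.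
  apply: le_lt_trans ((Hr h i hr).2) _; rewrite ltr_pdivrMr// ltr_pMr//; lra.
have [z i zd|||xi Hxi ->] := @mvt_box n f (g x) dd (g (h *: v + x)) (g x).
- by apply: df; apply: Ud0; apply: lt_le_trans zd _; rewrite ge_min lexx.
- by [].
- by rewrite subrr normr0.
rewrite mulr_sumr -sumrB; apply: le_trans (ler_norm_sum _ _ _) _.
apply: (@le_trans _ _ (\sum_(i < n) (2 * K * e' * `|h|))); last first.
  rewrite sumr_const card_ord -mulr_natr.
  have : e' <= e / (2 * K * (n%:R + 1)) by rewrite ge_min lexx orbT.
  rewrite ler_pdivlMr ?mulr_gt0// ?(lt_le_trans _ K1)// => He.
  have h0 := normr_ge0 h.
  have nn : 0 <= n%:R :> R by [].
  have : e' * (2 * K * n%:R) <= e.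
    apply: le_trans He; rewrite ler_wpM2l ?(ltW e'0)// ler_wpM2l ?lerDl//.
    by rewrite mulr_ge0// (le_trans _ K1).
  by move=> He2; have := ler_wpM2r h0 He2; lra.
apply: ler_sum => i _.
have [A1 _] := Hr h i hr.
have A2 : `|'D_(e_ i) f (xi i) - 'D_(e_ i) f (g x)| <= e'.
  by apply: Hd1; apply: lt_le_trans (Hxi i) _; rewrite ge_min lexx orbT.
have e'1 : e' <= 1 by rewrite ge_min lexx.
rewrite [X in `|X|](_ : _ =
  'D_(e_ i) f (xi i) * (g (h *: v + x) 0 i - g x 0 i - h * dg i)
  + ('D_(e_ i) f (xi i) - 'D_(e_ i) f (g x)) * (h * dg i)); last by ring.
apply: le_trans (ler_normD _ _) _; rewrite !normrM.
have h0 := normr_ge0 h.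
have A3 : `|'D_(e_ i) f (xi i)| <= K.
  rewrite -(subrK ('D_(e_ i) f (g x)) ('D_(e_ i) f (xi i))).
  apply: le_trans (ler_normD _ _) _; apply: le_trans (Ki i).
  have := normr_ge0 (dg i); lra.
have A4 : `|dg i| <= K by apply: le_trans (Ki i); rewrite -addrA lerDl.
have B1 := ler_pM (normr_ge0 _) (normr_ge0 _) A3 A1.
have B2 : `|'D_(e_ i) f (xi i) - 'D_(e_ i) f (g x)| * (`|h| * `|dg i|)
    <= e' * (`|h| * K).
  by apply: ler_pM => //; exact: ler_wpM2l.
apply: le_trans (lerD B1 B2) _; lra.
Qed.

End DirectionalDerivatives.

(** * Differentiation rules in a fixed direction *)

Section DerivativeRules.
Context {R : realType} {V : normedModType R}.
Implicit Types (f g : V -> R) (x v : V).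

Lemma is_derive_lineP f x v (d : R) :
  is_derive x v f d <-> is_derive (0 : R) 1 (fun h : R => f (h *: v + x)) d.
Proof.
split=> [H|/is_derive_epsP H].
  by apply: is_derive_line; rewrite scale0r add0r.
apply/is_derive_epsP => e /H[r r0 {}H]; exists r => // h /H.
by rewrite addr0 [h%:A]mulr1 scale0r add0r.
Qed.

Lemma is_derive_cst_fun (c : R) x v : is_derive x v (fun _ : V => c) 0.
Proof. exact: is_derive_cst. Qed.

Lemma is_derive_add f g x v (df dg : R) : is_derive x v f df ->
  is_derive x v g dg -> is_derive x v (fun y => f y + g y) (df + dg).
Proof. by move=> ? ?; exact: is_deriveD. Qed.

Lemma is_derive_opp f x v (df : R) : is_derive x v f df ->
  is_derive x v (fun y => - f y) (- df).
Proof. by move=> ?; exact: is_deriveN. Qed.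

Lemma is_derive_sub f g x v (df dg : R) : is_derive x v f df ->
  is_derive x v g dg -> is_derive x v (fun y => f y - g y) (df - dg).
Proof. by move=> ? ?; exact: is_deriveB. Qed.

Lemma is_derive_mul f g x v (df dg : R) : is_derive x v f df ->
  is_derive x v g dg -> is_derive x v (fun y => f y * g y) (df * g x + f x * dg).
Proof.
move=> ? ?; rewrite (_ : _ + _ = f x *: dg + g x *: df); first exact: is_deriveM.
by rewrite addrC [df * _]mulrC.
Qed.

Lemma is_derive_scale (c : R) f x v (df : R) : is_derive x v f df ->
  is_derive x v (fun y => c * f y) (c * df).
Proof.
move=> /(is_derive_mul (is_derive_cst_fun c x v)); by rewrite mul0r add0r.
Qed.

Lemma is_derive_inv f x v (df : R) : f x != 0 -> is_derive x v f df ->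
  is_derive x v (fun y => (f y)^-1) (- df / f x ^+ 2).
Proof.
move=> fx df'; apply: DeriveDef.
  by apply: derivableV => //; exact: is_derive_ex df'.
by rewrite deriveV// (is_derive_val df') [LHS]mulrC mulrN mulNr.
Qed.

Lemma is_derive_comp1 (h : R -> R) f x v (dh df : R) :
  is_derive (f x) 1 h dh -> is_derive x v f df ->
  is_derive x v (fun y => h (f y)) (dh * df).
Proof.
move=> Hh /is_derive_lineP Hf; apply/is_derive_lineP.
have Hh' : is_derive (f (0 *: v + x)) 1 h dh by rewrite scale0r add0r.
exact: (@is_derive1_comp _ h (fun t : R => f (t *: v + x)) 0).
Qed.

Lemma is_derive_sum_seq (I : Type) (r : seq I) (F : I -> V -> R) (dF : I -> R) x v :
  (forall i, is_derive x v (F i) (dF i)) ->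
  is_derive x v (fun y => \sum_(i <- r) F i y) (\sum_(i <- r) dF i).
Proof.
move=> H; elim: r => [|i r IH].
  rewrite big_nil [X in is_derive _ _ X](_ : _ = fun=> 0).
    exact: is_derive_cst_fun.
  by apply/funext => y; rewrite big_nil.
rewrite big_cons [X in is_derive _ _ X](_ : _ = fun y => F i y + \sum_(j <- r) F j y).
  exact: is_derive_add.
by apply/funext => y; rewrite big_cons.
Qed.

Lemma is_derive_linear f x v : (forall (a : R) u w, f (a *: u + w) = a * f u + f w) ->
  is_derive x v f (f v).
Proof.
move=> fl; apply/is_derive_epsP => e e0; exists 1 => // h _.
by rewrite fl addrK subrr normr0 mulr_ge0// ltW.
Qed.

End DerivativeRules.

(** * Closure properties of the classes C^k *)

Section CkCalculus.
Context {R : realType}.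
Implicit Types (V : normedModType R) (k : nat).

Lemma Ck_continuous V k (U : set V) (f : V -> R) x :
  Ck k U f -> U x -> {for x, continuous f}.
Proof. by case: k => [|k] [H _]; exact: H. Qed.

Lemma Ck_is_derive V k (U : set V) (f : V -> R) x v :
  Ck k.+1 U f -> U x -> is_derive x v f ('D_v f x).
Proof. by move=> [_ H] Ux; apply/derivableP; exact: (H v).1. Qed.

Lemma Ck_derive V k (U : set V) (f : V -> R) v : Ck k.+1 U f -> Ck k U ('D_v f).
Proof. by move=> [_ /(_ v)[]]. Qed.

Lemma Ck_pred V k (U : set V) (f : V -> R) : Ck k.+1 U f -> Ck k U f.
Proof.
elim: k f => [|k IH] f [fc H]; first by split.
split=> // v; split; first exact: (H v).1.
by apply: IH; exact: (H v).2.
Qed.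

Lemma Ck_le V k l (U : set V) (f : V -> R) : (k <= l)%N -> Ck l U f -> Ck k U f.
Proof.
move=> /subnK <-; elim: (l - k)%N => [//|m IH].
by rewrite addSn => /Ck_pred.
Qed.

(** ['D_v] is taken in the whole space and the set only says where the conditions are imposed; hence
    the sets [W] may be arbitrary and depend on the point. *)
Lemma Ck_local V k (U : set V) (f : V -> R) :
  (forall x, U x -> exists2 W : set V, W x & Ck k W f) -> Ck k U f.
Proof.
elim: k f => [|k IH] f H.
  by split=> // x /H[W Wx [+ _]]; exact.
split=> [x /H[W Wx [+ _]]|v]; first exact.
split=> [x /H[W Wx [_ /(_ v)[+ _]]]|]; first exact.
by apply: IH => x /H[W Wx HW]; exists W => //; exact: Ck_derive.
Qed.

Lemma Ck_sub V k (U W : set V) (f : V -> R) : W `<=` U -> Ck k U f -> Ck k W f.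
Proof. by move=> WU H; apply: Ck_local => x /WU Ux; exists U. Qed.

Lemma continuous_near_eq V (f g : V -> R) x : (\near x, f x = g x) ->
  {for x, continuous f} -> {for x, continuous g}.
Proof.
move=> fg; rewrite /prop_for /continuous_at -(nbhs_singleton fg).
exact: cvg_trans (near_eq_cvg fg).
Qed.

Lemma Ck_eq V k (U : set V) (f g : V -> R) : open U ->
  (forall x, U x -> f x = g x) -> Ck k U f -> Ck k U g.
Proof.
move=> oU fg.
have nfg (f' g' : V -> R) : (forall x, U x -> f' x = g' x) -> forall x, U x -> \near x, f' x = g' x.
  by move=> fg' x Ux; apply: filterS (open_nbhs_nbhs (conj oU Ux)) => y /fg'.
elim: k f g fg => [|k IH] f g fg [fc Hf].
  by split=> // x Ux; apply: continuous_near_eq (fc _ Ux); exact: nfg.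
split=> [x Ux|v].
  by apply: continuous_near_eq (fc _ Ux); exact: nfg.
split=> [x Ux|].
  by apply: near_eq_derivable (nfg _ _ fg _ Ux) _; exact: (Hf v).1.
apply: IH (Hf v).2 => x Ux; exact: near_eq_derive (nfg _ _ fg _ Ux).
Qed.

(* For an open U, C^{k+1} functions are those with C^k directional derivatives,
   given by any formula. *)
Lemma Ck_intro V k (U : set V) (f : V -> R) (df : V -> V -> R) : open U ->
  (forall x, U x -> {for x, continuous f}) ->
  (forall x v, U x -> is_derive x v f (df v x)) ->
  (forall v, Ck k U (df v)) -> Ck k.+1 U f.
Proof.
move=> oU fc Df Cdf; split=> // v; split=> [x Ux|].
  exact: is_derive_ex (Df x v Ux).
by apply: Ck_eq (Cdf v) => // x Ux; rewrite (is_derive_val (Df x v Ux)).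
Qed.

Lemma Ck_cst V k (U : set V) (c : R) : open U -> Ck k U (fun=> c).
Proof.
move=> oU; elim: k c => [|k IH] c.
  by split=> // x _; exact: cst_continuous.
apply: (@Ck_intro _ _ _ _ (fun _ _ => 0)) => // x _.
exact: cst_continuous.
Qed.

Lemma Ck_linear V k (U : set V) (f : V -> R) : open U -> continuous f ->
  (forall (a : R) u w, f (a *: u + w) = a * f u + f w) -> Ck k U f.
Proof.
move=> oU fc fl; case: k => [|k].
  by split=> // x _; exact: fc.
apply: (@Ck_intro _ _ _ _ (fun v _ => f v)) => // [x _|x v _|v].
- exact: fc.
- exact: is_derive_linear.
- exact: Ck_cst.
Qed.

Lemma CkD V k (U : set V) (f g : V -> R) : open U -> Ck k U f -> Ck k U g ->
  Ck k U (fun x => f x + g x).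
Proof.
move=> oU; elim: k f g => [|k IH] f g Hf Hg.
  by split=> // x Ux; apply: continuousD; [exact: Ck_continuous Hf Ux|exact: Ck_continuous Hg Ux].
apply: (@Ck_intro _ _ _ _ (fun v x => 'D_v f x + 'D_v g x)) => // [x Ux|x v Ux|v].
- by apply: continuousD; [exact: Ck_continuous Hf Ux|exact: Ck_continuous Hg Ux].
- by apply: is_derive_add; [exact: Ck_is_derive Hf Ux|exact: Ck_is_derive Hg Ux].
- by apply: IH; exact: Ck_derive.
Qed.

Lemma CkM V k (U : set V) (f g : V -> R) : open U -> Ck k U f -> Ck k U g ->
  Ck k U (fun x => f x * g x).
Proof.
move=> oU; elim: k f g => [|k IH] f g Hf Hg.
  by split=> // x Ux; apply: continuousM; [exact: Ck_continuous Hf Ux|exact: Ck_continuous Hg Ux].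
apply: (@Ck_intro _ _ _ _ (fun v x => 'D_v f x * g x + f x * 'D_v g x)) => // [x Ux|x v Ux|v].
- by apply: continuousM; [exact: Ck_continuous Hf Ux|exact: Ck_continuous Hg Ux].
- by apply: is_derive_mul; [exact: Ck_is_derive Hf Ux|exact: Ck_is_derive Hg Ux].
- apply: CkD => //; apply: IH; try exact: Ck_derive; exact: Ck_pred.
Qed.

Lemma CkZ V k (U : set V) (c : R) (f : V -> R) : open U -> Ck k U f ->
  Ck k U (fun x => c * f x).
Proof. by move=> oU; apply: CkM => //; exact: Ck_cst. Qed.

Lemma CkN V k (U : set V) (f : V -> R) : open U -> Ck k U f ->
  Ck k U (fun x => - f x).
Proof.
move=> oU /(CkZ (-1) oU) H; apply: Ck_eq H => // x _; exact: mulN1r.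
Qed.

Lemma CkB V k (U : set V) (f g : V -> R) : open U -> Ck k U f -> Ck k U g ->
  Ck k U (fun x => f x - g x).
Proof. by move=> oU Hf /(CkN oU); exact: CkD. Qed.

Lemma Ck_sum V k (U : set V) (I : Type) (r : seq I) (F : I -> V -> R) : open U ->
  (forall i, Ck k U (F i)) -> Ck k U (fun x => \sum_(i <- r) F i x).
Proof.
move=> oU H; elim: r => [|i r IH].
  by apply: Ck_eq (Ck_cst k 0 oU) => // x _; rewrite big_nil.
by apply: Ck_eq (CkD oU (H i) IH) => // x _; rewrite big_cons.
Qed.

(** The derivative is a polynomial in ['D_v f] and the inverse itself, and the latter is covered by
    the induction hypothesis. [Ck_sqrt] follows the same pattern. *)
Lemma Ck_inv V k (U : set V) (f : V -> R) : open U ->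
  (forall x, U x -> f x != 0) -> Ck k U f -> Ck k U (fun x => (f x)^-1).
Proof.
move=> oU f0; elim: k f f0 => [|k IH] f f0 Hf.
  by split=> // x Ux; apply: continuousV; [exact: f0|exact: Ck_continuous Hf Ux].
apply: (@Ck_intro _ _ _ _ (fun v x => - 'D_v f x * ((f x)^-1 * (f x)^-1))) => // [x Ux|x v Ux|v].
- by apply: continuousV; [exact: f0|exact: Ck_continuous Hf Ux].
- rewrite -invfM -expr2; apply: is_derive_inv; first exact: f0.
  exact: Ck_is_derive Hf Ux.
- apply: CkM => //; first by apply: CkN => //; exact: Ck_derive.
  by apply: CkM => //; apply: IH => //; exact: Ck_pred.
Qed.

Lemma Ck_sqrt V k (U : set V) (f : V -> R) : open U ->
  (forall x, U x -> 0 < f x) -> Ck k U f -> Ck k U (fun x => Num.sqrt (f x)).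
Proof.
move=> oU f0; elim: k f f0 => [|k IH] f f0 Hf.
  split=> // x Ux; apply: continuous_comp; first exact: Ck_continuous Hf Ux.
  exact: sqrt_continuous.
apply: (@Ck_intro _ _ _ _ (fun v x => (2 * Num.sqrt (f x))^-1 * 'D_v f x)) => // [x Ux|x v Ux|v].
- apply: continuous_comp; first exact: Ck_continuous Hf Ux.
  exact: sqrt_continuous.
- apply: is_derive_comp1; last exact: Ck_is_derive Hf Ux.
  by apply: is_derive1_sqrt; exact: f0.
- apply: CkM => //; last exact: Ck_derive.
  apply: Ck_inv => // [x Ux|].
    by rewrite mulf_neq0 ?pnatr_eq0// gt_eqF// sqrtr_gt0 f0.
  by apply: CkZ => //; apply: IH => //; exact: Ck_pred.
Qed.

Lemma continuous_rV V n (g : V -> 'rV[R]_n) x :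
  (forall i, {for x, continuous (fun y => g y 0 i)}) -> {for x, continuous g}.
Proof.
move=> H; apply/cvgrPdist_lt => e e0.
have : \forall y \near x, forall i, `|g x 0 i - g y 0 i| < e.
  apply: (@filter_forall _ _ _ (nbhs x)) => i.
  by have /cvgrPdist_lt /(_ e e0) := H i.
apply: filterS => y Hy; apply: mx_norm_lt => // i; rewrite !mxE; exact: Hy.
Qed.

(** By the chain rule a derivative of the composite is a sum of products of ['D_(e_ i) f] after [g]
    with derivatives of [g]; the induction therefore runs over all [f] with [g] fixed. *)
Lemma Ck_comp V n k (U : set V) (W : set 'rV[R]_n) (f : 'rV[R]_n -> R)
    (g : V -> 'rV[R]_n) : open U -> open W ->
  (forall x, U x -> W (g x)) -> Ck k W f ->
  (forall i, Ck k U (fun x => g x 0 i)) -> Ck k U (fun x => f (g x)).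
Proof.
move=> oU oW UW; elim: k f => [|k IH] f Hf Hg.
  split=> // x Ux; apply: continuous_comp.
    by apply: continuous_rV => i; exact: Ck_continuous (Hg i) Ux.
  by apply: Ck_continuous Hf _; exact: UW.
have gc x : U x -> {for x, continuous g}.
  by move=> Ux; apply: continuous_rV => i; exact: Ck_continuous (Hg i) Ux.
apply: (@Ck_intro _ _ _ _ (fun v x =>
   \sum_i 'D_(e_ i) f (g x) * 'D_v (fun y => g y 0 i) x)) => // [x Ux|x v Ux|v].
- apply: continuous_comp; first exact: gc.
  by apply: Ck_continuous Hf _; exact: UW.
- apply: (chain_rule (U := W) (f := f) (g := g)) => // [|y i Wy|i|i].
  + exact: UW.
  + exact: is_derive_ex (Ck_is_derive _ Hf Wy).
  + by apply: Ck_continuous (Ck_derive (e_ i) Hf) _; exact: UW.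
  + exact: Ck_is_derive (Hg i) Ux.
- apply: Ck_sum => // i; apply: CkM => //; last exact: Ck_derive.
  by apply: (IH ('D_(e_ i) f)) => [|j]; [exact: Ck_derive|exact: Ck_pred].
Qed.

Lemma coord_linear n (i : 'I_n) (a : R) (u w : 'rV[R]_n) :
  (a *: u + w) 0 i = a * u 0 i + w 0 i.
Proof. by rewrite !mxE. Qed.

Lemma coord_continuous_rV n (i : 'I_n) : continuous (fun x : 'rV[R]_n => x 0 i).
Proof. exact: coord_continuous. Qed.

Lemma Ck_coord n k (U : set 'rV[R]_n) (i : 'I_n) : open U ->
  Ck k U (fun x => x 0 i).
Proof.
move=> oU; apply: Ck_linear => //; first exact: coord_continuous_rV.
by move=> a u w; exact: coord_linear.
Qed.

(* The chain rule for f composed with the identity. *)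
Lemma derive_partials n (U : set 'rV[R]_n) (f : 'rV[R]_n -> R) x v : open U ->
  U x -> (forall y i, U y -> derivable f y (e_ i)) ->
  (forall i, {for x, continuous ('D_(e_ i) f)}) ->
  is_derive x v f (\sum_i 'D_(e_ i) f x * v 0 i).
Proof.
move=> oU Ux df cf.
apply: (chain_rule (U := U) (f := f) (g := id)) => // i.
by apply: (@is_derive_linear _ _ (fun y : 'rV_n => y 0 i)) => a u w; exact: coord_linear.
Qed.

(** Every directional derivative of a function with continuous partials is a linear combination of
    them ([derive_partials]). Flows are shown to be smooth through their parameter and time
    derivatives in this way. *)
Lemma Ck_partials n k (U : set 'rV[R]_n) (f : 'rV[R]_n -> R) (df : 'I_n -> 'rV[R]_n -> R) :
  open U -> (forall x, U x -> {for x, continuous f}) ->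
  (forall x i, U x -> is_derive x (e_ i) f (df i x)) ->
  (forall i, Ck k U (df i)) -> Ck k.+1 U f.
Proof.
move=> oU fc Df Cdf.
apply: (@Ck_intro _ _ _ _ (fun v x => \sum_i df i x * v 0 i)) => // [x v Ux|v].
  have Df' i y : U y -> 'D_(e_ i) f y = df i y.
    by move=> Uy; exact: is_derive_val (Df y i Uy).
  under eq_bigr do rewrite -Df'//.
  apply: (derive_partials v oU Ux) => [y i Uy|i]; first exact: is_derive_ex (Df y i Uy).
  apply: continuous_near_eq (Ck_continuous (Cdf i) Ux).
  by apply: filterS (open_nbhs_nbhs (conj oU Ux)) => y /Df'.
apply: Ck_sum => // i; apply: CkM => //; exact: Ck_cst.
Qed.

Lemma C1_chain V n (W : set 'rV[R]_n) (f : 'rV[R]_n -> R)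
    (g : V -> 'rV[R]_n) x v (dg : 'I_n -> R) : open W -> W (g x) -> Ck 1 W f ->
  (forall i, is_derive x v (fun y => g y 0 i) (dg i)) ->
  is_derive x v (fun y => f (g y)) (\sum_i 'D_(e_ i) f (g x) * dg i).
Proof.
move=> oW Wg Hf Hg.
apply: (chain_rule (U := W) (f := f) (g := g)) => // [y i Wy|i].
  exact: is_derive_ex (Ck_is_derive _ Hf Wy).
exact: Ck_continuous (Ck_derive (e_ i) Hf) Wg.
Qed.

End CkCalculus.

(** * Symmetry of mixed derivatives *)

Section SchwarzTheorem.
Context {R : realType} {V : normedModType R}.

Lemma near_line2 (P : V -> Prop) (x v w : V) : (\forall y \near x, P y) ->
  exists2 r : R, 0 < r & forall h k : R, `|h| <= r -> `|k| <= r ->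
    P (h *: v + (k *: w + x)).
Proof.
move=> /nbhs_ball_norm[d d0 H].
have vw0 : 0 < `|v| + `|w| + 1 by rewrite ltr_wpDl// addr_ge0.
exists (d / 2 / (`|v| + `|w| + 1)); first by rewrite !divr_gt0.
move=> h k; rewrite !ler_pdivlMr// => Hh Hk; apply: H.
rewrite addrA addrK; apply: le_lt_trans (ler_normD _ _) _; rewrite !normrZ.
have := normr_ge0 h; have := normr_ge0 k; have := normr_ge0 v; have := normr_ge0 w.
have [hk|/ltW hk] := leP `|h| `|k|; nra.
Qed.

Lemma is_derive_shift_dir (f : V -> R) (x v z : V) (d : R) :
  is_derive (x + z) v f d -> is_derive x v (fun y => f (y + z)) d.
Proof.
move=> /is_derive_epsP H; apply/is_derive_epsP => e /H[r r0 {}H].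
by exists r => // h /H; rewrite addrA.
Qed.

(** The mean value theorem is used twice: along [v] for the increment of [f] by [k *: w], then along
    [w] for ['D_v f]. *)
Lemma second_difference (f : V -> R) (U : set V) (x v w : V) (r : R) (h k : R) :
  Ck 2 U f ->
  (forall h k : R, `|h| <= r -> `|k| <= r -> U (h *: v + (k *: w + x))) ->
  `|h| <= r -> `|k| <= r ->
  exists h' k', [/\ `|h'| <= `|h|, `|k'| <= `|k| &
    f (h *: v + (k *: w + x)) - f (h *: v + x) - f (k *: w + x) + f x
    = h * k * 'D_w ('D_v f) (h' *: v + (k' *: w + x))].
Proof.
move=> Hf HU hr kr.
have scale1 (a b : R) : 0 <= a <= 1 -> `|a * b| <= `|b|.
  by move=> /andP[a0 a1]; rewrite normrM ger0_norm// ler_piMl.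
have U1 (a b : R) : 0 <= a <= 1 -> 0 <= b <= 1 -> U (a *: (h *: v) + (b *: (k *: w) + x)).
  move=> a01 b01; rewrite !scalerA; apply: HU.
    exact: le_trans (scale1 _ _ a01) hr.
  exact: le_trans (scale1 _ _ b01) kr.
have i00 : 0 <= (0 : R) <= 1 by rewrite lexx ler01.
have i11 : 0 <= (1 : R) <= 1 by rewrite lexx ler01.
have D1 (a : R) : 0 <= a <= 1 -> is_derive (a *: (h *: v) + x) (h *: v)
    (fun y => f (y + k *: w) - f y)
    (h * ('D_v f (a *: (h *: v) + x + k *: w) - 'D_v f (a *: (h *: v) + x))).
  move=> a01; rewrite mulrBr; apply: is_derive_sub.
    apply: is_derive_shift_dir; apply: is_deriveZdir; apply: Ck_is_derive Hf _.
    by rewrite -addrA [x + _]addrC; have := U1 a 1 a01 i11; rewrite scale1r.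
  apply: is_deriveZdir; apply: Ck_is_derive Hf _.
  by have := U1 a 0 a01 i00; rewrite scale0r add0r.
have [a a01 E1] := mvt_line (df := fun y => h * ('D_v f (y + k *: w) - 'D_v f y)) D1.
have D2 (b : R) : 0 <= b <= 1 ->
    is_derive (b *: (k *: w) + (a *: (h *: v) + x)) (k *: w) ('D_v f)
      (k * 'D_w ('D_v f) (b *: (k *: w) + (a *: (h *: v) + x))).
  move=> b01; apply: is_deriveZdir; apply: Ck_is_derive (Ck_derive v Hf) _.
  by rewrite addrCA; exact: U1.
have [b b01 E2] := mvt_line (df := fun y => k * 'D_w ('D_v f) y) D2.
exists (a * h), (b * k); split; [exact: scale1|exact: scale1|].
rewrite -!scalerA [_ + (b *: _ + x)]addrCA -mulrA -E2.
rewrite [k *: w + (a *: _ + x)]addrC -E1 [k *: w + x]addrC [h *: v + (x + _)]addrA.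
by ring.
Qed.

Lemma half_triangle (p q m e : R) : `|p - m| <= e / 2 -> `|q - m| <= e / 2 ->
  `|p - q| <= e.
Proof.
move=> pm qm; rewrite (splitr e) -(subrKA m).
by apply: le_trans (ler_normD _ _) _; rewrite lerD// distrC.
Qed.

Lemma derive_comm (f : V -> R) (U : set V) (x v w : V) : open U -> U x ->
  Ck 2 U f -> 'D_w ('D_v f) x = 'D_v ('D_w f) x.
Proof.
move=> oU Ux Hf; apply/eqP; rewrite -subr_eq0 -normr_le0.
apply/ler_addgt0Pl => /= e e0; rewrite addr0.
have e2 : 0 < e / 2 by rewrite divr_gt0.
have cvw : \forall y \near x, U y /\ (`|'D_w ('D_v f) x - 'D_w ('D_v f) y| <= e / 2
    /\ `|'D_v ('D_w f) x - 'D_v ('D_w f) y| <= e / 2).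
  apply: filterI; first exact: open_nbhs_nbhs (conj oU Ux).
  have := Ck_continuous (Ck_derive w (Ck_derive v Hf)) Ux.
  move=> /cvgrPdist_le /(_ _ e2) A.
  have := Ck_continuous (Ck_derive v (Ck_derive w Hf)) Ux.
  move=> /cvgrPdist_le /(_ _ e2) B.
  exact: filterI A B.
have [r r0 Hr] := near_line2 v w cvw.
have r0' : `|r| <= r by rewrite ger0_norm// ltW.
have HU1 (h k : R) : `|h| <= r -> `|k| <= r -> U (h *: v + (k *: w + x)).
  by move=> hr kr; exact: (Hr _ _ hr kr).1.
have HU2 (h k : R) : `|h| <= r -> `|k| <= r -> U (h *: w + (k *: v + x)).
  by move=> hr kr; rewrite addrCA; exact: (Hr _ _ kr hr).1.
have [h1 [k1 [h1r k1r E1]]] := second_difference Hf HU1 r0' r0'.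
have [h2 [k2 [h2r k2r E2]]] := second_difference Hf HU2 r0' r0'.
rewrite (ger0_norm (ltW r0)) in h1r k1r h2r k2r.
(* The second difference is symmetric in [v] and [w], so the mean values of the two mixed
   derivatives coincide exactly; each is within [e / 2] of its derivative at [x]. *)
have E : 'D_w ('D_v f) (h1 *: v + (k1 *: w + x)) =
    'D_v ('D_w f) (h2 *: w + (k2 *: v + x)).
  have rr : r * r != 0 by rewrite mulf_neq0// gt_eqF.
  have rrI (p q : R) : r * r * p = r * r * q -> p = q by move/(mulfI rr).
  have E3 : f (r *: v + (r *: w + x)) - f (r *: v + x) - f (r *: w + x) + f x =
    f (r *: w + (r *: v + x)) - f (r *: w + x) - f (r *: v + x) + f x.
    by rewrite [r *: w + (r *: v + x)]addrCA; ring.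
  exact: rrI (etrans (esym E1) (etrans E3 E2)).
have [_ [A _]] := Hr _ _ h1r k1r.
have [_ [_ B]] := Hr _ _ k2r h2r.
rewrite addrCA -E in B.
exact: half_triangle A B.
Qed.

End SchwarzTheorem.

(** * Induction along a real interval *)

Section RealInduction.
Context {R : realType}.

(** Supremum argument. The assumption at [x] yields [P] around [x], including [x] itself; at [x = a]
    it starts the induction. It serves to continue the equality of two geodesics and to glue local
    densities along the curve. *)
Lemma real_induction (a b : R) (P : R -> Prop) :
  (forall x, a <= x <= b -> (forall y, a <= y < x -> P y) ->
     exists2 d : R, 0 < d & forall y, a <= y <= b -> `|y - x| < d -> P y) ->
  forall x, a <= x <= b -> P x.
Proof.
move=> H x /andP[ax xb]; have ab := le_trans ax xb.
apply: contrapT => NPx.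
pose S := [set y | a <= y <= x /\ forall z, a <= z <= y -> P z].
have Pa : P a.
  have [||d d0 Hd] := H a; first by rewrite lexx ab.
    by move=> y /andP[/le_lt_trans h /h]; rewrite ltxx.
  by apply: Hd; rewrite ?lexx ?ab// subrr normr0.
have Sa : S a.
  split; first by rewrite lexx ax.
  by move=> z; rewrite -eq_le => /eqP <-.
have supS : has_sup S by split; [exists a|exists x => y [/andP[]]].
have aS : a <= sup S by exact: sup_upper_bound supS _ Sa.
have Sx : sup S <= x by apply: ge_sup; [exists a|move=> y [/andP[]]].
have [||d d0 Hd] := H (sup S); first by rewrite aS (le_trans Sx).
  move=> y /andP[ay yS]; have yS' : 0 < sup S - y by rewrite subr_gt0.
  have [z [/andP[az zx] Pz] yz] := sup_adherent yS' supS.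
  by apply: Pz; rewrite ay ltW//; move: yz; rewrite opprB addrCA subrr addr0.
have [z [/andP[az zx] Pz] yz] := sup_adherent d0 supS.
have zS : z <= sup S by apply: sup_upper_bound => //; split; rewrite ?az.
pose u := Num.min x (sup S + d / 2).
have Su : S u.
  split; first by rewrite le_min ax ge_min lexx/= (le_trans aS)// lerDl divr_ge0// ltW.
  move=> t /andP[at_ tu]; have [tz|zt] := leP t z; first by apply: Pz; rewrite at_.
  move: tu; rewrite le_min => /andP[tx tu].
  apply: Hd; first by rewrite at_ (le_trans tx).
  rewrite ltr_norml; apply/andP; split; lra.
have us := sup_upper_bound supS Su.
have ux : u = x.
  by rewrite /u; apply/min_idPl; move: us; rewrite /u /Num.min; case: ltP => //; lra.
by apply: NPx; apply: Su.2; rewrite ux lexx ax.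
Qed.

End RealInduction.

(** * Gronwall estimates *)

Section Gronwall.
Context {R : realType}.

(** [E s * expR (- C * s) - B * s] has a nonpositive derivative on [[0, T]], since the exponential
    is at most 1 there. *)
Lemma gronwall_scalar (E dE : R -> R) (C B T : R) : 0 <= C -> 0 <= B ->
  (forall t : R, 0 <= t <= T -> is_derive t 1 E (dE t)) ->
  (forall t : R, 0 <= t <= T -> dE t <= C * E t + B) ->
  forall t, 0 <= t <= T -> E t <= (E 0 + B * t) * expR (C * t).
Proof.
move=> C0 B0 DE HE t /andP[t0 tT].
have D (s : R) : 0 <= s <= T -> is_derive s 1 (fun s => E s * expR (- C * s) - B * s)
    ((dE s - C * E s) * expR (- C * s) - B).
  move=> sT.
  have e1 : is_derive s 1 (fun s : R => - C * s) (- C).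
    have := @is_derive_linear R R (fun s : R => - C * s) s 1 _.
    by rewrite mulr1; apply => a u w; rewrite mulrDr mulrCA.
  have e2 := is_derive_comp1 (is_derive_expR (- C * s)) e1.
  have e3 : is_derive s 1 (fun s : R => B * s) B.
    have := @is_derive_linear R R (fun s : R => B * s) s 1 _.
    by rewrite mulr1; apply => a u w; rewrite mulrDr mulrCA.
  have := is_derive_sub (is_derive_mul (DE s sT) e2) e3.
  by congr is_derive; ring.
have D' (s : R) : s \in `]0, t[ -> is_derive s 1 (fun s => E s * expR (- C * s) - B * s)
    ((dE s - C * E s) * expR (- C * s) - B).
  rewrite in_itv/= => /andP[s0 st]; apply: D.
  by rewrite ltW//= (le_trans (ltW st)).
have Cn : {within `[0, t], continuous (fun s => E s * expR (- C * s) - B * s)}.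
  apply: derivable_within_continuous => s; rewrite in_itv/= => /andP[s0 st].
  by apply: is_derive_ex (D s _); rewrite s0 (le_trans st).
have [c + Hc] := MVT_segment t0 D' Cn.
rewrite in_itv/= => /andP[c0 ct].
have cT : 0 <= c <= T by rewrite c0 (le_trans ct).
have ec : expR (- C * c) <= 1 by rewrite expR_le1 mulNr oppr_le0 mulr_ge0.
have ec0 := expR_gt0 (- C * c).
have dc : (dE c - C * E c) * expR (- C * c) - B <= 0.
  have h := HE c cT.
  rewrite subr_le0; apply: (@le_trans _ _ (B * expR (- C * c))).
    rewrite ler_wpM2r ?(ltW ec0)//; lra.
  by rewrite ler_piMr.
have : E t * expR (- C * t) - B * t <= E 0.
  have : E t * expR (- C * t) - B * t - (E 0 * expR (- C * 0) - B * 0) <= 0.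
    by rewrite Hc mulr_le0_ge0// subr0.
  by rewrite !mulr0 expR0 mulr1 subr0 subr_le0.
rewrite lerBlDr => h; have et := expR_gt0 (C * t).
rewrite -[E t]mulr1 -(expRxMexpNx_1 (C * t)) [expR (C * t) * _]mulrC mulrA -mulNr.
by rewrite ler_pM2r.
Qed.

(** The sum of squares of the coordinates grows at a rate of at most [n * (2 * K + 1)]; the factor
    [(n + 1) * (1 + T)] absorbs its initial value and the constant term. The square root due at the
    end is bounded by the constant itself, which is at least 1. *)
Definition gronwall_const (n : nat) (K T : R) : R :=
  (n%:R + 1) * (1 + T) * expR (n%:R * (2 * K + 1) * T).

Lemma gronwall_const_ge1 n K T : 0 <= K -> 0 <= T -> 1 <= gronwall_const n K T.
Proof.
move=> K0 T0; have n1 : 1 <= n%:R + 1 :> R by rewrite lerDr.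
have T1 : 1 <= 1 + T by rewrite lerDl.
have e1 : 1 <= expR (n%:R * (2 * K + 1) * T).
  by rewrite -expR0 ler_expR !mulr_ge0// addr_ge0// mulr_ge0.
by rewrite /gronwall_const !mulr_ege1.
Qed.

(** The sup norm is not differentiable, so the estimate is made for the sum of squares, which lies
    between [|D|^2] and [n * |D|^2]. *)
Lemma gronwall_vec_pos n (D : R -> 'rV[R]_n) (dD : 'I_n -> R -> R) (K b T : R) :
  0 <= K -> 0 <= b ->
  (forall (t : R) i, 0 <= t <= T -> is_derive t 1 (fun s => D s 0 i) (dD i t)) ->
  (forall (t : R) i, 0 <= t <= T -> `|dD i t| <= K * `|D t| + b) ->
  forall t, 0 <= t <= T -> `|D t| <= gronwall_const n K T * (`|D 0| + b).
Proof.
move=> K0 b0 HD Hb t tT; have /andP[t0 tT'] := tT; have T0 := le_trans t0 tT'.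
pose E t := \sum_i (D t 0 i) ^+ 2.
pose dE t := \sum_i (2 * D t 0 i * dD i t).
have DE s : 0 <= s <= T -> is_derive s 1 E (dE s).
  move=> sT; apply: is_derive_sum_seq => i.
  have := is_derive_mul (HD s i sT) (HD s i sT).
  rewrite (_ : _ + _ = 2 * D s 0 i * dD i s); last by ring.
  by under eq_fun do rewrite -expr2.
have E0 s : 0 <= E s by apply: sumr_ge0 => i _; rewrite sqr_ge0.
have DEn s : `|D s| ^+ 2 <= E s.
  have -> : E s = Num.sqrt (E s) ^+ 2 by rewrite sqr_sqrtr.
  rewrite ler_pXn2r ?nnegrE ?sqrtr_ge0//; apply: mx_norm_le; first exact: sqrtr_ge0.
  move=> i; rewrite -sqrtr_sqr; apply: ler_wsqrtr.
  by rewrite /E (bigD1 i)//= lerDl sumr_ge0// => j _; rewrite sqr_ge0.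
have En s : E s <= n%:R * `|D s| ^+ 2.
  apply: (@le_trans _ _ (\sum_(i < n) `|D s| ^+ 2)); last first.
    by rewrite sumr_const card_ord mulr_natl.
  apply: ler_sum => i _; rewrite -real_normK ?num_real//.
  by rewrite ler_pXn2r ?nnegrE//; exact: mx_norm_coord.
have HE s : 0 <= s <= T -> dE s <= (n%:R * (2 * K + 1)) * E s + n%:R * b ^+ 2.
  move=> sT; apply: (@le_trans _ _ (\sum_(i < n) ((2 * K + 1) * E s + b ^+ 2))); last first.
    by rewrite sumr_const card_ord -[leLHS]mulr_natl mulrDr mulrA.
  apply: ler_sum => i _; have h1 := Hb s i sT; have h2 := mx_norm_coord (D s) i.
  have h3 := DEn s; have h4 := normr_ge0 (dD i s); have h5 := normr_ge0 (D s 0 i).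
  apply: le_trans (ler_norm _) _; rewrite -mulrA !normrM ger0_norm//.
  have : `|D s 0 i| * `|dD i s| <= `|D s| * (K * `|D s| + b) by exact: ler_pM.
  move=> h6; have h7 := normr_ge0 (D s).
  have h8 : K * `|D s| ^+ 2 <= K * E s by exact: ler_wpM2l.
  have := sqr_ge0 (`|D s| - b); rewrite sqrrB => h9.
  move: h6; rewrite mulrDr mulrCA -expr2 => h6; lra.
have C0 : 0 <= n%:R * (2 * K + 1) by rewrite mulr_ge0// addr_ge0// mulr_ge0.
have B0 : 0 <= n%:R * b ^+ 2 by rewrite mulr_ge0// sqr_ge0.
have := gronwall_scalar C0 B0 DE HE tT => H.
have M1 := gronwall_const_ge1 n K0 T0.
have ge0 : 0 <= gronwall_const n K T * (`|D 0| + b).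
  by rewrite mulr_ge0 ?addr_ge0// (le_trans ler01).
rewrite -(@ler_pXn2r _ 2)// ?nnegrE//; apply: le_trans (DEn t) _.
apply: le_trans H _; rewrite exprMn [gronwall_const _ _ _ ^+ 2]expr2 -[leRHS]mulrA.
have et : expR (n%:R * (2 * K + 1) * t) <= expR (n%:R * (2 * K + 1) * T).
  by rewrite ler_expR ler_wpM2l.
have e0 := expR_gt0 (n%:R * (2 * K + 1) * t).
have h1 : E 0 + n%:R * b ^+ 2 * t <= (n%:R + 1) * (1 + T) * (`|D 0| + b) ^+ 2.
  have d0 := normr_ge0 (D 0); have e2 := En 0; have n0 : 0 <= n%:R :> R by [].
  have h2 : `|D 0| ^+ 2 <= (`|D 0| + b) ^+ 2 by rewrite ler_pXn2r ?nnegrE ?addr_ge0// lerDl.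
  have h3 : b ^+ 2 <= (`|D 0| + b) ^+ 2 by rewrite ler_pXn2r ?nnegrE ?addr_ge0// lerDr.
  have h4 : n%:R * b ^+ 2 * t <= n%:R * (`|D 0| + b) ^+ 2 * T.
    by apply: ler_pM => //; rewrite ?mulr_ge0 ?sqr_ge0// ler_wpM2l.
  have h5 : n%:R * `|D 0| ^+ 2 <= n%:R * (`|D 0| + b) ^+ 2 by rewrite ler_wpM2l.
  have h6 := mulr_ge0 T0 (sqr_ge0 (`|D 0| + b)).
  have h7 := sqr_ge0 (`|D 0| + b); lra.
have h2 : (E 0 + n%:R * b ^+ 2 * t) * expR (n%:R * (2 * K + 1) * t) <=
   (n%:R + 1) * (1 + T) * (`|D 0| + b) ^+ 2 * expR (n%:R * (2 * K + 1) * T).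
  by apply: ler_pM => //; rewrite ?addr_ge0// ?mulr_ge0// ltW.
apply: le_trans h2 _.
rewrite (_ : _ * _ = gronwall_const n K T * (`|D 0| + b) ^+ 2).
  by rewrite ler_peMl// mulr_ge0 ?sqr_ge0// (le_trans ler01).
by rewrite /gronwall_const; ring.
Qed.

Lemma is_derive_reflect (f : R -> R) (t d : R) : is_derive (- t) 1 f d ->
  is_derive t 1 (fun s => f (- s)) (- d).
Proof.
move=> H; rewrite -mulrN1; exact: is_derive_comp1 H _.
Qed.

Lemma gronwall_vec n (D : R -> 'rV[R]_n) (dD : 'I_n -> R -> R) (K b T : R) :
  0 <= K -> 0 <= b ->
  (forall (t : R) i, `|t| <= T -> is_derive t 1 (fun s => D s 0 i) (dD i t)) ->
  (forall (t : R) i, `|t| <= T -> `|dD i t| <= K * `|D t| + b) ->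
  forall t : R, `|t| <= T -> `|D t| <= gronwall_const n K T * (`|D 0| + b).
Proof.
move=> K0 b0 HD Hb t; have [t0|t0] := leP 0 t => tT.
  apply: gronwall_vec_pos K0 b0 _ _ _ _ => [s i /andP[s0 sT]|s i /andP[s0 sT]|].
  - by apply: HD; rewrite ger0_norm.
  - by apply: Hb; rewrite ger0_norm.
  - by rewrite t0 -(ger0_norm t0).
have := @gronwall_vec_pos n (fun s => D (- s)) (fun i s => - dD i (- s)) K b T K0 b0.
rewrite oppr0 => /(_ _ _ (- t)); rewrite opprK; apply => [s i /andP[s0 sT]|s i /andP[s0 sT]|].
- by apply: (is_derive_reflect (f := fun s => D s 0 i)); apply: HD; rewrite normrN ger0_norm.
- by rewrite normrN; apply: Hb; rewrite normrN ger0_norm.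
- by rewrite oppr_ge0 ltW//= -(ltr0_norm t0).
Qed.

End Gronwall.

Lemma continuous_epsP (R : realType) (V : normedModType R) (f : V -> R) (x : V) :
  {for x, continuous f} <-> forall e : R, 0 < e -> exists2 d : R, 0 < d &
    forall y, `|y - x| < d -> `|f y - f x| <= e.
Proof.
split=> [/cvgrPdist_le H e /H {}H|H].
  have /(nbhs_ball_norm x _).1[d d0 Hd] := H.
  by exists d => // y /Hd; rewrite distrC.
apply/cvgrPdist_le => e /H[d d0 {}H].
apply/(nbhs_ball_norm x _); exists d => // y /H; by rewrite distrC.
Qed.

(** * Primitives, clamping and geometric limits *)

Section Primitives.
Context {R : realType}.
Local Notation mu := (@lebesgue_measure R).

Lemma ex_primitive (h : R -> R) (a : R) : continuous h ->
  exists P : R -> R, P 0 = 0 /\ forall t : R, `|t| < a -> is_derive t 1 P (h t).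
Proof.
move=> hc.
pose F x := \int[mu]_(t in `[- a - 1, x]) h t.
have Fd (x : R) : - a - 1 < x -> is_derive x 1 F (h x).
  move=> ax.
  have int : mu.-integrable `[- a - 1, x + 1] (EFin \o h).
    apply: continuous_compact_integrable; first exact: segment_compact.
    exact: continuous_subspaceT.
  have xx : x < x + 1 by rewrite ltrDl.
  have [d1 d2] := continuous_FTC1_closed xx int ax (hc x).
  by split; [exact: d1|rewrite -d2 derive1E].
exists (fun t => F t - F 0); split; first by rewrite subrr.
move=> t ta; rewrite -[h t]subr0; apply: is_derive_sub.
by apply: Fd; move: ta; rewrite ltr_norml => /andP[]; lra.
Qed.

Lemma mvt_lipschitz (P dP : R -> R) (B a : R) :
  (forall t : R, `|t| < a -> is_derive t 1 P (dP t)) ->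
  (forall t : R, `|t| < a -> `|dP t| <= B) ->
  forall s s', `|s| < a -> `|s'| < a -> `|P s - P s'| <= B * `|s - s'|.
Proof.
move=> HP HB.
have key s s' : s' <= s -> `|s| < a -> `|s'| < a -> `|P s - P s'| <= B * `|s - s'|.
  move=> ss; rewrite !ltr_norml => /andP[sa1 sa2] /andP[sa3 sa4].
  have in_a t : s' <= t <= s -> `|t| < a.
    by move=> /andP[t1 t2]; rewrite ltr_norml; apply/andP; split; lra.
  have D (t : R) : t \in `]s', s[ -> is_derive t 1 P (dP t).
    by rewrite in_itv/= => /andP[t1 t2]; apply/HP/in_a; rewrite !ltW.
  have C : {within `[s', s], continuous P}.
    apply: derivable_within_continuous => t; rewrite in_itv/= => t12.
    exact: is_derive_ex (HP t (in_a t t12)).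
  have [c + ->] := MVT_segment ss D C.
  by rewrite in_itv/= => /in_a /HB cB; rewrite normrM ler_wpM2r.
move=> s s' sa s'a; have [ss|/ltW ss] := leP s' s; first exact: key.
by rewrite distrC [`|s - s'|]distrC; exact: key.
Qed.

(** Retraction onto [[-r, r]]. In the Picard iteration it makes the field and the time variable
    globally defined, so that no iterate can leave its domain. *)
Definition clamp (r x : R) : R := Num.max (- r) (Num.min r x).

Lemma clamp_norm r x : 0 <= r -> `|clamp r x| <= r.
Proof.
move=> r0; rewrite ler_norml /clamp le_max lexx /= ge_max ge_min lexx andbT.
lra.
Qed.

Lemma clamp_id r x : `|x| <= r -> clamp r x = x.
Proof.
rewrite ler_norml => /andP[x1 x2]; rewrite /clamp (min_idPr x2).
exact/max_idPr.
Qed.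

Lemma clamp_lip r x y : 0 <= r -> `|clamp r x - clamp r y| <= `|x - y|.
Proof.
move=> r0; have a1 := ler_norm (x - y); have a2 := ler_norm (y - x).
rewrite (distrC y) in a2; rewrite /clamp /Num.max /Num.min.
case: (ltP r x) => h1; case: (ltP r y) => h2; case: (ltP (- r) r) => h3;
  case: (ltP (- r) x) => h4; case: (ltP (- r) y) => h5; rewrite ler_norml;
  apply/andP; split; lra.
Qed.

(** The intervals of radius [2 * C / 2 ^+ m] around [u m] are nested; the limit is the supremum of
    their left end points. *)
Lemma geometric_limit (u : nat -> R) (C : R) :
  (forall m, `|u m.+1 - u m| <= C / 2 ^+ m) ->
  exists l, forall m, `|u m - l| <= 2 * C / 2 ^+ m.
Proof.
move=> H.
have C0 : 0 <= C by have := H 0; rewrite expr0 divr1; exact: le_trans.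
pose e m := 2 * C / 2 ^+ m.
have eS m : e m = e m.+1 + C / 2 ^+ m.
  by rewrite /e exprS; field; rewrite expf_neq0.
have e0 m : 0 <= e m by rewrite !mulr_ge0// invr_ge0 exprn_ge0.
have lo m k : u m - e m <= u (m + k)%N - e (m + k)%N.
  elim: k => [|k IH]; rewrite ?addn0// addnS; apply: le_trans IH _.
  by have := H (m + k)%N; rewrite ler_norml => /andP[]; have := eS (m + k)%N; lra.
have hi m k : u (m + k)%N + e (m + k)%N <= u m + e m.
  elim: k => [|k IH]; rewrite ?addn0// addnS; apply: le_trans _ IH.
  by have := H (m + k)%N; rewrite ler_norml => /andP[]; have := eS (m + k)%N; lra.
have cross m k : u m - e m <= u k + e k.
  have h1 := lo m k; have h2 := hi k m; have := e0 (m + k)%N.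
  by move: h2; rewrite addnC; lra.
pose S := [set x | exists m, x = u m - e m].
have supS : has_sup S.
  by split; [exists (u 0%N - e 0%N), 0%N|exists (u 0%N + e 0%N) => x [m ->]].
exists (sup S) => m.
have h1 : u m - e m <= sup S by apply: sup_upper_bound => //; exists m.
have h2 : sup S <= u m + e m by apply: ge_sup; [exact: supS.1|move=> x [k ->]].
by rewrite ler_norml -/(e m); apply/andP; split; lra.
Qed.

Lemma le_geometric_eq0 (x C : R) : (forall m, x <= C / 2 ^+ m) -> x <= 0.
Proof.
move=> H; apply/ler_addgt0Pl => e e0; rewrite addr0.
have C0 : 0 < `|C| + 1 by rewrite ltr_wpDl.
have [m Hm] : exists m, (`|C| + 1) / e <= 2 ^+ m.
  exists (Num.bound ((`|C| + 1) / e)); apply: le_trans (ltW (archi_boundP _)) _.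
    by rewrite ltW// divr_gt0.
  by rewrite -natrX ler_nat ltnW// ltn_expl.
apply: le_trans (H m) _; rewrite ler_pdivrMr ?exprn_gt0//.
rewrite ler_pdivrMr// mulrC in Hm; apply: le_trans Hm.
by apply: le_trans (ler_norm C) _; rewrite lerDl.
Qed.

End Primitives.

(** * Existence of solutions by Picard iteration *)

Section Picard.
Context {R : realType} (n : nat).
Variables (X : 'I_n -> 'rV[R]_n -> R) (c p : 'rV[R]_n) (r M K T : R).
Hypotheses (r0 : 0 < r) (M0 : 0 <= M) (K0 : 0 <= K) (T0 : 0 < T).
Hypothesis XM : forall y i, `|y - c| <= r -> `|X i y| <= M.
Hypothesis XK : forall y y' i, `|y - c| <= r -> `|y' - c| <= r ->
  `|X i y - X i y'| <= K * `|y - y'|.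
Hypotheses (MT : M * T <= r / 2) (KT : K * T <= 1 / 2) (pc : `|p - c| <= r / 2).

Let clampv (y : 'rV[R]_n) : 'rV[R]_n := \row_i (c 0 i + clamp r (y 0 i - c 0 i)).

Let clampv_in y : `|clampv y - c| <= r.
Proof.
apply: mx_norm_le; first exact: ltW.
by move=> i; rewrite !mxE addrC addKr; apply: clamp_norm; exact: ltW.
Qed.

Let clampv_id y : `|y - c| <= r -> clampv y = y.
Proof.
move=> yc; apply/rowP => i; rewrite !mxE clamp_id; first by rewrite addrC subrK.
by have := le_trans (mx_norm_coord _ i) yc; rewrite !mxE.
Qed.

Let clampv_lip y y' : `|clampv y - clampv y'| <= `|y - y'|.
Proof.
apply: mx_norm_le => // i; rewrite !mxE.
rewrite [X in `|X|](_ : _ = clamp r (y 0 i - c 0 i) - clamp r (y' 0 i - c 0 i)); last by ring.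
apply: le_trans (clamp_lip _ _ (ltW r0)) _.
rewrite [X in `|X|](_ : _ = (y - y') 0 i); last by rewrite !mxE; ring.
exact: mx_norm_coord.
Qed.

Let Xc i y := X i (clampv y).

Let XcM i y : `|Xc i y| <= M. Proof. exact: XM. Qed.

Let XcK i y y' : `|Xc i y - Xc i y'| <= K * `|y - y'|.
Proof.
by apply: le_trans (XK _ _ _) _; rewrite ?clampv_in// ler_wpM2l.
Qed.

Let lipM (z : R -> 'rV[R]_n) := forall t t', `|z t - z t'| <= M * `|t - t'|.

Let Xz_continuous z i : lipM z -> continuous (fun t => Xc i (z t)).
Proof.
move=> zl t; apply/continuous_epsP => e e0.
have KM : 0 < K * M + 1 by rewrite ltr_wpDl// mulr_ge0.
exists (e / (K * M + 1)); first exact: divr_gt0.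
move=> s; rewrite ltr_pdivlMr// => st.
apply: le_trans (XcK _ _ _) _.
apply: (@le_trans _ _ (K * (M * `|s - t|))); first by rewrite ler_wpM2l.
have := normr_ge0 (s - t); lra.
Qed.

(** A primitive on an interval exceeding [[-T, T]] by 1 on each side: all clamped times, also the
    extreme ones, are interior points with a two-sided derivative. *)
Let prim (h : R -> R) : R -> R := xget (fun=> 0)
  [set P : R -> R | P 0 = 0 /\ forall t : R, `|t| < T + 1 -> is_derive t 1 P (h t)].

Let primP h : continuous h ->
  prim h 0 = 0 /\ forall t : R, `|t| < T + 1 -> is_derive t 1 (prim h) (h t).
Proof. by move=> /(ex_primitive (T + 1)) /cid[P HP]; rewrite /prim; case: xgetP => // /(_ P). Qed.

Let cT (t : R) : `|clamp T t| < T + 1.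
Proof. by apply: le_lt_trans (clamp_norm _ (ltW T0)) _; rewrite ltrDl. Qed.

Let step (z : R -> 'rV[R]_n) : R -> 'rV[R]_n := fun t =>
  \row_i (p 0 i + prim (fun s => Xc i (z s)) (clamp T t)).

Let step_lip z : lipM z -> lipM (step z).
Proof.
move=> zl t t'; apply: mx_norm_le; first by rewrite mulr_ge0.
move=> i; rewrite !mxE opprD addrACA subrr add0r.
have [_ HP] := primP (@Xz_continuous _ i zl).
apply: le_trans (mvt_lipschitz HP (B := M) _ (cT t) (cT t')) _ => //.
by rewrite ler_wpM2l// clamp_lip// ltW.
Qed.

Let step_start z t : lipM z -> `|step z t - p| <= M * T.
Proof.
move=> zl; apply: mx_norm_le; first by rewrite mulr_ge0// ltW.
move=> i; rewrite !mxE addrAC subrr add0r.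
have [P0 HP] := primP (@Xz_continuous _ i zl).
rewrite -[prim _ _]subr0 -P0.
have z0 : `|0 : R| < T + 1 by rewrite normr0 addr_gt0.
apply: le_trans (mvt_lipschitz HP (B := M) _ (cT t) z0) _ => //.
by rewrite ler_wpM2l// subr0 clamp_norm// ltW.
Qed.

Let step_contract z z' d t : lipM z -> lipM z' -> (forall t, `|z t - z' t| <= d) ->
  `|step z t - step z' t| <= d / 2.
Proof.
move=> zl zl' zz; have d0 : 0 <= d by apply: le_trans (zz 0).
apply: mx_norm_le; first by rewrite divr_ge0.
move=> i; rewrite !mxE opprD addrACA subrr add0r.
have [P0 HP] := primP (@Xz_continuous _ i zl).
have [P0' HP'] := primP (@Xz_continuous _ i zl').
have HD (s : R) : `|s| < T + 1 -> is_derive s 1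
   (fun s => prim (fun s => Xc i (z s)) s - prim (fun s => Xc i (z' s)) s)
   (Xc i (z s) - Xc i (z' s)).
  by move=> sT; exact: is_derive_sub (HP s sT) (HP' s sT).
have z0 : `|0 : R| < T + 1 by rewrite normr0 addr_gt0.
have Hb (s : R) : `|s| < T + 1 -> `|Xc i (z s) - Xc i (z' s)| <= K * d.
  by move=> _; apply: le_trans (XcK _ _ _) _; rewrite ler_wpM2l.
have := mvt_lipschitz HD Hb (cT t) z0; rewrite P0 P0' !subr0 => /le_trans; apply.
apply: (@le_trans _ _ (K * d * T)); first by rewrite ler_wpM2l ?mulr_ge0// clamp_norm// ltW.
by rewrite mulrAC; have := ler_wpM2r d0 KT; lra.
Qed.

Let it m : R -> 'rV[R]_n := iter m step (fun=> p).

Let it_lip m : lipM (it m).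
Proof.
by elim: m => [|m IH]; [move=> t t'; rewrite subrr normr0 mulr_ge0|exact: step_lip].
Qed.

Let it_step m t : `|it m.+1 t - it m t| <= M * T / 2 ^+ m.
Proof.
elim: m t => [|m IH] t; first by rewrite expr0 divr1; exact: (step_start (z := fun=> p) t (it_lip 0)).
apply: le_trans (step_contract t (it_lip m.+1) (it_lip m) IH) _.
by rewrite exprS invfM mulrCA mulrC.
Qed.

(** The iteration is run for the field composed with the retraction [clampv] onto the ball of radius
    [r]. It contracts by [1 / 2] because [K * T <= 1 / 2]. The limit stays within
    [M * T + r / 2 <= r] of [c], where the retraction is the identity, so it solves the original
    equation. *)
Lemma picard : exists z : R -> 'rV[R]_n, z 0 = p /\ forall t : R, `|t| < T ->
  `|z t - c| <= r /\ forall i, is_derive t 1 (fun s => z s 0 i) (X i (z t)).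
Proof.
have /choice[l Hl] : forall ti : R * 'I_n, exists l, forall m,
    `|it m ti.1 0 ti.2 - l| <= 2 * (M * T) / 2 ^+ m.
  move=> [t i]; apply: geometric_limit => m /=; apply: le_trans (it_step m t).
  by have := mx_norm_coord (it m.+1 t - it m t) i; rewrite !mxE.
pose z t : 'rV[R]_n := \row_i l (t, i).
have zit m t : `|it m t - z t| <= 2 * (M * T) / 2 ^+ m.
  apply: mx_norm_le => [|i]; last by rewrite !mxE; exact: (Hl (t, i)).
  by rewrite !mulr_ge0 ?invr_ge0 ?exprn_ge0// ltW.
have zl : lipM z.
  move=> t t'; rewrite -subr_le0; apply: (@le_geometric_eq0 _ _ (4 * (M * T))) => m.
  have h1 := zit m t; have h2 := zit m t'; have h3 := it_lip m t t'.
  rewrite lerBlDr -(subrKA (it m t)); apply: le_trans (ler_normD _ _) _.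
  rewrite -(subrKA (it m t') (it m t)).
  have := ler_normD (it m t - it m t') (it m t' - z t').
  rewrite [`|z t - _|]distrC.
  have -> : 4 * (M * T) / 2 ^+ m = 2 * (M * T) / 2 ^+ m + 2 * (M * T) / 2 ^+ m by ring.
  lra.
have zE t : z t = step z t.
  apply/eqP; rewrite -subr_eq0 -normr_le0.
  apply: (@le_geometric_eq0 _ _ (4 * (M * T))) => m.
  have h1 := zit m.+1 t.
  have h2 := step_contract t (it_lip m) zl (zit m).
  apply: le_trans (ler_distD (it m.+1 t) _ _) _.
  rewrite [`|z t - _|]distrC; apply: le_trans (lerD h1 h2) _.
  rewrite exprS invfM.
  have : 0 <= (M * T) / 2 ^+ m by rewrite !mulr_ge0 ?invr_ge0 ?exprn_ge0// ltW.
  move=> q0; rewrite -[4 * _ / _]mulrA [leLHS](_ : _ = 2 * (M * T / 2 ^+ m)).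
    lra.
  by field; rewrite expf_neq0.
have zp t : `|z t - p| <= M * T by rewrite zE; exact: step_start.
have zc t : `|z t - c| <= r.
  rewrite -(subrKA p); apply: le_trans (ler_normD _ _) _.
  by have := zp t; move: MT pc; lra.
exists z; split.
  apply/rowP => i; rewrite zE !mxE clamp_id ?normr0 ?ltW//.
  by have [-> _] := primP (@Xz_continuous _ i zl); rewrite addr0.
move=> t tT; split=> // i.
have [_ HP] := primP (@Xz_continuous _ i zl).
have tT1 : `|t| < T + 1 by apply: lt_trans tT _; rewrite ltrDl.
have := is_derive_add (is_derive_cst_fun (p 0 i) t 1) (HP t tT1).
rewrite add0r /Xc clampv_id//.
apply: near_eq_is_derive.
apply/nbhs_ball_norm; exists (T - `|t|); first by rewrite subr_gt0.
move=> s st; rewrite [in RHS]zE !mxE clamp_id//.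
by rewrite -(subrK t s); apply: le_trans (ler_normD _ _) _; lra.
Qed.

End Picard.

(** * Local bounds and Taylor estimates in boxes *)

Section LocalBounds.
Context {R : realType}.

Lemma near_family_bounded (V : normedModType R) (I : finType) (F : I -> V -> R) (c : V) :
  (forall i, {for c, continuous (F i)}) ->
  exists d K : R, [/\ 0 < d, 0 <= K & forall y i, `|y - c| < d -> `|F i y| <= K].
Proof.
move=> Fc; pose K := \sum_i (`|F i c| + 1).
have : \forall y \near c, forall i, `|F i c - F i y| <= 1.
  apply: (@filter_forall _ _ _ (nbhs c)) => i.
  by have /cvgrPdist_le := Fc i; apply.
move=> /nbhs_ball_norm[d d0 H]; exists d, K; split=> // [|y i /H /(_ i) yi].
  by apply: sumr_ge0 => i _; rewrite addr_ge0.
apply: (@le_trans _ _ (`|F i c| + 1)); last first.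
  by rewrite /K (bigD1 i)//= lerDl sumr_ge0// => j _; rewrite addr_ge0.
have := ler_normD (F i y - F i c) (F i c); rewrite subrK distrC => /le_trans; apply.
by rewrite addrC lerD2l.
Qed.

Lemma C2_bounds n m (U : set 'rV[R]_n) (X : 'I_m -> 'rV[R]_n -> R) c :
  open U -> U c -> (forall i, Ck 2 U (X i)) ->
  exists d K : R, [/\ 0 < d, 0 <= K, (forall y, `|y - c| < d -> U y),
   (forall y i, `|y - c| < d -> `|X i y| <= K) &
   forall y i j, `|y - c| < d -> `|'D_(e_ j) (X i) y| <= K /\
     forall k, `|'D_(e_ k) ('D_(e_ j) (X i)) y| <= K].
Proof.
move=> oU Uc HX; have [d0 d00 H0] := ball_sub_open oU Uc.
have [d1 [K1 [d10 K10 H1]]] := near_family_bounded (fun i => Ck_continuous (HX i) Uc).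
have [d2 [K2 [d20 K20 H2]]] := @near_family_bounded _ ('I_m * 'I_n)%type
  (fun ij => 'D_(e_ ij.2) (X ij.1)) c
  (fun ij => Ck_continuous (Ck_derive (e_ ij.2) (HX ij.1)) Uc).
have [d3 [K3 [d30 K30 H3]]] := @near_family_bounded _ ('I_m * 'I_n * 'I_n)%type
  (fun ij => 'D_(e_ ij.2) ('D_(e_ ij.1.2) (X ij.1.1))) c
  (fun ij => Ck_continuous (Ck_derive (e_ ij.2) (Ck_derive (e_ ij.1.2) (HX ij.1.1))) Uc).
exists (Num.min (Num.min d0 d1) (Num.min d2 d3)), (K1 + K2 + K3); split.
- by rewrite !lt_min d00 d10 d20.
- by rewrite !addr_ge0.
- by move=> y; rewrite !lt_min => /andP[/andP[/H0]].
- move=> y i; rewrite !lt_min => /andP[/andP[_ yd] _].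
  by apply: le_trans (H1 y i yd) _; lra.
- move=> y i j; rewrite !lt_min => /andP[_ /andP[yd2 yd3]]; split=> [|k].
    by apply: le_trans (H2 y (i, j) yd2) _; lra.
  by apply: le_trans (H3 y (i, j, k) yd3) _; lra.
Qed.

Lemma mvt_box_lip n (f : 'rV[R]_n -> R) c (d K : R) :
  (forall z i, `|z - c| < d -> derivable f z (e_ i) /\ `|'D_(e_ i) f z| <= K) ->
  forall y y', `|y - c| < d -> `|y' - c| < d -> `|f y - f y'| <= n%:R * K * `|y - y'|.
Proof.
move=> H y y' yd y'd.
have [xi xid ->] := mvt_box (fun z i zd => (H z i zd).1) yd y'd.
apply: le_trans (ler_norm_sum _ _ _) _.
apply: (@le_trans _ _ (\sum_(i < n) K * `|y - y'|)); last first.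
  by rewrite sumr_const card_ord -mulrA mulr_natl.
apply: ler_sum => i _; rewrite normrM; apply: ler_pM => //.
  exact: (H _ _ (xid i)).2.
by have := mx_norm_coord (y - y') i; rewrite !mxE.
Qed.

(** The partials at the intermediate points of [mvt_box] are compared with those at [y'] by
    [mvt_box_lip]. Since [|y - y'| < 2 / 5 * d], the ball of radius [2 * |y - y'|] around [y'],
    which contains these points, stays in the ball of radius [d] around [c]; this explains
    [d / 5]. *)
Lemma taylor_box n (f : 'rV[R]_n -> R) c (d K : R) : 0 < d ->
  (forall z i, `|z - c| < d -> derivable f z (e_ i)) ->
  (forall z i j, `|z - c| < d -> derivable ('D_(e_ i) f) z (e_ j) /\
     `|'D_(e_ j) ('D_(e_ i) f) z| <= K) ->
  forall y y', `|y - c| < d / 5 -> `|y' - c| < d / 5 ->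
   `|f y - f y' - \sum_i 'D_(e_ i) f y' * (y 0 i - y' 0 i)|
     <= 2 * n%:R ^+ 2 * K * `|y - y'| ^+ 2.
Proof.
move=> d0 Hf H y y' yd y'd.
have [->|yy'] := eqVneq y y'.
  by rewrite big1 => [|i _]; rewrite !subrr ?mulr0// ?subr0 !normr0 expr0n mulr0.
pose q := `|y - y'|; have q0 : 0 < q by rewrite normr_gt0 subr_eq0.
have qd : q < 2 / 5 * d.
  by apply: le_lt_trans (ler_distD c _ _) _; rewrite [`|c - _|]distrC; lra.
have sub z : `|z - y'| < 2 * q -> `|z - c| < d.
  by move=> zq; apply: le_lt_trans (ler_distD y' _ _) _; lra.
have yq : `|y - y'| < 2 * q by rewrite -/q; lra.
have y'q : `|y' - y'| < 2 * q by rewrite subrr normr0 mulr_gt0.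
have [xi xid ->] := mvt_box (fun z i zq => Hf z i (sub z zq)) yq y'q.
rewrite -sumrB; apply: le_trans (ler_norm_sum _ _ _) _.
apply: (@le_trans _ _ (\sum_(i < n) (n%:R * K * (2 * q) * q))); last first.
  rewrite sumr_const card_ord -[leLHS]mulr_natl -/q.
  by rewrite [leLHS](_ : _ = 2 * n%:R ^+ 2 * K * q ^+ 2)//; ring.
apply: ler_sum => i _; rewrite -mulrBl normrM; apply: ler_pM => //; last first.
  by have := mx_norm_coord (y - y') i; rewrite !mxE.
have y'c : `|y' - c| < d by apply: sub.
apply: le_trans (mvt_box_lip (fun z j zd => H z i j zd) (sub _ (xid i)) y'c) _.
apply: ler_wpM2l; last exact/ltW/xid.
by apply: mulr_ge0 => //; exact: le_trans (H y' i i y'c).2.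
Qed.

End LocalBounds.

(** * Local flows and their continuity in the initial data *)

Section Flow.
Context {R : realType}.

Definition pt (s r : R) : 'rV[R]_2 := \row_i (if i == 0 then s else r).

Definition box (s0 rho : R) : set 'rV[R]_2 := [set p | `|p - pt s0 0| < rho].

Lemma pt0 s r : pt s r 0 0 = s. Proof. by rewrite mxE. Qed.
Lemma pt1 s r : pt s r 0 1 = r. Proof. by rewrite mxE. Qed.

Lemma ptE (p : 'rV[R]_2) : p = pt (p 0 0) (p 0 1).
Proof.
apply/rowP => i; rewrite mxE; case: eqVneq => [->//|].
by case: i => [[|[|//]] Hi] //= _; congr (p 0 _); exact: val_inj.
Qed.

Lemma boxP s0 rho (p : 'rV[R]_2) : 0 < rho ->
  box s0 rho p <-> `|p 0 0 - s0| < rho /\ `|p 0 1| < rho.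
Proof.
move=> rho0; rewrite /box /=; split=> [H|[H0 H1]].
  split.
    by have := le_lt_trans (mx_norm_coord _ 0) H; rewrite !mxE.
  by have := le_lt_trans (mx_norm_coord _ 1) H; rewrite !mxE subr0.
apply: mx_norm_lt => // i; rewrite !mxE; case: eqVneq => [->//|].
case: i => [[|[|//]] Hi] //= _; rewrite subr0.
by rewrite (_ : Ordinal Hi = 1)//; exact: val_inj.
Qed.

Lemma box_open s0 rho : open (box s0 rho).
Proof.
rewrite openE => p; rewrite /box /interior /= => pr.
apply/(nbhs_ball_norm p _); exists (rho - `|p - pt s0 0|); first by rewrite subr_gt0.
by move=> q qp; apply: le_lt_trans (ler_distD p _ _) _; rewrite -ltrBrDr.
Qed.

Lemma pt_shift0 s r h : h *: e_ 0 + pt s r = pt (s + h) r.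
Proof.
by apply/rowP => i; rewrite !mxE eqxx /=; case: eqVneq => _; rewrite ?mulr1 ?mulr0 ?add0r// addrC.
Qed.

Lemma pt_shift1 s r h : h *: e_ 1 + pt s r = pt s (r + h).
Proof.
apply/rowP => i; rewrite !mxE eqxx /=; case: i => [[|[|//]] Hi] //=.
  by rewrite mulr0 add0r.
by rewrite mulr1 addrC.
Qed.

Lemma is_derive_pt1 (F : 'rV[R]_2 -> R) (s t d : R) : is_derive (pt s t) (e_ 1) F d ->
  is_derive t 1 (fun t => F (pt s t)) d.
Proof.
move=> /is_derive_epsP H; apply/is_derive_epsP => e /H[r r0 {}H].
by exists r => // h /H; rewrite pt_shift1 [h%:A]mulr1 [h + t]addrC.
Qed.

Lemma is_derive_pt1V (F : 'rV[R]_2 -> R) (s t d : R) :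
  is_derive t 1 (fun t => F (pt s t)) d -> is_derive (pt s t) (e_ 1) F d.
Proof.
move=> /is_derive_epsP H; apply/is_derive_epsP => e /H[r r0 {}H].
by exists r => // h /H; rewrite pt_shift1 [h%:A]mulr1 [h + t]addrC.
Qed.

(** The first coordinate of the argument is the parameter on the curve [z0] of initial values, the
    second one is time. *)
Definition is_flow n (U : set 'rV[R]_n) (X : 'I_n -> 'rV[R]_n -> R) (J : set R)
    (z0 : R -> 'rV[R]_n) (s0 rho : R) (Phi : 'rV[R]_2 -> 'rV[R]_n) : Prop :=
  [/\ (forall p, box s0 rho p -> U (Phi p)),
      (forall s, `|s - s0| < rho -> J s /\ Phi (pt s 0) = z0 s) &
      forall p i, box s0 rho p -> is_derive p (e_ 1) (fun q => Phi q 0 i) (X i (Phi p))].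

Lemma is_flow_shrink n (U : set 'rV[R]_n) X J z0 s0 rho rho' Phi :
  rho' <= rho -> is_flow U X J z0 s0 rho Phi -> is_flow U X J z0 s0 rho' Phi.
Proof.
move=> rr [H1 H2 H3].
have bb p : box s0 rho' p -> box s0 rho p by move=> /lt_le_trans; apply.
split=> [p /bb|s sr|p i /bb]; [exact: H1| |exact: H3].
by apply: H2; exact: lt_le_trans rr.
Qed.

(** Picard solutions with a common existence time are chosen for each [s] separately. Gronwall's
    estimate for two of them gives continuity in [s], and boundedness of the field gives continuity
    in time. *)
Lemma local_flow n (U : set 'rV[R]_n) (X : 'I_n -> 'rV[R]_n -> R) (J : set R)
    (z0 : R -> 'rV[R]_n) (s0 : R) : open U -> (forall i, Ck 2 U (X i)) -> open J ->
  J s0 -> (forall i, Ck 0 J (fun s => z0 s 0 i)) -> U (z0 s0) ->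
  exists rho Phi, [/\ 0 < rho, is_flow U X J z0 s0 rho Phi &
    forall i, Ck 0 (box s0 rho) (fun p => Phi p 0 i)].
Proof.
move=> oU HX oJ Js0 z0c Uz0.
have [d [K [d0 K0 HU HXK HDX]]] := C2_bounds oU Uz0 HX.
pose r := d / 2; have r0 : 0 < r by rewrite divr_gt0.
have rd : r < d by rewrite /r ltr_pdivrMr// ltr_pMr// ltr1n.
pose L := n%:R * K; have L0 : 0 <= L by rewrite mulr_ge0.
have XL y y' i : `|y - z0 s0| <= r -> `|y' - z0 s0| <= r ->
    `|X i y - X i y'| <= L * `|y - y'|.
  move=> yr y'r; apply: (@mvt_box_lip _ _ _ (z0 s0) d K).
  - move=> z j zd; split; last exact: (HDX z i j zd).1.
    exact: is_derive_ex (Ck_is_derive _ (HX i) (HU _ zd)).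
  - exact: le_lt_trans rd.
  - exact: le_lt_trans rd.
pose T := Num.min 1 (Num.min (r / 2 / (K + 1)) (1 / 2 / (L + 1))).
have K1 : 0 < K + 1 by rewrite ltr_wpDl.
have L1 : 0 < L + 1 by rewrite ltr_wpDl.
have T0 : 0 < T by rewrite !lt_min ltr01 !divr_gt0.
have KT : K * T <= r / 2.
  have : T <= r / 2 / (K + 1) by rewrite /T !ge_min lexx orbT.
  by rewrite ler_pdivlMr//; have := T0; nra.
have LT : L * T <= 1 / 2.
  have : T <= 1 / 2 / (L + 1) by rewrite /T !ge_min lexx !orbT.
  by rewrite ler_pdivlMr//; have := T0; nra.
have z0c' s : J s -> {for s, continuous z0}.
  by move=> Js; apply: continuous_rV => i; exact: Ck_continuous (z0c i) Js.
have [r1 r10 Hr1] : exists2 r1, 0 < r1 & forall s, `|s - s0| < r1 ->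
    J s /\ `|z0 s - z0 s0| <= r / 2.
  have r2 : 0 < r / 2 by rewrite divr_gt0.
  have : \forall s \near s0, J s /\ `|z0 s0 - z0 s| <= r / 2.
    apply: filterI; first exact: open_nbhs_nbhs (conj oJ Js0).
    by have /cvgrPdist_le /(_ _ r2) := z0c' _ Js0.
  by move=> /nbhs_ball_norm[r1 r10 H]; exists r1 => // s /H; rewrite distrC.
have /choice[z Hz] : forall s, exists z : R -> 'rV[R]_n, `|s - s0| < r1 ->
   z 0 = z0 s /\ forall t : R, `|t| < T ->
  `|z t - z0 s0| <= r /\ forall i, is_derive t 1 (fun s => z s 0 i) (X i (z t)).
  move=> s; have [sr|sr] := ltP `|s - s0| r1; last by exists (fun=> 0).
  have [z Hz] := @picard R n X (z0 s0) (z0 s) r K L T r0 K0 L0 T0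
    (fun y i yr => HXK y i (le_lt_trans yr rd)) XL KT LT (Hr1 _ sr).2.
  by exists z.
pose rho := Num.min r1 (T / 2); pose Phi (p : 'rV[R]_2) := z (p 0 0) (p 0 1).
have rho0 : 0 < rho by rewrite lt_min r10 divr_gt0.
have rho1 : rho <= r1 by rewrite ge_min lexx.
have rhoT : rho < T.
  by rewrite gt_min; apply/orP; right; rewrite ltr_pdivrMr// ltr_pMr// ltr1n.
have flow p : box s0 rho p -> `|p 0 0 - s0| < r1 /\ `|p 0 1| < T.
  by move=> /(boxP _ _ rho0)[h0 h1]; split; [exact: lt_le_trans rho1|exact: lt_trans rhoT].
have PhiU p : box s0 rho p -> `|Phi p - z0 s0| <= r.
  by move=> /flow[h0 h1]; have [_ /(_ _ h1)[]] := Hz _ h0.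
exists rho, Phi; split=> //.
  split.
  - by move=> p /PhiU pr; apply: HU; exact: le_lt_trans rd.
  - move=> s sr; have sr1 := lt_le_trans sr rho1; split; first exact: (Hr1 _ sr1).1.
    by rewrite /Phi pt0 pt1; exact: (Hz _ sr1).1.
  - move=> p i /flow[h0 h1]; rewrite [p in is_derive p]ptE.
    apply: is_derive_pt1V; rewrite [X in is_derive _ _ X](_ : _ = fun t => z (p 0 0) t 0 i).
      exact: ((Hz _ h0).2 _ h1).2.
    by apply/funext => t; rewrite /Phi pt0 pt1.
move=> i; split=> // p pb; have [h0 h1] := (boxP _ _ rho0).1 pb.
apply/continuous_epsP => e e0.
pose G := gronwall_const n L rho.
have G1 : 1 <= G by apply: gronwall_const_ge1 => //; exact: ltW.
have G0 : 0 < G by apply: lt_le_trans G1.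
have e3 : 0 < e / 2 / G by rewrite !divr_gt0.
have sr1 := lt_le_trans h0 rho1.
have /cvgrPdist_le /(_ _ e3) := z0c' _ (Hr1 _ sr1).1.
move=> /(nbhs_ball_norm (p 0 0) _).1[d1 d10 Hd1].
have bo : open (box s0 rho) by exact: box_open.
have [d2 d20 Hd2] := ball_sub_open bo pb.
exists (Num.min (Num.min d1 d2) (e / 2 / (K + 1))).
  by rewrite !lt_min d10 d20 !divr_gt0.
move=> q; rewrite !lt_min => /andP[/andP[qd1 qd2] qe].
have qb := Hd2 _ qd2; have [q0 q1] := (boxP _ _ rho0).1 qb.
have qsr1 := lt_le_trans q0 rho1.
have q0d : `|q 0 0 - p 0 0| < d1.
  by have := le_lt_trans (mx_norm_coord (q - p) 0) qd1; rewrite !mxE.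
have q1d : `|q 0 1 - p 0 1| < e / 2 / (K + 1).
  by have := le_lt_trans (mx_norm_coord (q - p) 1) qe; rewrite !mxE.
have tT (t : R) : `|t| <= rho -> `|t| < T by move=> /le_lt_trans; apply.
have HDt (t : R) j : `|t| <= rho -> is_derive t 1
    (fun t => (z (q 0 0) t - z (p 0 0) t) 0 j) (X j (z (q 0 0) t) - X j (z (p 0 0) t)).
  move=> /tT tr.
  under eq_fun do rewrite !mxE.
  exact: is_derive_sub (((Hz _ qsr1).2 _ tr).2 j) (((Hz _ sr1).2 _ tr).2 j).
have Hb (t : R) j : `|t| <= rho -> `|X j (z (q 0 0) t) - X j (z (p 0 0) t)| <=
   L * `|z (q 0 0) t - z (p 0 0) t| + 0.
  move=> /tT tr; rewrite addr0; apply: XL.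
    exact: ((Hz _ qsr1).2 _ tr).1.
  exact: ((Hz _ sr1).2 _ tr).1.
have gr := gronwall_vec L0 (lexx 0) HDt Hb (ltW q1).
rewrite addr0 (Hz _ qsr1).1 (Hz _ sr1).1 -/G distrC in gr.
apply: le_trans (ler_distD (z (p 0 0) (q 0 1) 0 i) _ _) _.
rewrite [e]splitr lerD//.
  have := mx_norm_coord (z (q 0 0) (q 0 1) - z (p 0 0) (q 0 1)) i; rewrite !mxE => /le_trans; apply.
  rewrite distrC; apply: le_trans gr _; rewrite -ler_pdivlMl// mulrC distrC; exact: Hd1.
have HX1 (t : R) : `|t| < T -> is_derive t 1 (fun t => z (p 0 0) t 0 i) (X i (z (p 0 0) t)).
  by move=> tr; exact: ((Hz _ sr1).2 _ tr).2.
have HX2 (t : R) : `|t| < T -> `|X i (z (p 0 0) t)| <= K.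
  by move=> tr; apply: HXK; apply: le_lt_trans rd; exact: ((Hz _ sr1).2 _ tr).1.
apply: le_trans (mvt_lipschitz HX1 HX2 (lt_trans q1 rhoT) (lt_trans h1 rhoT)) _.
move: q1d; rewrite ltr_pdivlMr// => q1d; have := normr_ge0 (q 0 1 - p 0 1); lra.
Qed.

End Flow.

(** * First variation equation and smoothness of flows *)

Section TangentLift.
Context {R : realType} (n : nat).

(** The equation together with its first variation. For the initial curve [lift_init z0], the second
    half of a solution is the derivative of the first half with respect to the parameter
    ([flow_derive]). *)
Definition lift_field (X : 'I_n -> 'rV[R]_n -> R) (i : 'I_(n + n)) (y : 'rV[R]_(n + n)) : R :=
  match fintype.split i with
  | inl j => X j (lsubmx y)
  | inr j => \sum_l 'D_(e_ l) (X j) (lsubmx y) * y 0 (rshift n l)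
  end.

Definition lift_init (z0 : R -> 'rV[R]_n) (s : R) : 'rV[R]_(n + n) :=
  row_mx (z0 s) (\row_i 'D_1 (fun s => z0 s 0 i) s).

Lemma lift_fieldl X i y : lift_field X (lshift n i) y = X i (lsubmx y).
Proof. by rewrite /lift_field (unsplitK (inl i)). Qed.

Lemma lift_fieldr X i y : lift_field X (rshift n i) y =
  \sum_l 'D_(e_ l) (X i) (lsubmx y) * y 0 (rshift n l).
Proof. by rewrite /lift_field (unsplitK (inr i)). Qed.

Lemma lsubmx_continuous : continuous (lsubmx : 'rV[R]_(n + n) -> 'rV[R]_n).
Proof.
move=> y; apply: continuous_rV => i.
rewrite (_ : (fun _ => _) = fun y : 'rV[R]_(n + n) => y 0 (lshift n i)).
  exact: coord_continuous_rV.
by apply/funext => x; rewrite mxE.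
Qed.

Lemma lift_open (U : set 'rV[R]_n) : open U -> open [set y : 'rV[R]_(n + n) | U (lsubmx y)].
Proof. by move=> oU; apply: open_comp => // y _; exact: lsubmx_continuous. Qed.

Lemma lift_field_Ck (U : set 'rV[R]_n) X : open U -> (forall i l, Ck l U (X i)) ->
  forall i l, Ck l [set y : 'rV[R]_(n + n) | U (lsubmx y)] (lift_field X i).
Proof.
move=> oU HX i l; have oV := lift_open oU.
have comp f : Ck l U f -> Ck l [set y : 'rV[R]_(n + n) | U (lsubmx y)] (fun y => f (lsubmx y)).
  move=> Hf; apply: (Ck_comp oV oU) => // j.
  by apply: Ck_eq (Ck_coord l (lshift n j) oV) => // x _; rewrite mxE.
rewrite /lift_field; case: (fintype.split i) => j; first exact: comp.
apply: Ck_sum => // k; apply: CkM => //; last exact: Ck_coord.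
by apply: (comp ('D_(e_ k) (X j))); apply: Ck_derive; exact: HX.
Qed.

Lemma lift_init_Ck (J : set R) (z0 : R -> 'rV[R]_n) : open J -> (forall i l, Ck l J (fun s => z0 s 0 i)) ->
  forall i l, Ck l J (fun s => lift_init z0 s 0 i).
Proof.
move=> oJ Hz i l; rewrite -(splitK i); case: (fintype.split i) => j /=.
  by apply: Ck_eq (Hz j l) => // s _; rewrite /lift_init row_mxEl.
have H := Ck_derive (1 : R) (Hz j l.+1).
by apply: Ck_eq H => // s _; rewrite /lift_init row_mxEr mxE.
Qed.

End TangentLift.

Section SmoothFlow.
Context {R : realType}.

Lemma rV_eps_derive n (z : R -> 'rV[R]_n) (s : R) (dz : 'rV[R]_n) :
  (forall i, is_derive s 1 (fun s => z s 0 i) (dz 0 i)) ->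
  forall e : R, 0 < e -> exists2 r : R, 0 < r &
   forall h : R, `|h| < r -> `|z (s + h) - z s - h *: dz| <= e * `|h|.
Proof.
move=> H e e0.
have : \forall h \near (0 : R), forall i, `|z (s + h) 0 i - z s 0 i - h * dz 0 i| <= e * `|h|.
  apply: (@filter_forall _ _ _ (nbhs (0 : R))) => i; apply/nbhs0P.
  have [r r0 Hr] := (is_derive_epsP _ _ _ _).1 (H i) e e0.
  by exists r => // h /Hr; rewrite [h%:A]mulr1 [h + s]addrC.
move=> /nbhs0P[r r0 Hr]; exists r => // h /Hr hi.
by apply: mx_norm_le => [|i]; [rewrite mulr_ge0// ltW|rewrite !mxE; exact: hi].
Qed.

(* The s-derivative of the flow: both Phi(s+h) - Phi(s) and its first order
   expansion solve the same linearised equation up to O(h^2). *)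
Lemma flow_derive n (U : set 'rV[R]_n) (X : 'I_n -> 'rV[R]_n -> R) (J : set R)
    (z0 : R -> 'rV[R]_n) (s0 rho d K : R) (Phi W : 'rV[R]_2 -> 'rV[R]_n) :
  0 < rho -> 0 < d -> 0 <= K ->
  (forall z i, `|z - z0 s0| < d -> derivable (X i) z 0 /\ Ck 2 U (X i) /\ U z) ->
  (forall z i j, `|z - z0 s0| < d -> `|'D_(e_ j) (X i) z| <= K /\
     forall k, `|'D_(e_ k) ('D_(e_ j) (X i)) z| <= K) ->
  is_flow U X J z0 s0 rho Phi ->
  (forall p, box s0 rho p -> `|Phi p - z0 s0| < d / 5) ->
  (forall s i, `|s - s0| < rho -> is_derive s 1 (fun s => z0 s 0 i) (W (pt s 0) 0 i)) ->
  (forall p i, box s0 rho p -> is_derive p (e_ 1) (fun q => W q 0 i)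
      (\sum_l 'D_(e_ l) (X i) (Phi p) * W p 0 l)) ->
  forall p i, box s0 rho p -> is_derive p (e_ 0) (fun q => Phi q 0 i) (W p 0 i).
Proof.
move=> rho0 d0 K0 HX HD [FU F0 FD] Fd W0 WD p i pb.
have [pb0 pb1] := (boxP _ _ rho0).1 pb.
set s := p 0 0 in pb0; set r := p 0 1 in pb1.
pose L := n%:R * K; have L0 : 0 <= L by rewrite mulr_ge0.
pose T := `|r|; pose G := gronwall_const n L T.
have G1 : 1 <= G by apply: gronwall_const_ge1 => //; exact: normr_ge0.
have G0 : 0 < G by apply: lt_le_trans G1.
have dX z j : `|z - z0 s0| < d -> forall k, derivable (X j) z (e_ k).
  by move=> zd k; have [_ [H2 Uz]] := HX z j zd; exact: is_derive_ex (Ck_is_derive _ H2 Uz).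
have ddX z j : `|z - z0 s0| < d -> forall k l, derivable ('D_(e_ k) (X j)) z (e_ l).
  move=> zd k l; have [_ [H2 Uz]] := HX z j zd.
  exact: is_derive_ex (Ck_is_derive _ (Ck_derive (e_ k) H2) Uz).
have d5 z : `|z - z0 s0| < d / 5 -> `|z - z0 s0| < d.
  by move=> /lt_trans; apply; rewrite ltr_pdivrMr// ltr_pMr// ltr1n.
have ptb s' (t : R) : `|s' - s0| < rho -> `|t| <= T -> box s0 rho (pt s' t).
  move=> s'r tT; apply/(boxP _ _ rho0); rewrite pt0 pt1; split=> //.
  exact: le_lt_trans pb1.
have PD s' (t : R) j : `|s' - s0| < rho -> `|t| <= T ->
   is_derive t 1 (fun t => Phi (pt s' t) 0 j) (X j (Phi (pt s' t))).
  move=> s'r tT; apply: (is_derive_pt1 (F := fun q => Phi q 0 j)); exact: FD (ptb _ _ s'r tT).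
rewrite [p in is_derive p]ptE -/s -/r; apply/is_derive_epsP => e e0.
pose Z := `|W (pt s 0)|.
pose C1 := Z + 1; have C10 : 0 < C1 by rewrite /C1 ltr_wpDl// normr_ge0.
pose B := 2 * n%:R ^+ 2 * K * (G * C1) ^+ 2.
have B0 : 0 <= B.
  apply: mulr_ge0; last exact: sqr_ge0.
  by apply: mulr_ge0 => //; apply: mulr_ge0 => //; exact: sqr_ge0.
(* After Gronwall the error is at most [G] times the sum of the initial error and the quadratic
   remainder [B * |h|^2]; each of these is made at most [e' * |h|]. *)
pose e' := Num.min 1 (e / (2 * G)).
have e'0 : 0 < e' by rewrite lt_min ltr01 divr_gt0// mulr_gt0.
have [h0 h00 Hh] := rV_eps_derive (W0 s ^~ pb0) e'0.
exists (Num.min (Num.min h0 (rho - `|s - s0|)) (e' / (B + 1))).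
  rewrite !lt_min h00 subr_gt0 pb0 divr_gt0// ltr_wpDl//.
move=> h; rewrite !lt_min => /andP[/andP[/Hh {}Hh hs] hB].
have shr : `|s + h - s0| < rho.
  by rewrite addrAC; apply: le_lt_trans (ler_normD _ _) _; lra.
rewrite pt_shift0.
have z0E : Phi (pt s 0) = z0 s by exact: (F0 s pb0).2.
have z0E' : Phi (pt (s + h) 0) = z0 (s + h) by exact: (F0 _ shr).2.
have lipz : `|z0 (s + h) - z0 s| <= C1 * `|h|.
  have := ler_normD (z0 (s + h) - z0 s - h *: W (pt s 0)) (h *: W (pt s 0)).
  rewrite subrK normrZ -/Z => /le_trans; apply.
  have : e' <= 1 by rewrite ge_min lexx.
  by have := normr_ge0 h; move: Hh; rewrite /C1; nra.
have D1b (u : R) : `|u| <= T -> `|Phi (pt (s + h) u) - Phi (pt s u)| <= G * (C1 * `|h|).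
  move=> tT.
  have HDt (t : R) j : `|t| <= T -> is_derive t 1
     (fun t => (Phi (pt (s + h) t) - Phi (pt s t)) 0 j) (X j (Phi (pt (s + h) t)) - X j (Phi (pt s t))).
    move=> t'T; under eq_fun do rewrite !mxE.
    exact: is_derive_sub (PD _ _ j shr t'T) (PD _ _ j pb0 t'T).
  have Hb (t : R) j : `|t| <= T -> `|X j (Phi (pt (s + h) t)) - X j (Phi (pt s t))| <=
      L * `|Phi (pt (s + h) t) - Phi (pt s t)| + 0.
    move=> t'T; rewrite addr0; apply: (@mvt_box_lip _ _ _ (z0 s0) d).
    - by move=> z k zd; split; [exact: dX|exact: (HD z j k zd).1].
    - exact/d5/Fd/ptb.
    - exact/d5/Fd/ptb.
  have := gronwall_vec L0 (lexx 0) HDt Hb tT; rewrite addr0 z0E z0E' => /le_trans; apply.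
  by rewrite ler_wpM2l// ltW.
pose D (t : R) := Phi (pt (s + h) t) - Phi (pt s t) - h *: W (pt s t).
pose dD j (t : R) := X j (Phi (pt (s + h) t)) - X j (Phi (pt s t))
  - h * \sum_l 'D_(e_ l) (X j) (Phi (pt s t)) * W (pt s t) 0 l.
have HDt (t : R) j : `|t| <= T -> is_derive t 1 (fun t => D t 0 j) (dD j t).
  move=> tT; rewrite /D; under eq_fun do rewrite !mxE.
  apply: is_derive_sub; first exact: is_derive_sub (PD _ _ j shr tT) (PD _ _ j pb0 tT).
  apply: is_derive_scale; apply: (is_derive_pt1 (F := fun q => W q 0 j)).
  exact: WD (ptb _ _ pb0 tT).
have Hb (t : R) j : `|t| <= T -> `|dD j t| <= L * `|D t| + B * `|h| ^+ 2.
  move=> tT; set y := Phi (pt (s + h) t); set y' := Phi (pt s t).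
  have tay := @taylor_box _ _ (X j) (z0 s0) d K d0 (fun z k zd => dX z j zd k)
    (fun z k l zd => conj (ddX z j zd k l) ((HD z j k zd).2 l)) y y'
    (Fd _ (ptb _ _ shr tT)) (Fd _ (ptb _ _ pb0 tT)).
  have -> : dD j t = (X j y - X j y' - \sum_l 'D_(e_ l) (X j) y' * (y 0 l - y' 0 l))
     + \sum_l 'D_(e_ l) (X j) y' * D t 0 l.
    have -> : \sum_l 'D_(e_ l) (X j) y' * D t 0 l =
       \sum_l 'D_(e_ l) (X j) y' * (y 0 l - y' 0 l)
       - h * \sum_l 'D_(e_ l) (X j) y' * W (pt s t) 0 l.
      rewrite mulr_sumr -sumrB; apply: eq_bigr => l _.
      by rewrite /D -/y -/y' !mxE; ring.
    by rewrite /dD -/y -/y'; ring.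
  apply: le_trans (ler_normD _ _) _; rewrite addrC; apply: lerD.
    apply: le_trans (ler_norm_sum _ _ _) _.
    apply: (@le_trans _ _ (\sum_(l < n) K * `|D t|)); last first.
      by rewrite sumr_const card_ord /L -mulrA mulr_natl.
    apply: ler_sum => l _; rewrite normrM; apply: ler_pM => //; last exact: mx_norm_coord.
    exact: (HD _ j l (d5 _ (Fd _ (ptb _ _ pb0 tT)))).1.
  apply: le_trans tay _; rewrite /B -[leRHS]mulrA -exprMn.
  apply: ler_wpM2l.
    by apply: mulr_ge0 => //; apply: mulr_ge0 => //; exact: sqr_ge0.
  have G00 := ltW G0; have C10' := ltW C10.
  apply: lerXn2r; rewrite ?nnegrE; first exact: normr_ge0.
    by apply: mulr_ge0; [exact: mulr_ge0|exact: normr_ge0].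
  by rewrite -mulrA; exact: D1b.
have bh0 : 0 <= B * `|h| ^+ 2 by rewrite mulr_ge0// exprn_ge0.
have := gronwall_vec L0 bh0 HDt Hb (lexx T).
rewrite -/G => gr.
have -> : Phi (pt (s + h) r) 0 i - Phi (pt s r) 0 i - h * W p 0 i = D r 0 i.
  by rewrite /D !mxE /s /r -ptE.
apply: le_trans (mx_norm_coord _ _) _; apply: le_trans gr _.
have D0 : `|D 0| <= e' * `|h| by rewrite /D z0E z0E'.
have hB' : B * `|h| ^+ 2 <= e' * `|h|.
  rewrite expr2 mulrA ler_wpM2r//; move: hB; rewrite ltr_pdivlMr ?ltr_wpDl// => hB.
  by have := normr_ge0 h; lra.
have : e' <= e / (2 * G) by rewrite ge_min lexx orbT.
have G2 : 0 < 2 * G by exact: mulr_gt0.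
rewrite (ler_pdivlMr _ _ G2) => He'.
apply: (@le_trans _ _ (G * (2 * (e' * `|h|)))).
  by apply: ler_wpM2l; [exact: ltW|rewrite mulr_natl mulr2n; exact: lerD].
by have := ler_wpM2r (normr_ge0 h) He'; lra.
Qed.

(** Induction over all systems and dimensions at once: the induction hypothesis is applied to the
    lifted system in dimension [n + n]. The first half [Phi] of its flow is a flow of [X], the
    second half is the parameter derivative of [Phi], and the time derivative is [X] after [Phi].
    All of these are C^k, so [Phi] is C^{k+1}. *)
Theorem flow_Ck k : forall n (U : set 'rV[R]_n) (X : 'I_n -> 'rV[R]_n -> R)
    (J : set R) (z0 : R -> 'rV[R]_n) (s0 : R), open U -> (forall i l, Ck l U (X i)) ->
  open J -> J s0 -> (forall i l, Ck l J (fun s => z0 s 0 i)) -> U (z0 s0) ->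
  exists rho Phi, [/\ 0 < rho, is_flow U X J z0 s0 rho Phi &
    forall i, Ck k (box s0 rho) (fun p => Phi p 0 i)].
Proof.
elim: k => [|k IH] n U X J z0 s0 oU HX oJ Js0 Hz Uz0.
  by apply: local_flow.
have oV := lift_open oU.
have [|rho1 [Psi [rho10 [PU P0 PD] PC]]] := IH _ _ _ _ _ s0 oV (lift_field_Ck oU HX) oJ Js0
  (lift_init_Ck oJ Hz).
  by rewrite /= /lift_init row_mxKl.
have [d [K [d0 K0 HU HXK HDX]]] := C2_bounds oU Uz0 (HX ^~ 2).
pose Phi p := lsubmx (Psi p); pose W p := rsubmx (Psi p).
have PhiE0 i : (fun q => Phi q 0 i) = (fun q => Psi q 0 (lshift n i)).
  by apply/funext => q; rewrite mxE.
have WE0 i : (fun q => W q 0 i) = (fun q => Psi q 0 (rshift n i)).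
  by apply/funext => q; rewrite mxE.
have bo rho : open (box s0 rho) by exact: box_open.
have Phi_C i : Ck k (box s0 rho1) (fun p => Phi p 0 i).
  by apply: Ck_eq (PC (lshift n i)) => // p _; rewrite mxE.
have W_C i : Ck k (box s0 rho1) (fun p => W p 0 i).
  by apply: Ck_eq (PC (rshift n i)) => // p _; rewrite mxE.
have b0 : box s0 rho1 (pt s0 0) by rewrite /box /= subrr normr0.
have Phic : {for pt s0 0, continuous Phi}.
  by apply: continuous_rV => i; exact: Ck_continuous (Phi_C i) b0.
have d5 : 0 < d / 5 by rewrite divr_gt0.
have s00 : `|s0 - s0| < rho1 by rewrite subrr normr0.
have PhiE s : `|s - s0| < rho1 -> Phi (pt s 0) = z0 s.
  by move=> sr; rewrite /Phi (P0 s sr).2 /lift_init row_mxKl.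
have /cvgrPdist_lt /(_ _ d5) := Phic.
move=> /(nbhs_ball_norm (pt s0 0) _).1[rho2 rho20 Hrho2].
pose rho := Num.min rho1 rho2.
have rho0 : 0 < rho by rewrite lt_min rho10.
have rr1 : rho <= rho1 by rewrite ge_min lexx.
have bb p : box s0 rho p -> box s0 rho1 p by move=> /lt_le_trans; apply.
have Fl : is_flow U X J z0 s0 rho1 Phi.
  split=> [p /PU//|s sr|p i pb]; first by split; [exact: (P0 s sr).1|exact: PhiE].
  have := PD p (lshift n i) pb; rewrite lift_fieldl.
  by rewrite PhiE0.
have Flr := is_flow_shrink rr1 Fl.
(* The box is shrunk until the flow stays in the ball of radius [d / 5] on which [taylor_box]
   operates. *)
have Fd p : box s0 rho p -> `|Phi p - z0 s0| < d / 5.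
  rewrite -(PhiE s0 s00) distrC => pb; apply: Hrho2.
  by apply: lt_le_trans pb _; rewrite ge_min lexx orbT.
have W0 s i : `|s - s0| < rho -> is_derive s 1 (fun s => z0 s 0 i) (W (pt s 0) 0 i).
  move=> sr; have [Js E] := P0 s (lt_le_trans sr rr1).
  rewrite /W E /lift_init row_mxKr mxE; exact: Ck_is_derive (Hz i 1%N) Js.
have WD p i : box s0 rho p -> is_derive p (e_ 1) (fun q => W q 0 i)
      (\sum_l 'D_(e_ l) (X i) (Phi p) * W p 0 l).
  move=> /bb pb; have := PD p (rshift n i) pb; rewrite lift_fieldr.
  rewrite WE0; congr is_derive; apply: eq_bigr => l _.
  by rewrite -[W p 0 l]/((fun q => W q 0 l) p) WE0.
have HXd z i : `|z - z0 s0| < d -> derivable (X i) z 0 /\ Ck 2 U (X i) /\ U z.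
  by move=> zd; split; [exact: derivable0|split; [exact: HX|exact: HU]].
have D0 := flow_derive rho0 d0 K0 HXd HDX Flr Fd W0 WD.
exists rho, Phi; split=> // i.
have C0 j : Ck k (box s0 rho) (fun p => Phi p 0 j) by apply: Ck_sub (Phi_C j).
apply: (@Ck_partials _ _ _ _ _ (fun j p => if j == 0 then W p 0 i else X i (Phi p))) => //.
- by move=> p pb; exact: Ck_continuous (C0 i) pb.
- move=> p j pb; case: eqVneq => [->|]; first exact: D0.
  case: j => [[|[|//]] Hj] //= _.
  rewrite (_ : Ordinal Hj = 1); last exact: val_inj.
  by case: Flr => _ _; apply.
- move=> j; case: eqVneq => _; first by apply: Ck_sub (W_C i).
  apply: (Ck_comp (W := U)) => // p pb; by case: Flr => H _ _; exact: H.
Qed.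

End SmoothFlow.

(** * Algebra of Christoffel symbols and curvature in dimension two *)

Section ChristoffelAlgebra.
Context {R : realType}.

Lemma sum2E (F : 'I_2 -> R) : \sum_i F i = F 0 + F 1.
Proof.
by rewrite big_ord_recl big_ord_recl big_ord0 addr0; congr (F _ + F _); exact: val_inj.
Qed.

Lemma ord2P (i : 'I_2) : i = 0 \/ i = 1.
Proof.
by case: i => [[|[|//]] Hi]; [left|right]; exact: val_inj.
Qed.

Lemma det2E (M : 'M[R]_2) : \det M = M 0 0 * M 1 1 - M 0 1 * M 1 0.
Proof.
rewrite (expand_det_row _ 0) sum2E /cofactor !det_mx11 !mxE /= expr0 expr1.
rewrite mul1r mulN1r mulrN; congr (_ * M _ _ - _ * M _ _); exact: val_inj.
Qed.

(** [dg] is the derivative of the pulled back metric J h J^T. In the combination for the Christoffel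
    symbols of the first kind the terms with [H i l] and [H j l] cancel, and [H i j] survives
    twice. *)
Lemma first_kind_transform (h J : 'I_2 -> 'I_2 -> R) (dh H : 'I_2 -> 'I_2 -> 'I_2 -> R)
    (i j l : 'I_2) :
  (forall a b, h a b = h b a) -> (forall c a b, dh c a b = dh c b a) ->
  (forall p k a, H p k a = H k p a) ->
  let dg p i j := \sum_a \sum_b ((H p i a * h a b + J i a * (\sum_c dh c a b * J p c)) * J j b
     + J i a * h a b * H p j b) in
  dg i j l + dg j i l - dg l i j =
  2 * (\sum_a \sum_c J l a * h a c * H i j c) +
  \sum_a \sum_b \sum_c J l a * (dh b c a + dh c b a - dh a b c) * J i b * J j c.
Proof.
move=> hs dhs Hs /=; rewrite !sum2E (hs 1 0) !(dhs _ 1 0).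
case: (ord2P i) => ->; case: (ord2P j) => ->; case: (ord2P l) => ->;
  rewrite ?(Hs 1 0); ring.
Qed.

(** Raising an index without an inverse matrix: the defect of the transformation law is annihilated
    by J h, which is invertible in the application. *)
Lemma raise_first_kind (g h J : 'I_2 -> 'I_2 -> R) (C H : 'I_2 -> R)
    (C' : 'I_2 -> 'I_2 -> 'I_2 -> R) (i j l : 'I_2) :
  (forall k, g l k = \sum_a \sum_b J l a * h a b * J k b) ->
  2 * (\sum_k g l k * C k) = 2 * (\sum_a \sum_c J l a * h a c * H c) +
    \sum_a \sum_b \sum_c J l a * (2 * \sum_k h a k * C' k b c) * J i b * J j c ->
  \sum_c (\sum_a J l a * h a c) *
    (\sum_k C k * J k c - (H c + \sum_a \sum_b C' c a b * J i a * J j b)) = 0.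
Proof.
move=> gE E; have two : (2 : R) != 0 by [].
apply: (mulfI two); rewrite mulr0.
move/eqP: E; rewrite -subr_eq0 => /eqP E; apply: etrans E.
by rewrite !sum2E !gE !sum2E; ring.
Qed.

(** The [l]-th component of the curvature R(d_0, d_1) applied to d_k, with the derivatives of the
    Christoffel symbols as independent arguments. *)
Definition riem (C : 'I_2 -> 'I_2 -> 'I_2 -> R) (dC : 'I_2 -> 'I_2 -> 'I_2 -> 'I_2 -> R)
    (l k : 'I_2) : R :=
  dC 0 l 1 k - dC 1 l 0 k + \sum_m (C m 1 k * C l 0 m - C m 0 k * C l 1 m).

(* C l i j stands for the Christoffel symbol and dC p l i j for its p-th
   derivative; the third derivatives T drop out by antisymmetrisation. *)
Lemma riem_transform (C C' : 'I_2 -> 'I_2 -> 'I_2 -> R)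
    (dC dC' : 'I_2 -> 'I_2 -> 'I_2 -> 'I_2 -> R) (J : 'I_2 -> 'I_2 -> R)
    (H : 'I_2 -> 'I_2 -> 'I_2 -> R) (T : 'I_2 -> 'I_2 -> 'I_2 -> 'I_2 -> R) (c : 'I_2) :
  (forall l i j, C l i j = C l j i) -> (forall l i j, C' l i j = C' l j i) ->
  (forall p k a, H p k a = H k p a) -> (forall p q r a, T p q r a = T q p r a) ->
  (forall c i j, \sum_k C k i j * J k c = H i j c + \sum_a \sum_b C' c a b * J i a * J j b) ->
  (forall c p i j, \sum_k (dC p k i j * J k c + C k i j * H p k c) =
     T p i j c + \sum_a \sum_b (((\sum_d dC' d c a b * J p d) * J i a + C' c a b * H p i a) * J j b +
        C' c a b * J i a * H p j b)) ->
  \sum_l riem C dC l 1 * J l c =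
   (J 0 0 * J 1 1 - J 0 1 * J 1 0) * \sum_k J 1 k * riem C' dC' c k.
Proof.
move=> Cs C's Hs Ts E1 E2.
pose e1 c i j := \sum_k C k i j * J k c - (H i j c + \sum_a \sum_b C' c a b * J i a * J j b).
pose e2 c p i j := \sum_k (dC p k i j * J k c + C k i j * H p k c) -
     (T p i j c + \sum_a \sum_b (((\sum_d dC' d c a b * J p d) * J i a + C' c a b * H p i a) * J j b +
        C' c a b * J i a * H p j b)).
have e10 x i j : e1 x i j = 0 by rewrite /e1 E1 subrr.
have e20 x p i j : e2 x p i j = 0 by rewrite /e2 E2 subrr.
apply/eqP; rewrite -subr_eq0; apply/eqP.
(* The difference of the two sides is a combination of the vanishing defects [e1], [e2]: the
   differentiated law, antisymmetrised, corrected by the undifferentiated law times Christoffel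
   symbols. *)
transitivity (e2 c 0 1 1 - e2 c 1 0 1
  + (C 0 1 1 * e1 c 0 0 + C 1 1 1 * e1 c 0 1) - (C 0 0 1 * e1 c 1 0 + C 1 0 1 * e1 c 1 1)
  + (C' c 0 0 * J 0 0 * e1 0 1 1 + C' c 0 1 * J 0 0 * e1 1 1 1
    + C' c 0 1 * J 0 1 * e1 0 1 1 + C' c 1 1 * J 0 1 * e1 1 1 1)
  - (C' c 0 0 * J 1 0 * e1 0 0 1 + C' c 0 1 * J 1 0 * e1 1 0 1
    + C' c 0 1 * J 1 1 * e1 0 0 1 + C' c 1 1 * J 1 1 * e1 1 0 1));
  last by rewrite !e10 !e20; ring.
rewrite /e1 /e2 /riem !sum2E !(Cs _ 1 0) !(C's _ 1 0) !(Hs 1 0) !(Ts 1 0).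
ring.
Qed.

(** Metric compatibility is differentiated once more and antisymmetrised in the two directions; the
    second derivatives of the metric drop out and skew symmetry of the lowered curvature remains. *)
Lemma riem_skew (C : 'I_2 -> 'I_2 -> 'I_2 -> R) (dC : 'I_2 -> 'I_2 -> 'I_2 -> 'I_2 -> R)
    (h : 'I_2 -> 'I_2 -> R) (dh : 'I_2 -> 'I_2 -> 'I_2 -> R)
    (ddh : 'I_2 -> 'I_2 -> 'I_2 -> 'I_2 -> R) (a d : 'I_2) :
  (forall l i j, C l i j = C l j i) -> (forall a b, h a b = h b a) ->
  (forall i a b, dh i a b = \sum_c (C c i a * h c b + C c i b * h a c)) ->
  (forall p i a b, ddh p i a b = \sum_c (dC p c i a * h c b + C c i a * dh p c b +
     (dC p c i b * h a c + C c i b * dh p a c))) ->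
  (forall p i a b, ddh p i a b = ddh i p a b) ->
  \sum_c h a c * riem C dC c d + \sum_c h d c * riem C dC c a = 0.
Proof.
move=> Cs hs Hdh Hddh ddhs.
transitivity (ddh 0 1 a d - ddh 1 0 a d); last by rewrite ddhs subrr.
rewrite !Hddh !sum2E !Hdh /riem !sum2E.
case: (ord2P a) => ->; case: (ord2P d) => ->;
  rewrite !(hs 1 0) ?(Cs _ 1 0); ring.
Qed.

(** By skew symmetry the lowered curvature has the single independent entry [S 0 1]. One factor det
    J is already in the first hypothesis, from the pair of antisymmetric indices; the other one
    comes from transforming [S]. *)
Lemma gauss_algebra (C C' : 'I_2 -> 'I_2 -> 'I_2 -> R)
    (dC dC' : 'I_2 -> 'I_2 -> 'I_2 -> 'I_2 -> R) (g h J : 'I_2 -> 'I_2 -> R) :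
  (forall c, \sum_l riem C dC l 1 * J l c =
     (J 0 0 * J 1 1 - J 0 1 * J 1 0) * \sum_k J 1 k * riem C' dC' c k) ->
  (forall a d, \sum_c h a c * riem C' dC' c d + \sum_c h d c * riem C' dC' c a = 0) ->
  (forall a b, h a b = h b a) ->
  (forall i j, g i j = \sum_a \sum_b J i a * h a b * J j b) ->
  \sum_l g 0 l * riem C dC l 1 =
  (J 0 0 * J 1 1 - J 0 1 * J 1 0) ^+ 2 * \sum_c h 0 c * riem C' dC' c 1.
Proof.
move=> E Sk hs gE.
pose r c := \sum_k J 1 k * riem C' dC' c k.
pose D := J 0 0 * J 1 1 - J 0 1 * J 1 0.
have -> : \sum_l g 0 l * riem C dC l 1 =
    \sum_a \sum_c J 0 a * h a c * (\sum_l riem C dC l 1 * J l c).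
  by rewrite !sum2E !gE !sum2E; ring.
have -> : \sum_a \sum_c J 0 a * h a c * (\sum_l riem C dC l 1 * J l c) =
    D * \sum_a \sum_c J 0 a * h a c * r c.
  rewrite mulr_sumr; apply: eq_bigr => a _; rewrite mulr_sumr; apply: eq_bigr => c _.
  by rewrite E -/(r c) -/D; ring.
pose S a d := \sum_c h a c * riem C' dC' c d.
have S00 : S 0 0 = 0.
  by have := Sk 0 0; rewrite -/(S 0 0) -mulr2n => /eqP; rewrite mulrn_eq0 => /eqP.
have S11 : S 1 1 = 0.
  by have := Sk 1 1; rewrite -/(S 1 1) -mulr2n => /eqP; rewrite mulrn_eq0 => /eqP.
have S10 : S 1 0 = - S 0 1.
  by apply/eqP; rewrite -addr_eq0 addrC; apply/eqP; exact: Sk.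
rewrite -/(S 0 1) -/D expr2 -mulrA; congr (_ * _).
transitivity (J 0 0 * J 1 0 * S 0 0 + J 0 0 * J 1 1 * S 0 1 + J 0 1 * J 1 0 * S 1 0
  + J 0 1 * J 1 1 * S 1 1); last by rewrite S00 S11 S10 /D; ring.
by rewrite /r /S !sum2E; ring.
Qed.

End ChristoffelAlgebra.

(** * Christoffel symbols and curvature of a metric in coordinates *)

Section MetricInCoordinates.
Context {R : realType}.

Lemma invmx2E (M : 'M[R]_2) i j : M \in unitmx ->
  invmx M i j = ((M 0 0 + M 1 1) * (i == j)%:R - M i j) / \det M.
Proof.
move=> uM; have d0 : \det M != 0 by rewrite -unitfE -unitmxE.
pose N : 'M[R]_2 := \matrix_(i, j) (((M 0 0 + M 1 1) * (i == j)%:R - M i j) / \det M).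
have MN : M *m N = 1%:M.
  apply/matrixP => a b; rewrite !mxE sum2E !mxE.
  case: (ord2P a) => ->; case: (ord2P b) => -> /=; rewrite ?mulr1n ?mulr0n ?eqxx /=;
  apply: (mulIf d0); rewrite mulrDl !mulrA !mulfVK// det2E; ring.
by rewrite -[invmx M]mulmx1 -MN mulKmx// mxE.
Qed.

Variables (g : 'rV[R]_2 -> 'M[R]_2) (D : set 'rV[R]_2).
Hypothesis oD : open D.
Hypothesis gC : forall i j k, Ck k D (fun x => g x i j).
Hypothesis gS : forall x, D x -> (g x)^T = g x.
Hypothesis gU : forall x, D x -> g x \in unitmx.

Let gsym x i j : D x -> g x i j = g x j i.
Proof. by move=> Dx; rewrite -[in LHS](gS Dx) mxE. Qed.

Lemma pd_is_derive (U : set 'rV[R]_2) (f : 'rV[R]_2 -> R) k x i :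
  Ck k.+1 U f -> U x -> is_derive x (e_ i) f (pd i f x).
Proof. exact: Ck_is_derive. Qed.

Lemma pd_Ck (U : set 'rV[R]_2) (f : 'rV[R]_2 -> R) k i : Ck k.+1 U f -> Ck k U (pd i f).
Proof. exact: Ck_derive. Qed.

Lemma pd_eq (U : set 'rV[R]_2) (f f' : 'rV[R]_2 -> R) x i : open U -> U x ->
  (forall y, U y -> f y = f' y) -> pd i f x = pd i f' x.
Proof.
move=> oU Ux ff'; apply: near_eq_derive.
by apply: filterS (open_nbhs_nbhs (conj oU Ux)) => y /ff'.
Qed.

Lemma pd_comm (U : set 'rV[R]_2) (f : 'rV[R]_2 -> R) x i j : open U -> U x ->
  Ck 2 U f -> pd i (pd j f) x = pd j (pd i f) x.
Proof. by move=> oU Ux Hf; exact: derive_comm oU Ux Hf. Qed.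

Lemma det_Ck k : Ck k D (fun x => \det (g x)).
Proof.
have H : Ck k D (fun x => g x 0 0 * g x 1 1 - g x 0 1 * g x 1 0).
  by apply: CkB => //; apply: CkM => //; exact: gC.
by apply: Ck_eq H => // x _; rewrite det2E.
Qed.

Lemma det_neq0 x : D x -> \det (g x) != 0.
Proof. by move=> /gU; rewrite unitmxE unitfE. Qed.

Lemma christoffel_Ck k l i j : Ck k D (christoffel g l i j).
Proof.
apply: CkZ => //; apply: Ck_sum => // m; apply: CkM => //.
  have H : Ck k D (fun x => ((g x 0 0 + g x 1 1) * (l == m)%:R - g x l m) * (\det (g x))^-1).
    apply: CkM => //; last by apply: Ck_inv => //; [exact: det_neq0|exact: det_Ck].
    apply: CkB => //; apply: CkM => //; first by apply: CkD => //; exact: gC.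
    exact: Ck_cst.
  by apply: Ck_eq H => // x Dx; rewrite invmx2E// gU.
apply: CkB => //; [apply: CkD => //|]; apply: pd_Ck; exact: gC.
Qed.

Lemma christoffel_sym x l i j : D x -> christoffel g l i j x = christoffel g l j i x.
Proof.
move=> Dx; rewrite /christoffel; congr (_ * _); apply: eq_bigr => m _; congr (_ * _).
by rewrite (pd_eq m oD Dx (fun y Dy => gsym i j Dy)); ring.
Qed.

Lemma christoffel_lower x l i j : D x ->
  2 * \sum_k g x l k * christoffel g k i j x =
  pd i (fun y => g y j l) x + pd j (fun y => g y i l) x - pd l (fun y => g y i j) x.
Proof.
move=> Dx; pose F : 'cV[R]_2 := \col_m (pd i (fun y => g y j m) x + pd j (fun y => g y i m) x
  - pd m (fun y => g y i j) x).
have E k : christoffel g k i j x = 2^-1 * (invmx (g x) *m F) k 0.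
  by rewrite /christoffel mxE; congr (_ * _); apply: eq_bigr => m _; rewrite [F _ _]mxE.
transitivity ((g x *m (invmx (g x) *m F)) l 0); last by rewrite mulKVmx ?gU// mxE.
rewrite mxE mulr_sumr; apply: eq_bigr => k _; rewrite E.
by rewrite !mulrA [2 * _]mulrC -!mulrA; congr (_ * _); rewrite mulrA divff// mul1r.
Qed.

Lemma metric_compat x i a b : D x -> pd i (fun y => g y a b) x =
  \sum_c (christoffel g c i a x * g x c b + christoffel g c i b x * g x a c).
Proof.
move=> Dx; have two : (2 : R) != 0 by [].
apply: (mulfI two).
have A := christoffel_lower b i a Dx; have B := christoffel_lower a i b Dx.
rewrite (pd_eq i oD Dx (fun y Dy => gsym b a Dy)) in B.
have -> : 2 * \sum_c (christoffel g c i a x * g x c b + christoffel g c i b x * g x a c) =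
    2 * \sum_k g x b k * christoffel g k i a x + 2 * \sum_k g x a k * christoffel g k i b x.
  rewrite -mulrDr -big_split /=; congr (_ * _); apply: eq_bigr => c _.
  by rewrite (gsym c b Dx); ring.
rewrite A B; move: (pd i _ x) (pd a _ x) (pd b _ x) => p q r; ring.
Qed.

Let C x l i j := christoffel g l i j x.
Let dC x p l i j := pd p (christoffel g l i j) x.

Lemma christoffel_riem_skew x a d : D x ->
  \sum_c g x a c * riem (C x) (dC x) c d + \sum_c g x d c * riem (C x) (dC x) c a = 0.
Proof.
move=> Dx.
apply: (@riem_skew _ _ _ _ (fun p a b => pd p (fun y => g y a b) x)
  (fun p i a b => pd p (pd i (fun y => g y a b)) x)).
- by move=> l i j; exact: christoffel_sym.
- by move=> i j; exact: gsym.
- by move=> i u v; exact: metric_compat.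
- move=> p i u v.
  rewrite (pd_eq p oD Dx (fun y Dy => metric_compat i u v Dy)).
  apply: is_derive_val; apply: is_derive_sum_seq => c.
  have G s t := pd_is_derive p (gC s t 1) Dx.
  have K s t r := pd_is_derive p (christoffel_Ck 1 s t r) Dx.
  exact: is_derive_add (is_derive_mul (K c i u) (G c v)) (is_derive_mul (K c i v) (G u c)).
- by move=> p i u v; exact: pd_comm oD Dx (gC u v 2).
Qed.

Lemma gauss_coordE x :
  gauss_coord g x = (\sum_l g x 0 l * riem (C x) (dC x) l 1) / \det (g x).
Proof. by []. Qed.

Lemma gauss_coord_Ck k : Ck k D (gauss_coord g).
Proof.
apply: CkM => //; last by apply: Ck_inv => //; [exact: det_neq0|exact: det_Ck].
apply: Ck_sum => // l; apply: CkM; [exact: oD|exact: gC|].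
apply: CkD => //; first by apply: CkB => //; apply: pd_Ck; exact: christoffel_Ck.
by apply: Ck_sum => // m; apply: CkB => //; apply: CkM => //; exact: christoffel_Ck.
Qed.

End MetricInCoordinates.

(** * Behaviour under a change of coordinates *)

Section CoordinateChange.
Context {R : realType}.
Variables (g h : 'rV[R]_2 -> 'M[R]_2) (phi : 'rV[R]_2 -> 'rV[R]_2) (D D' : set 'rV[R]_2).
Hypotheses (oD : open D) (oD' : open D').
Hypothesis gC : forall i j k, Ck k D (fun x => g x i j).
Hypothesis hC : forall i j k, Ck k D' (fun x => h x i j).
Hypothesis phiC : forall i k, Ck k D (fun x => phi x 0 i).
Hypothesis phiD : forall x, D x -> D' (phi x).
Hypothesis gS : forall x, D x -> (g x)^T = g x.
Hypothesis hS : forall x, D' x -> (h x)^T = h x.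
Hypothesis gU : forall x, D x -> g x \in unitmx.
Hypothesis hU : forall x, D' x -> h x \in unitmx.
Hypothesis JU : forall x, D x -> jac phi x \in unitmx.
Hypothesis gE : forall x, D x -> g x = jac phi x *m h (phi x) *m (jac phi x)^T.

Let J i a x := pd i (fun y => phi y 0 a) x.
Let H p i a x := pd p (J i a) x.

Let J_C i a k : Ck k D (J i a). Proof. by apply: pd_Ck; exact: phiC. Qed.
Let H_C p i a k : Ck k D (H p i a). Proof. by apply: pd_Ck; exact: J_C. Qed.

Let Hsym x p i a : D x -> H p i a x = H i p a x.
Proof. by move=> Dx; exact: pd_comm oD Dx (phiC a 2). Qed.

Let gsum x i j : D x -> g x i j = \sum_a \sum_b J i a x * h (phi x) a b * J j b x.
Proof.
move=> Dx; rewrite gE// mxE.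
under eq_bigr do rewrite !mxE mulr_suml.
rewrite exchange_big /=; apply: eq_bigr => a _; apply: eq_bigr => b _.
by rewrite !mxE.
Qed.

Let comp_derive (f : 'rV[R]_2 -> R) x p : D x -> Ck 1 D' f ->
  is_derive x (e_ p) (fun y => f (phi y)) (\sum_c pd c f (phi x) * J p c x).
Proof.
move=> Dx Hf; apply: (C1_chain oD' (phiD Dx) Hf) => c.
exact: pd_is_derive (phiC c 1) Dx.
Qed.

Let pd_g x p i j : D x -> pd p (fun y => g y i j) x =
  \sum_a \sum_b ((H p i a x * h (phi x) a b +
     J i a x * (\sum_c pd c (fun y => h y a b) (phi x) * J p c x)) * J j b x
     + J i a x * h (phi x) a b * H p j b x).
Proof.
move=> Dx; rewrite (pd_eq p oD Dx (fun y Dy => gsum i j Dy)).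
apply: is_derive_val; apply: is_derive_sum_seq => a; apply: is_derive_sum_seq => b.
have JD s t := pd_is_derive p (J_C s t 1) Dx.
exact: is_derive_mul (is_derive_mul (JD i a) (comp_derive p Dx (hC a b 1))) (JD j b).
Qed.

(** Both sides are compared after multiplication by the invertible matrix J h, where the claim is
    the transformation of the symbols of the first kind. *)
Lemma christoffel_transform x c i j : D x ->
  \sum_k christoffel g k i j x * J k c x =
  H i j c x + \sum_a \sum_b christoffel h c a b (phi x) * J i a x * J j b x.
Proof.
move=> Dx; have D'y := phiD Dx.
pose M := jac phi x *m h (phi x).
have uM : M \in unitmx by rewrite unitmx_mul JU// hU.
pose Y : 'cV[R]_2 := \col_c (\sum_k christoffel g k i j x * J k c x -
  (H i j c x + \sum_a \sum_b christoffel h c a b (phi x) * J i a x * J j b x)).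
suff Y0 : Y = 0.
  by have := congr1 (fun Z : 'cV_2 => Z c 0) Y0; rewrite !mxE => /eqP; rewrite subr_eq0 => /eqP.
rewrite -[Y](mulKmx uM) (_ : M *m Y = 0) ?mulmx0//.
apply/colP => l; rewrite mxE [RHS]mxE.
have hs a b : h (phi x) a b = h (phi x) b a by rewrite -[in LHS](hS D'y) mxE.
have dhs p a b : pd p (fun y => h y a b) (phi x) = pd p (fun y => h y b a) (phi x).
  by apply: (pd_eq p oD' D'y) => y Dy; rewrite -[in LHS](hS Dy) mxE.
have FK := @first_kind_transform _ (fun a b => h (phi x) a b) (fun i a => J i a x)
  (fun c a b => pd c (fun y => h y a b) (phi x)) (fun p i a => H p i a x) i j l
  hs dhs (fun p i a => Hsym p i a Dx).
rewrite /= in FK.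
have E3 (a1 a2 a3 b1 b2 b3 : R) : a1 = b1 -> a2 = b2 -> a3 = b3 ->
    a1 + a2 - a3 = b1 + b2 - b3 by move=> -> -> ->.
have {FK} FK := etrans (etrans (christoffel_lower gU l i j Dx)
  (E3 _ _ _ _ _ _ (pd_g i j l Dx) (pd_g j i l Dx) (pd_g l i j Dx))) FK.
have := @raise_first_kind _ (fun l k => g x l k) (fun a b => h (phi x) a b)
  (fun i a => J i a x) (fun k => christoffel g k i j x) (fun c => H i j c x)
  (fun c a b => christoffel h c a b (phi x)) i j l (fun k => gsum l k Dx).
have Yc c0 : Y c0 0 = \sum_k christoffel g k i j x * J k c0 x -
  (H i j c0 x + \sum_a \sum_b christoffel h c0 a b (phi x) * J i a x * J j b x) by rewrite mxE.
have Mc c0 : M l c0 = \sum_a J l a x * h (phi x) a c0.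
  by rewrite mxE; apply: eq_bigr => a _; rewrite mxE.
under [X in _ -> X = _]eq_bigr do rewrite Yc Mc.
apply; apply: etrans FK _; congr (_ + _).
apply: eq_bigr => a _; apply: eq_bigr => b _; apply: eq_bigr => b' _.
by rewrite (christoffel_lower hU a b b' D'y).
Qed.

(** Numerator and determinant both acquire the factor (det J)^2. Invariance is needed because
    [gaussK] refers to an unspecified chart at each point, while the flow is computed in one
    chart. *)
Lemma gauss_coord_transform x : D x -> gauss_coord g x = gauss_coord h (phi x).
Proof.
move=> Dx; have D'y := phiD Dx.
have hs a b : h (phi x) a b = h (phi x) b a by rewrite -[in LHS](hS D'y) mxE.
have detE : \det (g x) = (J 0 0 x * J 1 1 x - J 0 1 x * J 1 0 x) ^+ 2 * \det (h (phi x)).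
  have dJ : \det (jac phi x) = J 0 0 x * J 1 1 x - J 0 1 x * J 1 0 x.
    by rewrite det2E !mxE.
  rewrite gE// !det_mulmx det_tr dJ.
  by move: (_ - _) (\det _) => u v; ring.
have d0 : J 0 0 x * J 1 1 x - J 0 1 x * J 1 0 x != 0.
  by have := JU Dx; rewrite unitmxE unitfE det2E !mxE.
have h0 : \det (h (phi x)) != 0 by have := hU D'y; rewrite unitmxE unitfE.
have GA : \sum_l g x 0 l * riem (fun l i j => christoffel g l i j x)
    (fun p l i j => pd p (christoffel g l i j) x) l 1 =
  (J 0 0 x * J 1 1 x - J 0 1 x * J 1 0 x) ^+ 2 *
  \sum_c h (phi x) 0 c * riem (fun l i j => christoffel h l i j (phi x))
    (fun p l i j => pd p (christoffel h l i j) (phi x)) c 1; last first.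
  apply: etrans (gauss_coordE g x) (etrans _ (esym (gauss_coordE h (phi x)))).
  rewrite detE; apply: etrans (congr1 (fun z => z / _) GA) _.
  move: d0 h0; move: (_ - _) (\det _) (\sum_c _) => u v w u0 v0.
  by field; rewrite u0 v0.
apply: (@gauss_algebra _ _ (fun l i j => christoffel h l i j (phi x)) _
  (fun p l i j => pd p (christoffel h l i j) (phi x)) (fun a b => g x a b)
  (fun a b => h (phi x) a b) (fun i a => J i a x)).
- move=> c; apply: (@riem_transform R (fun l i j => christoffel g l i j x)
   (fun l i j => christoffel h l i j (phi x)) (fun p l i j => pd p (christoffel g l i j) x)
   (fun p l i j => pd p (christoffel h l i j) (phi x)) (fun i a => J i a x)
   (fun p i a => H p i a x) (fun p q r a => pd p (H q r a) x) c).
  + by move=> l i j; apply: (@christoffel_sym R g D).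
  + by move=> l i j; apply: (@christoffel_sym R h D').
  + by move=> p i a; exact: Hsym.
  + by move=> p q r a; exact: pd_comm oD Dx (J_C r a 2).
  + by move=> c' i j; exact: christoffel_transform.
  + move=> c' p i j.
    have JD s t := pd_is_derive p (J_C s t 1) Dx.
    have GD s t r := pd_is_derive p (christoffel_Ck oD gC gU 1 s t r) Dx.
    have HD s t r := pd_is_derive p (H_C s t r 1) Dx.
    have lhs : is_derive x (e_ p) (fun y => \sum_k christoffel g k i j y * J k c' y)
      (\sum_k (pd p (christoffel g k i j) x * J k c' x + christoffel g k i j x * H p k c' x)).
      by apply: is_derive_sum_seq => k; exact: is_derive_mul (GD k i j) (JD k c').
    apply: etrans (esym (is_derive_val lhs)) _.
    apply: etrans (pd_eq p oD Dx (fun y Dy => christoffel_transform c' i j Dy)) _.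
    apply: is_derive_val; apply: is_derive_add (HD i j c') _.
    apply: is_derive_sum_seq => a; apply: is_derive_sum_seq => b.
    exact: is_derive_mul (is_derive_mul (comp_derive p Dx (christoffel_Ck oD' hC hU 1 c' a b))
      (JD i a)) (JD j b).
- by move=> a d; exact: christoffel_riem_skew D'y.
- exact: hs.
- by move=> i j; exact: gsum.
Qed.

End CoordinateChange.

(** * Charts of the surface and the unit normal *)

Section SurfaceCharts.
Context {R : realType} {A : riemSurface R}.
Implicit Types (i j : chartIndex A) (p : A).

Definition cdom i : set 'rV[R]_2 := chart i @` dom i.
Definition odom i j : set 'rV[R]_2 := chart i @` (dom i `&` dom j).
Definition trans i j : 'rV[R]_2 -> 'rV[R]_2 := chart j \o chartV i.

Lemma cdom_open i : open (cdom i). Proof. exact: codom_open. Qed.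

Lemma cdomK i x : cdom i x -> chart i (chartV i x) = x /\ dom i (chartV i x).
Proof. by move=> [p ip <-]; rewrite chartK. Qed.

Lemma odom_cdom i j x : odom i j x -> cdom i x.
Proof. by move=> [p [ip _] <-]; exists p. Qed.

Lemma odomP i j x : odom i j x <-> cdom i x /\ dom j (chartV i x).
Proof.
split=> [[p [ip jp] <-]|[ix jx]].
  by rewrite chartK//; split=> //; exists p.
by have [E ix'] := cdomK ix; exists (chartV i x).
Qed.

Lemma odom_open i j : open (odom i j).
Proof.
rewrite openE => x xij; have [ix jx] := (odomP i j x).1 xij.
have nD : \forall y \near x, cdom i y by exact: open_nbhs_nbhs (conj (@cdom_open i) ix).
have nV : \forall y \near x, dom j (chartV i y).
  by apply: (chartV_continuous ix); exact: open_nbhs_nbhs (conj (dom_open j) jx).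
by rewrite /interior /=; apply: filterS2 nD nV => y iy jy; apply/odomP.
Qed.

Lemma trans_cdom i j x : odom i j x -> cdom j (trans i j x).
Proof. by move=> /odomP[_ jx]; exists (chartV i x). Qed.

Lemma gram_symE i x a b : cdom i x -> gram i x a b = gram i x b a.
Proof. by move=> ix; rewrite -[in LHS](gram_sym ix) mxE. Qed.

Lemma gram_det_gt0 i x : cdom i x -> 0 < \det (gram i x).
Proof.
move=> ix; have S := gram_symE 1 0 ix.
have q (v : 'rV[R]_2) : (v *m gram i x *m v^T) 0 0 =
   v 0 0 * v 0 0 * gram i x 0 0 + 2 * v 0 0 * v 0 1 * gram i x 0 1 + v 0 1 * v 0 1 * gram i x 1 1.
  by rewrite mxE sum2E !mxE !sum2E S; ring.
have v0 : (delta_mx 0 0 : 'rV[R]_2) != 0.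
  by apply/eqP => /rowP /(_ 0); rewrite !mxE/= => /eqP; rewrite oner_eq0.
have := gram_pos ix v0; rewrite q !mxE/= => g00.
(* At this vector the quadratic form equals g_00 times the determinant. *)
pose v : 'rV[R]_2 := \row_k (if k == 0 then - gram i x 0 1 else gram i x 0 0).
have g00' : 0 < gram i x 0 0 by lra.
have v1 : v != 0.
  by apply/eqP => /rowP /(_ 1); rewrite !mxE/= => /eqP; rewrite gt_eqF.
have := gram_pos ix v1; rewrite q !mxE/= => h.
by rewrite det2E S -(pmulr_rgt0 _ g00'); move: h; congr (_ < _); ring.
Qed.

Lemma gram_unit i x : cdom i x -> gram i x \in unitmx.
Proof. by move=> /gram_det_gt0 d; rewrite unitmxE unitfE gt_eqF. Qed.

Lemma gram_Ck i a b k : Ck k (cdom i) (fun x => gram i x a b).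
Proof. exact: gram_smooth. Qed.

Lemma trans_Ck i j b k : Ck k (odom i j) (fun x => trans i j x 0 b).
Proof. exact: transition_smooth. Qed.

Lemma jac_unit i j x : odom i j x -> jac (trans i j) x \in unitmx.
Proof. by move=> /transition_oriented d; rewrite unitmxE unitfE gt_eqF. Qed.

Lemma chart_christoffel_Ck i k l a b : Ck k (cdom i) (christoffel (gram i) l a b).
Proof. by apply: christoffel_Ck; [exact: cdom_open|exact: gram_Ck|exact: gram_unit]. Qed.

Lemma chart_gauss_Ck i k : Ck k (cdom i) (gauss_coord (gram i)).
Proof. by apply: gauss_coord_Ck; [exact: cdom_open|exact: gram_Ck|exact: gram_unit]. Qed.

Lemma gram_odom_Ck i j a b k : Ck k (odom i j) (fun x => gram i x a b).
Proof. by apply: Ck_sub (gram_Ck i a b k) => x; exact: odom_cdom. Qed.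

Local Ltac chart_side := try solve [exact: odom_open | exact: cdom_open | exact: gram_odom_Ck
  | exact: gram_Ck | exact: trans_Ck | exact: trans_cdom
  | by move=> y yy; exact: gram_sym | by move=> y /odom_cdom yy; exact: gram_sym
  | exact: gram_unit | by move=> y /odom_cdom yy; exact: gram_unit
  | exact: jac_unit | by move=> y yy; exact: gram_transition].

Lemma chart_christoffel_transform i j x c a b : odom i j x ->
  \sum_k christoffel (gram i) k a b x * pd k (fun y => trans i j y 0 c) x =
  pd a (pd b (fun y => trans i j y 0 c)) x +
  \sum_u \sum_v christoffel (gram j) c u v (trans i j x) *
    pd a (fun y => trans i j y 0 u) x * pd b (fun y => trans i j y 0 v) x.
Proof.
by apply: (@christoffel_transform R (gram i) (gram j) (trans i j) (odom i j) (cdom j)); chart_side.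
Qed.

Lemma gauss_chart_indep i j p : dom i p -> dom j p ->
  gauss_coord (gram i) (chart i p) = gauss_coord (gram j) (chart j p).
Proof.
move=> ip jp; have xij : odom i j (chart i p) by exists p.
rewrite -{2}(chartK ip) -[chart j _]/(trans i j (chart i p)).
by apply: (@gauss_coord_transform R (gram i) (gram j) (trans i j) (odom i j) (cdom j)) xij; chart_side.
Qed.

Lemma gaussKE i p : dom i p -> gaussK p = gauss_coord (gram i) (chart i p).
Proof.
by move=> ip; rewrite /gaussK; case: (cid (dom_cover p)) => j jp /=; exact: gauss_chart_indep.
Qed.

Lemma inner_trans i j p (v w : 'rV[R]_2) : dom i p -> dom j p ->
  inner p j (v *m jac (trans i j) (chart i p)) (w *m jac (trans i j) (chart i p)) = inner p i v w.
Proof.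
move=> ip jp; have xij : odom i j (chart i p) by exists p.
rewrite /inner (gram_transition xij) chartK// trmx_mul !mulmxA.
by rewrite -[jac (chart j \o chartV i)]/(jac (trans i j)).
Qed.

(** Rotation of a unit tangent by a positive right angle with respect to [gram i x]. It exhibits the
    unit normal as a smooth function of the tangent, whereas the field [N] is only given
    pointwise. *)
Definition rot_normal i x (T : 'rV[R]_2) : 'rV[R]_2 :=
  \row_k ((Num.sqrt (\det (gram i x)))^-1 *
     (if k == 0 then - (T *m gram i x) 0 1 else (T *m gram i x) 0 0)).

Lemma inner2E i p (v w : 'rV[R]_2) : inner p i v w =
  (v *m gram i (chart i p)) 0 0 * w 0 0 + (v *m gram i (chart i p)) 0 1 * w 0 1.
Proof. by rewrite /inner mxE sum2E ![w^T _ _]mxE. Qed.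

Lemma normal_unique i p (T N : 'rV[R]_2) : dom i p ->
  inner p i T T = 1 -> inner p i N N = 1 -> inner p i T N = 0 ->
  0 < T 0 0 * N 0 1 - T 0 1 * N 0 0 -> N = rot_normal i (chart i p) T.
Proof.
move=> ip TT NN TN or; set x := chart i p; have ix : cdom i x by exists p.
have d0 := gram_det_gt0 ix; set s := Num.sqrt (\det (gram i x)).
have s0 : 0 < s by rewrite sqrtr_gt0.
have s2 : s ^+ 2 = \det (gram i x) by rewrite sqr_sqrtr// ltW.
have S := gram_symE 1 0 ix.
(* Orthogonality makes [N] equal to [D] times the rotated covector of [T]; the unit length gives
   [(D * s) ^+ 2 = 1] and the orientation selects the positive root. *)
pose D := T 0 0 * N 0 1 - T 0 1 * N 0 0.
rewrite inner2E -/x in TT; rewrite inner2E -/x in TN.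
pose a := (T *m gram i x) 0 0; pose b := (T *m gram i x) 0 1.
rewrite -/a -/b in TT TN.
have N0 : N 0 0 = - (D * b).
  by rewrite -[LHS]mul1r -TT -[RHS]addr0 -(mulr0 (T 0 0)) -TN /D; ring.
have N1 : N 0 1 = D * a.
  by rewrite -[LHS]mul1r -TT -[RHS]addr0 -(mulr0 (T 0 1)) -TN /D; ring.
have Ds : D * s = 1.
  have Ds2 : (D * s) ^+ 2 = 1.
    rewrite exprMn s2 -NN inner2E -/x !mxE !sum2E N0 N1.
    have -> : \det (gram i x) = \det (gram i x) * (a * T 0 0 + b * T 0 1) by rewrite TT mulr1.
    by rewrite det2E S /a /b !mxE !sum2E S; ring.
  have Ds0 : 0 < D * s by exact: mulr_gt0.
  by move/eqP: Ds2; rewrite sqrf_eq1 => /orP[/eqP//|/eqP Dn]; move: Ds0; rewrite Dn oppr_gt0 ltr10.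
have Di : D = s^-1 by apply: (mulIf (lt0r_neq0 s0)); rewrite Ds mulVf// gt_eqF.
by apply/rowP => k; case: (ord2P k) => ->; rewrite [RHS]mxE /= -/x -/s -Di -/a -/b ?N0 ?N1 ?mulrN.
Qed.

End SurfaceCharts.

(** The second derivatives [P2] of the coordinate change are eliminated by the transformation law of
    the Christoffel symbols; what remains is the vector law for the covariant acceleration. *)
Lemma acceleration_algebra (R : realType) (C : 'I_2 -> 'I_2 -> 'I_2 -> R)
    (P2 C' J : 'I_2 -> 'I_2 -> R) (w a : 'I_2 -> R) (b : 'I_2) :
  (forall u v, \sum_k C k u v * J k b =
     P2 u v + \sum_p \sum_q C' p q * J u p * J v q) ->
  \sum_k ((\sum_p P2 p k * w p) * w k + J k b * a k) +
   \sum_p \sum_q C' p q * (\sum_k J k p * w k) * (\sum_k J k q * w k) =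
  \sum_k (a k + \sum_u \sum_v C k u v * w u * w v) * J k b.
Proof.
move=> E.
have e u v : P2 u v = \sum_k C k u v * J k b - \sum_p \sum_q C' p q * J u p * J v q.
  by rewrite E addrK.
by rewrite !sum2E !e !sum2E; ring.
Qed.

(** * Curves and geodesics read in charts *)

Section CurvesInCharts.
Context {R : realType} {A : riemSurface R}.
Implicit Types (i j : chartIndex A) (p : A).

Lemma velocityE (c : R -> A) (s : R) i k (d : R) :
  is_derive s 1 (curve_coord c i k) d -> velocity c s i 0 k = d.
Proof. by move=> H; rewrite mxE derive1E (is_derive_val H). Qed.

Lemma near_R (s : R) (J : set R) : open J -> J s -> \forall t \near s, J t.
Proof. by move=> oJ Js; exact: open_nbhs_nbhs (conj oJ Js). Qed.

(* A curve given in the chart i by x, with first and second derivatives w, a,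
   read in an overlapping chart j. *)
Lemma curve_trans i j (x w a : R -> 'rV[R]_2) (J : set R) s : open J -> J s ->
  (forall t, J t -> odom i j (x t)) ->
  (forall t k, J t -> is_derive t 1 (fun t => x t 0 k) (w t 0 k)) ->
  (forall t k, J t -> is_derive t 1 (fun t => w t 0 k) (a t 0 k)) ->
  let c := chartV i \o x in
  (forall b, is_derive s 1 (curve_coord c j b) ((w s *m jac (trans i j) (x s)) 0 b)) /\
  acceleration c s j =
   (\row_k (a s 0 k + \sum_u \sum_v christoffel (gram i) k u v (x s) * w s 0 u * w s 0 v))
     *m jac (trans i j) (x s).
Proof.
move=> oJ Js Jx Hx Hw c.
have D1 t b : J t -> is_derive t 1 (curve_coord c j b)
    (\sum_k pd k (fun y => trans i j y 0 b) (x t) * w t 0 k).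
  move=> Jt; apply: (C1_chain (@odom_open _ _ i j) (Jx t Jt) (trans_Ck i j b 1)) => k.
  exact: Hx.
have V b : velocity c s j 0 b = \sum_k pd k (fun y => trans i j y 0 b) (x s) * w s 0 k.
  exact: velocityE (D1 s b Js).
split=> [b|].
  have := D1 s b Js; congr is_derive; rewrite mxE; apply: eq_bigr => k _.
  by rewrite [jac _ _ _ _]mxE mulrC.
apply/rowP => b; rewrite mxE.
have D2 : derive1n 2 (curve_coord c j b) s =
    \sum_k ((\sum_p pd p (pd k (fun y => trans i j y 0 b)) (x s) * w s 0 p) * w s 0 k
      + pd k (fun y => trans i j y 0 b) (x s) * a s 0 k).
  rewrite /derive1n /= derive1E.
  transitivity ('D_1 (fun t => \sum_k pd k (fun y => trans i j y 0 b) (x t) * w t 0 k) s).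
    apply: near_eq_derive; apply: filterS (near_R oJ Js) => t Jt.
    by rewrite derive1E (is_derive_val (D1 t b Jt)).
  apply: is_derive_val; apply: is_derive_sum_seq => k; apply: is_derive_mul; last exact: Hw.
  apply: (C1_chain (@odom_open _ _ i j) (Jx s Js) (pd_Ck k (trans_Ck i j b 2))) => p.
  exact: Hx.
rewrite D2 [RHS]mxE.
under [X in _ + X = _]eq_bigr => p _ do under eq_bigr => q _ do rewrite !V.
under [X in _ = X]eq_bigr => k _ do rewrite ![_ k b]mxE ![_ 0 k]mxE.
apply: (@acceleration_algebra R (fun k u v => christoffel (gram i) k u v (x s))
  (fun u k => pd u (pd k (fun y => trans i j y 0 b)) (x s))
  (fun u v => christoffel (gram j) b u v (chart j (c s)))
  (fun k b => pd k (fun y => trans i j y 0 b) (x s)) (fun k => w s 0 k) (fun k => a s 0 k) b).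
by move=> u v; exact: chart_christoffel_transform b u v (Jx s Js).
Qed.

(** Bootstrapping: the derivative of a solution is the smooth field along the solution, hence as
    regular as the solution itself. *)
Lemma ode_solution_smooth n (U : set 'rV[R]_n) (X : 'I_n -> 'rV[R]_n -> R) (J : set R)
    (z : R -> 'rV[R]_n) : open U -> open J -> (forall m k, Ck k U (X m)) ->
  (forall t, J t -> U (z t)) ->
  (forall (t : R) m, J t -> is_derive t 1 (fun t => z t 0 m) (X m (z t))) ->
  forall k m, Ck k J (fun t => z t 0 m).
Proof.
move=> oU oJ HX Uz Hz.
have zc (t : R) m : J t -> {for t, continuous (fun t => z t 0 m)}.
  move=> Jt; apply: differentiable_continuous; apply/derivable1_diffP.
  exact: is_derive_ex (Hz t m Jt).
elim=> [|k IH] m; first by split=> // t Jt; exact: zc.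
apply: (@Ck_intro R R _ _ _ (fun v t : R => v * X m (z t))) => // [t Jt|t v Jt|v].
- exact: zc.
- by have := is_deriveZdir v (Hz t m Jt); rewrite [v *: 1]mulr1.
- by apply: CkZ => //; apply: (Ck_comp oJ oU).
Qed.

Definition geo_acc i (x w : 'rV[R]_2) (k : 'I_2) : R :=
  - \sum_u \sum_v christoffel (gram i) k u v x * w 0 u * w 0 v.

(* The geodesic equation as a first order system for (x, w). *)
Definition geo_field i (k : 'I_(2 + 2)) (z : 'rV[R]_(2 + 2)) : R :=
  match fintype.split k with
  | inl l => z 0 (rshift 2 l)
  | inr l => geo_acc i (lsubmx z) (rsubmx z) l
  end.

Definition geo_dom i : set 'rV[R]_(2 + 2) := [set z | cdom i (lsubmx z)].

Lemma geo_dom_open i : open (geo_dom i).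
Proof. by apply: lift_open; exact: cdom_open. Qed.

Lemma comp_lsubmx_Ck n m (U : set 'rV[R]_n) (V : set 'rV[R]_(n + m)) (f : 'rV[R]_n -> R) k :
  open U -> open V -> (forall z, V z -> U (lsubmx z)) -> Ck k U f -> Ck k V (fun z => f (lsubmx z)).
Proof.
move=> oU oV VU Hf; apply: (Ck_comp oV oU) => // j.
by apply: Ck_eq (Ck_coord k (lshift m j) oV) => // y _; rewrite mxE.
Qed.

Lemma geo_field_Ck i l k : Ck k (geo_dom i) (geo_field i l).
Proof.
have oG := @geo_dom_open i; rewrite /geo_field; case: (fintype.split l) => m.
  exact: Ck_coord.
apply: CkN => //; apply: Ck_sum => // u; apply: Ck_sum => // v.
have cr w : Ck k (geo_dom i) (fun z : 'rV[R]_(2 + 2) => rsubmx z 0 w).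
  by apply: Ck_eq (Ck_coord k (rshift 2 w) oG) => // y _; rewrite mxE.
apply: CkM => //; apply: CkM => //.
apply: (comp_lsubmx_Ck (@cdom_open _ _ i) oG) => //; exact: chart_christoffel_Ck.
Qed.

Lemma geo_fieldl i l x w : geo_field i (lshift 2 l) (row_mx x w) = w 0 l.
Proof. by rewrite /geo_field (unsplitK (inl l)) row_mxEr. Qed.

Lemma geo_fieldr i l x w : geo_field i (rshift 2 l) (row_mx x w) = geo_acc i x w l.
Proof. by rewrite /geo_field (unsplitK (inr l)) row_mxKl row_mxKr. Qed.

(** Written so as to coincide with the interval in [smooth_curve c 0 1]. *)
Definition itvoo_nbhd (d : R) : set R := [set t | 0 - d < t < 1 + d].

Lemma itvoo_nbhd_open d : open (itvoo_nbhd d).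
Proof.
rewrite /itvoo_nbhd (_ : [set t | _] = `]0 - d, 1 + d[%classic); first exact: interval_open.
by apply/seteqP; split=> t; rewrite /= in_itv.
Qed.

Lemma continuous_preimage_open (c : R -> A) (J : set R) (W : set A) : open J -> open W ->
  (forall t, J t -> {for t, continuous c}) -> open (J `&` c @^-1` W).
Proof.
move=> oJ oW cc; rewrite openE => t [Jt Wt]; rewrite /interior /=.
apply: filterI; first exact: near_R.
by apply: (cc t Jt); exact: open_nbhs_nbhs (conj oW Wt).
Qed.

Section ChartGeodesic.
Variables (i : chartIndex A) (x w : R -> 'rV[R]_2) (d : R).
Hypothesis d0 : 0 < d.
Let J := itvoo_nbhd d.
Hypothesis xD : forall t, J t -> cdom i (x t).
Hypothesis xw : forall t k, J t -> is_derive t 1 (fun t => x t 0 k) (w t 0 k).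
Hypothesis ww : forall t k, J t -> is_derive t 1 (fun t => w t 0 k) (geo_acc i (x t) (w t) k).

Let c := chartV i \o x.

Let z t := row_mx (x t) (w t).

Lemma geo_solution t k : J t -> is_derive t 1 (fun t => z t 0 k) (geo_field i k (z t)).
Proof.
move=> Jt; rewrite -(splitK k); case: (fintype.split k) => l /=.
  rewrite geo_fieldl; have := xw l Jt; congr is_derive.
  by apply/funext => u; rewrite row_mxEl.
rewrite geo_fieldr; have := ww l Jt; congr is_derive.
by apply/funext => u; rewrite row_mxEr.
Qed.

Let oJ : open J. Proof. exact: itvoo_nbhd_open. Qed.

Lemma chart_geodesic_smooth k l : Ck k J (fun t => x t 0 l).
Proof.
have H : Ck k J (fun t => z t 0 (lshift 2 l)).
  apply: (@ode_solution_smooth _ (geo_dom i) (geo_field i)) => //.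
  - exact: geo_dom_open.
  - exact: geo_field_Ck.
  - by move=> t Jt; rewrite /geo_dom /= row_mxKl; exact: xD.
  - by move=> t m Jt; exact: geo_solution.
by apply: Ck_eq H => // t _; rewrite row_mxEl.
Qed.

Lemma chart_geodesic_continuous t : J t -> {for t, continuous c}.
Proof.
move=> Jt; apply: continuous_comp; last exact: chartV_continuous (xD Jt).
by apply: continuous_rV => l; exact: Ck_continuous (chart_geodesic_smooth 0 l) Jt.
Qed.

Lemma chart_geodesic_odom j t : J t -> dom j (c t) -> odom i j (x t).
Proof. by move=> Jt jc; apply/odomP; split=> //; exact: xD. Qed.

Let geo_d2 j t : J t -> dom j (c t) ->
  (forall b, is_derive t 1 (curve_coord c j b) ((w t *m jac (trans i j) (x t)) 0 b)) /\
  acceleration c t j = 0.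
Proof.
move=> Jt jt.
have oJ' : open (J `&` c @^-1` dom j).
  by apply: continuous_preimage_open => //; [exact: dom_open|exact: chart_geodesic_continuous].
have [D1 ->] := @curve_trans i j x w (fun t => \row_k geo_acc i (x t) (w t) k)
  (J `&` c @^-1` dom j) t oJ' (conj Jt jt)
  (fun t H => chart_geodesic_odom H.1 H.2) (fun t k H => xw k H.1)
  (fun t k H => ltac:(rewrite mxE; exact: ww k H.1)).
split=> //; rewrite [X in X *m _](_ : _ = 0) ?mul0mx//.
by apply/rowP => k; rewrite !mxE /geo_acc addNr.
Qed.

Lemma chart_geodesic_velocity j t : J t -> dom j (c t) ->
  velocity c t j = w t *m jac (trans i j) (x t).
Proof.
by move=> Jt jt; apply/rowP => b; apply: velocityE; exact: (geo_d2 Jt jt).1.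
Qed.

(** [geodesic] asks for regularity and vanishing acceleration in every chart met by the curve; both
    are carried over from chart [i] by the transition maps. *)
Lemma chart_geodesic : geodesic c 0 1.
Proof.
split; last first.
  move=> t j t01 jt; apply: (geo_d2 _ jt).2.
  move: t01 => /andP[t0 t1]; apply/andP; split.
    by rewrite sub0r; apply: lt_le_trans t0; rewrite oppr_lt0.
  by apply: le_lt_trans t1 _; rewrite ltrDl.
exists d => //=; split=> [t Jt|j k l]; first exact: chart_geodesic_continuous.
have oJ' : open (J `&` c @^-1` dom j).
  by apply: continuous_preimage_open => //; [exact: dom_open|exact: chart_geodesic_continuous].
apply: (Ck_comp (f := fun y => trans i j y 0 k) oJ' (@odom_open _ _ i j)).
- by move=> t [Jt jt]; exact: chart_geodesic_odom.
- exact: trans_Ck.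
- move=> m; apply: Ck_sub (chart_geodesic_smooth l m); by move=> t [].
Qed.

End ChartGeodesic.

End CurvesInCharts.

(** * Uniqueness of geodesics and the value of the exponential map *)

Section GeodesicUniqueness.
Context {R : realType} {A : riemSurface R}.

Lemma left_limit_eq (T : topologicalType) (f g : R -> T) (a t : R) : hausdorff_space T ->
  a < t -> {for t, continuous f} -> {for t, continuous g} ->
  (forall y, a <= y < t -> f y = g y) -> f t = g t.
Proof.
move=> hT at_ fc gc fg.
have nfg : \forall y \near t^'-, g y = f y.
  near=> y; apply/esym/fg/andP; split.
    by near: y; exact: nbhs_left_ge.
  by near: y; exact: nbhs_left_lt.
have fl : f y @[y --> t^'-] --> f t by apply: cvg_at_left_filter.
have gl : g y @[y --> t^'-] --> g t by apply: cvg_at_left_filter.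
apply: (cvg_unique hT fl); apply: cvg_trans gl; exact: near_eq_cvg.
Unshelve. all: by end_near. Qed.

Lemma row_mx_continuous n m (u : R -> 'rV[R]_n) (v : R -> 'rV[R]_m) (t : R) :
  (forall k, {for t, continuous (fun t => u t 0 k)}) ->
  (forall k, {for t, continuous (fun t => v t 0 k)}) ->
  {for t, continuous (fun t => row_mx (u t) (v t))}.
Proof.
move=> uc vc; apply: continuous_rV => k.
rewrite -(splitK k); case: (fintype.split k) => l /=.
  rewrite (_ : (fun t => _) = (fun t => u t 0 l)); first exact: uc.
  by apply/funext => s; rewrite row_mxEl.
rewrite (_ : (fun t => _) = (fun t => v t 0 l)); first exact: vc.
by apply/funext => s; rewrite row_mxEr.
Qed.

Lemma is_derive_continuous (f : R -> R) (t d : R) : is_derive t 1 f d -> {for t, continuous f}.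
Proof.
move=> H; apply: differentiable_continuous; apply/derivable1_diffP.
exact: is_derive_ex H.
Qed.

Variables (i : chartIndex A) (x w : R -> 'rV[R]_2) (d : R).
Hypothesis d0 : 0 < d.
Let J := itvoo_nbhd d.
Hypothesis xD : forall t, J t -> cdom i (x t).
Hypothesis xw : forall t k, J t -> is_derive t 1 (fun t => x t 0 k) (w t 0 k).
Hypothesis ww : forall t k, J t -> is_derive t 1 (fun t => w t 0 k) (geo_acc i (x t) (w t) k).

Let c := chartV i \o x.

Let itv_J t : 0 <= t <= 1 -> J t.
Proof.
move=> /andP[t0 t1]; apply/andP; split.
  by rewrite sub0r; apply: lt_le_trans t0; rewrite oppr_lt0.
by apply: le_lt_trans t1 _; rewrite ltrDl.
Qed.

(** Real induction for point and velocity together. Equality before [t] passes to [t] because the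
    surface is Hausdorff; beyond [t] both curves solve the same locally Lipschitz system in chart
    [i] and Gronwall applies. That [c2] stays in this chart is part of what is proved. *)
Lemma geodesic_unique (c2 : R -> A) : geodesic c2 0 1 -> c2 0 = c 0 ->
  velocity c2 0 i = w 0 -> forall t, 0 <= t <= 1 -> c2 t = c t.
Proof.
move=> [[e e0 [c2c c2s]] c2g] c20 v20.
set J2 := [set s | 0 - e < s < 1 + e] in c2c c2s.
have J2i t : 0 <= t <= 1 -> J2 t.
  move=> /andP[t0 t1]; apply/andP; split.
    by rewrite sub0r; apply: lt_le_trans t0; rewrite oppr_lt0.
  by apply: le_lt_trans t1 _; rewrite ltrDl.
have oS : open (J2 `&` c2 @^-1` dom i).
  apply: continuous_preimage_open => //; last exact: dom_open.
  exact: itvoo_nbhd_open.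
set S := J2 `&` _ in oS.
pose x2 t : 'rV[R]_2 := chart i (c2 t).
pose v2 t : 'rV[R]_2 := velocity c2 t i.
have x2s k l : Ck l S (fun t => x2 t 0 k) by exact: c2s.
have v2E k : (fun t => v2 t 0 k) = 'D_1 (fun t => x2 t 0 k).
  by apply/funext => t; rewrite mxE derive1E.
have x2d t k : S t -> is_derive t 1 (fun t => x2 t 0 k) (v2 t 0 k).
  by move=> St; rewrite -[v2 t 0 k]/((fun t => v2 t 0 k) t) v2E; exact: Ck_is_derive (x2s k 1) St.
have v2d t k : S t -> 0 <= t <= 1 -> is_derive t 1 (fun t => v2 t 0 k) (geo_acc i (x2 t) (v2 t) k).
  move=> St t01.
  have D2 : is_derive t 1 (fun t => v2 t 0 k) ('D_1 ('D_1 (fun t => x2 t 0 k)) t).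
    by rewrite v2E; exact: Ck_is_derive (Ck_derive (1 : R) (x2s k 2)) St.
  have := c2g t i t01 St.2 => /rowP /(_ k); rewrite !mxE.
  rewrite (_ : derive1n 2 _ t = 'D_1 ('D_1 (fun t => x2 t 0 k)) t); last first.
    by rewrite /derive1n /= derive1E; congr ('D_1 _ t); apply/funext => u; rewrite derive1E.
  move=> /eqP; rewrite addr_eq0 => /eqP E; move: D2; rewrite E; congr is_derive.
have xc t k : J t -> {for t, continuous (fun t => x t 0 k)}.
  by move=> Jt; exact: is_derive_continuous (xw k Jt).
have wc t k : J t -> {for t, continuous (fun t => w t 0 k)}.
  by move=> Jt; exact: is_derive_continuous (ww k Jt).
have cc t : J t -> {for t, continuous c}.
  by move=> Jt; exact: (chart_geodesic_continuous xD xw ww).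
have x2c t k : S t -> {for t, continuous (fun t => x2 t 0 k)}.
  by move=> St; exact: Ck_continuous (x2s k 0) St.
have v2c t k : S t -> {for t, continuous (fun t => v2 t 0 k)}.
  by move=> St; rewrite v2E; exact: Ck_continuous (Ck_derive (1 : R) (x2s k 1)) St.
have cE t : J t -> dom i (c t) /\ chart i (c t) = x t.
  by move=> Jt; have [E ?] := cdomK (xD Jt).
suff H : forall t, 0 <= t <= 1 -> c2 t = c t /\ v2 t = w t by move=> t /H[].
apply: real_induction => t t01 IH.
have /andP[t0 t1] := t01; have Jt := itv_J t01.
(* The points come first: continuity of the velocity [v2] at [t] is available only once [c2 t] is
   known to lie in chart [i]. *)
have [ct vt] : c2 t = c t /\ (c2 t = c t -> v2 t = w t).
  have [t00|tn0] := eqVneq t 0; first by rewrite t00; split=> // _; exact: v20.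
  have tp : 0 < t by rewrite lt_def tn0.
  split.
    apply: (left_limit_eq (@points_hausdorff _ A) tp) => //; [exact/c2c/J2i|exact: cc|].
    by move=> y /IH[].
  move=> ct; have St : S t by split; [exact: J2i|rewrite /= ct; exact: (cE t Jt).1].
  apply/rowP => k; apply: (@left_limit_eq R (fun t => v2 t 0 k) (fun t => w t 0 k) 0) => //.
  - exact: v2c.
  - exact: wc.
  - by move=> y /IH[_ ->].
have {}vt := vt ct.
have St : S t by split; [exact: J2i|rewrite /= ct; exact: (cE t Jt).1].
have x2t : x2 t = x t by rewrite /x2 ct; exact: (cE t Jt).2.
pose z t := row_mx (x t) (w t); pose z2 t := row_mx (x2 t) (v2 t).
have zt : z2 t = z t by rewrite /z2 /z x2t vt.
have zG : geo_dom i (z t) by rewrite /geo_dom /= row_mxKl; exact: xD.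
have [dl [K [dl0 K0 HU _ HD]]] := C2_bounds (@geo_dom_open _ _ i) zG (fun m => geo_field_Ck i m 2).
have zc : {for t, continuous z} by apply: row_mx_continuous => k; [exact: xc|exact: wc].
have z2c : {for t, continuous z2} by apply: row_mx_continuous => k; [exact: x2c|exact: v2c].
have oJ : open J by exact: itvoo_nbhd_open.
have : \forall y \near t, S y /\ (J y /\ (`|z t - z y| < dl /\ `|z t - z2 y| < dl)).
  apply: filterI; first exact: near_R.
  apply: filterI; first exact: near_R.
  apply: filterI; first by have /cvgrPdist_lt /(_ _ dl0) := zc.
  by rewrite -zt; have /cvgrPdist_lt /(_ _ dl0) := z2c.
move=> /(nbhs_ball_norm t _).1[et et0 Het].
exists et => // y y01 yt; have /andP[y0 y1] := y01.
have [ylt|tley] := ltP y t; first by apply: IH; rewrite y0.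
have bd u : t <= u <= y -> `|u - t| < et.
  move=> /andP[tu uy]; apply: le_lt_trans yt; rewrite !ger0_norm ?subr_ge0//.
  by rewrite lerD2r.
pose D tau := z2 (t + tau) - z (t + tau).
have D_in tau : 0 <= tau <= y - t -> t <= t + tau <= y.
  by move=> /andP[? ?]; apply/andP; split; lra.
have sh (f : R -> R) (tau dd : R) : is_derive (t + tau) 1 f dd -> is_derive tau 1 (fun s => f (t + s)) dd.
  move=> H; rewrite -[dd]mulr1; apply: is_derive_comp1 H _.
  by rewrite -[1 in X in is_derive _ _ _ X]add0r; apply: is_derive_add; exact: is_derive_id.
have HDt tau m : 0 <= tau <= y - t -> is_derive tau 1 (fun s => D s 0 m)
    (geo_field i m (z2 (t + tau)) - geo_field i m (z (t + tau))).
  move=> /D_in /[dup] ty /bd /Het[Su [Ju _]].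
  rewrite (_ : (fun s => D s 0 m) = (fun s => z2 (t + s) 0 m - z (t + s) 0 m)); last first.
    by apply/funext => s; rewrite /D [LHS]mxE [X in _ + X]mxE.
  apply: is_derive_sub; last first.
    exact: (sh (fun s => z s 0 m)) (geo_solution xw ww m Ju).
  apply: (sh (fun s => z2 s 0 m)).
  have u01 : 0 <= t + tau <= 1.
    by move: ty => /andP[? ?]; apply/andP; split; lra.
  rewrite -(splitK m); case: (fintype.split m) => l /=.
    rewrite geo_fieldl; have := x2d _ l Su; congr is_derive.
    by apply/funext => u; rewrite row_mxEl.
  rewrite geo_fieldr; have := v2d _ l Su u01; congr is_derive.
  by apply/funext => u; rewrite row_mxEr.
have Hb tau m : 0 <= tau <= y - t ->
   `|geo_field i m (z2 (t + tau)) - geo_field i m (z (t + tau))| <=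
   (2 + 2)%:R * K * `|D tau| + 0.
  move=> /D_in /bd /Het[_ [_ [zd z2d]]]; rewrite addr0.
  apply: (@mvt_box_lip _ _ _ (z t) dl); rewrite 1?distrC// => y' l yd.
  split; last exact: (HD y' m l yd).1.
  exact: is_derive_ex (Ck_is_derive _ (geo_field_Ck i m 1) (HU _ yd)).
have L0 : 0 <= (2 + 2)%:R * K by rewrite mulr_ge0.
have yT : 0 <= y - t <= y - t by rewrite subr_ge0 tley lexx.
have := gronwall_vec_pos L0 (lexx 0) HDt Hb yT.
rewrite /D !addr0 zt subrr normr0 mulr0 normr_le0 subr_eq0 addrC subrK => /eqP zy.
have [E1 E2] := eq_row_mx zy.
have [Sy [Jy _]] := Het y yt.
split=> //; rewrite -(chartK Sy.2) -[chart i _]/(x2 y) E1.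
by [].
Qed.

Lemma expmap_chart (v : tvec A) :
  (forall j, dom j (c 0) -> v j = w 0 *m jac (trans i j) (x 0)) -> expmap (c 0) v = c 1.
Proof.
move=> Hv; have J0 : J 0 by apply: itv_J; rewrite lexx ler01.
have [E ic0] := cdomK (xD J0).
have [cg [c0 cv]] : geodesic c 0 1 /\ c 0 = c 0 /\ forall j, dom j (c 0) -> velocity c 0 j = w 0 *m jac (trans i j) (x 0).
  split; first exact: (chart_geodesic d0 xD xw ww).
  split=> // j jc; exact: (chart_geodesic_velocity xD xw ww).
have wi : velocity c 0 i = w 0.
  apply/rowP => b; rewrite mxE derive1E.
  have H : is_derive (0 : R) 1 (curve_coord c i b) (w 0 0 b).
    apply: near_eq_is_derive (xw b J0).
    have : \forall y \near (0 : R), J y by apply: near_R J0; exact: itvoo_nbhd_open.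
    by apply: filterS => y /xD /cdomK[ky _]; rewrite /curve_coord /c /= ky.
  exact: is_derive_val H.
have H q : (exists c', [/\ geodesic c' 0 1, c' 0 = c 0,
    (forall j, dom j (c 0) -> velocity c' 0 j = v j) & c' 1 = q]) -> q = c 1.
  move=> [c' [gc' c'0 v' <-]]; apply: (geodesic_unique gc' c'0); last by rewrite lexx ler01.
  by rewrite (v' i ic0) (Hv i ic0) -(cv i ic0).
rewrite /expmap; case: xgetP => [q _ /H //|/(_ (c 1)) []].
by exists c; split=> // j jc; rewrite cv// Hv.
Qed.

End GeodesicUniqueness.

(** * Fermi coordinates and the density G *)

Section LocalDensity.
Context {R : realType} {A : riemSurface R}.

Lemma geo_accZ i (x w : 'rV[R]_2) (r : R) k : geo_acc (A := A) i x (r *: w) k = r * (r * geo_acc i x w k).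
Proof.
rewrite /geo_acc mulrN mulrN; congr (- _); rewrite 2!mulr_sumr; apply: eq_bigr => u _.
rewrite 2!mulr_sumr; apply: eq_bigr => v _; rewrite !mxE.
by move: (christoffel _ _ _ _ _) (w 0 u) (w 0 v) => a b c; ring.
Qed.

(** The reparametrisation [X (r * t)] is again a geodesic, with initial velocity [r *: W 0], because
    the equation is quadratic in the velocity ([geo_accZ]). *)
Lemma expmap_flow (i : chartIndex A) (X W : R -> 'rV[R]_2) (rho r : R) (v : tvec A) :
  (forall t : R, `|t| < rho -> cdom i (X t)) ->
  (forall (t : R) k, `|t| < rho -> is_derive t 1 (fun t => X t 0 k) (W t 0 k)) ->
  (forall (t : R) k, `|t| < rho -> is_derive t 1 (fun t => W t 0 k) (geo_acc i (X t) (W t) k)) ->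
  `|r| < rho ->
  (forall j, dom j (chartV i (X 0)) -> v j = (r *: W 0) *m jac (trans i j) (X 0)) ->
  expmap (chartV i (X 0)) v = chartV i (X r).
Proof.
move=> XD XW WW rr Hv.
have rho0 : 0 < rho by apply: le_lt_trans rr.
(* A margin beyond [[0, 1]] for which [|r| * (1 + d) < rho] still holds. *)
pose d := (rho - `|r|) / rho / 2.
have d0 : 0 < d by rewrite !divr_gt0// subr_gt0.
have Jr t : itvoo_nbhd d t -> `|r * t| < rho.
  move=> /andP[]; rewrite sub0r => t1 t2.
  have ta : `|t| < 1 + d by rewrite ltr_norml t2 andbT; lra.
  have drho : d * rho = (rho - `|r|) / 2 by rewrite /d; field; rewrite gt_eqF.
  rewrite normrM; have r0 := normr_ge0 r.
  have : `|r| * `|t| <= `|r| * (1 + d) by rewrite ler_wpM2l// ltW.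
  have : `|r| * d <= rho * d by rewrite ler_wpM2r// ltW.
  by move: (`|r|) (`|t|) drho rr => a b; lra.
have dr (f : R -> R) (t dd : R) : is_derive (r * t) 1 f dd -> is_derive t 1 (fun t => f (r * t)) (r * dd).
  move=> H; rewrite mulrC; apply: is_derive_comp1 H _.
  by rewrite -[r in X in is_derive _ _ _ X]mulr1; apply: is_derive_scale; exact: is_derive_id.
have := @expmap_chart _ _ i (fun t => X (r * t)) (fun t => r *: W (r * t)) d d0
  (fun t Jt => XD _ (Jr t Jt)) _ _ v.
rewrite /= mulr0 mulr1; apply=> // t k Jt.
- have := dr _ _ _ (XW _ k (Jr t Jt)); congr is_derive; by rewrite mxE.
- rewrite geo_accZ; rewrite (_ : (fun t => _) = (fun t => r * (W (r * t) 0 k))); last first.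
    by apply/funext => u; rewrite mxE.
  apply: is_derive_scale; apply: (dr (fun t => W t 0 k)); exact: WW (Jr t Jt).
Qed.

(** Position and velocity of a geodesic in the chart, followed by a pair (Y, Y') with Y'' = - K Y
    along it. The Jacobi equation is solved at unit scale, and eps will enter only as a factor of
    time. *)
Definition den_field i (k : 'I_(2 + 2 + 2)) (z : 'rV[R]_(2 + 2 + 2)) : R :=
  match fintype.split k with
  | inl l => geo_field (A := A) i l (lsubmx z)
  | inr l => if l == 0 then rsubmx z 0 1
             else - gauss_coord (gram i) (lsubmx (lsubmx z)) * rsubmx z 0 0
  end.

Definition den_dom i : set 'rV[R]_(2 + 2 + 2) := [set z | geo_dom (A := A) i (lsubmx z)].

Lemma lsubmx_continuousV n m : continuous (lsubmx : 'rV[R]_(n + m) -> 'rV[R]_n).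
Proof.
move=> y; apply: continuous_rV => j.
rewrite (_ : (fun _ => _) = fun y : 'rV[R]_(n + m) => y 0 (lshift m j)).
  exact: coord_continuous_rV.
by apply/funext => x; rewrite mxE.
Qed.

Lemma den_dom_open i : open (den_dom i).
Proof. apply: open_comp => [y _|]; [exact: lsubmx_continuousV|exact: geo_dom_open]. Qed.

Lemma den_field_Ck i l k : Ck k (den_dom i) (den_field i l).
Proof.
have oG := @den_dom_open i; rewrite /den_field; case: (fintype.split l) => m.
  by apply: (comp_lsubmx_Ck (@geo_dom_open _ _ i) oG) => //; exact: geo_field_Ck.
have cr w : Ck k (den_dom i) (fun z : 'rV[R]_(2 + 2 + 2) => rsubmx z 0 w).
  by apply: Ck_eq (Ck_coord k (rshift (2 + 2) w) oG) => // y _; rewrite mxE.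
case: (m == 0) => //; apply: CkM => //; apply: CkN => //.
apply: (@comp_lsubmx_Ck _ _ _ (geo_dom i) _ (fun y => gauss_coord (gram i) (lsubmx y))) => //.
  exact: geo_dom_open.
by apply: (comp_lsubmx_Ck (@cdom_open _ _ i) (@geo_dom_open _ _ i)) => //; exact: chart_gauss_Ck.
Qed.

Lemma Ck_row_mx (V : normedModType R) n m k (U : set V) (u : V -> 'rV[R]_n) (v : V -> 'rV[R]_m) : open U ->
  (forall j, Ck k U (fun t => u t 0 j)) -> (forall j, Ck k U (fun t => v t 0 j)) ->
  forall j, Ck k U (fun t => row_mx (u t) (v t) 0 j).
Proof.
move=> oU Hu Hv j; rewrite -(splitK j); case: (fintype.split j) => l /=.
  by apply: Ck_eq (Hu l) => // s _; rewrite row_mxEl.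
by apply: Ck_eq (Hv l) => // s _; rewrite row_mxEr.
Qed.

Section Frame.
Variables (L : R) (Gam : R -> A) (N : R -> tvec A) (kappa : R -> R).
Hypothesis HG : embedded_arclength_curve Gam 0 L.
Hypothesis HN : unit_normal_field Gam 0 L N.
Hypothesis Hk : curvature_along Gam 0 L N kappa.

(** [N] and [kappa] are described on [[0, L]] only, whereas the flow wants smooth initial values on
    an open set of parameters, also around the end points. The curve is smooth on a larger interval,
    so its rotated tangent and the pairing of this with the acceleration are smooth extensions. *)
Lemma normal_frame s0 i : 0 <= s0 <= L -> dom i (Gam s0) ->
  exists (J : set R) (n : R -> 'rV[R]_2) (kt : R -> R),
   [/\ open J /\ J s0, (forall s, J s -> dom i (Gam s)),
     forall l k, Ck k J (fun s => chart i (Gam s) 0 l) /\ Ck k J (fun s => n s 0 l), forall k, Ck k J kt &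
     forall s, J s -> 0 <= s <= L -> kappa s = kt s /\
       forall j, dom j (Gam s) -> N s j = n s *m jac (trans i j) (chart i (Gam s))].
Proof.
move=> s0L is0; have [[d d0 [Gc Gs]] _ G1] := HG.
set Jd := [set s | _] in Gc Gs.
have oJd : open Jd.
  rewrite /Jd (_ : [set t | _] = `]0 - d, L + d[%classic); first exact: interval_open.
  by apply/seteqP; split=> t; rewrite /= in_itv.
have JL s : 0 <= s <= L -> Jd s by move=> /andP[? ?]; apply/andP; split; lra.
pose S j := Jd `&` Gam @^-1` dom j.
have oS j : open (S j) by apply: continuous_preimage_open => //; exact: dom_open.
pose g j s := chart j (Gam s); pose T j s : 'rV[R]_2 := velocity Gam s j.
have gC j l m : Ck m (S j) (fun s => g j s 0 l) by exact: Gs.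
have TE j l : (fun s => T j s 0 l) = 'D_1 (fun s => g j s 0 l).
  by apply/funext => t; rewrite mxE derive1E.
have TC j l m : Ck m (S j) (fun s => T j s 0 l) by rewrite TE; exact: Ck_derive (gC j l m.+1).
have gD j s : S j s -> cdom j (g j s) by move=> [_ ?]; exists (Gam s).
have gramC j a b m : Ck m (S j) (fun s => gram j (g j s) a b).
  by apply: (@Ck_comp _ _ _ _ _ _ (fun x => gram j x a b) (g j) (oS j) (@cdom_open _ _ j)) => //; [exact: gD|exact: gram_Ck].
pose n s := rot_normal i (g i s) (T i s).
pose ac s : 'rV[R]_2 := \row_l ('D_1 ('D_1 (fun s => g i s 0 l)) s +
  \sum_a \sum_b christoffel (gram i) l a b (g i s) * T i s 0 a * T i s 0 b).
have detC m : Ck m (S i) (fun s => (Num.sqrt (\det (gram i (g i s))))^-1).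
  apply: Ck_inv => //; last apply: Ck_sqrt => //.
  - by move=> s /gD /gram_det_gt0 ?; rewrite gt_eqF// sqrtr_gt0.
  - by move=> s /gD /gram_det_gt0.
  - apply: (@Ck_eq _ _ _ _ (fun s => gram i (g i s) 0 0 * gram i (g i s) 1 1 - gram i (g i s) 0 1 * gram i (g i s) 1 0)) => //.
      by move=> s _; rewrite det2E.
    by apply: CkB => //; apply: CkM.
have TgC m l : Ck m (S i) (fun s => (T i s *m gram i (g i s)) 0 l).
  apply: (@Ck_eq _ _ _ _ (fun s => \sum_p T i s 0 p * gram i (g i s) p l)) => //.
    by move=> s _; rewrite mxE.
  by apply: Ck_sum => // p; apply: CkM.
have nC l m : Ck m (S i) (fun s => n s 0 l).
  apply: (@Ck_eq _ _ _ _ (fun s => (Num.sqrt (\det (gram i (g i s))))^-1 *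
     (if l == 0 then - (T i s *m gram i (g i s)) 0 1 else (T i s *m gram i (g i s)) 0 0))) => //.
    by move=> s _; rewrite /n [RHS]mxE.
  by apply: CkM => //; case: (l == 0); [apply: CkN => //|]; exact: TgC.
have acC l m : Ck m (S i) (fun s => ac s 0 l).
  apply: (@Ck_eq _ _ _ _ (fun s => 'D_1 ('D_1 (fun s => g i s 0 l)) s +
    \sum_a \sum_b christoffel (gram i) l a b (g i s) * T i s 0 a * T i s 0 b)) => //.
    by move=> s _; rewrite /ac mxE.
  apply: CkD => //; first exact: Ck_derive (Ck_derive _ (gC i l m.+2)).
  apply: Ck_sum => // a; apply: Ck_sum => // b; apply: CkM => //; apply: CkM => //.
  apply: (Ck_comp (oS i) (@cdom_open _ _ i)) => //; [exact: gD|exact: chart_christoffel_Ck].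
pose kt s := \sum_p (\sum_q ac s 0 q * gram i (g i s) q p) * n s 0 p.
exists (S i), n, kt; split.
- by split=> //; split; [exact: JL|].
- by move=> s [].
- by move=> l k; split; [exact: gC|exact: nC].
- move=> k; apply: Ck_sum => // p; apply: CkM => //; apply: Ck_sum => // q; exact: CkM.
- move=> s Ss sL; have is_ := Ss.2.
  have [NN TN orN] := HN sL is_; have TT := G1 s i sL is_.
  have Nn : N s i = n s by exact: normal_unique TT NN TN orN.
  split.
    have E : acceleration Gam s i = ac s.
      have D2 l : derive1n 2 (curve_coord Gam i l) s = 'D_1 ('D_1 (fun s => g i s 0 l)) s.
        by rewrite /derive1n /= derive1E; congr ('D_1 _ s); apply/funext => u; rewrite derive1E.
      by apply/rowP => l; rewrite /acceleration [LHS]mxE D2 /ac [RHS]mxE.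
    have -> : kt s = inner (Gam s) i (ac s) (n s).
      rewrite /inner mxE; apply: eq_bigr => p _; congr (_ * _); [by rewrite [RHS]mxE|by rewrite [RHS]mxE].
    rewrite -E (Hk sL is_) -Nn /inner -2!scalemxAl mxE.
    by move: NN; rewrite /inner => ->; rewrite mulr1.
  move=> j js; rewrite -Nn; have Sj : S j s by split; [exact: JL|].
  have [NNj TNj orj] := HN sL js; have TTj := G1 s j sL js.
  have Tj : T j s = T i s *m jac (trans i j) (chart i (Gam s)).
    apply/rowP => b; apply: velocityE.
    have odm : odom i j (g i s) by exists (Gam s).
    have H : is_derive (s : R) 1 (fun u => trans i j (g i u) 0 b)
        (\sum_l 'D_(e_ l) (fun y => trans i j y 0 b) (g i s) * T i s 0 l).
      apply: (C1_chain (@odom_open _ _ i j) odm (trans_Ck i j b 1)) => l.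
      by rewrite -[T i s 0 l]/((fun s => T i s 0 l) s) TE; exact: Ck_is_derive (gC i l 1) Ss.
    rewrite mxE (_ : \sum_j0 _ = \sum_l 'D_(e_ l) (fun y => trans i j y 0 b) (g i s) * T i s 0 l); last first.
      by apply: eq_bigr => l _; rewrite [jac _ _ _ _]mxE mulrC.
    apply: near_eq_is_derive H.
    apply: filterS (near_R (oS i) Ss) => u [_ iu].
    by rewrite /curve_coord /trans /= /g chartK.
  have odm : odom i j (g i s) by exists (Gam s).
  rewrite (normal_unique js TTj NNj TNj orj).
  apply/esym; apply: normal_unique => //.
  - by rewrite inner_trans.
  - by rewrite -/(T j s) Tj inner_trans.
  - have dj := transition_oriented odm.
    rewrite -/(T j s) Tj; move: orN dj; rewrite -/(T i s) -[chart j \o _]/(trans i j).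
    move: (jac _ _) (T i s) (N s i) => Q a b; rewrite det2E !mxE !sum2E.
    move: (Q 0 0) (Q 0 1) (Q 1 0) (Q 1 1) (a 0 0) (a 0 1) (b 0 0) (b 0 1).
    move=> q r t u a0 a1 b0 b1 H1 H2; have := mulr_gt0 H1 H2.
    by congr (_ < _); ring.
Qed.

(** For fixed [s], both [f (s, t)] and [G (pt s (eps * t))] solve the same linear equation in [t]
    with the same initial values, since the curvature on the strip is that of the flow at time
    [eps * t]. Gronwall's estimate forces their difference to vanish. *)
Lemma local_density s0 k : 0 <= s0 <= L -> exists (rho : R) (G : 'rV[R]_2 -> R),
  [/\ 0 < rho, Ck k (box s0 rho) G, (forall s : R, `|s - s0| < rho -> G (pt s 0) = 1) &
   forall eps f, 0 < eps < rho -> is_jacobi_density Gam L N kappa eps f ->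
   forall s t : R, 0 <= s <= L -> `|s - s0| < rho -> `|t| < 1 -> f (s, t) = G (pt s (eps * t))].
Proof.
move=> s0L; have [i is0] := dom_cover (Gam s0).
have [J [n [kt [[oJ Js0] iJ Cxn Ckt HJ]]]] :
  exists (J : set R) (n : R -> 'rV[R]_2) (kt : R -> R),
   [/\ open J /\ J s0, (forall s, J s -> dom i (Gam s)),
     forall l m, Ck m J (fun s => chart i (Gam s) 0 l) /\ Ck m J (fun s => n s 0 l), forall m, Ck m J kt &
     forall s, J s -> 0 <= s <= L -> kappa s = kt s /\
       forall j, dom j (Gam s) -> N s j = n s *m jac (trans i j) (chart i (Gam s))].
  exact: normal_frame.
pose z0 s : 'rV[R]_(2 + 2 + 2) := row_mx (row_mx (chart i (Gam s)) (n s)) (pt 1 (- kt s)).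
have z0C m l : Ck l J (fun s => z0 s 0 m).
  move: m; apply: Ck_row_mx => // [|m].
    by apply: Ck_row_mx => // m; [exact: (Cxn m l).1|exact: (Cxn m l).2].
  apply: (@Ck_eq _ _ _ _ (fun s => if m == 0 then 1 else - kt s)) => //.
    by move=> s _; rewrite mxE.
  by case: (m == 0); [exact: Ck_cst|apply: CkN].
have z0D : den_dom i (z0 s0).
  by rewrite /den_dom /geo_dom /= /z0 2!row_mxKl; exists (Gam s0).
have [rho [Phi [rho0 [PU P0 PD] PC]]] := flow_Ck k (@den_dom_open i)
  (fun m l => @den_field_Ck i m l) oJ Js0 z0C z0D.
pose X p := lsubmx (lsubmx (Phi p)); pose W p := rsubmx (lsubmx (Phi p)).
pose Y p := rsubmx (Phi p).
have XE p l : X p 0 l = Phi p 0 (lshift 2 (lshift 2 l)) by rewrite !mxE.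
have WE p l : W p 0 l = Phi p 0 (lshift 2 (rshift 2 l)) by rewrite !mxE.
have YE p l : Y p 0 l = Phi p 0 (rshift (2 + 2) l) by rewrite !mxE.
pose KX p := gauss_coord (gram i) (X p).
have bp : box s0 rho (pt s0 0) by rewrite /box /= subrr normr0.
have oB := @box_open R s0 rho.
have KC : Ck 0 (box s0 rho) KX.
  apply: (@Ck_comp _ _ _ _ _ _ (gauss_coord (gram i)) X oB (@cdom_open _ _ i)).
  - by move=> p /PU.
  - exact: chart_gauss_Ck.
  - by move=> l; apply: Ck_eq (Ck_le (leq0n k) (PC (lshift 2 (lshift 2 l)))) => // p _; rewrite XE.
have [d [M [d0 M0 HM]]] := @near_family_bounded _ _ 'I_1 (fun _ => KX) (pt s0 0)
  (fun _ => Ck_continuous KC bp).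
(* On this smaller box the curvature is bounded by [M], which provides the constant for Gronwall's
   estimate. *)
pose r := Num.min rho d.
have r0 : 0 < r by rewrite lt_min rho0.
have rrho : r <= rho by rewrite ge_min lexx.
have bb p : box s0 r p -> box s0 rho p by move=> /lt_le_trans; apply.
have bd p : box s0 r p -> `|p - pt s0 0| < d by move=> /lt_le_trans; apply; rewrite ge_min lexx orbT.
exists r, (fun p => Y p 0 0); split => //.
- by apply: (Ck_sub bb); apply: Ck_eq (PC (rshift (2 + 2) 0)) => // p _; rewrite YE.
- move=> s sr; rewrite /Y (P0 s (lt_le_trans sr rrho)).2 /z0 row_mxKr; exact: pt0.
move=> eps f /andP[eps0 epsr] Hf s t sL sr t1.
have [Js Ps] := P0 s (lt_le_trans sr rrho).
have [kE NE] := HJ s Js sL.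
have X0 : X (pt s 0) = chart i (Gam s) by rewrite /X Ps /z0 2!row_mxKl.
have W0 : W (pt s 0) = n s by rewrite /W Ps /z0 row_mxKl row_mxKr.
have Y0 : Y (pt s 0) = pt 1 (- kt s) by rewrite /Y Ps /z0 row_mxKr.
have inb u : `|u| < r -> box s0 r (pt s u) by move=> ur; apply/boxP => //; rewrite pt0 pt1.
have XD u : `|u| < r -> cdom i (X (pt s u)) by move=> /inb /bb /PU.
have DX u l : `|u| < r -> is_derive (u : R) 1 (fun u => X (pt s u) 0 l) (W (pt s u) 0 l).
  move=> /inb /bb /(PD _ (lshift 2 (lshift 2 l))) /is_derive_pt1.
  rewrite /den_field (unsplitK (inl (lshift 2 l))) -(hsubmxK (lsubmx _)) geo_fieldl.
  by congr is_derive; apply/funext => v; rewrite XE.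
have DW u l : `|u| < r -> is_derive (u : R) 1 (fun u => W (pt s u) 0 l) (geo_acc i (X (pt s u)) (W (pt s u)) l).
  move=> /inb /bb /(PD _ (lshift 2 (rshift 2 l))) /is_derive_pt1.
  rewrite /den_field (unsplitK (inl (rshift 2 l))) -(hsubmxK (lsubmx _)) geo_fieldr.
  by congr is_derive; apply/funext => v; rewrite WE.
have DY0 u : `|u| < r -> is_derive (u : R) 1 (fun u => Y (pt s u) 0 0) (Y (pt s u) 0 1).
  move=> /inb /bb /(PD _ (rshift (2 + 2) 0)) /is_derive_pt1.
  rewrite /den_field (unsplitK (inr 0)) /=.
  by congr is_derive; apply/funext => v; rewrite YE.
have DY1 u : `|u| < r -> is_derive (u : R) 1 (fun u => Y (pt s u) 0 1) (- KX (pt s u) * Y (pt s u) 0 0).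
  move=> /inb /bb /(PD _ (rshift (2 + 2) 1)) /is_derive_pt1.
  rewrite /den_field (unsplitK (inr 1)) /=.
  by congr is_derive; apply/funext => v; rewrite YE.
have epst u : `|u| < 1 -> `|eps * u| < r.
  move=> u1; rewrite normrM (gtr0_norm eps0); apply: lt_trans epsr.
  by rewrite -[ltRHS]mulr1 ltr_pM2l.
have KE u : `|u| < 1 -> Keps Gam N eps (s, u) = KX (pt s (eps * u)).
  move=> u1; rewrite /Keps /strip_map /=.
  have -> : Gam s = chartV i (X (pt s 0)) by rewrite X0 chartK//; exact: iJ.
  rewrite (@expmap_flow i (fun u => X (pt s u)) (fun u => W (pt s u)) r (eps * u)) //.
  - have [E dE] := cdomK (XD _ (epst u u1)).
    by rewrite (gaussKE dE) E.
  - exact: epst.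
  - move=> j; rewrite X0 W0 chartK; last exact: iJ.
    by move=> js; rewrite NE// -scalemxAl.
have [_ Hy y0 y'0] := Hf s sL; move: Hy y0 y'0.
set y : R -> R := fun t => f (s, t) => Hy y0 y'0.
have {}y0 : y 0 = 1 := y0.
pose D u : 'rV[R]_2 := pt (y u - Y (pt s (eps * u)) 0 0) (derive1 y u - eps * Y (pt s (eps * u)) 0 1).
pose dD (m : 'I_2) u := if m == 0 then D u 0 1 else - (eps ^+ 2 * KX (pt s (eps * u))) * D u 0 0.
have dsc (g : R -> R) (u dd : R) : is_derive (eps * u) 1 g dd -> is_derive u 1 (fun u => g (eps * u)) (eps * dd).
  move=> H; rewrite mulrC; apply: is_derive_comp1 H _.
  by rewrite -[eps in X in is_derive _ _ _ X]mulr1; apply: is_derive_scale; exact: is_derive_id.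
have HD u m : `|u| <= `|t| -> is_derive (u : R) 1 (fun u => D u 0 m) (dD m u).
  move=> /le_lt_trans /(_ t1) u1; have ur := epst u u1.
  have u11 : -1 < u < 1 by rewrite -ltr_norml.
  have [yd y'd yE] := Hy u u11.
  have Dy : is_derive (u : R) 1 y (derive1 y u) by rewrite derive1E; exact/derivableP.
  have Dy' : is_derive (u : R) 1 (derive1 y) (derive1n 2 y u).
    rewrite (_ : derive1n 2 y u = 'D_1 (derive1 y) u); first exact/derivableP.
    by rewrite /derive1n /= derive1E.
  rewrite /dD; case: (ord2P m) => -> /=.
    rewrite (_ : (fun u => D u 0 0) = (fun u => y u - Y (pt s (eps * u)) 0 0)); last first.
      by apply/funext => v; rewrite /D pt0.
    rewrite /D pt1; apply: is_derive_sub Dy _.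
    exact: (dsc (fun u => Y (pt s u) 0 0)) (DY0 _ ur).
  rewrite (_ : (fun u => D u 0 1) = (fun u => derive1 y u - eps * Y (pt s (eps * u)) 0 1)); last first.
    by apply/funext => v; rewrite /D pt1.
  rewrite /D pt0 (_ : _ * _ = derive1n 2 y u - eps * (eps * (- KX (pt s (eps * u)) * Y (pt s (eps * u)) 0 0))).
    apply: is_derive_sub Dy' _; apply: is_derive_scale.
    exact: (dsc (fun u => Y (pt s u) 0 1)) (DY1 _ ur).
  move: yE; rewrite (KE u u1) -[f (s, u)]/(y u).
  move: (derive1n 2 y u) (KX _) (Y _ 0 0) (y u) => a b c e H.
  by rewrite (_ : a = - (eps ^+ 2 * b * e)); [ring|lra].
have Hb u m : `|u| <= `|t| -> `|dD m u| <= (1 + eps ^+ 2 * M) * `|D u| + 0.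
  move=> /le_lt_trans /(_ t1) u1; have ur := epst u u1; rewrite addr0.
  have KM := HM _ ord0 (bd _ (inb _ ur)).
  have e2 : 0 <= eps ^+ 2 by rewrite sqr_ge0.
  have N0 := normr_ge0 (D u); have P0' : 0 <= eps ^+ 2 * M by rewrite mulr_ge0.
  rewrite /dD; case: (m == 0).
    apply: (le_trans (mx_norm_coord _ 1)); rewrite mulrDl mul1r lerDl mulr_ge0//.
  rewrite normrM normrN normrM (ger0_norm e2) mulrDl mul1r.
  apply: (@le_trans _ _ (eps ^+ 2 * M * `|D u|)); last by rewrite lerDr.
  by apply: ler_pM => //; [rewrite mulr_ge0|rewrite ler_wpM2l|exact: mx_norm_coord].
have C0 : 0 <= 1 + eps ^+ 2 * M by rewrite addr_ge0// mulr_ge0// sqr_ge0.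
have := gronwall_vec C0 (lexx 0) HD Hb (lexx `|t|).
have -> : D 0 = 0.
  apply/rowP => m; rewrite /D y0 y'0 mulr0 Y0 pt0 pt1 kE !mxE; case: (m == 0); ring.
rewrite normr0 addr0 mulr0 normr_le0 => /eqP /rowP /(_ 0).
by rewrite [D t 0 0]pt0 [X in _ = X]mxE => /eqP; rewrite subr_eq0 => /eqP.
Qed.

Definition tube (b rho : R) : set 'rV[R]_2 := [set p | -rho < p 0 0 < b + rho /\ `|p 0 1| < rho].

Lemma slab_open (a b r : R) : open [set p : 'rV[R]_2 | a < p 0 0 < b /\ `|p 0 1| < r].
Proof.
have c0 := @coord_continuous_rV R 2 0; have c1 := @coord_continuous_rV R 2 1.
rewrite (_ : [set p | _] = (fun p : 'rV[R]_2 => p 0 0) @^-1` `]a, b[%classic `&` (fun p : 'rV[R]_2 => p 0 1) @^-1` `]-r, r[%classic).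
  by apply: openI; apply: open_comp => //; exact: interval_open.
by apply/seteqP; split=> p /=; rewrite !in_itv /= ltr_norml.
Qed.

Local Ltac slra := repeat match goal with H : ?T |- _ =>
  lazymatch T with is_true _ => fail | _ = _ => fail | _ => lazymatch type of T with Prop => clear H end end end; lra.

(** Real induction on the right end [b] of the part already covered. A local density around [x]
    either reaches down to the left end of the curve or is glued to a density valid up to some
    [y0 < x]. *)
Lemma global_density k (f : R -> R * R -> R) (e0 : R) : 0 <= L -> 0 < e0 ->
  (forall eps, 0 < eps < e0 -> is_jacobi_density Gam L N kappa eps (f eps)) ->
  exists (rho : R) (G : 'rV[R]_2 -> R), [/\ 0 < rho, Ck k (tube L rho) G,
   (forall s : R, - rho < s < L + rho -> G (pt s 0) = 1) &
   forall eps s t : R, 0 < eps < rho -> 0 <= s <= L -> `|t| < 1 -> f eps (s, t) = G (pt s (eps * t))].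
Proof.
move=> L0 e00 Hf.
suff H : forall b, 0 <= b <= L -> exists (rho : R) (G : 'rV[R]_2 -> R), [/\ 0 < rho, Ck k (tube b rho) G,
   (forall s : R, - rho < s < b + rho -> G (pt s 0) = 1) &
   forall eps s t : R, 0 < eps < rho -> 0 <= s <= L -> s < b + rho -> `|t| < 1 -> f eps (s, t) = G (pt s (eps * t))].
  have [|rho [G [r0 GC G1 HG']]] := H L; first by rewrite L0 lexx.
  exists rho, G; split=> // eps s t er /[dup] sL /andP[_ sL'] t1; apply: HG' => //.
  by apply: (le_lt_trans sL'); rewrite ltrDl.
apply: real_induction => x xL IH.
have [r [G2 [r0 G2C G21 HG2]]] := local_density k xL.
have {}G2C (a b c : R) : x - r <= a -> b <= x + r -> c <= r ->
    Ck k [set p : 'rV[R]_2 | a < p 0 0 < b /\ `|p 0 1| < c] G2.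
  move=> ar br cr; apply: Ck_sub G2C => p [/andP[p0 p1] p2]; apply/boxP => //; split.
    by rewrite ltr_norml; apply/andP; split; slra.
  exact: lt_le_trans cr.
have /andP[x0 xL'] := xL.
have [xr|rx] := ltP x r.
  exists (Num.min (r - x) e0 / 2); first by rewrite divr_gt0// lt_min subr_gt0 xr e00.
  set d := _ / 2 => y /andP[y0 yL]; rewrite ltr_norml => /andP[yx1 yx2].
  have d0 : 0 < d by rewrite divr_gt0// lt_min subr_gt0 xr e00.
  have d1 : d <= (r - x) / 2 by rewrite ler_pM2r ?invr_gt0// ge_min lexx.
  have d2 : d < e0.
    by apply: (@le_lt_trans _ _ (e0 / 2)); [rewrite ler_pM2r ?invr_gt0// ge_min lexx orbT|slra].
  exists d, G2; split=> //.
  - by apply: G2C; slra.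
  - by move=> s /andP[s1 s2]; apply: G21; rewrite ltr_norml; apply/andP; split; slra.
  - move=> eps s t /andP[eps0 epsr] /[dup] sL /andP[s0 s1] sy t1.
    apply: (HG2 eps (f eps)) => //; first by rewrite eps0 /=; slra.
      by apply: Hf; rewrite eps0 /=; slra.
    by rewrite ltr_norml; apply/andP; split; slra.
pose y0 := x - r / 2.
have y0E : y0 = x - r / 2 by [].
clearbody y0.
have y0x : 0 <= y0 < x by apply/andP; split; slra.
have [rho' [G1 [rho'0 G1C' G11' HG1']]] := IH y0 y0x.
pose r1 := Num.min rho' (r / 2).
have r10 : 0 < r1 by rewrite lt_min rho'0 divr_gt0.
have r1a : r1 <= rho' by rewrite ge_min lexx.
have r1b : r1 <= r / 2 by rewrite ge_min lexx orbT.
pose E := Num.min r1 e0 / 2.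
have E0 : 0 < E by rewrite divr_gt0// lt_min r10.
have Ea : E <= r1 / 2 by rewrite ler_pM2r ?invr_gt0// ge_min lexx.
have Eb : E <= e0 / 2 by rewrite ler_pM2r ?invr_gt0// ge_min lexx orbT.
clearbody E r1.
have /andP[y00 y0x'] := y0x.
(* Over [[0, L]] both densities are read off from [f]: a point with second coordinate below [E] in
   absolute value is [(s, E * t)] with [|t| < 1], and there both equal [f E (s, t)]. *)
have agree (p : 'rV[R]_2) : y0 <= p 0 0 < y0 + r1 -> `|p 0 1| < E -> G1 p = G2 p.
  move=> /andP[p1 p2] p3; have EE : E != 0 by rewrite gt_eqF.
  have -> : p = pt (p 0 0) (E * (p 0 1 / E)).
    by rewrite {1}(ptE p); congr pt; field.
  have t1 : `|p 0 1 / E| < 1 by rewrite normrM normfV (gtr0_norm E0) ltr_pdivrMr// mul1r.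
  have sL : 0 <= p 0 0 <= L by apply/andP; split; slra.
  rewrite -(HG1' E) //; first last.
  - by slra.
  - by rewrite E0 /=; slra.
  rewrite -(HG2 E (f E)) //; first by rewrite E0 /=; slra.
  - by apply: Hf; rewrite E0 /=; slra.
  - by rewrite ltr_norml; apply/andP; split; slra.
(* The cut is placed in the middle of the overlap, so that near it either formula may be used. *)
have [c cE] : exists c, c = y0 + r1 / 2 by exists (y0 + r1 / 2).
pose G (p : 'rV[R]_2) := if p 0 0 < c then G1 p else G2 p.
exists E => // y /andP[yp yL]; rewrite ltr_norml => /andP[yx1 yx2].
exists E, G; split=> //.
- apply: Ck_local => p [/andP[p1 p2] p3]; have [pc|cp] := ltP (p 0 0) (y0 + r1).
    exists [set p : 'rV[R]_2 | - E < p 0 0 < y0 + r1 /\ `|p 0 1| < E]; first by rewrite /= p1.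
    apply: (@Ck_eq _ _ _ _ G1 G); first exact: slab_open.
      move=> q [/andP[q1 q2] q3]; rewrite /G; case: ltP => // qc.
      by apply: agree => //; rewrite q2 andbT; rewrite cE in qc; slra.
    by apply: Ck_sub G1C' => q [/andP[q1 q2] q3]; split; [apply/andP; split; slra|slra].
  exists [set p : 'rV[R]_2 | y0 < p 0 0 < y + E /\ `|p 0 1| < E]; first by rewrite /= p2 andbT; split=> //; slra.
  apply: (@Ck_eq _ _ _ _ G2 G); first exact: slab_open.
    move=> q [/andP[q1 q2] q3]; rewrite /G; case: ltP => // qc.
    by apply/esym/agree => //; rewrite (ltW q1) /=; rewrite cE in qc; slra.
  by apply: G2C; slra.
- move=> s /andP[s1 s2]; rewrite /G pt0; case: ltP => sc; rewrite cE in sc.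
    by apply: G11'; apply/andP; split; slra.
  by apply: G21; rewrite ltr_norml; apply/andP; split; slra.
- move=> eps s t /andP[eps0 epsr] /[dup] sL /andP[s0 s1] sy t1; rewrite /G pt0; case: ltP => sc; rewrite cE in sc.
    by apply: HG1' => //; [rewrite eps0 /=|]; slra.
  apply: (HG2 eps (f eps)) => //; first by rewrite eps0 /=; slra.
    by apply: Hf; rewrite eps0 /=; slra.
  by rewrite ltr_norml; apply/andP; split; slra.
Qed.

End Frame.
End LocalDensity.

(** * Weighted Wiener algebra of a family of functions *)

Section Wiener.
Context {R : realType} {T I : Type}.
Implicit Types (S : set T) (phi : I -> T -> R) (w : I -> R) (l : seq (R * I)).

(** A finite combination is a list of coefficients and indices, repetitions allowed. Sums become
    concatenations; like terms stay uncollected, as only upper bounds of the norm are used. *)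
Definition eval phi l x : R := \sum_(c <- l) c.1 * phi c.2 x.
Definition wnorm w l : R := \sum_(c <- l) `|c.1| * w c.2.

(* M bounds the norm of u in the w-weighted Wiener algebra of the phi i. *)
Definition wiener S phi w (u : T -> R) (M : R) : Prop :=
  forall d : R, 0 < d -> exists2 l, wnorm w l <= M & forall x, S x -> `|u x - eval phi l x| <= d.

Lemma eval_cat phi l1 l2 x : eval phi (l1 ++ l2) x = eval phi l1 x + eval phi l2 x.
Proof. by rewrite /eval big_cat. Qed.

Lemma wnorm_cat w l1 l2 : wnorm w (l1 ++ l2) = wnorm w l1 + wnorm w l2.
Proof. by rewrite /wnorm big_cat. Qed.

Definition lscale (a : R) l := [seq (a * c.1, c.2) | c <- l].

Lemma eval_scale phi a l x : eval phi (lscale a l) x = a * eval phi l x.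
Proof. by rewrite /eval /lscale big_map mulr_sumr; apply: eq_bigr => c _; rewrite mulrA. Qed.

Lemma wnorm_scale w a l : wnorm w (lscale a l) = `|a| * wnorm w l.
Proof. by rewrite /wnorm /lscale big_map mulr_sumr; apply: eq_bigr => c _; rewrite normrM mulrA. Qed.

Lemma wnorm_ge0 w l : (forall i, 0 <= w i) -> 0 <= wnorm w l.
Proof. by move=> w0; apply: sumr_ge0 => c _; rewrite mulr_ge0. Qed.

Variables (S : set T) (phi : I -> T -> R) (w : I -> R).
Hypothesis w0 : forall i, 0 <= w i.

Lemma wiener_ge0 u M : wiener S phi w u M -> 0 <= M.
Proof. by move=> /(_ 1 ltr01)[l lM _]; exact: le_trans (wnorm_ge0 l w0) lM. Qed.

Lemma wiener_le u M M' : M <= M' -> wiener S phi w u M -> wiener S phi w u M'.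
Proof. by move=> MM H d /H[l lM Hl]; exists l => //; exact: le_trans MM. Qed.

Lemma wiener_eq u v M : (forall x, S x -> u x = v x) -> wiener S phi w u M -> wiener S phi w v M.
Proof. by move=> uv H d /H[l lM Hl]; exists l => // x Sx; rewrite -uv//; exact: Hl. Qed.

Lemma wiener_add u v M M' : wiener S phi w u M -> wiener S phi w v M' ->
  wiener S phi w (fun x => u x + v x) (M + M').
Proof.
move=> Hu Hv d d0; have d20 : 0 < d / 2 by rewrite divr_gt0.
have [l lM Hl] := Hu _ d20; have [k kM Hk] := Hv _ d20.
exists (l ++ k) => [|x Sx]; first by rewrite wnorm_cat lerD.
rewrite eval_cat opprD addrACA; apply: le_trans (ler_normD _ _) _.
by have := Hl x Sx; have := Hk x Sx; lra.
Qed.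

Lemma wiener_scale a u M : wiener S phi w u M -> wiener S phi w (fun x => a * u x) (`|a| * M).
Proof.
move=> Hu d d0; have a0 := normr_ge0 a; have a1 : 0 < `|a| + 1 by rewrite ltr_wpDl.
have [l lM Hl] := Hu _ (divr_gt0 d0 a1).
exists (lscale a l) => [|x Sx]; first by rewrite wnorm_scale ler_wpM2l.
rewrite eval_scale -mulrBr normrM.
apply: (@le_trans _ _ (`|a| * (d / (`|a| + 1)))); first by rewrite ler_wpM2l// Hl.
rewrite mulrCA ger_pMr// ler_pdivrMr// mul1r lerDl ler01 //.
Qed.

Lemma wiener_opp u M : wiener S phi w u M -> wiener S phi w (fun x => - u x) M.
Proof.
move=> /(wiener_scale (-1)); rewrite normrN normr1 mul1r.
by apply: wiener_eq => x _; rewrite mulN1r.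
Qed.

Lemma wiener_sub u v M M' : wiener S phi w u M -> wiener S phi w v M' ->
  wiener S phi w (fun x => u x - v x) (M + M').
Proof. by move=> Hu /wiener_opp; exact: wiener_add. Qed.

(** The bound survives uniform limits, which is how functions given by infinite series enter the
    algebra. *)
Lemma wiener_close u M : (forall d : R, 0 < d -> exists2 v, wiener S phi w v M & forall x, S x -> `|u x - v x| <= d) ->
  wiener S phi w u M.
Proof.
move=> H d d0; have d20 : 0 < d / 2 by rewrite divr_gt0.
have [v Hv uv] := H _ d20; have [l lM Hl] := Hv _ d20.
exists l => // x Sx; rewrite -(subrKA (v x)); apply: le_trans (ler_normD _ _) _.
by have := Hl x Sx; have := uv x Sx; lra.
Qed.

Lemma wiener_atom i : wiener S phi w (phi i) (w i).
Proof.
move=> d d0; exists [:: (1, i)] => [|x _]; first by rewrite /wnorm big_seq1 /= normr1 mul1r.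
by rewrite /eval big_seq1 /= mul1r subrr normr0 ltW.
Qed.

Lemma wiener_zero : wiener S phi w (fun _ => 0) 0.
Proof.
move=> d d0; exists [::] => [|x _]; first by rewrite /wnorm big_nil.
by rewrite /eval big_nil subrr normr0 ltW.
Qed.

Lemma wiener_sum (J : Type) (r : seq J) (u : J -> T -> R) (M : J -> R) :
  (forall j, wiener S phi w (u j) (M j)) -> wiener S phi w (fun x => \sum_(j <- r) u j x) (\sum_(j <- r) M j).
Proof.
move=> H; elim: r => [|j r IH].
  by rewrite big_nil; apply: wiener_eq wiener_zero => x _; rewrite big_nil.
by rewrite big_cons; apply: wiener_eq (wiener_add (H j) IH) => x _; rewrite big_cons.
Qed.

Hypothesis phi1 : forall i x, S x -> `|phi i x| <= 1.
Hypothesis w1 : forall i, 1 <= w i.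

Lemma eval_le l x : S x -> `|eval phi l x| <= wnorm w l.
Proof.
move=> Sx; apply: le_trans (ler_norm_sum _ _ _) _; apply: ler_sum => c _.
by rewrite normrM ler_wpM2l//; apply: (@le_trans _ _ 1); [exact: phi1|exact: w1].
Qed.

Lemma wiener_bound u M x : wiener S phi w u M -> S x -> `|u x| <= M.
Proof.
move=> H Sx; apply/ler_addgt0Pr => d /H[l lM Hl].
rewrite -(subrK (eval phi l x) (u x)); apply: le_trans (ler_normD _ _) _.
by have := Hl x Sx; have := eval_le l Sx; lra.
Qed.

Variable mu : I -> I -> seq (R * I).
Hypothesis mu_eval : forall i j x, S x -> phi i x * phi j x = eval phi (mu i j) x.
Hypothesis mu_norm : forall i j, wnorm w (mu i j) <= w i * w j.

(** The table [mu] expands the product of two atoms in atoms; [mu_norm] makes the norm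
    submultiplicative. *)
Definition lmul l k := flatten [seq flatten [seq lscale (c.1 * e.1) (mu c.2 e.2) | e <- k] | c <- l].

Lemma eval_lmul l k x : S x -> eval phi (lmul l k) x = eval phi l x * eval phi k x.
Proof.
move=> Sx; rewrite /eval /lmul big_flatten big_map mulr_suml; apply: eq_bigr => c _.
rewrite big_flatten big_map mulr_sumr; apply: eq_bigr => e _.
by rewrite -/(eval _ _ _) eval_scale -mu_eval//; ring.
Qed.

Lemma wnorm_lmul l k : wnorm w (lmul l k) <= wnorm w l * wnorm w k.
Proof.
rewrite /wnorm /lmul big_flatten big_map mulr_suml; apply: ler_sum => c _.
rewrite big_flatten big_map mulr_sumr; apply: ler_sum => e _.
by rewrite -/(wnorm _ _) wnorm_scale normrM mulrACA ler_wpM2l// mulr_ge0.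
Qed.

Lemma wiener_mul u v M M' : wiener S phi w u M -> wiener S phi w v M' ->
  wiener S phi w (fun x => u x * v x) (M * M').
Proof.
move=> Hu Hv d d0.
have M0 := wiener_ge0 Hu; have M'0 := wiener_ge0 Hv.
have MM : 0 < M + M' + 1 by rewrite ltr_wpDl// addr_ge0.
have [l lM Hl] := Hu _ (divr_gt0 d0 MM); have [k kM Hk] := Hv _ (divr_gt0 d0 MM).
set e := d / _ in Hl Hk.
exists (lmul l k) => [|x Sx].
  by apply: le_trans (wnorm_lmul l k) _; apply: ler_pM => //; exact: wnorm_ge0.
rewrite eval_lmul//.
have -> : u x * v x - eval phi l x * eval phi k x =
   (u x - eval phi l x) * v x + eval phi l x * (v x - eval phi k x) by ring.
apply: le_trans (ler_normD _ _) _; rewrite !normrM.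
have e0 : 0 < e by rewrite divr_gt0.
have E : d = e * M' + M * e + e.
  by rewrite /e; move: MM => /lt0r_neq0 ?; field.
have h1 : `|u x - eval phi l x| * `|v x| <= e * M'.
  by apply: ler_pM => //; [exact: Hl|exact: wiener_bound Hv Sx].
have h2 : `|eval phi l x| * `|v x - eval phi k x| <= M * e.
  by apply: ler_pM => //; [exact: le_trans (eval_le l Sx) lM|exact: Hk].
by rewrite {}E; lra.
Qed.

End Wiener.

(** * Uniform estimates for the sawtooth series and its primitive *)

Section Sawtooth.
Context {R : realType}.
Implicit Types (x y : R).

Lemma mvt1 (f df : R -> R) (a b : R) : a <= b ->
  (forall x : R, a <= x <= b -> is_derive x 1 f (df x)) ->
  exists2 c : R, a <= c <= b & f b - f a = df c * (b - a).
Proof.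
move=> ab H.
have [c] := @MVT_segment R f df a b ab
  (fun x (xi : x \in `]a, b[%R) => H x (subset_itv_oo_cc xi)) (derivable_within_continuous
  (fun x (xi : x \in `[a, b]%R) => is_derive_ex (H x xi))).
by rewrite in_itv /= => cab E; exists c.
Qed.

(** The mean value theorem for [g - f] and [g + f]; it takes the place of estimates of integrals. *)
Lemma derive_le_mono (f df g dg : R -> R) (a b : R) : a <= b ->
  (forall x : R, a <= x <= b -> is_derive x 1 f (df x)) ->
  (forall x : R, a <= x <= b -> is_derive x 1 g (dg x)) ->
  (forall x : R, a <= x <= b -> `|df x| <= dg x) -> `|f b - f a| <= g b - g a.
Proof.
move=> ab Hf Hg H.
have P (e : R) : e = 1 \/ e = -1 -> e * (f b - f a) <= g b - g a.
  move=> e1; have [|c cab E] := @mvt1 (fun x => g x - e * f x) (fun x => dg x - e * df x) a b ab.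
    by move=> x xab; apply: is_derive_sub (Hg x xab) _; apply: is_derive_scale; exact: Hf.
  have : 0 <= (dg c - e * df c) * (b - a).
    rewrite mulr_ge0 ?subr_ge0//; apply: le_trans (H c cab).
    by case: e1 => ->; [rewrite mul1r ler_norm|rewrite mulN1r -normrN ler_norm].
  by rewrite -E; lra.
rewrite ler_norml; apply/andP; split.
  by have := P _ (or_intror erefl); lra.
by have := P _ (or_introl erefl); lra.
Qed.

Lemma is_derive_lin (a x : R) : is_derive x 1 (fun y => a * y) a.
Proof. by rewrite -[a in X in is_derive _ _ _ X]mulr1; apply: is_derive_scale; exact: is_derive_id. Qed.

Lemma is_derive_affine (a b x : R) : is_derive x 1 (fun y => a * y + b) a.
Proof. by have := is_derive_add (is_derive_lin a x) (is_derive_cst_fun b x 1); rewrite addr0. Qed.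

Lemma is_derive_sina (a x : R) : is_derive x 1 (fun y => sin (a * y)) (a * cos (a * x)).
Proof. by rewrite mulrC; apply: is_derive_comp1 (is_derive_lin a x); exact: is_derive_sin. Qed.

Lemma is_derive_cosa (a x : R) : is_derive x 1 (fun y => cos (a * y)) (- (a * sin (a * x))).
Proof. by rewrite mulrC -mulNr; apply: is_derive_comp1 (is_derive_lin a x); exact: is_derive_cos. Qed.

Lemma sin_lip x y : `|sin x - sin y| <= `|x - y|.
Proof.
wlog yx : x y / y <= x.
  move=> W; have [/W//|/ltW /W] := leP y x.
  by rewrite distrC [X in _ <= X]distrC.
have := @derive_le_mono sin cos id (fun=> 1) y x yx (fun z _ => is_derive_sin z)
  (fun z _ => is_derive_id z 1) (fun z _ => cos_max z).
by move/le_trans; apply; rewrite ler_norm.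
Qed.

Lemma cos_lip x y : `|cos x - cos y| <= `|x - y|.
Proof. by rewrite -!sinDpihalf; apply: le_trans (sin_lip _ _) _; rewrite opprD addrACA subrr addr0. Qed.

Lemma sin_le_norm x : `|sin x| <= `|x|.
Proof. by have := sin_lip x 0; rewrite sin0 !subr0. Qed.

Lemma sin_ge_half x : 0 <= x <= 2^-1 -> x / 2 <= sin x.
Proof.
move=> /andP[x0 x1].
have [c /andP[c0 c1] E] := @mvt1 sin cos 0 x x0 (fun z _ => is_derive_sin z).
have := cos_lip c 0; rewrite cos0 subr0 (ger0_norm c0) ler_norml => /andP[H _].
move: E; rewrite sin0 !subr0 => ->; nra.
Qed.

Lemma sin_half_mono x y : 0 <= x -> x <= y -> y <= pi -> sin (x / 2) <= sin (y / 2).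
Proof.
move=> x0 xy yp; have p0 := @pi_gt0 R.
have [z zab E] := @mvt1 sin cos (x / 2) (y / 2) ltac:(lra) (fun z _ => is_derive_sin z).
rewrite -subr_ge0 E mulr_ge0 ?subr_ge0//; last by rewrite ler_pM2r.
by apply: cos_ge0_pihalf; move: zab => /andP[? ?]; apply/andP; split; lra.
Qed.

Definition saw N x : R := \sum_(k < N) sin (k.+1%:R * x) / k.+1%:R.

(** The sawtooth series represents (pi - x) / 2 on the open interval from 0 to 2 pi. *)
Definition saw_err N x : R := (pi - x) / 2 - saw N x.

Lemma dirichlet_kernel N x :
  2 * sin (x / 2) * \sum_(k < N) cos (k.+1%:R * x) = sin ((N%:R + 2^-1) * x) - sin (x / 2).
Proof.
elim: N => [|N IH].
  by rewrite big_ord0 mulr0 add0r mulrC subrr.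
rewrite big_ord_recr mulrDr IH /=.
have -> : (N%:R + 2^-1) * x = N.+1%:R * x - x / 2 by rewrite -natr1; field.
have -> : (N.+1%:R + 2^-1) * x = N.+1%:R * x + x / 2 by field.
by rewrite sinB sinD; ring.
Qed.

Lemma saw_derive N x : is_derive x 1 (saw N) (\sum_(k < N) cos (k.+1%:R * x)).
Proof.
apply: (@is_derive_sum_seq _ _ _ _ (fun (k : 'I_N) x => sin (k.+1%:R * x) / k.+1%:R)) => k.
rewrite [cos _](_ : _ = k.+1%:R^-1 * (k.+1%:R * cos (k.+1%:R * x))); last first.
  by rewrite mulrA mulVf ?mul1r// pnatr_eq0.
rewrite (_ : (fun x => _) = (fun x => k.+1%:R^-1 * sin (k.+1%:R * x))); last first.
  by apply/funext => y; rewrite mulrC.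
by apply: is_derive_scale; exact: is_derive_sina.
Qed.

Lemma saw_err_derive N x : is_derive x 1 (saw_err N) (- 2^-1 - \sum_(k < N) cos (k.+1%:R * x)).
Proof.
apply: is_derive_sub (saw_derive N x).
rewrite (_ : (fun x => _) = (fun x => - 2^-1 * x + pi / 2)); last by apply/funext => y; field.
exact: is_derive_affine.
Qed.

Lemma natpi_sin n : sin (n%:R * pi) = 0 :> R.
Proof.
elim: n => [|n IH]; first by rewrite mul0r sin0.
by rewrite -natr1 mulrDl mul1r sinDpi IH oppr0.
Qed.

Lemma natpi_cos n : cos (n%:R * pi) = (-1) ^+ n :> R.
Proof.
elim: n => [|n IH]; first by rewrite mul0r cos0.
by rewrite -natr1 mulrDl mul1r cosDpi IH exprS mulN1r.
Qed.

(* cos (M y) / (2 M sin (y / 2)), M = N + 1/2, is a primitive of the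
   derivative - sin (M y) / (2 sin (y / 2)) of saw_err up to an error
   controlled by the derivative of cotan. *)
Lemma saw_err_bound N x : 0 < x <= pi -> `|saw_err N x| <= 3 / ((2 * N%:R + 1) * sin (x / 2)).
Proof.
move=> /andP[x0 xp]; pose M : R := N%:R + 2^-1.
have M0 : 0 < M by rewrite /M ltr_wpDl.
have s0 y : x <= y <= pi -> 0 < sin (y / 2).
  by move=> /andP[xy yp]; apply: sin_gt0_pi; apply/andP; split; lra.
pose g y := cos (M * y) / (2 * M * sin (y / 2)).
pose k y := - cos (y / 2) / (2 * M * sin (y / 2)).
have dsin (y : R) : is_derive y 1 (fun y => sin (y / 2)) (cos (y / 2) / 2).
  have := is_derive_sina 2^-1 y; rewrite [_ * cos _]mulrC [2^-1 * y]mulrC; congr is_derive.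
  by apply/funext => z; rewrite mulrC.
have dcos (y : R) : is_derive y 1 (fun y => cos (y / 2)) (- (sin (y / 2) / 2)).
  have := is_derive_cosa 2^-1 y; rewrite [_ * sin _]mulrC [2^-1 * y]mulrC; congr is_derive.
  by apply/funext => z; rewrite mulrC.
have dinv (y : R) : x <= y <= pi -> is_derive y 1 (fun y => (2 * M * sin (y / 2))^-1)
    (- (2 * M * (cos (y / 2) / 2)) / (2 * M * sin (y / 2)) ^+ 2).
  move=> /s0 sy; have sn : 2 * M * sin (y / 2) != 0 by rewrite gt_eqF// !mulr_gt0.
  exact: (@is_derive_inv _ _ (fun y => 2 * M * sin (y / 2)) y 1 _ sn (is_derive_scale (2 * M) (dsin y))).
have dg (y : R) : x <= y <= pi -> is_derive y 1 (fun y => saw_err N y - g y)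
    (cos (M * y) * cos (y / 2) / (4 * M * sin (y / 2) ^+ 2)).
  move=> xy; have sy := s0 y xy.
  rewrite (_ : _ / _ = (- 2^-1 - \sum_(k < N) cos (k.+1%:R * y)) -
     (- (M * sin (M * y)) / (2 * M * sin (y / 2)) + cos (M * y) * (- (2 * M * (cos (y / 2) / 2)) / (2 * M * sin (y / 2)) ^+ 2))).
    apply: is_derive_sub; first exact: saw_err_derive.
    apply: is_derive_mul (dinv y xy); exact: is_derive_cosa.
  have := dirichlet_kernel N y; rewrite -/M.
  move: (\sum_(k < N) _) (sin (M * y)) (cos (M * y)) (cos (y / 2)) sy => S a b c sy E.
  move: (sin (y / 2)) sy E => s sy E.
  have -> : a = 2 * s * S + s by rewrite E subrK.
  by field; rewrite !gt_eqF.
have dk (y : R) : x <= y <= pi -> is_derive y 1 k ((4 * M * sin (y / 2) ^+ 2)^-1).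
  move=> xy; have sy := s0 y xy.
  rewrite (_ : _^-1 = - - (sin (y / 2) / 2) / (2 * M * sin (y / 2)) +
    - cos (y / 2) * (- (2 * M * (cos (y / 2) / 2)) / (2 * M * sin (y / 2)) ^+ 2)).
    by apply: is_derive_mul (dinv y xy); apply: is_derive_opp.
  have := cos2Dsin2 (y / 2); move: (cos (y / 2)) (sin (y / 2)) sy => c s sy E.
  have -> : (4 * M * s ^+ 2)^-1 = (c ^+ 2 + s ^+ 2) / (4 * M * s ^+ 2) by rewrite E mul1r.
  by field; rewrite !gt_eqF.
have := derive_le_mono xp dg dk.
have gpi : g pi = 0.
  rewrite /g /M mulrDl [2^-1 * _]mulrC cosDpihalf natpi_sin oppr0 mul0r //.
have hpi : saw_err N pi = 0.
  rewrite /saw_err subrr mul0r sub0r /saw big1 ?oppr0// => i _.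
  by rewrite natpi_sin mul0r.
have kpi : k pi = 0 by rewrite /k cos_pihalf oppr0 mul0r.
rewrite gpi hpi kpi subrr !sub0r normrN => H.
have xx : x <= x <= pi by rewrite lexx.
have sx := s0 x xx; have P0 : 0 < 2 * M * sin (x / 2) by rewrite !mulr_gt0.
have {}H : `|saw_err N x - g x| <= (2 * M * sin (x / 2))^-1.
  apply: (le_trans (H _)).
    move=> y xy; have sy := s0 y xy.
    rewrite normrM normfV normrM [`|_ * _ ^+ 2|]ger0_norm; last by rewrite !mulr_ge0 ?sqr_ge0 ?ltW.
    have I0 : 0 <= (4 * M * sin (y / 2) ^+ 2)^-1 by rewrite invr_ge0 !mulr_ge0 ?sqr_ge0// ltW.
    rewrite ler_piMl//.
    by apply: mulr_ile1 => //; exact: cos_max.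
  by rewrite /k mulNr opprK ler_piMl ?cos_le1// invr_ge0 ltW.
have G : `|g x| <= (2 * M * sin (x / 2))^-1.
  by rewrite /g normrM normfV (gtr0_norm P0) ler_piMl ?cos_max// invr_ge0 ltW.
have -> : (2 * N%:R + 1) * sin (x / 2) = 2 * M * sin (x / 2) by rewrite /M; field.
rewrite -(subrK (g x) (saw_err N x)); apply: le_trans (ler_normD _ _) _.
have := invr_gt0 (2 * M * sin (x / 2)); rewrite P0.
by move: H G; move: (_^-1) => z; lra.
Qed.

(** A bound up to [x = 0], where convergence is not uniform. For [N * x <= 1] each term is at most
    [x]; otherwise [saw_err_bound] applies, and 12 comes from [sin (x / 2) >= 1 / 4] for [x > 1]. *)
Lemma saw_err_le N x : 0 <= x <= pi -> `|saw_err N x| <= 12.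
Proof.
move=> /andP[x0 xp].
have pi4 : pi < 4 :> R by have := @pihalf_lt2 R; lra.
have [Nx|Nx] := leP (N%:R * x) 1.
  have : `|saw N x| <= 1.
    apply: le_trans Nx; apply: le_trans (ler_norm_sum _ _ _) _.
    apply: (@le_trans _ _ (\sum_(k < N) x)); last by rewrite sumr_const card_ord mulr_natl.
    apply: ler_sum => k _; rewrite normrM normfV [`|k.+1%:R|]ger0_norm // ler_pdivrMr ?ltr0n// mulrC.
    by apply: le_trans (sin_le_norm _) _; rewrite normrM (ger0_norm x0) ger0_norm.
  rewrite /saw_err => H; apply: le_trans (ler_normB _ _) _.
  have h : `|(pi - x) / 2| <= 2 by rewrite ger0_norm; lra.
  by lra.
have xp0 : 0 < x by rewrite lt_def x0 andbT; apply: contraTneq Nx => ->; rewrite mulr0 -leNgt.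
apply: le_trans (saw_err_bound N _) _; first by rewrite xp0.
have N0 : 0 <= N%:R :> R by [].
have [x1|x1] := leP x 1.
  have : x / 2 / 2 <= sin (x / 2) by apply: sin_ge_half; apply/andP; split; lra.
  move=> sx; rewrite ler_pdivrMr; last by rewrite mulr_gt0//; lra.
  move: (sin _) sx => s sx; nra.
have : 2^-1 / 2 <= sin (x / 2).
  apply: (@le_trans _ _ (sin (1 / 2))); first by have := @sin_ge_half (1 / 2) ltac:(lra); lra.
  by apply: sin_half_mono; lra.
move=> sx; rewrite ler_pdivrMr; last by rewrite mulr_gt0//; lra.
by move: (sin _) sx => s sx; nra.
Qed.

Definition theta N x : R := \sum_(k < N) cos (k.+1%:R * x) / k.+1%:R ^+ 2.
Definition theta_err N x : R := theta N x + pi * x / 2 - x ^+ 2 / 4.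

Lemma theta_err_derive N x : is_derive x 1 (theta_err N) (saw_err N x).
Proof.
have H : is_derive x 1 (theta N) (- saw N x).
  rewrite /saw -sumrN.
  apply: (@is_derive_sum_seq _ _ _ _ (fun (k : 'I_N) x => cos (k.+1%:R * x) / k.+1%:R ^+ 2)) => k.
  rewrite (_ : - _ = (k.+1%:R ^+ 2)^-1 * - (k.+1%:R * sin (k.+1%:R * x))); last first.
    have : k.+1%:R != 0 :> R by rewrite pnatr_eq0.
    by move: (k.+1%:R) => a a0; field.
  rewrite (_ : (fun x => _) = (fun x => (k.+1%:R ^+ 2)^-1 * cos (k.+1%:R * x))); last first.
    by apply/funext => y; rewrite mulrC.
  by apply: is_derive_scale; exact: is_derive_cosa.
rewrite (_ : saw_err N x = - saw N x + pi / 2 - x / 2); last by rewrite /saw_err; field.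
apply: is_derive_sub.
  apply: is_derive_add H _.
  rewrite (_ : (fun x => _) = (fun x => pi / 2 * x)); last by apply/funext => y; field.
  exact: is_derive_lin.
rewrite (_ : (fun x => _) = (fun x => 4^-1 * (x * x))); last by apply/funext => y; rewrite expr2 mulrC.
rewrite (_ : x / 2 = 4^-1 * (1 * x + x * 1)); last by field.
by apply: is_derive_scale; apply: is_derive_mul; exact: is_derive_id.
Qed.

Lemma theta_err_sym N x : theta_err N (2 * pi - x) = theta_err N x.
Proof.
rewrite /theta_err -!addrA; congr (_ + _); last by field.
apply: eq_bigr => k _; congr (_ / _).
rewrite mulrBr cosB mulrA [k.+1%:R * 2]mulrC -mulrA mulr2n mulrDl mul1r cosD sinD.
rewrite natpi_sin natpi_cos -expr2 sqrr_sign; ring.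
Qed.

(** Away from 0 the derivative [saw_err N] is O(1 / N), and on the short remaining interval it is at
    most 12. Hence [theta_err N] is uniformly close to a constant, represented by its value at [pi];
    symmetry covers the second half of the period. *)
Lemma theta_cvg (d : R) : 0 < d -> exists N0 : nat, forall N x, (N0 <= N)%N -> 0 <= x <= 2 * pi ->
  `|theta_err N x - theta_err N pi| <= d.
Proof.
move=> d0; have p0 := @pi_gt0 R; have p2 := @pi_ge2 R.
(* The bound 12 on an interval of length at most [eta] contributes at most [d / 2]. *)
pose eta := Num.min 1 (d / 24).
have e0 : 0 < eta by rewrite lt_min ltr01 divr_gt0.
have e1 : eta <= 1 by rewrite ge_min lexx.
have e2 : eta <= d / 24 by rewrite ge_min lexx orbT.
have s0 : 0 < sin (eta / 2) by apply: sin_gt0_pihalf; apply/andP; split; lra.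
pose N0 := (Num.truncn (3 * pi / (sin (eta / 2) * d))).+1.
have HN0 : 3 * pi / (sin (eta / 2) * d) < N0%:R by exact: truncnS_gt.
exists N0 => N x NN.
suff H : forall x, 0 <= x <= pi -> `|theta_err N x - theta_err N pi| <= d.
  move=> /andP[x0 x2]; have [xp|px] := leP x pi; first by apply: H; rewrite x0.
  by rewrite -theta_err_sym; apply: H; apply/andP; split; lra.
move=> {}x /andP[x0 xp].
have far y : eta <= y <= pi -> `|theta_err N y - theta_err N pi| <= d / 2.
  move=> /andP[ey yp]; rewrite distrC.
  have dr (z : R) : y <= z <= pi -> is_derive z 1 (fun z => 3 / ((2 * N%:R + 1) * sin (eta / 2)) * z) (3 / ((2 * N%:R + 1) * sin (eta / 2))).
    by move=> _; exact: is_derive_lin.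
  apply: le_trans (derive_le_mono yp (fun z _ => theta_err_derive N z) dr _) _.
    move=> z /andP[yz zp]; apply: le_trans (saw_err_bound N _) _; first by rewrite zp andbT; lra.
    have N1 : 0 < 2 * N%:R + 1 :> R by rewrite ltr_wpDl// mulr_ge0.
    have sz : sin (eta / 2) <= sin (z / 2) by apply: sin_half_mono; lra.
    by rewrite ler_pM2l// lef_pV2 ?posrE ?mulr_gt0 ?ler_pM2l//; apply: lt_le_trans sz.
  rewrite -mulrBr; set K := 3 / _.
  have K0 : 0 <= K by rewrite divr_ge0// mulr_ge0 ?ltW// addr_ge0// mulr_ge0.
  apply: (@le_trans _ _ (K * pi)); first by rewrite ler_wpM2l//; lra.
  have NN' : N0%:R <= N%:R :> R by rewrite ler_nat.
  move: HN0; rewrite ltr_pdivrMr; last by rewrite mulr_gt0.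
  move=> HN; rewrite /K mulrAC ler_pdivrMr; last by rewrite mulr_gt0// ltr_wpDl// mulr_ge0.
  have := mulr_gt0 s0 d0; move: (sin _) HN => s; nra.
have [ex|xe] := leP eta x.
  by apply: le_trans (far x _) _; [rewrite ex|lra].
have dr (z : R) : x <= z <= eta -> is_derive z 1 (fun z => 12 * z) 12 by move=> _; exact: is_derive_lin.
have := derive_le_mono (ltW xe) (fun z _ => theta_err_derive N z) dr _.
have Hz z : x <= z <= eta -> `|saw_err N z| <= 12.
  by move=> /andP[xz ze]; apply: saw_err_le; apply/andP; split; lra.
move=> /(_ Hz) H1.
have H2 := far eta ltac:(rewrite lexx /=; lra).
rewrite -(subrKA (theta_err N eta)); apply: le_trans (ler_normD _ _) _.
by rewrite distrC; lra.
Qed.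

End Sawtooth.

Lemma cos_dist (R : realType) (a b : nat) (z : R) : cos ((a - b + (b - a))%N%:R * z) = cos ((a%:R - b%:R) * z).
Proof.
have [ab|/ltnW ba] := leqP a b.
  have -> : (a - b + (b - a) = b - a)%N by lia.
  by rewrite natrB// -cosN -mulNr opprB.
have -> : (a - b + (b - a) = a - b)%N by lia.
by rewrite natrB.
Qed.

(** * Cosine series on an interval *)

Section CosineSeries.
Context {R : realType}.
Variable g : R.
Hypothesis g01 : 0 <= g < 1.

(** Sums of frequencies are compatible with this weight since 1 + a + b <= (1 + a) (1 + b). *)
Definition wt (n : nat) : R := n.+1%:R `^ g.

Lemma wt_mono n m : (n <= m)%N -> wt n <= wt m.
Proof.
move=> nm; have /andP[g0 _] := g01; rewrite /wt; apply: ge0_ler_powR; rewrite ?nnegrE//.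
by rewrite ler_nat.
Qed.

Lemma wt_ge1 n : 1 <= wt n.
Proof. have /andP[g0 _] := g01; have <- : 1 `^ g = 1 :> R by rewrite powR1.
by apply: ge0_ler_powR; rewrite ?nnegrE// ler1n. Qed.

Lemma wt_ge0 n : 0 <= wt n. Proof. exact: le_trans ler01 (wt_ge1 n). Qed.

Lemma wt_mul n a b : (n.+1 <= a.+1 * b.+1)%N -> wt n <= wt a * wt b.
Proof.
move=> nab; have /andP[g0 _] := g01; rewrite /wt -powRM// -natrM.
by apply: ge0_ler_powR; rewrite ?nnegrE// ler_nat.
Qed.

Lemma wt1_le2 : wt 1 <= 2.
Proof. by have /andP[_ /ltW g1] := g01; apply: ler1_powR => //; rewrite ler1n. Qed.

Lemma wt_le2 n a : (n.+1 <= 2 * a.+1)%N -> wt n <= 2 * wt a.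
Proof. by move=> na; apply: le_trans (wt_mul na) _; rewrite ler_wpM2r// ?wt_ge0// wt1_le2. Qed.

Definition zeta_bound : R := 2 + 2 / (1 - g).

Lemma zeta_bound_ge2 : 2 <= zeta_bound.
Proof. by have /andP[_ g1] := g01; rewrite lerDl divr_ge0// subr_ge0 ltW. Qed.

(** By the mean value theorem the terms are compared with telescoping differences of the power g -
    1; it is here that [g < 1] makes the series converge. *)
Lemma zeta_le N : \sum_(k < N) wt k.+1 / k.+1%:R ^+ 2 <= zeta_bound.
Proof.
have /andP[g0 g1] := g01; have g10 : 0 < 1 - g by rewrite subr_gt0.
suff H : \sum_(k < N) wt k.+1 / k.+1%:R ^+ 2 <= 2 + 2 / (1 - g) * (1 - N%:R `^ (g - 1)) \/ N = 0%N.
  case: H => [H|->]; last by rewrite big_ord0 (le_trans _ zeta_bound_ge2).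
  apply: le_trans H _; rewrite lerD2l; apply: ler_piMr; first by rewrite divr_ge0// ltW.
  by rewrite gerBl powR_ge0.
elim: N => [|[|N] IH]; first by right.
  left; rewrite big_ord_recr big_ord0 /= add0r powR1 subrr mulr0 addr0 expr1n divr1.
  exact: wt1_le2.
left; case: IH => // IH; rewrite big_ord_recr /=; set x : R := N.+1%:R in IH *.
have x0 : 0 < x by rewrite ltr0n.
have x1E : N.+2%:R = x + 1 :> R by rewrite natr1.
have d (y : R) : x <= y <= x + 1 -> is_derive y 1 (fun y : R => y `^ (g - 1)) ((g - 1) * y `^ (g - 1 - 1)).
  by move=> /andP[xy _]; apply: is_derive1_powR; exact: lt_le_trans xy.
have xx1 : x <= x + 1 by rewrite lerDl.
have [c /andP[xc cx] E] := mvt1 xx1 d.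
have c0 : 0 < c := lt_le_trans x0 xc.
have x10 : 0 < x + 1 by rewrite addr_gt0.
have T : wt N.+2 / N.+2%:R ^+ 2 <= 2 * (x + 1) `^ (g - 1 - 1).
  have -> : (x + 1) `^ (g - 1 - 1) = (x + 1) `^ g / (x + 1) ^+ 2.
    rewrite -addrA -opprD powRB; first by rewrite (_ : 1 + 1 = 2%:R) // powR_mulrn// ltW.
    by apply/implyP => _; rewrite gt_eqF.
  rewrite x1E mulrA ler_pM2r ?invr_gt0 ?exprn_gt0//.
  by rewrite -x1E; apply: wt_le2; lia.
have M : (x + 1) `^ (g - 1 - 1) <= c `^ (g - 1 - 1).
  have -> : g - 1 - 1 = - (2 - g) by ring.
  rewrite !powRN lef_pV2 ?posrE ?powR_gt0//.
  by apply: ge0_ler_powR => //; rewrite ?nnegrE ?(ltW c0)// ?(ltW x10)//; lra.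
rewrite x1E in E *; apply: (@le_trans _ _ (2 + 2 / (1 - g) * (1 - x `^ (g - 1)) + 2 * c `^ (g - 1 - 1))).
  by apply: lerD => //; rewrite -x1E; apply: le_trans T _; rewrite ler_pM2l.
have -> : c `^ (g - 1 - 1) = ((x `^ (g - 1)) - (x + 1) `^ (g - 1)) / (1 - g).
  apply: (mulIf (lt0r_neq0 g10)); rewrite divfK ?gt_eqF//.
  by move: E; rewrite (_ : x + 1 - x = 1); [lra|ring].
by rewrite le_eqVlt; apply/orP; left; apply/eqP; field; rewrite gt_eqF.
Qed.

Variable l : R.
Hypothesis l0 : 0 < l.

Definition cosl (k : nat) (x : R) : R := cos (k%:R * (pi * x / l)).
Definition sinl (k : nat) (x : R) : R := sin (k%:R * (pi * x / l)).
Definition seg : set R := [set x | 0 <= x <= l].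

Lemma seg_angle x : seg x -> 0 <= pi * x / l <= pi.
Proof.
move=> /andP[x0 xl]; rewrite divr_ge0 ?mulr_ge0 ?pi_ge0 ?(ltW l0)//=.
by rewrite ler_pdivrMr// ler_pM2l// pi_gt0.
Qed.

Lemma cosl_le1 k x : `|cosl k x| <= 1. Proof. exact: cos_max. Qed.
Lemma sinl_le1 k x : `|sinl k x| <= 1. Proof. exact: sin_max. Qed.

(** On the strip the weight depends on the sum of both frequencies; [q] is the frequency in the
    other variable. *)
Definition wt_from (q k : nat) : R := wt (q + k).

Local Notation W q := (wiener seg cosl (wt_from q)).

Let wq0 q k : 0 <= wt_from q k. Proof. exact: wt_ge0. Qed.

Lemma wiener_cst c : W 0 (fun _ => c) `|c|.
Proof.
have H := wiener_scale c (wiener_atom seg cosl (wt_from 0) 0%N).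
have E : wt_from 0 0 = 1 by rewrite /wt_from /wt powR1.
rewrite E mulr1 in H; apply: wiener_eq H => x _.
by rewrite /cosl mul0r cos0 mulr1.
Qed.

(** The limit of [theta N] on the closed interval from 0 to 2 pi, up to an additive constant: a
    quadratic polynomial with cosine coefficients 1 / k^2. *)
Definition theta_lim (z : R) : R := z ^+ 2 / 4 - pi * z / 2.

Lemma theta_pi_bound N : `|theta_err N pi| <= zeta_bound + 4 :> R.
Proof.
have p4 : pi < 4 :> R by have := @pihalf_lt2 R; lra.
have p0 := @pi_gt0 R.
rewrite /theta_err -addrA; apply: le_trans (ler_normD _ _) _; apply: lerD.
  apply: le_trans (zeta_le N); apply: le_trans (ler_norm_sum _ _ _) _; apply: ler_sum => k _.
  rewrite normrM normfV [`|_ ^+ 2|]ger0_norm ?sqr_ge0// ler_pM2r ?invr_gt0 ?exprn_gt0//.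
  exact: le_trans (cos_max _) (wt_ge1 _).
by rewrite (_ : _ - _ = pi ^+ 2 / 4) ?ger0_norm ?divr_ge0 ?sqr_ge0//; [nra|field].
Qed.

Definition theta_norm : R := 6 * zeta_bound + 8.

(* The hypothesis says that the k-th terms of theta at Z1 and Z2 add up to a
   multiple of one cosine, of frequency at most 2 (k + 1). *)
Lemma theta_wiener (Z1 Z2 : R -> R) (a : nat -> R) (f : nat -> nat) (Zd : R) : 0 <= Zd <= 1 ->
  (forall k, `|a k| <= 2) -> (forall k, (f k <= 2 * k.+1)%N) ->
  (forall x, seg x -> 0 <= Z1 x <= 2 * pi /\ 0 <= Z2 x <= 2 * pi) ->
  (forall k x, seg x -> cos (k.+1%:R * Z1 x) + Zd * cos (k.+1%:R * Z2 x) = a k * cosl (f k) x) ->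
  W 0 (fun x => theta_lim (Z1 x) + Zd * theta_lim (Z2 x)) theta_norm.
Proof.
move=> /andP[Zd0 Zd1] Ha Hf HZ HE; apply: wiener_close => // d d0.
have d20 : 0 < d / 2 by rewrite divr_gt0.
have [N HN] := theta_cvg d20.
pose v x := \sum_(k < N) (a k / k.+1%:R ^+ 2) * cosl (f k) x - (1 + Zd) * theta_err N pi.
exists v.
  have H1 : W 0 (fun x => \sum_(k < N) (a k / k.+1%:R ^+ 2) * cosl (f k) x)
     (\sum_(k < N) `|a k / k.+1%:R ^+ 2| * wt (f k)).
    by apply: wiener_sum => k; apply: wiener_scale; exact: wiener_atom.
  apply: wiener_le (wiener_sub H1 (wiener_cst ((1 + Zd) * theta_err N pi))).
  have A : \sum_(k < N) `|a k / k.+1%:R ^+ 2| * wt (f k) <= 4 * zeta_bound.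
    apply: le_trans (ler_wpM2l _ (zeta_le N)) => //; rewrite mulr_sumr; apply: ler_sum => k _.
    rewrite normrM normfV [`|_ ^+ 2|]ger0_norm ?sqr_ge0// mulrAC mulrA.
    rewrite ler_pM2r ?invr_gt0 ?exprn_gt0//.
    have fk : ((f k).+1 <= 2 * k.+2)%N by move: (Hf k); clear; lia.
    apply: le_trans (ler_wpM2r (wt_ge0 _) (Ha k)) _.
    by move: (wt_le2 fk); clear; move: (wt (f k)) (wt k.+1) => u v; lra.
  have B := theta_pi_bound N; rewrite normrM ger0_norm ?addr_ge0//.
  have : (1 + Zd) * `|theta_err N pi| <= 2 * `|theta_err N pi| by rewrite ler_wpM2r//; lra.
  by move: A B; rewrite /theta_norm; move: (\sum_(k < N) _) `|theta_err _ _| (_ * _) zeta_bound; clear => a b c e; lra.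
move=> x Sx; have [Z1x Z2x] := HZ x Sx.
have E z : theta_lim z = theta N z - theta_err N z.
  by rewrite /theta_lim /theta_err; move: (theta N z) => T; ring.
have -> : theta_lim (Z1 x) + Zd * theta_lim (Z2 x) - v x =
   - (theta_err N (Z1 x) - theta_err N pi) - Zd * (theta_err N (Z2 x) - theta_err N pi).
  have T : theta N (Z1 x) + Zd * theta N (Z2 x) = \sum_(k < N) (a k / k.+1%:R ^+ 2) * cosl (f k) x.
    rewrite /theta mulr_sumr -big_split; apply: eq_bigr => k _ /=.
    by rewrite [RHS]mulrAC -HE//; field; rewrite addrC natr1 pnatr_eq0.
  rewrite /v -T !E; move: (theta_err N pi) (theta_err _ _) (theta_err _ _) (theta _ _) (theta _ _).
  by move=> p e1 e2 t1 t2; ring.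
apply: le_trans (ler_normB _ _) _; rewrite normrN normrM (ger0_norm Zd0).
have h1 := HN N _ (leqnn N) Z1x; have h2 := HN N _ (leqnn N) Z2x.
by have := normr_ge0 (theta_err N (Z2 x) - theta_err N pi); nra.
Qed.

Let X (x : R) : R := pi * x / l.
Let pn : pi != 0 :> R. Proof. by rewrite gt_eqF// pi_gt0. Qed.
Let ln : l != 0. Proof. by rewrite gt_eqF. Qed.

(** The combination [theta_lim (2 * X) - 4 * theta_lim X] equals [pi * X], as the quadratic terms
    cancel. *)
Lemma wiener_angle : exists C, W 0 X C.
Proof.
have p0 := @pi_gt0 R.
have H1 : W 0 (fun x => theta_lim (X x) + 0 * theta_lim (X x)) theta_norm.
  apply: (theta_wiener (a := fun _ => 1) (f := fun k => k.+1)).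
  - by rewrite lexx ler01.
  - by move=> _; rewrite normr1 ler1n.
  - by move=> k; lia.
  - by move=> x /seg_angle /andP[? ?]; rewrite /X; split; apply/andP; split; lra.
  - by move=> k x _; rewrite mul0r addr0 mul1r.
have H2 : W 0 (fun x => theta_lim (2 * X x) + 0 * theta_lim (X x)) theta_norm.
  apply: (theta_wiener (Z1 := fun x => 2 * X x) (Z2 := X) (a := fun _ => 1) (f := fun k => (2 * k.+1)%N)).
  - by rewrite lexx ler01.
  - by move=> _; rewrite normr1 ler1n.
  - by move=> k; lia.
  - by move=> x /seg_angle /andP[? ?]; rewrite /X; split; apply/andP; split; lra.
  - by move=> k x _; rewrite mul0r addr0 mul1r /cosl natrM mulrA [k.+1%:R * 2]mulrC.
have := wiener_scale pi^-1 (wiener_sub H2 (wiener_scale 4 H1)).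
set C := (X in W 0 _ X -> _) => H; exists C; apply: wiener_eq H => x _.
by rewrite /theta_lim; move: (X x) (@pi R) pn => z q q0; field.
Qed.

Lemma wiener_angle2 : exists C, W 0 (fun x => X x ^+ 2) C.
Proof.
have [C1 HX] := wiener_angle; have p0 := @pi_gt0 R.
have H1 : W 0 (fun x => theta_lim (X x) + 0 * theta_lim (X x)) theta_norm.
  apply: (theta_wiener (a := fun _ => 1) (f := fun k => k.+1)).
  - by rewrite lexx ler01.
  - by move=> _; rewrite normr1 ler1n.
  - by move=> k; lia.
  - by move=> x /seg_angle /andP[? ?]; rewrite /X; split; apply/andP; split; lra.
  - by move=> k x _; rewrite mul0r addr0 mul1r.
have := wiener_add (wiener_scale 4 H1) (wiener_scale (2 * pi) HX).
set C := (X in W 0 _ X -> _) => H; exists C; apply: wiener_eq H => x _.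
by rewrite /theta_lim; move: (X x) => z; field.
Qed.

(** The bound must be uniform in the kink [y]. In [theta_lim |X - Y| + theta_lim (X + Y)] the k-th
    cosines combine to 2 cos (k Y) cos (k X), a single cosine with bounded coefficient, while the
    sum itself is quadratic plus a multiple of [|X - Y|]. A ramp is half of [|x - y| + x - y]. *)
Lemma wiener_ramp : exists C, forall y, seg y -> W 0 (fun x => Num.max (x - y) 0) C.
Proof.
have [C1 HX] := wiener_angle; have [C2 HX2] := wiener_angle2; have p0 := @pi_gt0 R.
have p4 : pi < 4 :> R by have := @pihalf_lt2 R; lra.
have C10 := wiener_ge0 (wq0 0) HX; have C20 := wiener_ge0 (wq0 0) HX2.
have HY y : seg y -> W 0 (fun x => theta_lim `|X x - X y| + 1 * theta_lim (X x + X y)) theta_norm.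
  move=> Sy; apply: (theta_wiener (a := fun k => 2 * cosl k.+1 y) (f := fun k => k.+1)).
  - by rewrite ler01 lexx.
  - by move=> k; rewrite normrM ger0_norm// ler_piMr// cosl_le1.
  - by move=> k; lia.
  - move=> x Sx; have := seg_angle Sx; have := seg_angle Sy; rewrite /X => /andP[a b] /andP[c d].
    split; last by apply/andP; split; lra.
    by rewrite normr_ge0 /= ler_norml; apply/andP; split; lra.
  - move=> k x _; rewrite mul1r -cos_norm normrM normr_id -normrM cos_norm /cosl -/(X x) -/(X y).
    by rewrite mulrBr mulrDr cosB cosD; ring.
pose K := l / pi / 2; have K0 : 0 <= K by rewrite !divr_ge0 ?ltW.
have [C H] : exists C, forall y, seg y -> W 0 (fun x => K * (2 / pi * ((X x ^+ 2 + X y ^+ 2) / 2 - pi * (X x + X y) / 2 -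
    (theta_lim `|X x - X y| + 1 * theta_lim (X x + X y))) + X x - X y)) C.
  pose C := K * (2 / pi * (2^-1 * (C2 + 16) + pi / 2 * (C1 + 4) + theta_norm) + C1 + 4).
  exists C => y Sy.
  have Y4 : `|X y| <= 4 by have /andP[? ?] := seg_angle Sy; rewrite ger0_norm // /X; lra.
  have Y16 : `|X y ^+ 2| <= 16.
    rewrite normrX; apply: (@le_trans _ _ (4 ^+ 2)); last by rewrite -natrX.
    by rewrite lerXn2r ?nnegrE.
  have cY := wiener_le Y4 (wiener_cst (X y)); have cY2 := wiener_le Y16 (wiener_cst (X y ^+ 2)).
  have := wiener_scale K (wiener_sub (wiener_add (wiener_scale (2 / pi)
    (wiener_sub (wiener_sub (wiener_scale 2^-1 (wiener_add HX2 cY2)) (wiener_scale (pi / 2) (wiener_add HX cY)))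
      (HY y Sy))) HX) cY).
  have n1 : `|2 / pi| = 2 / pi :> R by rewrite ger0_norm// divr_ge0// ltW.
  have n2 : `|2^-1| = 2^-1 :> R by rewrite ger0_norm.
  have n3 : `|pi / 2| = pi / 2 :> R by rewrite ger0_norm// divr_ge0// ltW.
  rewrite (ger0_norm K0) n1 n2 n3 -/C; apply: wiener_eq => x _.
  by move: (theta_lim `|X x - X y|) (theta_lim (X x + X y)) (X x) (X y) (@pi R) => a b c d q; ring.
exists C => y Sy; apply: wiener_eq (H y Sy) => x Sx.
have -> : (X x ^+ 2 + X y ^+ 2) / 2 - pi * (X x + X y) / 2 -
    (theta_lim `|X x - X y| + 1 * theta_lim (X x + X y)) = pi / 2 * `|X x - X y|.
  by rewrite /theta_lim (real_normK (num_real (X x - X y))); move: (X x) (X y) `|_| => a b c; field.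
have -> : `|X x - X y| = pi / l * `|x - y|.
  rewrite /X -(ger0_norm (_ : 0 <= pi / l)); last by rewrite divr_ge0 ?ltW.
  by rewrite -normrM; congr `|_|; field.
rewrite /X /K; have [xy|yx] := leP (x - y) 0.
  by rewrite (ler0_norm xy); move: (@pi R) pn ln => q q0 q1; field; rewrite ?q0 ?q1.
by rewrite (gtr0_norm yx); move: (@pi R) pn ln => q q0 q1; field; rewrite ?q0 ?q1.
Qed.

Definition C2_bounded (h : R -> R) (B : R) : Prop := exists h1 h2 : R -> R, forall x, seg x ->
  [/\ is_derive x 1 h (h1 x), is_derive x 1 h1 (h2 x), `|h x| <= B, `|h1 x| <= B & `|h2 x| <= B].

Lemma C2_bounded_lip h B x y : C2_bounded h B -> seg x -> seg y -> x <= y -> `|h y - h x| <= B * (y - x).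
Proof.
move=> [h1 [h2 H]] /andP[x0 xl] /andP[y0 yl] xy; rewrite mulrBr.
have in_seg z : x <= z <= y -> seg z by move=> /andP[? ?]; apply/andP; split; lra.
apply: (@derive_le_mono R h h1 _ (fun=> B) _ _ xy) => z zxy.
- by have [] := H z (in_seg z zxy).
- exact: is_derive_lin.
- by have [] := H z (in_seg z zxy).
Qed.

Definition slope (c : R) (h : R -> R) (b : nat) : R := (h (b.+1%:R * c) - h (b%:R * c)) / c.

Definition ramp (c : R) (b : nat) (x : R) : R := Num.max (x - b%:R * c) 0.

(** Piecewise linear interpolation on a mesh of size [c], written through second differences: a
    discrete form of h (0) + h' (0) x plus the integral of h'' (y) max (x - y, 0). *)
Definition interp (c : R) (n : nat) (h : R -> R) (x : R) : R :=
  h 0 + (slope c h 0 * ramp c 0 x + \sum_(b < n) (slope c h b.+1 - slope c h b) * ramp c b.+1 x).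

Section Interpolation.
Variables (n : nat) (h : R -> R) (B : R).
Let c := l / n.+1%:R.
Hypothesis HB : C2_bounded h B.

Let c0 : 0 < c. Proof. by rewrite divr_gt0// ltr0n. Qed.

Let z (b : nat) := b%:R * c.
Let sg := slope c h.
Let r := ramp c.

Let zS b : z b.+1 = z b + c. Proof. by rewrite /z -natr1 mulrDl mul1r. Qed.

Let Sz b : (b <= n.+1)%N -> seg (z b).
Proof.
move=> bN; rewrite /seg /= mulr_ge0 ?(ltW c0)//=.
by rewrite /z /c mulrA ler_pdivrMr ?ltr0n// mulrC ler_pM2l// ler_nat.
Qed.

Let B0 : 0 <= B.
Proof. by have [h1 [h2 H]] := HB; have [_ _ + _ _] := H _ (Sz (leq0n _)); exact: le_trans. Qed.

Lemma slope_le b : (b <= n)%N -> `|slope c h b| <= B.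
Proof.
move=> bN; rewrite normrM normfV (gtr0_norm c0) ler_pdivrMr//.
apply: le_trans (C2_bounded_lip HB (@Sz b _) (@Sz b.+1 bN) _) _; first exact: leqW.
  by rewrite -/(z b) -/(z b.+1) zS lerDl ltW.
by rewrite -/(z b) -/(z b.+1) zS addrAC subrr add0r.
Qed.

Lemma slope_diff_le b : (b < n)%N -> `|slope c h b.+1 - slope c h b| <= 2 * c * B.
Proof.
have [h1 [h2 H]] := HB => bN.
have zle k : z k <= z k.+1 by rewrite zS lerDl ltW.
have Szz k y : (k <= n)%N -> z k <= y <= z k.+1 -> seg y.
  move=> kN /andP[a1 a2]; have /andP[b1 _] := Sz (leqW kN); have /andP[_ b2] := @Sz k.+1 kN.
  by apply/andP; split; lra.
have mv k : (k <= n)%N -> exists2 y, z k <= y <= z k.+1 & sg k = h1 y.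
  move=> kN; have dh y : z k <= y <= z k.+1 -> is_derive y 1 h (h1 y).
    by move=> yy; have [] := H y (Szz k y kN yy).
  have [y yk E] := mvt1 (zle k) dh.
  by exists y => //; rewrite /sg /slope -/(z k) -/(z k.+1) E zS addrAC subrr add0r mulfK// gt_eqF.
rewrite -/sg; have [y1 y1k ->] := mv _ bN; have [y2 y2k ->] := mv _ (ltnW bN).
have Sy1 := Szz _ _ bN y1k; have Sy2 := Szz _ _ (ltnW bN) y2k.
move: y1k y2k => /andP[a1 a2] /andP[a3 a4]; have y21 : y2 <= y1 := le_trans a4 a1.
have Sy y : y2 <= y <= y1 -> seg y.
  by move: Sy1 Sy2 => /andP[? ?] /andP[? ?] /andP[? ?]; apply/andP; split; lra.
apply: le_trans (@derive_le_mono R h1 h2 (fun y => B * y) (fun=> B) _ _ y21 _ _ _) _.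
- by move=> y /Sy Hy; have [] := H y Hy.
- by move=> y _; exact: is_derive_lin.
- by move=> y /Sy Hy; have [] := H y Hy.
by rewrite -mulrBr mulrC ler_wpM2r//; rewrite !zS in a2 *; lra.
Qed.

(** Abel summation turns the ramps into the sum [I] of slopes times lengths, which reproduces [h] at
    the nodes; between nodes [h] and the interpolation each vary by at most [B * c]. *)
Lemma interp_err x : seg x -> `|h x - interp c n h x| <= 2 * B * c.
Proof.
pose I n x := \sum_(b < n) sg b * (r b x - r b.+1 x).
have Iparts m y : I m.+1 y = sg 0%N * r 0%N y + \sum_(b < m) (sg b.+1 - sg b) * r b.+1 y - sg m * r m.+1 y.
  elim: m => [|m IH]; first by rewrite /I big_ord_recl !big_ord0 /= !addr0 mulrBr.
  rewrite /I big_ord_recr -/(I m.+1 y) IH big_ord_recr /=.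
  by move: (\sum_(i < m) _) (r _ y) (r _ y) (r _ y) => s a b e; ring.
have zn : z n.+1 = l by rewrite /z /c mulrC divfK// pnatr_eq0.
move=> Sx; have -> : interp c n h x = h 0 + I n.+1 x.
  rewrite Iparts (_ : r n.+1 x = 0) ?mulr0 ?subr0//.
  by have /andP[_ xl] := Sx; apply/max_idPr; rewrite -/(z n.+1) zn; lra.
suff H m : (m <= n.+1)%N -> (forall x, seg x -> x <= z m -> `|h x - (h 0 + I m x)| <= 2 * B * c) /\
    (forall x, z m <= x -> I m x = h (z m) - h 0).
  by have [+ _] := H n.+1 (leqnn _); apply=> //; have /andP[_ xl] := Sx; rewrite zn.
elim: m => [_|m IH mN].
  split=> y; last by rewrite /I big_ord0 /z mul0r subrr.
  move=> /andP[y0 _]; rewrite {1}/z mul0r => y1; have -> : y = 0 by apply/le_anti/andP.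
  by rewrite /I big_ord0 addr0 subrr normr0 mulr_ge0// ?mulr_ge0// ltW.
have [IH1 IH2] := IH (ltnW mN); have Sn := Sz (ltnW mN).
have IS y : I m.+1 y = I m y + sg m * (r m y - r m.+1 y) by rewrite /I big_ord_recr.
split=> y.
  move=> Sy yn; have r1 : r m.+1 y = 0 by apply/max_idPr; rewrite -/(z m.+1); lra.
  rewrite IS r1 subr0; have [yz|zy] := leP y (z m).
    have -> : r m y = 0 by apply/max_idPr; rewrite -/(z m); lra.
    by rewrite mulr0 addr0; exact: IH1.
  rewrite IH2; last exact: ltW.
  have -> : r m y = y - z m by apply/max_idPl; rewrite -/(z m); lra.
  rewrite (_ : h y - _ = (h y - h (z m)) - sg m * (y - z m)); last by ring.
  have xc : 0 <= y - z m <= c by rewrite zS in yn; apply/andP; split; lra.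
  apply: le_trans (ler_normB _ _) _; rewrite normrM.
  have a1 := C2_bounded_lip HB Sn Sy (ltW zy); have a2 := slope_le mN.
  have /andP[xc0 xc1] := xc; rewrite (ger0_norm xc0).
  have : B * (y - z m) <= B * c by rewrite ler_wpM2l.
  have : `|sg m| * (y - z m) <= B * c by rewrite ler_pM.
  by lra.
move=> zy; rewrite zS in zy; rewrite IS IH2; last by have := c0; lra.
have -> : r m y = y - z m by apply/max_idPl; rewrite -/(z m); have := c0; lra.
have -> : r m.+1 y = y - z m.+1 by apply/max_idPl; rewrite -/(z m.+1) zS; lra.
have -> : y - z m - (y - z m.+1) = c by rewrite zS; ring.
by rewrite /sg /slope -/(z m) -/(z m.+1) divfK ?gt_eqF//; ring.
Qed.

End Interpolation.

Lemma mesh_exists (B d : R) : 0 < d -> exists n : nat, 2 * B * (l / n.+1%:R) <= d.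
Proof.
move=> d0; exists (Num.truncn (2 * B * l / d)).
have : 2 * B * l / d < (Num.truncn (2 * B * l / d)).+1%:R by exact: truncnS_gt.
by rewrite ltr_pdivrMr// mulrA ler_pdivrMr ?ltr0n// [d * _]mulrC => /ltW.
Qed.

Lemma node_seg n b : (b <= n.+1)%N -> seg (b%:R * (l / n.+1%:R)).
Proof.
move=> bN; rewrite /seg /= mulr_ge0 ?divr_ge0 ?(ltW l0)//=.
by rewrite mulrA ler_pdivrMr ?ltr0n// mulrC ler_pM2l// ler_nat.
Qed.

Lemma mesh_sum n (B C : R) : 0 <= B -> 0 <= C -> \sum_(b < n) 2 * (l / n.+1%:R) * B * C <= 2 * l * (B * C).
Proof.
move=> B0 C0; rewrite sumr_const card_ord -[_ *+ _]mulr_natl.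
have : n%:R * (l / n.+1%:R) <= l.
  by rewrite mulrA ler_pdivrMr ?ltr0n// mulrC ler_pM2l// ler_nat.
move: (l / _) (n%:R) => c m mc; have BC : 0 <= B * C by rewrite mulr_ge0.
by rewrite (_ : m * _ = 2 * (m * c) * (B * C)); [have := ler_wpM2r BC mc; lra|ring].
Qed.

(** The ramps have a common bound and the second differences of [h] add up to at most [2 * l * B],
    so the norms of the interpolations are bounded independently of the mesh; [wiener_close] passes
    to the limit. *)
Lemma wiener_C2 : exists C, forall h B, C2_bounded h B -> W 0 h (C * B).
Proof.
have [Cr HCr] := wiener_ramp; exists (1 + (1 + 2 * l) * Cr) => h B HB.
have S0 : seg 0 by rewrite /seg /= lexx ltW.
have hB0 : `|h 0| <= B by have [h1 [h2 H]] := HB; have [] := H 0 S0.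
have B0 : 0 <= B := le_trans (normr_ge0 _) hB0.
have Cr0 : 0 <= Cr := wiener_ge0 (wq0 0) (HCr 0 S0).
apply: wiener_close => // d /(mesh_exists B)[n Hn]; pose c := l / n.+1%:R.
exists (interp c n h); last by move=> x Sx; apply: le_trans (interp_err n HB Sx) Hn.
have H1 : W 0 (fun x => slope c h 0 * ramp c 0 x) (B * Cr).
  apply: wiener_le (wiener_scale (slope c h 0) (HCr _ (node_seg (leq0n n.+1)))).
  by rewrite ler_wpM2r// slope_le.
have H2 : W 0 (fun x => \sum_(b < n) (slope c h b.+1 - slope c h b) * ramp c b.+1 x) (\sum_(b < n) 2 * c * B * Cr).
  apply: wiener_sum => b; have bn : (b.+1 <= n.+1)%N by rewrite ltnW// ltnS ltn_ord.
  apply: wiener_le (wiener_scale (slope c h b.+1 - slope c h b) (HCr _ (node_seg bn))).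
  by rewrite ler_wpM2r// slope_diff_le.
apply: wiener_le (wiener_add (wiener_le hB0 (wiener_cst (h 0))) (wiener_add H1 H2)).
have := mesh_sum n B0 Cr0; rewrite -/c.
by rewrite (_ : (1 + (1 + 2 * l) * Cr) * B = B + (B * Cr + 2 * l * (B * Cr))); [lra|ring].
Qed.

(** Partial sums of the square wave, which has the value pi / 4 on the open interval from 0 to
    pi. *)
Definition odd_saw N x : R := \sum_(k < N) sin ((2 * k).+1%:R * x) / (2 * k).+1%:R.

(** The error may grow like 1 / sin x towards both ends; the factor [sin x] that absorbs this is
    later supplied by [sin_mul_le]. *)
Lemma odd_saw_err N (x : R) : 0 <= x <= pi -> `|odd_saw N x - pi / 4| * sin x <= 8 / (2 * N%:R + 1).
Proof.
move=> /andP[x0 xp]; have N1 : 0 < 2 * N%:R + 1 :> R by rewrite ltr_wpDl// mulr_ge0.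
have [->|xn0] := eqVneq x 0; first by rewrite sin0 mulr0 divr_ge0// ltW.
have [->|xnp] := eqVneq x pi; first by rewrite sinpi mulr0 divr_ge0// ltW.
have x00 : 0 < x by rewrite lt_def xn0.
have xpp : x < pi by rewrite lt_def eq_sym xnp.
have E : odd_saw N x = saw (N + N) x - saw N (2 * x) / 2.
  rewrite /odd_saw /saw; elim: N {N1} => [|N IH]; first by rewrite !big_ord0 mul0r subr0.
  rewrite addSn addnS !big_ord_recr /= IH.
  have -> : (2 * N).+1 = (N + N).+1 by clear; lia.
  have E2 : (N + N).+2%:R = 2 * N.+1%:R :> R by rewrite -natrM; congr _%:R; clear; lia.
  rewrite E2 [2 * N.+1%:R * x]mulrAC [2 * x * _]mulrC.
  have : N.+1%:R != 0 :> R by rewrite pnatr_eq0.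
  move: (sin (N.+1%:R * (2 * x))) (N.+1%:R) (_ / (N + N).+1%:R) (\sum_(i < N) _) (\sum_(i < N + N) _).
  by move=> s m t u v m0; field.
have -> : odd_saw N x - pi / 4 = - saw_err (N + N) x + saw_err N (2 * x) / 2.
  by rewrite E /saw_err; move: (saw _ _) (saw _ _) => a b; field.
have sx : 0 < sin x by apply: sin_gt0_pi; rewrite x00.
have s2 : 0 < sin (x / 2) by apply: sin_gt0_pi; apply/andP; split; lra.
have e1 : `|saw_err (N + N) x| * sin x <= 6 / (2 * N%:R + 1).
  have h := saw_err_bound (N + N) (x := x); rewrite x00 xp in h; have {}h := h isT.
  have sxE : sin x <= 2 * sin (x / 2).
    rewrite [x in X in X <= _](_ : x = (x / 2) *+ 2); last by rewrite -mulr_natr divfK.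
    rewrite sin_mulr2n -mulr_natl ler_pM2l// ler_piMl ?cos_le1// ltW//.
  have N2 : 0 < 2 * (N + N)%:R + 1 :> R by rewrite ltr_wpDl// mulr_ge0.
  apply: le_trans (ler_pM (normr_ge0 _) (ltW sx) h sxE) _.
  rewrite (_ : 3 / ((2 * (N + N)%:R + 1) * sin (x / 2)) * (2 * sin (x / 2)) = 6 / (2 * (N + N)%:R + 1)); last first.
    move: N2 s2; move: (2 * (N + N)%:R + 1) (sin (x / 2)) => u s /lt0r_neq0 a /lt0r_neq0 b.
    by field; rewrite ?a ?b.
  rewrite ler_pM2l// lef_pV2 ?posrE// natrD; have : 0 <= N%:R :> R by []. lra.
have sawsym y : saw_err N (2 * pi - y) = - saw_err N y.
  rewrite /saw_err (_ : saw N (2 * pi - y) = - saw N y); first by field.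
  rewrite /saw -sumrN; apply: eq_bigr => k _; rewrite -mulNr; congr (_ / _).
  rewrite mulrBr sinB mulrA [k.+1%:R * 2]mulrC -mulrA mulr2n mulrDl mul1r cosD sinD.
  by rewrite natpi_sin natpi_cos -expr2 sqrr_sign; ring.
have e2 : `|saw_err N (2 * x)| * sin x <= 3 / (2 * N%:R + 1).
  have h : `|saw_err N (2 * x)| <= 3 / ((2 * N%:R + 1) * sin x).
    have [h|h] := leP (2 * x) pi.
      have := saw_err_bound N (x := 2 * x); rewrite (_ : 2 * x / 2 = x); last by field.
      by apply; apply/andP; split; lra.
    have := saw_err_bound N (x := 2 * pi - 2 * x).
    rewrite sawsym normrN (_ : (2 * pi - 2 * x) / 2 = pi - x); last by field.
    rewrite sinB sinpi cospi mul0r sub0r mulN1r opprK; apply.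
    by apply/andP; split; lra.
  apply: le_trans (ler_wpM2r (ltW sx) h) _.
  rewrite (_ : 3 / ((2 * N%:R + 1) * sin x) * sin x = 3 / (2 * N%:R + 1))//.
  move: N1 sx; move: (2 * N%:R + 1) (sin x) => u s /lt0r_neq0 a /lt0r_neq0 b.
  by field; rewrite ?a ?b.
apply: (@le_trans _ _ ((`|saw_err (N + N) x| + `|saw_err N (2 * x)| / 2) * sin x)).
  rewrite ler_wpM2r ?(ltW sx)//; apply: le_trans (ler_normD _ _) _.
  by rewrite normrN normrM [`|2^-1|]ger0_norm.
rewrite mulrDl mulrAC; have : 0 <= (2 * N%:R + 1)^-1 :> R by rewrite invr_ge0 ltW.
by move: e1 e2; move: (_^-1) (_ * sin x) (_ * sin x) => i a b; lra.
Qed.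

Lemma sin_mul_le m (x : R) : 0 <= x <= pi -> `|sin (m%:R * x)| <= m%:R * sin x.
Proof.
move=> xp; have s0 := sin_ge0_pi xp; elim: m => [|m IH]; first by rewrite !mul0r sin0 normr0.
rewrite -natr1 !mulrDl !mul1r sinD; apply: le_trans (ler_normD _ _) _; rewrite !normrM.
apply: lerD; first by apply: le_trans IH; rewrite ler_piMr// cos_max.
by rewrite (ger0_norm s0) ler_piMl// cos_max.
Qed.

(* sin (m x) is the limit of its products with the partial sums of the square
   wave; the products are regrouped by frequency. *)
Lemma sin_wiener : exists C, forall m q, (0 < m)%N -> W q (sinl m) (C * m%:R * wt (q + m)).
Proof.
have p0 := @pi_gt0 R; have p2 := @pi_ge2 R; have z2 := zeta_bound_ge2.
exists (1 + 4 * zeta_bound) => m q m0; apply: wiener_close => // d d0.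
(* The total truncation error is at most 2 / pi times (2 * 8 + 1) m / P, hence the factor 17. *)
pose P := (Num.truncn (17 * m%:R / d)).+1.
have P0 : 0 < P%:R :> R by rewrite ltr0n.
have HP : 17 * m%:R / P%:R <= d.
  have : 17 * m%:R / d < P%:R by exact: truncnS_gt.
  by rewrite ltr_pdivrMr// ler_pdivrMr// [d * _]mulrC => /ltW.
pose a r := (2 * r).+1%:R : R.
have a0 r : 0 < a r by rewrite ltr0n.
pose i1 r := ((2 * r).+1 - m + (m - (2 * r).+1))%N.
pose i2 p := (m + (2 * p).+1)%N.
(* In the product of sin (m y) with the square wave the frequency a_p + m occurs for the indices p
   and m + p, and the two coefficients nearly cancel: their difference is of size m / p^2, summable
   against the weight. The [m] lowest terms remain by themselves. *)
pose v x := 2 / pi * (\sum_(r < m) (a r)^-1 * cosl (i1 r) x + \sum_(p < P) ((a (m + p))^-1 - (a p)^-1) * cosl (i2 p) x).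
have pi21 : 0 <= (2 / pi : R) <= 1 by apply/andP; split; [rewrite divr_ge0// ltW|rewrite ler_pdivrMr// mul1r].
exists v.
  have H1 : W q (fun x => \sum_(r < m) (a r)^-1 * cosl (i1 r) x) (m%:R * wt (q + m)).
    have := @wiener_sum R R nat seg cosl (wt_from q) 'I_m (index_enum _) _ (fun=> wt (q + m))
      (fun r => _ : W q (fun x => (a r)^-1 * cosl (i1 r) x) (wt (q + m))).
    rewrite sumr_const card_ord -[_ *+ _]mulr_natl; apply=> r.
    apply: wiener_le (wiener_scale _ (wiener_atom _ _ _ _)).
    rewrite normfV (gtr0_norm (a0 r)); apply: (@le_trans _ _ (1 * wt (q + m))); last by rewrite mul1r.
    apply: ler_pM; rewrite ?invr_ge0 ?ler0n ?wt_ge0//.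
      by rewrite invf_le1 ?a0// ler1n.
    by apply: wt_mono; rewrite leq_add2l /i1; have := ltn_ord r; clear; lia.
  have H2 : W q (fun x => \sum_(p < P) ((a (m + p))^-1 - (a p)^-1) * cosl (i2 p) x) (4 * zeta_bound * m%:R * wt (q + m)).
    apply: wiener_le (wiener_sum _ (fun p : 'I_P => wiener_scale ((a (m + p))^-1 - (a p)^-1) (wiener_atom seg cosl (wt_from q) (i2 p)))).
    apply: (@le_trans _ _ (4 * m%:R * wt (q + m) * \sum_(p < P) wt p.+1 / p.+1%:R ^+ 2)); last first.
      apply: le_trans (ler_wpM2l _ (zeta_le P)) _; first by rewrite !mulr_ge0// wt_ge0.
      by rewrite le_eqVlt; apply/orP; left; apply/eqP; ring.
    rewrite mulr_sumr; apply: ler_sum => p _.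
    have -> : (a (m + p))^-1 - (a p)^-1 = - (2 * m%:R / (a p * a (m + p))).
      have aE : a (m + p)%N = 2 * m%:R + a p by rewrite /a -natrM -natrD; congr _%:R; clear; lia.
      have := a0 (m + p)%N; have := a0 p; move: aE; move: (a (m + p)%N) (a p) (m%:R : R).
      by move=> u w e -> /lt0r_neq0 h1 /lt0r_neq0 h2; field; rewrite ?h1 ?h2.
    have w2 : wt_from q (i2 p) <= wt (q + m) * (2 * wt p.+1).
      apply: le_trans (wt_mul (a := q + m) (b := (2 * p.+1)) _) _; first by rewrite /i2; clear; lia.
      by rewrite ler_wpM2l ?wt_ge0//; apply: wt_le2; clear; lia.
    rewrite normrN [`|_ / _|]ger0_norm; last by rewrite divr_ge0 ?mulr_ge0// ltW.
    have s1 : (a p * a (m + p))^-1 <= (p.+1%:R ^+ 2)^-1.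
      rewrite lef_pV2 ?posrE ?mulr_gt0 ?exprn_gt0//.
      by rewrite expr2; apply: ler_pM => //; rewrite ler_nat; clear; lia.
    have m00 : 0 <= 2 * m%:R :> R by rewrite mulr_ge0.
    apply: le_trans (ler_pM _ (wt_ge0 _) (ler_wpM2l m00 s1) w2) _; first by rewrite mulr_ge0// invr_ge0 mulr_ge0// ltW.
    by move: (wt (q + m)) (wt p.+1) (m%:R) (_^-1) => e f u s; rewrite le_eqVlt; apply/orP; left; apply/eqP; ring.
  have := wiener_scale (2 / pi) (wiener_add H1 H2).
  have /andP[pp0 pp1] := pi21; rewrite (ger0_norm pp0); apply: wiener_le.
  have w0 : 0 <= m%:R * wt (q + m) :> R by rewrite mulr_ge0// wt_ge0.
  have zz : 0 <= m%:R * wt (q + m) + 4 * zeta_bound * m%:R * wt (q + m).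
    by rewrite addr_ge0// -mulrA mulr_ge0//; lra.
  apply: le_trans (ler_piMl zz pp1) _.
  by rewrite le_eqVlt; apply/orP; left; apply/eqP; ring.
move=> x Sx; have Xp := seg_angle Sx; rewrite -/(X x) in Xp.
have mx := sin_mul_le m Xp; have oe := odd_saw_err (m + P) Xp.
set y := X x in Xp mx oe *.
have vE : v x = 4 / pi * odd_saw (m + P) y * sin (m%:R * y) + 2 / pi * \sum_(r < m) cosl (i2 (P + r)) x / a (P + r).
  have co r : cosl (i1 r) x = cos ((a r - m%:R) * y) by rewrite /cosl /i1 cos_dist.
  have co2 r : cosl (i2 r) x = cos ((a r + m%:R) * y) by rewrite /cosl /i2 natrD addrC.
  have S1 : odd_saw (m + P) y * sin (m%:R * y) = 2^-1 * (\sum_(r < m + P) cos ((a r - m%:R) * y) / a r - \sum_(r < P + m) cos ((a r + m%:R) * y) / a r).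
    rewrite [(P + m)%N]addnC /odd_saw mulr_suml -sumrB mulr_sumr; apply: eq_bigr => r _.
    rewrite mulrBl mulrDl cosB cosD -/(a r).
    by move: (a0 r) => /lt0r_neq0; move: (a r) (sin _) (sin _) (cos _) (cos _) => u s1 s2 c1 c2 u0; field.
  have S2 : \sum_(r < m + P) cos ((a r - m%:R) * y) / a r = \sum_(r < m) cosl (i1 r) x / a r + \sum_(p < P) cosl (i2 p) x / a (m + p)%N.
    rewrite big_split_ord /=; congr (_ + _); apply: eq_bigr => r _; first by rewrite co.
    rewrite co2; congr (cos (_ * _) / _).
    by rewrite /a (_ : (2 * (m + r)).+1%:R = m%:R + m%:R + (2 * r).+1%:R); [ring|rewrite -!natrD; congr _%:R; clear; lia].
  have S3 : \sum_(r < P + m) cos ((a r + m%:R) * y) / a r = \sum_(p < P) cosl (i2 p) x / a p + \sum_(r < m) cosl (i2 (P + r)) x / a (P + r)%N.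
    by rewrite big_split_ord /=; congr (_ + _); apply: eq_bigr => r _; rewrite co2.
  have S4 : \sum_(p < P) ((a (m + p)%N)^-1 - (a p)^-1) * cosl (i2 p) x = \sum_(p < P) cosl (i2 p) x / a (m + p)%N - \sum_(p < P) cosl (i2 p) x / a p.
    by rewrite -sumrB; apply: eq_bigr => p _; rewrite mulrBl ![_^-1 * _]mulrC.
  have S5 : \sum_(r < m) (a r)^-1 * cosl (i1 r) x = \sum_(r < m) cosl (i1 r) x / a r.
    by apply: eq_bigr => r _; rewrite mulrC.
  rewrite /v S4 S5 -[4 / pi * _ * _]mulrA S1 S2 S3.
  move: (\sum_(r < m) cosl (i1 r) x / a r) (\sum_(p < P) cosl (i2 p) x / a (m + p)%N) (\sum_(p < P) cosl (i2 p) x / a p).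
  by move: (\sum_(r < m) _) (@pi R) pn => s4 q0 qn s1 s2 s3; field.
have tail : `|\sum_(r < m) cosl (i2 (P + r)) x / a (P + r)%N| <= m%:R / P%:R.
  apply: le_trans (ler_norm_sum _ _ _) _.
  apply: (@le_trans _ _ (\sum_(r < m) P%:R^-1)); last by rewrite sumr_const card_ord -[_ *+ _]mulr_natl.
  apply: ler_sum => r _; rewrite normrM normfV (gtr0_norm (a0 _)).
  apply: (@le_trans _ _ (1 * (a (P + r)%N)^-1)); first by rewrite ler_wpM2r ?cosl_le1// invr_ge0 ltW.
  by rewrite mul1r lef_pV2 ?posrE// ler_nat; clear; lia.
have -> : sinl m x - v x = - (4 / pi * ((odd_saw (m + P) y - pi / 4) * sin (m%:R * y)))
    - 2 / pi * \sum_(r < m) cosl (i2 (P + r)) x / a (P + r)%N.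
  rewrite vE -/(sinl m x) /sinl -/(X x) -/y.
  by move: (\sum_(r < m) _) (odd_saw _ _) (sin _) (@pi R) pn => s o u q0 qn; field.
apply: le_trans (ler_normB _ _) _; rewrite normrN !normrM.
have /andP[pp0 pp1] := pi21; rewrite -!normrM (_ : 4 / pi = 2 * (2 / pi)); last by rewrite mulrA; congr (_ / _); ring.
have b1 : `|(odd_saw (m + P) y - pi / 4) * sin (m%:R * y)| <= m%:R * (8 / (2 * (m + P)%:R + 1)).
  rewrite normrM; apply: le_trans (ler_wpM2l (normr_ge0 _) mx) _.
  by rewrite mulrCA ler_wpM2l.
have b2 : 8 / (2 * (m + P)%:R + 1) <= 8 / P%:R :> R.
  rewrite ler_pM2l// lef_pV2 ?posrE ?ltr_wpDl ?mulr_ge0//.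
  by rewrite natrD; have : 0 <= m%:R :> R by []; lra.
have b3 : m%:R * (8 / (2 * (m + P)%:R + 1)) <= 8 * (m%:R / P%:R) :> R.
  by apply: le_trans (ler_wpM2l _ b2) _ => //; rewrite mulrCA.
have nn (c z : R) : 0 <= c -> `|c * z| = c * `|z| by move=> c0; rewrite normrM ger0_norm.
have pp2 : 0 <= 2 * (2 / pi) :> R by rewrite mulr_ge0.
rewrite (nn _ _ pp2) (nn _ _ pp0).
move: HP; rewrite -mulrA; have : 0 <= m%:R / P%:R :> R by rewrite divr_ge0.
move: (le_trans b1 b3) tail pp0 pp1 (normr_ge0 ((odd_saw (m + P) y - pi / 4) * sin (m%:R * y))) (normr_ge0 (\sum_(r < m) cosl (i2 (P + r)) x / a (P + r)%N)).
move: (m%:R / P%:R) (2 / pi) `|(odd_saw (m + P) y - pi / 4) * sin (m%:R * y)| `|\sum_(r < m) cosl (i2 (P + r)) x / a (P + r)%N|; clear => u w s t h1 h2 h3 h4 h5 h6 h7 h8; nra.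
Qed.

End CosineSeries.

Lemma cosl_mul (R : realType) (l : R) j k x :
  cosl l j x * cosl l k x = 2^-1 * cosl l (j - k + (k - j)) x + 2^-1 * cosl l (j + k) x.
Proof.
have E1 := cosB (j%:R * (pi * x / l)) (k%:R * (pi * x / l)); rewrite -mulrBl in E1.
have E2 := cosD (j%:R * (pi * x / l)) (k%:R * (pi * x / l)); rewrite -mulrDl in E2.
rewrite /cosl cos_dist natrD E1 E2.
by move: (cos _) (cos _) (sin _) (sin _) => a b c d; field.
Qed.

(** * Cosine series on the strip *)

Section Modes.
Context {R : realType}.
Variables (g L : R).
Hypothesis g01 : 0 <= g < 1.
Hypothesis L0 : 0 < L.

Definition cstrip : set (R * R) := [set p | 0 <= p.1 <= L /\ -1 <= p.2 <= 1].

Definition mode (i : nat * nat) (p : R * R) : R := cosl L i.1 p.1 * cosl 2 i.2 (p.2 + 1).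

Definition wt2 (i : nat * nat) : R := wt g (i.1 + i.2).

Local Notation W2 := (wiener cstrip mode wt2).
Local Notation WL q := (wiener (seg L) (cosl L) (wt_from g q)).
Local Notation WT q := (wiener (seg 2) (cosl 2) (wt_from g q)).

Lemma cstrip_seg p : cstrip p -> seg L p.1 /\ seg 2 (p.2 + 1).
Proof. by move=> [/andP[a b] /andP[c d]]; split; apply/andP; split; lra. Qed.

Lemma mode_le1 i p : `|mode i p| <= 1.
Proof. by rewrite /mode normrM; apply: mulr_ile1 => //; exact: cosl_le1. Qed.

Lemma wt2_ge1 i : 1 <= wt2 i. Proof. exact: wt_ge1. Qed.
Lemma wt2_ge0 i : 0 <= wt2 i. Proof. exact: wt_ge0. Qed.

Definition mode_mul (i i' : nat * nat) : seq (R * (nat * nat)) :=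
  let a := (i.1 - i'.1 + (i'.1 - i.1))%N in let b := (i.2 - i'.2 + (i'.2 - i.2))%N in
  [:: (4^-1, (a, b)); (4^-1, (a, i.2 + i'.2)%N); (4^-1, (i.1 + i'.1, b)%N); (4^-1, (i.1 + i'.1, i.2 + i'.2)%N)].

Lemma mode_mulE i i' p : mode i p * mode i' p = eval mode (mode_mul i i') p.
Proof.
rewrite /eval /mode_mul !big_cons big_nil /= /mode /= mulrACA !cosl_mul.
by move: (cosl _ _ _) (cosl _ _ _) (cosl _ _ _) (cosl _ _ _) => a b c d; field.
Qed.

Lemma mode_mul_norm i i' : wnorm wt2 (mode_mul i i') <= wt2 i * wt2 i'.
Proof.
rewrite /wnorm /mode_mul !big_cons big_nil /= addr0 ger0_norm//.
have H n : (n <= i.1 + i'.1 + (i.2 + i'.2))%N -> wt g n <= wt2 i * wt2 i'.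
  by move=> nle; apply: wt_mul => //; move: nle; clear; lia.
rewrite /wt2 /=.
have h1 := H (i.1 - i'.1 + (i'.1 - i.1) + (i.2 - i'.2 + (i'.2 - i.2)))%N ltac:(clear; lia).
have h2 := H (i.1 - i'.1 + (i'.1 - i.1) + (i.2 + i'.2))%N ltac:(clear; lia).
have h3 := H (i.1 + i'.1 + (i.2 - i'.2 + (i'.2 - i.2)))%N ltac:(clear; lia).
have h4 := H (i.1 + i'.1 + (i.2 + i'.2))%N ltac:(clear; lia).
by move: h1 h2 h3 h4; rewrite /wt2; clear; lra.
Qed.

Lemma W2_mul u v M M' : W2 u M -> W2 v M' -> W2 (fun p => u p * v p) (M * M').
Proof.
apply: (@wiener_mul R _ _ cstrip mode wt2 wt2_ge0 (fun i p _ => mode_le1 i p) wt2_ge1 mode_mul).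
- by move=> i j p _; exact: mode_mulE.
- exact: mode_mul_norm.
Qed.

Lemma W2_bound u M p : W2 u M -> cstrip p -> `|u p| <= M.
Proof. by move=> Hu Sp; apply: (wiener_bound _ _ Hu Sp) => *; rewrite ?mode_le1 ?wt2_ge1 ?wt2_ge0. Qed.

Lemma W2_lift_s k u M : WL k u M -> W2 (fun p => u p.1 * cosl 2 k (p.2 + 1)) M.
Proof.
move=> Hu d /Hu[l lM Hl]; exists [seq (c.1, (c.2, k)) | c <- l].
  rewrite /wnorm big_map; apply: le_trans lM; rewrite le_eqVlt; apply/orP; left; apply/eqP.
  by apply: eq_bigr => c _; rewrite /wt2 /wt_from /= addnC.
move=> p /cstrip_seg[Sp _].
have -> : eval mode [seq (c.1, (c.2, k)) | c <- l] p = eval (cosl L) l p.1 * cosl 2 k (p.2 + 1).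
  by rewrite /eval big_map mulr_suml; apply: eq_bigr => c _; rewrite /mode /= mulrA.
rewrite -mulrBl normrM; apply: le_trans (Hl _ Sp).
by rewrite ler_piMr ?cosl_le1.
Qed.

Lemma W2_lift_t j u M : WT j u M -> W2 (fun p => cosl L j p.1 * u (p.2 + 1)) M.
Proof.
move=> Hu d /Hu[l lM Hl]; exists [seq (c.1, (j, c.2)) | c <- l].
  by rewrite /wnorm big_map.
move=> p /cstrip_seg[_ Sp].
have -> : eval mode [seq (c.1, (j, c.2)) | c <- l] p = cosl L j p.1 * eval (cosl 2) l (p.2 + 1).
  by rewrite /eval big_map mulr_sumr; apply: eq_bigr => c _; rewrite /mode /= mulrCA.
rewrite -mulrBr normrM; apply: le_trans (Hl _ Sp).
by rewrite ler_piMl ?cosl_le1.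
Qed.

Lemma cosl0 l x : cosl l 0 x = 1 :> R. Proof. by rewrite /cosl mul0r cos0. Qed.

Lemma W2_tensor u v M M' : WL 0 u M -> WT 0 v M' -> W2 (fun p => u p.1 * v (p.2 + 1)) (M * M').
Proof.
move=> /W2_lift_s Hu /W2_lift_t Hv; apply: wiener_eq (W2_mul Hu Hv) => p _.
by rewrite !cosl0 mulr1 mul1r.
Qed.

Lemma W2_cst c : W2 (fun _ => c) `|c|.
Proof.
by apply: wiener_eq (W2_lift_s (wiener_cst g L c)) => p _; rewrite cosl0 mulr1.
Qed.

Lemma W2_sin_cos : exists C, forall j k, W2 (fun p => sinl L j p.1 * cosl 2 k (p.2 + 1)) (C * j%:R * wt2 (j, k)).
Proof.
have [C H] := sin_wiener g01 L0; exists C => -[|j] k.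
  rewrite mulr0 mul0r; apply: wiener_eq (wiener_zero _ _ _) => p _.
  by rewrite /sinl mul0r sin0 mul0r.
by have := W2_lift_s (H j.+1 k isT); rewrite /wt2 addnC.
Qed.

Lemma W2_cos_sin : exists C, forall j k, W2 (fun p => cosl L j p.1 * sinl 2 k (p.2 + 1)) (C * k%:R * wt2 (j, k)).
Proof.
have [C H] := sin_wiener g01 (ltr0Sn R 1); exists C => j [|k].
  rewrite mulr0 mul0r; apply: wiener_eq (wiener_zero _ _ _) => p _.
  by rewrite /sinl mul0r sin0 mulr0.
exact: W2_lift_t (H k.+1 j isT).
Qed.

(* D a b stands for d_t^b d_s^a (D 0 0) *)
Definition C22_bounded (D : nat -> nat -> R -> R -> R) (B : R) : Prop :=
  forall s t, cstrip (s, t) -> forall a, (a <= 2)%N ->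
   [/\ (a < 2)%N -> is_derive s 1 (fun s => D a 0%N s t) (D a.+1 0%N s t),
       (forall b, (b < 2)%N -> is_derive t 1 (fun t => D a b s t) (D a b.+1 s t)) &
       forall b, (b <= 2)%N -> `|D a b s t| <= B].

(** Interpolation is done in [t] only: the coefficients are C^2 functions of [s], handled by
    [wiener_C2], and multiply ramps in [t]. This is why mixed derivatives of order up to two in each
    variable have to be bounded. *)
Lemma W2_C22 : exists C, forall D B, C22_bounded D B -> W2 (fun p => D 0%N 0%N p.1 p.2) (C * B).
Proof.
have l20 : 0 < 2 :> R by [].
have [C1 HC1] := wiener_C2 g01 L0; have [Cr HCr] := wiener_ramp g01 l20.
exists (C1 * (1 + Cr + 4 * Cr)) => D B HD.
have seg20 : seg 2 (0 : R) by rewrite /seg /= lexx /=.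
have segL0 : seg L 0 by rewrite /seg /= lexx ltW.
have st s x : seg L s -> seg 2 x -> cstrip (s, x - 1).
  by move=> /andP[? ?] /andP[? ?]; split => /=; apply/andP; split; lra.
pose h a s x := D a 0%N s (x - 1).
have hC a s : (a <= 2)%N -> seg L s -> C2_bounded 2 (h a s) B.
  move=> a2 Ss; exists (fun x => D a 1%N s (x - 1)), (fun x => D a 2%N s (x - 1)) => x Sx.
  have [_ Ht HB] := HD _ _ (st s x Ss Sx) a a2.
  have sh b : (b < 2)%N -> is_derive x 1 (fun x => D a b s (x - 1)) (D a b.+1 s (x - 1)).
    move=> b2; have D1 : is_derive x 1 (fun x : R => x - 1) (1 - 0).
      exact: is_derive_sub (is_derive_id x 1) (is_derive_cst_fun 1 x 1).
    by have := @is_derive_comp1 _ _ (D a b s) (fun x : R => x - 1) x 1 _ _ (Ht b b2) D1; rewrite subr0 mulr1.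
  by split; [exact: (sh 0%N)|exact: (sh 1%N)|exact: HB|exact: HB|exact: HB].
have B0 : 0 <= B.
  have [_ _ /(_ 0%N isT)] := HD _ _ (st 0 0 segL0 seg20) 0%N isT; exact: le_trans.
have hs a s x : (a < 2)%N -> seg L s -> seg 2 x -> is_derive s 1 (fun s => h a s x) (h a.+1 s x).
  by move=> a2 Ss Sx; have [H _ _] := HD _ _ (st s x Ss Sx) a (ltnW a2); exact: H.
have C1B : 0 <= C1 * B.
  have H0 : C2_bounded L (fun s => h 0%N s 0) B.
    exists (fun s => h 1%N s 0), (fun s => h 2%N s 0) => s Ss.
    have [_ _ H0] := HD _ _ (st s 0 Ss seg20) 0%N isT.
    have [_ _ H1] := HD _ _ (st s 0 Ss seg20) 1%N isT.
    have [_ _ H2] := HD _ _ (st s 0 Ss seg20) 2%N isT.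
    by split; [exact: hs|exact: hs|exact: H0|exact: H1|exact: H2].
  exact: (wiener_ge0 (fun i => wt_ge0 g01 _) (HC1 _ _ H0)).
have Cr0 : 0 <= Cr := wiener_ge0 (fun i => wt_ge0 g01 _) (HCr _ seg20).
(* [e] stands for the functionals giving the interpolation coefficients of a function of [t], a
   slope or a difference of slopes; they commute with differentiation in [s]. *)
have comb (c : R) n (e : (R -> R) -> R) : (forall a s, (a <= 2)%N -> seg L s -> `|e (h a s)| <= c * B) ->
   (forall a s, (a < 2)%N -> seg L s -> is_derive s 1 (fun s => e (h a s)) (e (h a.+1 s))) ->
   forall b, (b <= n.+1)%N -> 0 <= c ->
   W2 (fun p => e (h 0%N p.1) * ramp (2 / n.+1%:R) b (p.2 + 1)) (C1 * (c * B) * Cr).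
  move=> eB eD b bn c0; apply: (@W2_tensor (fun s => e (h 0%N s))); last exact: HCr (node_seg l20 bn).
  apply: HC1; exists (fun s => e (h 1%N s)), (fun s => e (h 2%N s)) => s Ss.
  by split; [exact: eD|exact: eD|exact: eB|exact: eB|exact: eB].
have dsl c b a s : (0 < c) -> seg 2 (b%:R * c) -> seg 2 (b.+1%:R * c) -> (a < 2)%N -> seg L s ->
    is_derive s 1 (fun s => slope c (h a s) b) (slope c (h a.+1 s) b).
  move=> c0 S1 S2 a2 Ss; rewrite /slope [_ / c]mulrC.
  rewrite (_ : (fun s => _) = (fun s => c^-1 * (h a s (b.+1%:R * c) - h a s (b%:R * c)))); last first.
    by apply/funext => u; rewrite mulrC.
  by apply: is_derive_scale; apply: is_derive_sub; exact: hs.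
apply: wiener_close => // d /(mesh_exists 2 B)[n Hn]; pose c : R := 2 / n.+1%:R.
have c0 : 0 < c by rewrite divr_gt0// ltr0n.
exists (fun p => interp c n (h 0%N p.1) (p.2 + 1)); last first.
  move=> p Sp; have [S1 S2] := cstrip_seg Sp; apply: le_trans Hn.
  have := interp_err l20 n (hC 0%N p.1 isT S1) S2; rewrite /h addrK.
  exact.
have H0 : W2 (fun p => h 0%N p.1 0) (C1 * B).
  have H := @W2_tensor (fun s => h 0%N s 0) (fun _ => 1) (C1 * B) 1.
  have -> : C1 * B = C1 * B * 1 by rewrite mulr1.
  apply: wiener_eq (H _ _) => [p _||]; first by rewrite mulr1.
    apply: HC1; exists (fun s => h 1%N s 0), (fun s => h 2%N s 0) => s Ss.
    have [_ _ B00] := HD _ _ (st s 0 Ss seg20) 0%N isT.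
    have [_ _ B1] := HD _ _ (st s 0 Ss seg20) 1%N isT.
    have [_ _ B2] := HD _ _ (st s 0 Ss seg20) 2%N isT.
    by split; [exact: hs|exact: hs|exact: B00|exact: B1|exact: B2].
  by rewrite -[X in WT 0 _ X]normr1; exact: wiener_cst.
have H1 : W2 (fun p => slope c (h 0%N p.1) 0 * ramp c 0 (p.2 + 1)) (C1 * (1 * B) * Cr).
  apply: (comb 1 n (fun u => slope c u 0)) => //.
  - by move=> a s a2 Ss; rewrite mul1r; exact: (slope_le (n := n) l20 (hC a s a2 Ss) (leq0n n)).
  - by move=> a s a2 Ss; apply: dsl => //; exact: node_seg.
have H2 : W2 (fun p => \sum_(b < n) (slope c (h 0%N p.1) b.+1 - slope c (h 0%N p.1) b) * ramp c b.+1 (p.2 + 1))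
    (\sum_(b < n) C1 * (2 * c * B) * Cr).
  apply: wiener_sum => b; have bn := ltn_ord b.
  apply: (comb (2 * c) n (fun u => slope c u b.+1 - slope c u b)) => //.
  - by move=> a s a2 Ss; exact: (slope_diff_le (n := n) l20 (hC a s a2 Ss) bn).
  - move=> a s a2 Ss; apply: is_derive_sub; apply: dsl => //; apply: node_seg => //; by move: bn; clear; lia.
  - by move: bn; clear; lia.
  - by rewrite mulr_ge0// ltW.
apply: wiener_le (wiener_add H0 (wiener_add H1 H2)).
have := mesh_sum l20 n (mulr_ge0 C1B Cr0) ler01; rewrite -/c.
rewrite (eq_bigr (fun _ => C1 * (2 * c * B) * Cr)); last by move=> b _; ring.
rewrite (_ : C1 * (1 + Cr + 4 * Cr) * B = C1 * B + (C1 * (1 * B) * Cr + 2 * 2 * (C1 * B * Cr * 1))); last by ring.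
by move: (\sum_(b < n) _) => S; lra.
Qed.

End Modes.

(** * Smooth cut-off functions *)

Section SmoothFunctions.
Context {R : realType}.

Lemma Ck_comp1 (V : normedModType R) (U : set V) (f : R -> R) (g : V -> R) k : open U ->
  (forall l, Ck l setT f) -> Ck k U g -> Ck k U (fun x => f (g x)).
Proof.
move=> oU; elim: k f => [|k IH] f Hf Hg.
  split=> // x Ux; apply: continuous_comp; first exact: Ck_continuous Hg Ux.
  exact: (@Ck_continuous R R 0 setT f).
apply: (@Ck_intro _ _ _ _ _ (fun v x => 'D_1 f (g x) * 'D_v g x)) => // [x Ux|x v Ux|v].
- apply: continuous_comp; first exact: Ck_continuous Hg Ux.
  exact: (@Ck_continuous R R 0 setT f).
- by apply: is_derive_comp1; [exact: (@Ck_is_derive R R 0 setT f)|exact: Ck_is_derive Hg Ux].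
- apply: CkM => //; last exact: Ck_derive.
  by apply: (IH ('D_1 f)); [move=> l; exact: Ck_derive (Hf l.+1)|exact: Ck_pred].
Qed.

Lemma Ck_intro1 (f f' : R -> R) k : (forall x : R, is_derive x 1 f (f' x)) -> Ck k setT f' -> Ck k.+1 setT f.
Proof.
move=> Hf Hf'; apply: (@Ck_intro R R k setT f (fun v x => v * f' x)) => //.
- exact: openT.
- move=> x _; apply: differentiable_continuous; apply/derivable1_diffP; exact: is_derive_ex (Hf x).
- by move=> x v _; have := is_deriveZdir v (Hf x); rewrite [v *: 1]mulr1.
- by move=> v; apply: CkZ => //; exact: openT.
Qed.

Lemma sin_cos_Ck k : Ck k setT (@sin R) /\ Ck k setT (@cos R).
Proof.
elim: k => [|k [IHs IHc]].
  by split; split=> // x _; [exact: continuous_sin|exact: continuous_cos].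
split; first by apply: Ck_intro1 IHc => x; exact: is_derive_sin.
apply: (Ck_intro1 (f' := fun x => - sin x)).
by apply: CkN => //; exact: openT.
Qed.

Lemma is_derive_exp n (x : R) : is_derive x 1 (fun x : R => x ^+ n) (n%:R * x ^+ n.-1).
Proof.
elim: n x => [|n IH] x; first by rewrite mul0r; exact: is_derive_cst_fun.
rewrite (_ : (fun x => _) = (fun x : R => x * x ^+ n)); last by apply/funext => y; rewrite exprS.
rewrite (_ : _ * _ = 1 * x ^+ n + x * (n%:R * x ^+ n.-1)); first exact: is_derive_mul (is_derive_id x 1) (IH x).
case: n {IH} => [|n]; first by rewrite mul0r mulr0 addr0.
by rewrite /= mulrCA -exprS -mulrDl nat1r.
Qed.

Lemma expR_ge_monom m (y : R) : 0 <= y -> y ^+ m.+1 / m.+1`!%:R <= expR y.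
Proof.
move=> y0; elim: m y y0 => [|m IH] y y0.
  by rewrite expr1 divr1; apply: le_trans (expR_ge1Dx y); rewrite lerDr.
have dx (x : R) : is_derive x 1 (fun x : R => x ^+ m.+2 / m.+2`!%:R) (x ^+ m.+1 / m.+1`!%:R).
  rewrite (_ : (fun x => _) = (fun x => m.+2`!%:R^-1 * x ^+ m.+2)); last by apply/funext => z; rewrite mulrC.
  rewrite (_ : _ / _ = m.+2`!%:R^-1 * (m.+2%:R * x ^+ m.+1)).
    by apply: is_derive_scale; exact: is_derive_exp.
  rewrite [m.+2`!]factS natrM invfM; have : m.+2%:R != 0 :> R by rewrite pnatr_eq0.
  by move: (m.+2%:R) (m.+1`!%:R^-1) (x ^+ _) => a b c a0; field.
have := @derive_le_mono R (fun x : R => x ^+ m.+2 / m.+2`!%:R) (fun x => x ^+ m.+1 / m.+1`!%:R)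
  expR expR 0 y y0 (fun x _ => dx x) (fun x _ => is_derive_expR x).
rewrite expr0n /= mul0r subr0 expR0 => H; apply: le_trans (ler_norm _) _; apply: le_trans (H _) _; last by rewrite gerBl.
move=> x /andP[x0 _]; rewrite ger0_norm; first exact: IH.
by rewrite divr_ge0 ?exprn_ge0.
Qed.

(** The standard flat function exp (- 1 / x) divided by powers of x. The span of this family is
    closed under differentiation ([flat_derive]), so all members are smooth at once. *)
Definition flat (n : nat) (x : R) : R := if 0 < x then expR (- x^-1) / x ^+ n else 0.

Lemma flat_ge0 n x : 0 <= flat n x.
Proof. by rewrite /flat; case: ltP => // x0; rewrite divr_ge0 ?expR_ge0 ?exprn_ge0// ltW. Qed.

Lemma flat_le n x : flat n x <= n.+2`!%:R * x ^+ 2.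
Proof.
rewrite /flat; case: ltP => [x0|_]; last by rewrite mulr_ge0 ?sqr_ge0.
have xi : 0 < x^-1 by rewrite invr_gt0.
have := expR_ge_monom n.+1 (ltW xi); rewrite exprVn expRN => H.
have f0 : 0 < n.+2`!%:R :> R by rewrite ltr0n fact_gt0.
have x2 : 0 < x ^+ n.+2 by rewrite exprn_gt0.
rewrite ler_pdivrMr ?exprn_gt0// -mulrA -exprD addSn addSn add0n.
have e0 := expR_gt0 x^-1; rewrite -[leRHS]mulr1 -[X in _ * X](mulfV (lt0r_neq0 e0)) mulrA.
rewrite -[leLHS]mul1r ler_pM2r ?invr_gt0//; move: H.
rewrite ler_pdivrMr// -[X in X <= _]mul1r ler_pdivrMr// => /le_trans; apply.
by rewrite le_eqVlt; apply/orP; left; apply/eqP; ring.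
Qed.

Lemma flat_derive n (x : R) : is_derive x 1 (flat n) (flat n.+2 x - n%:R * flat n.+1 x).
Proof.
have [x0|x0|->] := ltgtP x 0.
- rewrite {2 3}/flat ltNge (ltW x0) /= mulr0 subr0; apply: near_eq_is_derive (is_derive_cst_fun 0 x 1).
  by near=> u; rewrite /flat ltNge (_ : u <= 0)//; near: u; apply: filterS (lt_nbhsl x0) => u /ltW.
- have xn : x != 0 by rewrite gt_eqF.
  have xnn : x ^+ n != 0 by rewrite expf_neq0.
  have D1 : is_derive x 1 (fun x : R => expR (- x^-1)) (expR (- x^-1) * (x ^+ 2)^-1).
    apply: (@is_derive_comp1 _ _ expR (fun x : R => - x^-1)).
    have := is_derive_opp (is_derive_inv xn (is_derive_id x 1)).
    by rewrite mulN1r opprK.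
  have D2 : is_derive x 1 (fun x : R => x ^+ n) (n%:R * x ^+ n.-1).
    exact: is_derive_exp.
  have D3 := is_derive_mul D1 (@is_derive_inv _ _ (fun x : R => x ^+ n) x 1 _ xnn D2).
  suff E : flat n.+2 x - n%:R * flat n.+1 x = expR (- x^-1) * (x ^+ 2)^-1 * (x ^+ n)^-1 +
      expR (- x^-1) * (- (n%:R * x ^+ n.-1) / (x ^+ n) ^+ 2).
    rewrite E; apply: near_eq_is_derive D3.
    by near=> u; rewrite /flat (_ : 0 < u)//; near: u; exact: lt_nbhsr.
  rewrite /flat x0; move: (expR _) => e.
  case: n {D2 D3} xnn => [|n] xnn; first by rewrite !expr0 mul0r mul0r subr0 oppr0 mul0r mulr0 addr0 invr1 mulr1.
  rewrite /= !exprS; have xnn' : x ^+ n != 0 by rewrite expf_neq0.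
  by move: (x ^+ n) xnn' (n.+1%:R) => y y0 k; field; rewrite ?xn ?y0.
- have -> : flat n.+2 0 - n%:R * flat n.+1 0 = 0 by rewrite /flat ltxx mulr0 subrr.
  apply/is_derive_epsP => e e0; have f0 : 0 < n.+2`!%:R :> R by rewrite ltr0n fact_gt0.
  exists (e / n.+2`!%:R); first by rewrite divr_gt0.
  move=> h hr; rewrite addr0 [h%:A]mulr1 {2}/flat ltxx subr0 mulr0 subr0 ger0_norm ?flat_ge0//.
  apply: le_trans (flat_le n h) _; rewrite -real_normK ?num_real// expr2 mulrA ler_wpM2r//.
  by rewrite mulrC -ler_pdivlMr// ltW.
Unshelve. all: by end_near. Qed.

Lemma flat_Ck k n : Ck k setT (flat n).
Proof.
elim: k n => [|k IH] n.
  split=> // x _; apply: differentiable_continuous; apply/derivable1_diffP.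
  exact: is_derive_ex (flat_derive n x).
apply: (Ck_intro1 (flat_derive n)).
by apply: CkB; [exact: openT|exact: IH|apply: CkZ; [exact: openT|exact: IH]].
Qed.

Lemma flat0_le1 x : flat 0 x <= 1.
Proof.
rewrite /flat; case: ltP => // x0; rewrite expr0 divr1 -expR0 ler_expR.
by rewrite oppr_le0 invr_ge0 ltW.
Qed.

Lemma flat2_le x : 0 < x -> flat 2 x <= 2 /\ flat 2 x * x ^+ 2 <= 1.
Proof.
move=> x0; split; last first.
  by rewrite /flat x0 divfK ?expf_neq0 ?gt_eqF// -expR0 ler_expR oppr_le0 invr_ge0 ltW.
rewrite /flat x0 expRN ler_pdivrMr ?exprn_gt0//.
have xi : 0 < x^-1 by rewrite invr_gt0.
have := expR_ge_monom 1 (ltW xi); rewrite exprVn => H.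
rewrite -[leLHS]mul1r ler_pdivrMr ?expR_gt0//.
have x2 : 0 < x ^+ 2 by rewrite exprn_gt0.
move: H; have -> : 2`! = 2%N by [].
rewrite ler_pdivrMr// -[X in X <= _]mul1r ler_pdivrMr// => /le_trans; apply.
by rewrite le_eqVlt; apply/orP; left; apply/eqP; ring.
Qed.

(** The subtracted 1 confines the support to the points with [m * ((s - a) * (b - s)) >= 1], a
    compact part of the open interval; as [m] grows the functions converge to its indicator. *)
Definition bump (m : nat) (a b s : R) : R := flat 0 (m%:R * ((s - a) * (b - s)) - 1).

Lemma bump_supp m a b s : bump m a b s != 0 -> 1 <= m%:R * ((s - a) * (b - s)).
Proof. by rewrite /bump /flat; case: ltP; rewrite ?eqxx// subr_gt0 => /ltW. Qed.

Lemma bump_ge0_le1 m a b s : 0 <= bump m a b s <= 1.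
Proof. by rewrite flat_ge0 flat0_le1. Qed.

Lemma is_derive_bump m a b (s : R) : is_derive s 1 (bump m a b)
  (flat 2 (m%:R * ((s - a) * (b - s)) - 1) * (m%:R * (a + b - 2 * s))).
Proof.
have D1 : is_derive s 1 (fun s : R => m%:R * ((s - a) * (b - s)) - 1) (m%:R * (a + b - 2 * s) - 0).
  apply: is_derive_sub (is_derive_cst_fun 1 s 1); apply: is_derive_scale.
  have := is_derive_mul (is_derive_sub (is_derive_id s 1) (is_derive_cst_fun a s 1))
    (is_derive_sub (is_derive_cst_fun b s 1) (is_derive_id s 1)).
  by congr is_derive; ring.
have D0 := flat_derive 0 (m%:R * ((s - a) * (b - s)) - 1); rewrite mul0r subr0 in D0.
by have := @is_derive_comp1 _ _ (flat 0) (fun s : R => m%:R * ((s - a) * (b - s)) - 1) s 1 _ _ D0 D1; rewrite subr0.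
Qed.

Lemma bump_Ck k m a b : Ck k setT (bump m a b).
Proof.
apply: (@Ck_comp1 R setT (flat 0) (fun s : R => m%:R * ((s - a) * (b - s)) - 1)).
- exact: openT.
- by move=> l; exact: flat_Ck.
have id_Ck : Ck k setT (fun x : R => x).
  by apply: Ck_linear => //; [exact: openT|move=> x; exact: cvg_id].
have oT : open (setT : set R) := openT.
apply: CkB => //; last exact: Ck_cst.
apply: CkZ => //; apply: CkM => //; apply: CkB => //; exact: Ck_cst.
Qed.

Lemma bump_cvg a b s : a < b -> bump n a b s @[n --> \oo] --> (if a < s < b then 1 : R else 0).
Proof.
move=> ab; case: ifPn => [/andP[as_ sb]|nab]; last first.
  rewrite (_ : (fun n => _) = (fun _ => 0)); first exact: cvg_cst.
  apply/funext => n; apply: contraNeq nab => /bump_supp H.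
  have n0 : 0 <= n%:R :> R by [].
  have P : 0 < (s - a) * (b - s).
    by rewrite ltNge; apply: contraTN H => h; rewrite -ltNge; apply: le_lt_trans ltr01; rewrite mulr_ge0_le0.
  by apply/andP; split; nra.
pose r := (s - a) * (b - s); have r0 : 0 < r by rewrite mulr_gt0// subr_gt0.
apply/cvgrPdist_le => e e0.
exists (Num.truncn ((1 + e^-1) / r)).+1 => // n /= Hn.
have {}Hn : 1 + e^-1 < n%:R * r.
  rewrite -ltr_pdivrMr//; apply: lt_le_trans (truncnS_gt _) _; by rewrite ler_nat.
have ei : 0 < e^-1 by rewrite invr_gt0.
rewrite /bump -/r /flat (_ : 0 < n%:R * r - 1); last by lra.
rewrite expr0 divr1 ger0_norm; last by rewrite subr_ge0 -[X in _ <= X]expR0 ler_expR oppr_le0 invr_ge0; lra.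
have := expR_ge1Dx (- (n%:R * r - 1)^-1).
have : (n%:R * r - 1)^-1 <= e by rewrite invf_ple ?posrE//; lra.
lra.
Qed.

Lemma is_derive_fstc (h : R -> R) (p v : R * R) (d : R) :
  is_derive p.1 1 h d -> is_derive p v (fun p => h p.1) (d * v.1).
Proof.
move=> H; apply: (@is_derive_comp1 _ _ h fst) => //.
by apply: (@is_derive_linear _ _ (fun p : R * R => p.1)).
Qed.

Lemma is_derive_sndc (h : R -> R) (p v : R * R) (d : R) :
  is_derive p.2 1 h d -> is_derive p v (fun p => h p.2) (d * v.2).
Proof.
move=> H; apply: (@is_derive_comp1 _ _ h snd) => //.
by apply: (@is_derive_linear _ _ (fun p : R * R => p.2)).
Qed.

Lemma Ck_fstc k (h : R -> R) : (forall l, Ck l setT h) -> Ck k setT (fun p : R * R => h p.1).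
Proof.
move=> Hh; apply: (@Ck_comp1 _ setT h fst) => //; first exact: openT.
by apply: Ck_linear => //; [exact: openT|move=> p; exact: cvg_fst].
Qed.

Lemma Ck_sndc k (h : R -> R) : (forall l, Ck l setT h) -> Ck k setT (fun p : R * R => h p.2).
Proof.
move=> Hh; apply: (@Ck_comp1 _ setT h snd) => //; first exact: openT.
by apply: Ck_linear => //; [exact: openT|move=> p; exact: cvg_snd].
Qed.

Definition bump2 (m : nat) (a b c d : R) (p : R * R) : R := bump m a b p.1 * bump m c d p.2.

Lemma bump2_smooth k m a b c d : Ck k setT (bump2 m a b c d).
Proof.
by apply: CkM; [exact: openT|apply: Ck_fstc => l; exact: bump_Ck|apply: Ck_sndc => l; exact: bump_Ck].
Qed.

Lemma bump_test (L : R) m a b c d (F : R * R -> R) : 0 <= a -> a < b -> b <= L -> -1 <= c -> c < d -> d <= 1 ->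
  smooth setT F -> test_function L (fun p => bump2 m a b c d p * F p).
Proof.
move=> a0 ab bL c1 cd d1 HF; split.
  by move=> k; apply: CkM; [exact: openT|exact: bump2_smooth|exact: HF].
pose C := [set p : R * R | 1 <= m%:R * ((p.1 - a) * (b - p.1)) /\ 1 <= m%:R * ((p.2 - c) * (d - p.2))].
have in_ab (x u v : R) : u < v -> 1 <= m%:R * ((x - u) * (v - x)) -> u < x < v.
  move=> uv H; have m0 : 0 <= m%:R :> R by [].
  have P : 0 < (x - u) * (v - x).
    by rewrite ltNge; apply: contraTN H => h; rewrite -ltNge; apply: le_lt_trans ltr01; rewrite mulr_ge0_le0.
  by apply/andP; split; nra.
exists C.
  split; last first.
    move=> p [/(in_ab _ _ _ ab)/andP[h1 h2] /(in_ab _ _ _ cd)/andP[h3 h4]].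
    by split; apply/andP; split; lra.
  apply: (@subclosed_compact _ _ (`[a, b]%classic `*` `[c, d]%classic)).
  - have cl (h : R * R -> R) : continuous h -> closed [set p | 1 <= h p].
      move=> hc; rewrite (_ : [set p | _] = h @^-1` [set x | 1 <= x]); last by [].
      by apply: closed_comp => [p _|]; [exact: hc|exact: closed_ge].
    apply: closedI; apply: cl => p.
      apply: (@Ck_continuous _ _ 0 setT) => //; apply: (@Ck_fstc 0 (fun x => m%:R * ((x - a) * (b - x)))) => l.
      have oT : open (setT : set R) := openT.
      have id_Ck : Ck l setT (fun x : R => x) by apply: Ck_linear => //; move=> x; exact: cvg_id.
      by apply: CkZ => //; apply: CkM => //; apply: CkB => //; exact: Ck_cst.
    apply: (@Ck_continuous _ _ 0 setT) => //; apply: (@Ck_sndc 0 (fun x => m%:R * ((x - c) * (d - x)))) => l.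
    have oT : open (setT : set R) := openT.
    have id_Ck : Ck l setT (fun x : R => x) by apply: Ck_linear => //; move=> x; exact: cvg_id.
    by apply: CkZ => //; apply: CkM => //; apply: CkB => //; exact: Ck_cst.
  - by apply: compact_setX; exact: segment_compact.
  - move=> p [/(in_ab _ _ _ ab)/andP[h1 h2] /(in_ab _ _ _ cd)/andP[h3 h4]].
    by split; rewrite /= in_itv /= ?(ltW h1) ?(ltW h2) ?(ltW h3) ?(ltW h4).
move=> p nC; apply/eqP; rewrite mulf_eq0; apply/orP; left; apply/negPn/negP => nz; apply: nC.
move: nz; rewrite /bump2 mulf_eq0 negb_or => /andP[/bump_supp h1 /bump_supp h2]; by split.
Qed.

End SmoothFunctions.

(** * Integration over the strip and null functions *)

Section PlaneMeasure.
Context {R : realType}.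
Let MR : measurableType _ := measurableTypeR R.
Let T2 : measurableType _ := (MR * MR)%type.
Implicit Types (E : set T2) (h u v w : T2 -> R).

Lemma open_measurable2 E : open (E : set (R * R)) -> measurable E.
Proof.
move=> oE.
pose rect (q : (rat * rat) * (rat * rat)) : set T2 :=
  `]ratr q.1.1, ratr q.1.2[%classic `*` `]ratr q.2.1, ratr q.2.2[%classic.
rewrite (_ : E = \bigcup_q (if `[< rect q `<=` E >] then rect q else set0)).
  apply: countable_bigcupT_measurable => [|q]; first exact: countableP.
  case: ifP => // _.
  by apply: measurableX; exact: measurable_itv.
apply/seteqP; split=> [p Ep|p [q _]]; last first.
  by case: ifPn => // /asboolP; exact.
have /(nbhs_ball_norm p _).1[d d0 Hd] : nbhs p E by exact: open_nbhs_nbhs.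
have r0 (x : R) : exists2 a, x - d < ratr a < x & True.
  have : x - d < x by rewrite ltrBlDr ltrDl.
  by move=> /rat_in_itvoo[a]; rewrite in_itv /= => ?; exists a.
have r1 (x : R) : exists2 a, x < ratr a < x + d & True.
  have : x < x + d by rewrite ltrDl.
  by move=> /rat_in_itvoo[a]; rewrite in_itv /= => ?; exists a.
have [a1 /andP[a11 a12] _] := r0 p.1; have [a2 /andP[a21 a22] _] := r1 p.1.
have [b1 /andP[b11 b12] _] := r0 p.2; have [b2 /andP[b21 b22] _] := r1 p.2.
exists ((a1, a2), (b1, b2)) => //.
have -> : `[< rect (a1, a2, (b1, b2)) `<=` E >].
  apply/asboolP => q [/=]; rewrite !in_itv /= => /andP[q1 q2] /andP[q3 q4]; apply: Hd.
  by rewrite prod_normE gt_max; apply/andP; split; rewrite ltr_norml; apply/andP; split => /=; lra.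
by split; rewrite /= in_itv /= ?a12 ?a22 ?b12 ?b22.
Qed.

Lemma continuous_measurable2 h : continuous (h : R * R -> R) -> measurable_fun setT h.
Proof.
move=> /continuousP hc; apply: (measurability _ (RGenOpens.measurableE R)).
move=> _ [_ [a [b ->] <-]]; rewrite setTI; apply: open_measurable2.
exact/hc/interval_open.
Qed.

(** Dynkin's theorem for the zeros of a real set function. Sign and monotonicity do not enter, so
    integrals of a function of variable sign over variable sets are covered. *)
Lemma dynkin_null d (T : measurableType d) (G : set (set T)) (f : set T -> R) :
  setI_closed G -> @measurable _ T = <<s G >> -> (forall X, G X -> f X = 0) -> f setT = 0 ->
  (forall X, measurable X -> f (~` X) = f setT - f X) ->
  (forall F : (set T)^nat, (forall n, measurable (F n)) -> trivIset setT F ->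
     (forall n, f (F n) = 0) -> f (\bigcup_n F n) = 0) ->
  forall X, measurable X -> f X = 0.
Proof.
move=> GI mG fG fT fC fU X mX.
suff : <<d G >> `<=` [set X | measurable X /\ f X = 0].
  by rewrite setI_closed_g_dynkin_g_sigma_algebra// => /(_ X); rewrite -mG => /(_ mX)[].
apply: smallest_sub => [|Y GY]; last by split; [rewrite mG; exact: sub_sigma_algebra|exact: fG].
split=> [|Y [mY fY]|F tF HF].
- by split; [exact: measurableT|].
- by split; [exact: measurableC|rewrite fC// fT fY subrr].
- split; first by apply: bigcupT_measurable => n; exact: (HF n).1.
  by apply: fU => // n; [exact: (HF n).1|exact: (HF n).2].
Qed.

Variable L : R.
Hypothesis L0 : 0 < L.

Local Notation S := (strip L : set T2).
Local Notation mu := (@leb2 R).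
Local Notation "'Int' u" := (\int[mu]_(p in S) u p) (at level 10, u at level 9).
Definition integ u : Prop := mu.-integrable S (EFin \o u).

Lemma stripE : S = `]0, L[%classic `*` `]-1, 1[%classic.
Proof. by apply/seteqP; split=> p; rewrite /= !in_itv. Qed.

Lemma strip_measurable : measurable S.
Proof. by rewrite stripE; apply: measurableX; exact: measurable_itv. Qed.

Lemma strip_measure : mu S = (L * 2)%:E.
Proof.
rewrite stripE /leb2 product_measure1E ?measurable_itv//.
have i1 : lebesgue_measure (`]0, L[%classic : set R) = L%:E.
  by rewrite lebesgue_measure_itv /= lte_fin L0 sube0.
have i2 : lebesgue_measure (`]-1, 1[%classic : set R) = (2 : R)%:E.
  have h : (-1 : R) < 1 by lra.
  by rewrite lebesgue_measure_itv /= lte_fin h -EFinB opprK.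
by rewrite [X in (X * _)%E]i1 [X in (_ * X)%E]i2 -EFinM.
Qed.

Lemma strip_fin : (mu S < +oo)%E.
Proof. by rewrite strip_measure ltry. Qed.

Lemma integ_bounded w (K : R) : measurable_fun S w -> (forall p, S p -> `|w p| <= K) -> integ w.
Proof.
move=> mw wK; apply: measurable_bounded_integrable => //.
- exact: strip_measurable.
- exact: strip_fin.
- exists K; split; first exact: num_real.
  by move=> x Kx p Sp; apply: le_trans (wK p Sp) (ltW Kx).
Qed.

Lemma integ_measurable u : integ u -> measurable_fun S u.
Proof. by move=> /integrableP[mu' _]; apply/measurable_EFinP. Qed.

Lemma integ_mul u w (K : R) : integ u -> measurable_fun S w -> (forall p, S p -> `|w p| <= K) ->
  integ (fun p => u p * w p).
Proof.
move=> iu mw wK.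
have iKu : mu.-integrable S (fun p => (K * u p)%:E).
  have := integrableZl strip_measurable K iu; apply: eq_integrable => //.
  exact: strip_measurable.
apply: (le_integrable _ _ _ iKu); first exact: strip_measurable.
  by apply/measurable_EFinP; apply: measurable_funM => //; exact: integ_measurable.
move=> p Sp; rewrite /= lee_fin !normrM mulrC ler_wpM2r//.
exact: le_trans (wK p Sp) (ler_norm _).
Qed.

Lemma integ_ext u v : integ u -> (forall p, S p -> u p = v p) -> integ v.
Proof.
move=> iu uv; apply: (eq_integrable strip_measurable (EFin \o u)) iu.
by move=> p; rewrite inE => Sp /=; rewrite uv.
Qed.

Lemma Int_ext u v : (forall p, S p -> u p = v p) -> Int u = Int v.
Proof. by move=> uv; apply: eq_Rintegral => p; rewrite inE; exact: uv. Qed.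

Lemma integ_add u v : integ u -> integ v -> integ (fun p => u p + v p).
Proof.
move=> iu iv; have := integrableD strip_measurable iu iv; apply: eq_integrable => //.
exact: strip_measurable.
Qed.

Lemma integ_scale (c : R) u : integ u -> integ (fun p => c * u p).
Proof.
move=> iu; have := integrableZl strip_measurable c iu; apply: eq_integrable => //.
exact: strip_measurable.
Qed.

Lemma Int_add u v : integ u -> integ v -> Int (fun p => u p + v p) = Int u + Int v.
Proof. by move=> iu iv; rewrite RintegralD//; exact: strip_measurable. Qed.

Lemma Int_scale (c : R) u : integ u -> Int (fun p => c * u p) = c * Int u.
Proof. by move=> iu; rewrite RintegralZl//; exact: strip_measurable. Qed.

Lemma integ_sub u v : integ u -> integ v -> integ (fun p => u p - v p).
Proof.
move=> iu iv; have := integ_add iu (integ_scale (-1) iv); move=> H; apply: (integ_ext H) => p _.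
by rewrite mulN1r.
Qed.

Lemma Int_sub u v : integ u -> integ v -> Int (fun p => u p - v p) = Int u - Int v.
Proof. by move=> iu iv; rewrite RintegralB//; exact: strip_measurable. Qed.

Lemma Int_cst (c : R) : Int (fun _ => c) = c * (L * 2).
Proof.
rewrite Rintegral_cst; last exact: strip_measurable.
by rewrite [X in fine X]strip_measure.
Qed.

Lemma Int_norm_ge0 u : 0 <= Int (fun p => `|u p|).
Proof. by apply: Rintegral_ge0 => p _. Qed.

Lemma integ_norm u : integ u -> integ (fun p => `|u p|).
Proof. by move=> /(integrable_abse); apply: eq_integrable => //; exact: strip_measurable. Qed.

Lemma Int_bound u w (K : R) : integ u -> measurable_fun S w -> (forall p, S p -> `|w p| <= K) ->
  `|Int (fun p => u p * w p)| <= K * Int (fun p => `|u p|).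
Proof.
move=> iu mw wK; have iuw := integ_mul iu mw wK.
apply: le_trans (le_normr_Rintegral strip_measurable iuw) _.
rewrite -Int_scale; last exact: integ_norm.
apply: le_Rintegral; [exact: strip_measurable|exact: integ_norm|exact/integ_scale/integ_norm|].
by move=> p Sp; rewrite normrM mulrC ler_wpM2r// wK.
Qed.

Lemma integ_cst (c : R) : integ (fun _ => c).
Proof. by apply: (@integ_bounded _ `|c|). Qed.

Lemma L2_integ u : L2 L u -> integ u.
Proof.
move=> [mu' iu].
have i1 : integ (fun p => 1 + 1 * u p ^+ 2) by apply: integ_add => //; exact: integ_cst.
apply: (le_integrable _ _ _ i1); first exact: strip_measurable.
  exact/measurable_EFinP.
move=> p Sp; rewrite /= lee_fin mul1r [leRHS]ger0_norm; last by rewrite addr_ge0// sqr_ge0.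
rewrite -real_normK ?num_real//; have := sqr_ge0 (`|u p| - 1); have := normr_ge0 (u p).
by move: `|u p| => x; nra.
Qed.

Lemma bounded_L2 w (K : R) : measurable_fun S w -> (forall p, S p -> `|w p| <= K) -> L2 L w.
Proof.
move=> mw wK; split=> //; apply: (@integ_bounded (fun p => cst 1 p * w p ^+ 2) (K ^+ 2)).
  by apply: measurable_funM => //; exact: measurable_funX.
move=> p Sp; rewrite /cst mul1r normrX lerXn2r ?nnegrE//; last exact: wK.
exact: le_trans (normr_ge0 _) (wK p Sp).
Qed.

Lemma Int_dct u (w_ : nat -> R * R -> R) w (K : R) : integ u -> (forall n, measurable_fun S (w_ n)) ->
  (forall n p, S p -> `|w_ n p| <= K) -> (forall p, S p -> w_ n p @[n --> \oo] --> w p) ->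
  Int (fun p => u p * w_ n p) @[n --> \oo] --> Int (fun p => u p * w p).
Proof.
move=> iu mw wK wcv.
have wK' p : S p -> `|w p| <= K.
  move=> Sp; have nw : (`|w_ n p| @[n --> \oo] --> `|w p|) by apply: cvg_norm; exact: wcv.
  by rewrite -(cvg_lim _ nw)//; apply: limr_le; [apply: cvgP nw|apply: nearW => n; exact: wK].
have mwl : measurable_fun S w by apply: (measurable_fun_cvg mw).
have iKu : integ (fun p => `|K * u p|) by apply/integ_norm/integ_scale.
have := @dominated_cvg _ _ _ mu S strip_measurable (fun n p => (u p * w_ n p)%:E) (fun p => (u p * w p)%:E)
  (fun p => `|K * u p|%:E) _ _ _ iKu _.
move=> H; have {}H : (\int[mu]_(x in S) (u x * w_ n x)%:E @[n --> \oo] --> \int[mu]_(x in S) (u x * w x)%:E)%E.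
  apply: H => //.
  - by move=> n; apply/measurable_EFinP; apply: measurable_funM => //; exact: integ_measurable.
  - by move=> p Sp; apply: cvg_EFin; [exact: nearW|apply: cvgMr; exact: wcv].
  - move=> n p Sp; rewrite /= lee_fin !normrM mulrC ler_wpM2r//.
    exact: le_trans (wK n p Sp) (ler_norm _).
apply: fine_cvg; rewrite fineK//.
have iuw := integ_mul iu mwl wK'.
by apply: (integrable_fin_num _ iuw); exact: strip_measurable.
Qed.

(** The vanishing of [nu] is extended from rectangles by three Dynkin arguments: to measurable sets
    in the first factor with half-lines in the second, then to measurable sets in both, then to the
    product sigma-algebra. *)
Lemma Int_rect_null u : integ u ->
  (forall a b c d : R, 0 <= a -> a < b -> b <= L -> -1 <= c -> c < d -> d <= 1 ->
     Int (fun p => u p * \1_(`]a, b[%classic `*` `]c, d[%classic) p) = 0) ->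
  ae_eq_strip L u (fun _ => 0).
Proof.
move=> iu H.
pose nu E := Int (fun p => u p * \1_E p).
have m1 E : measurable E -> measurable_fun S (\1_E : R * R -> R).
  by move=> mE; apply: (measurable_funS measurableT) => //.
have b1 E p : S p -> `|(\1_E p : R)| <= 1.
  by move=> _; rewrite indicE; case: (p \in E); rewrite ?normr1 ?normr0.
have nuD E E' E'' : measurable E -> measurable E' -> (forall p, \1_E'' p = \1_E' p - \1_E p :> R) -> nu E'' = nu E' - nu E.
  move=> mE mE' EE; rewrite /nu -Int_sub; last 2 first.
  - exact: (integ_mul iu (m1 E' mE') (b1 E')).
  - exact: (integ_mul iu (m1 E mE) (b1 E)).
  by apply: Int_ext => p _; rewrite EE mulrBr.
have nuU (F : (set T2)^nat) : (forall n, measurable (F n)) -> trivIset setT F ->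
    (forall n, nu (F n) = 0) -> nu (\bigcup_n F n) = 0.
  move=> mF tF F0.
  pose B n := \bigcup_(k < n) F k.
  pose w n p : R := \1_(B n) p.
  have mB n : measurable (B n) by apply: bigcup_measurable.
  have wS n p : w n.+1 p = w n p + \1_(F n) p.
    rewrite /w !indicE; have [pn|pn] := pselect (F n p).
      rewrite mem_set; last by exists n => //=.
      rewrite memNset ?mem_set ?add0r// => -[k /= kn Fk].
      by move/trivIsetP: tF => /(_ k n I I (negbT (ltn_eqF kn))) /seteqP[/(_ p (conj Fk pn))].
    rewrite [p \in F n]memNset// addr0; congr (nat_of_bool _)%:R; apply/idP/idP; rewrite !inE => -[k /= kn Fk].
      by exists k => //=; move: kn; rewrite ltnS leq_eqVlt => /orP[/eqP kE|//]; rewrite kE in Fk.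
    by exists k => //=; exact: ltnW.
  have cv : Int (fun p => u p * w n p) @[n --> \oo] --> nu (\bigcup_n F n).
    apply: (@Int_dct u w _ 1) => //.
    - by move=> n; exact: m1.
    - by move=> n p Sp; exact: b1.
    - move=> p Sp; have [[k _ Fk]|nF] := pselect ((\bigcup_n F n) p).
        rewrite [X in _ --> X](_ : _ = 1); last by rewrite indicE mem_set//; exists k.
        apply: cvg_near_cst; exists k.+1 => // n /= kn.
        by rewrite /w indicE mem_set//; exists k.
      rewrite [X in _ --> X](_ : _ = 0); last by rewrite indicE memNset.
      apply: cvg_near_cst; apply: nearW => n; rewrite /w indicE memNset//.
      by move=> [k _ Fk]; apply: nF; exists k.
  have z n : Int (fun p => u p * w n p) = 0.
    elim: n => [|n IH].
      by rewrite (Int_ext (v := fun _ => 0)) ?Int_cst ?mul0r// => p _; rewrite /w indicE memNset ?mulr0// => -[].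
    rewrite (Int_ext (v := fun p => u p * w n p + u p * \1_(F n) p)); last first.
      by move=> p _; rewrite wS mulrDr.
    rewrite Int_add ?IH ?add0r//; first exact: F0.
      exact: (integ_mul iu (m1 _ (mB n)) (b1 _)).
    exact: (integ_mul iu (m1 _ (mF n)) (b1 _)).
  have : Int (fun p => u p * w n p) @[n --> \oo] --> (0 : R).
    by under eq_fun do rewrite z; exact: cvg_cst.
  by move=> /(cvg_unique _ cv); apply.
have IT : nu setT = 0.
  have h11 : (-1 : R) < 1 by lra.
  rewrite -(H 0 L (-1) 1 (lexx _) L0 (lexx _) (lexx _) h11 (lexx _)).
  by apply: Int_ext => p Sp; congr (_ * _); rewrite !indicE !mem_set.
have IG : setI_closed (@RGenOInfty.G R).
  move=> _ _ [a ->] [b ->]; exists (Num.max a b); apply/seteqP; split=> x /=; rewrite !in_itv /= !andbT gt_max.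
    by move=> [-> ->].
  by move=> /andP[].
have mGE : @measurable _ MR = <<s (@RGenOInfty.G R) >>.
  exact: RGenOInfty.measurableE.
have cut (g : T2 -> MR) (D : set T2) (A : set MR) : measurable_fun setT g -> measurable D -> nu D = 0 ->
    (forall c : R, nu (g @^-1` `]c, +oo[%classic `&` D) = 0) -> measurable A -> nu (g @^-1` A `&` D) = 0.
  move=> mg mD D0 Hc mA.
  have mI X : measurable X -> measurable (g @^-1` X `&` D).
    by move=> mX; apply: measurableI => //; rewrite -[X in measurable X]setTI; exact: mg.
  apply: (dynkin_null (f := fun A => nu (g @^-1` A `&` D)) IG mGE) mA => //.
  - by move=> _ [c ->].
  - by rewrite preimage_setT setTI.
  - move=> X mX; rewrite preimage_setT setTI; apply: nuD => //; first exact: mI.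
    move=> p; rewrite !indicE preimage_setC; have [pX|pX] := pselect (X (g p)); have [pD|pD] := pselect (D p).
    + by rewrite memNset ?mem_set ?subrr// => -[].
    + by rewrite !memNset ?subrr//; move=> [].
    + by rewrite mem_set// mem_set// memNset ?subr0// => -[].
    + by rewrite !memNset ?subrr//; move=> [].
  - move=> F mF tF F0; rewrite preimage_bigcup setI_bigcupl; apply: nuU => //; first by move=> n; exact: mI.
    apply/trivIsetP => i j _ _ ij; apply/seteqP; split=> // p [[pi _] [pj _]].
    by move/trivIsetP: tF => /(_ i j I I ij) /seteqP[/(_ (g p) (conj pi pj))].
have nuE E E' : (forall p, S p -> E p <-> E' p) -> nu E = nu E'.
  move=> EE; apply: Int_ext => p Sp; congr (_ * _); rewrite !indicE; congr (_%:R); congr nat_of_bool.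
  by apply/idP/idP; rewrite !inE => /EE; apply.
have nu0 E : (forall p, S p -> ~ E p) -> nu E = 0.
  move=> E0; rewrite /nu (Int_ext (v := fun _ => 0)) ?Int_cst ?mul0r// => p Sp.
  by rewrite indicE memNset ?mulr0//; exact: E0.
(* A quadrant meets the strip in a rectangle or not at all; [Num.max] moves its corner into the
   closed strip. *)
have half (a c : R) : nu (fst @^-1` `]a, +oo[%classic `&` snd @^-1` `]c, +oo[%classic) = 0.
  have [c1|c1] := leP 1 c.
    by apply: nu0 => p [_ /andP[_ p2]] [_ /=]; rewrite in_itv /= andbT => cp; lra.
  have [La|aL] := leP L a.
    by apply: nu0 => p [/andP[_ p2] _] [/= + _]; rewrite in_itv /= andbT => cp; lra.
  have a1 : 0 <= Num.max a 0 by rewrite le_max lexx orbT.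
  have a2 : Num.max a 0 < L by rewrite gt_max aL L0.
  have c'1 : -1 <= Num.max c (-1) by rewrite le_max lexx orbT.
  have c'2 : Num.max c (-1) < 1 by rewrite gt_max c1 /=; lra.
  rewrite -(H _ L _ 1 a1 a2 (lexx _) c'1 c'2 (lexx _)); apply: nuE => p [/andP[p1 p2] /andP[p3 p4]].
  split=> -[/=]; rewrite !in_itv /= ?gt_max ?andbT; first by move=> q1 q2; rewrite q1 q2 p1 p2 p3 p4.
  by move=> /andP[/andP[q1 _] _] /andP[/andP[q2 _] _].
have ray c : measurable (`]c, +oo[%classic : set MR) by exact: measurable_itv.
have mpre (g : T2 -> MR) A : measurable_fun setT g -> measurable A -> measurable (g @^-1` A).
  by move=> mg mA; rewrite -[X in measurable X]setTI; exact: mg.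
have h1 (A : set MR) (c : R) : measurable A -> nu (fst @^-1` A `&` snd @^-1` `]c, +oo[%classic) = 0.
  move=> mA; apply: cut => //; first exact: mpre.
  rewrite -(half (-1) c); apply: nuE => p [/andP[p1 _] _].
  by split=> [q|[_ //]]; split=> //=; rewrite in_itv /= andbT; lra.
have h2 (A B : set MR) : measurable A -> measurable B -> nu (A `*` B) = 0.
  move=> mA mB; rewrite (_ : A `*` B = snd @^-1` B `&` fst @^-1` A); last first.
    by apply/seteqP; split=> p [].
  apply: cut => //; [exact: mpre| |by move=> c; rewrite setIC; exact: h1].
  rewrite -(h1 A (-1) mA); apply: nuE => p [_ /andP[p1 _]].
  by split=> [q|[]//]; split=> //=; rewrite in_itv /= andbT.
have h3 E : measurable E -> nu E = 0.
  apply: (dynkin_null (f := nu) (G := [set A `*` B | A in measurable & B in measurable])) => //.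
  - move=> _ _ [A mA [B mB <-]] [A' mA' [B' mB' <-]].
    by rewrite -setXI; exists (A `&` A'); [exact: measurableI|exists (B `&` B'); [exact: measurableI|]].
  - exact: measurable_prod_measurableType.
  - by move=> _ [A mA [B mB <-]]; exact: h2.
  - move=> X mX; apply: nuD => // p; rewrite !indicE [p \in setT]mem_set//; have [pX|pX] := pselect (X p).
      by rewrite memNset ?mem_set ?subrr.
    by rewrite mem_set ?memNset ?subr0.
have : ae_eq mu S (EFin \o u) (EFin \o (fun _ => 0)).
  apply: integral_ae_eq => //; first exact: strip_measurable.
    exact: measurable_cst.
  move=> E ES mE; have := h3 E mE; rewrite /nu.
  have iE : integ (fun p => u p * \1_E p) := integ_mul iu (m1 E mE) (b1 E).
  move=> h; have : (\int[mu]_(p in S) (u p * \1_E p)%:E = 0)%E.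
    by rewrite -[LHS]fineK ?[fine _]h//; by apply: (integrable_fin_num _ iE); exact: strip_measurable.
  move=> Z; rewrite [RHS](_ : _ = 0%E); last by apply: integral0_eq.
  have SE : S `&` E = E by rewrite setIC; exact/setIidl.
  rewrite -SE (integral_mkcondr mu S E) -[RHS]Z; apply: eq_integral => p _.
  by rewrite /patch indicE; case: (p \in E); rewrite /= ?mulr1 ?mulr0.
by apply: filterS => p /= Hp Sp; have := Hp Sp => -[].
Qed.

End PlaneMeasure.

(** * Abstract perturbation of an eigenvector *)

Section PerturbedEigenvector.
Context {R : realType} {T : Type} {I : eqType}.
Variables (S : set T) (phi Ephi : I -> T -> R) (w D dd n : I -> R) (i0 : I) (K c : R).
Hypothesis phi1 : forall i x, S x -> `|phi i x| <= 1.
Hypothesis w1 : forall i, 1 <= w i.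
Hypothesis D1 : forall i, 1 <= D i.
Hypothesis c0 : 0 < c.
Hypothesis gap : forall i, i != i0 -> c * D i <= `|dd i|.
Hypothesis dd0 : dd i0 = 0.
Hypothesis K0 : 0 <= K.
Hypothesis small : 2 * K <= c.
Hypothesis HE : forall i, wiener S phi w (Ephi i) (K * (D i * w i)).

Let w0 i : 0 <= w i. Proof. exact: le_trans ler01 (w1 i). Qed.
Let D0 i : 0 <= D i. Proof. exact: le_trans ler01 (D1 i). Qed.
Let Dw i := D i * w i.
Let Dw0 i : 0 <= Dw i. Proof. exact: mulr_ge0. Qed.
Let dd_gt0 i : i != i0 -> 0 < `|dd i|.
Proof. by move=> ii; apply: lt_le_trans (gap ii); rewrite mulr_gt0// (lt_le_trans ltr01). Qed.

(** The image of [phi i] under the shifted operator: a diagonal part with eigenvalue [- dd i], zero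
    at [i0], and the part [Ephi i], small relative to [D i]. *)
Definition pert (i : I) (x : T) : R := Ephi i x - dd i * phi i x.

Lemma eval_cons (h : I -> T -> R) e l x : eval h (e :: l) x = e.1 * h e.2 x + eval h l x.
Proof. by rewrite /eval big_cons. Qed.

Lemma wnorm_cons (v : I -> R) e l : wnorm v (e :: l) = `|e.1| * v e.2 + wnorm v l.
Proof. by rewrite /wnorm big_cons. Qed.

Lemma eval_wiener l : wiener S phi w (eval Ephi l) (K * wnorm Dw l).
Proof.
elim: l => [|e l IH].
  rewrite /wnorm big_nil mulr0; apply: wiener_eq (wiener_zero _ _ _) => x _.
  by rewrite /eval big_nil.
rewrite wnorm_cons mulrDr; apply: (@wiener_eq _ _ _ _ _ _ (fun x => e.1 * Ephi e.2 x + eval Ephi l x)).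
  by move=> x _; rewrite eval_cons.
apply: wiener_add => //; rewrite mulrCA; exact: wiener_scale.
Qed.

(** Inverse of the diagonal part off [i0]. By [gap] it gains the factor [1 / (c * D)], just what the
    perturbation loses; the component at [i0] is dropped and accounts for the scalar [b] in
    [divide_eval]. *)
Definition divide (l : seq (R * I)) : seq (R * I) := [seq (e.1 / dd e.2, e.2) | e <- l & e.2 != i0].

Lemma divide_norm l : wnorm Dw (divide l) <= c^-1 * wnorm w l.
Proof.
elim: l => [|e l IH]; first by rewrite /wnorm !big_nil mulr0.
rewrite /divide /= wnorm_cons mulrDr; case: ifPn => ei /=; last first.
  by apply: le_trans IH _; rewrite lerDr; apply: mulr_ge0; [rewrite invr_ge0 ltW|apply: mulr_ge0].
rewrite wnorm_cons /=; apply: lerD => //.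
rewrite normrM normfV /Dw.
have -> : `|e.1| / `|dd e.2| * (D e.2 * w e.2) = (D e.2 / `|dd e.2|) * (`|e.1| * w e.2) by ring.
apply: ler_wpM2r; first exact: mulr_ge0.
by rewrite ler_pdivrMr ?dd_gt0// mulrC ler_pdivlMr// mulrC gap.
Qed.

Lemma divide_eval l : exists b, forall x,
  eval pert (divide l) x = eval Ephi (divide l) x - eval phi l x + b * phi i0 x.
Proof.
elim: l => [|e l [b IH]].
  by exists 0 => x; rewrite /eval !big_nil mul0r subr0 addr0.
rewrite /divide /=; case: (eqVneq e.2 i0) => [ei|ei] /=.
  by exists (b + e.1) => x; rewrite IH eval_cons ei; ring.
exists b => x; rewrite !eval_cons /= IH /pert.
have ddn : dd e.2 != 0 by rewrite -normr_gt0 dd_gt0.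
by rewrite mulrBr [e.1 / _ * (_ * _)]mulrA divfK//; ring.
Qed.

(* Truncated Neumann series for the perturbed eigenvector *)
Lemma neumann m (d : R) : 0 < d -> exists x y b,
  [/\ all (fun e => e.2 != i0) x, wnorm Dw x <= 2 * (K / c) * (1 - 2^-1 ^+ m) * Dw i0,
      wnorm Dw y <= 2^-1 ^+ m * Dw i0 &
      forall p, S p -> `|eval pert ((1, i0) :: x) p - b * phi i0 p - eval Ephi y p| <= d].
Proof.
elim: m d => [|m IH] d d_gt0.
  exists [::], [:: (1, i0)], 0; split=> //.
  - by rewrite /wnorm big_nil expr0 subrr mulr0 mul0r.
  - by rewrite wnorm_cons /wnorm big_nil normr1 expr0 addr0.
  - move=> p _; rewrite /eval !big_cons !big_nil /pert dd0 /= !mul0r !subr0 subrr normr0.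
    exact: ltW.
have d20 : 0 < d / 2 by rewrite divr_gt0.
have [x [y [b [xi Nx Ny H]]]] := IH _ d20.
have [k Nk Hk] := eval_wiener y d20.
have [b' Hb'] := divide_eval k.
have qc : K / c <= 2^-1 by rewrite ler_pdivrMr//; move: small; lra.
have q0 : 0 <= K / c by rewrite divr_ge0// ltW.
have Ndk : wnorm Dw (divide k) <= K / c * (2^-1 ^+ m * Dw i0).
  apply: le_trans (divide_norm k) _; rewrite mulrC -[K / c * _]mulrAC ler_pM2r ?invr_gt0//.
  by apply: le_trans Nk _; rewrite ler_wpM2l.
exists (x ++ divide k), (divide k), (b + b'); split.
- rewrite all_cat xi /=; apply/allP => e /mapP[e' + ->] /=.
  by rewrite mem_filter => /andP[].
- rewrite wnorm_cat; apply: le_trans (lerD Nx Ndk) _; rewrite exprS.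
  by rewrite le_eqVlt; apply/orP; left; apply/eqP; field; rewrite gt_eqF.
- apply: le_trans Ndk _; rewrite exprS -[leRHS]mulrA ler_wpM2r// mulr_ge0// exprn_ge0//.
- move=> p Sp; have := H p Sp; have := Hk p Sp.
  rewrite !eval_cons !eval_cat Hb' /=; move: (eval Ephi y p) (eval phi k p) (eval Ephi _ p) (eval pert x p) (1 * _) (phi i0 p).
  move=> A B C E F P h1 h2; rewrite (_ : _ - _ = (F + E - b * P - C) + (C - B)); last by ring.
  by apply: le_trans (ler_normD _ _) _; rewrite [leRHS]splitr; exact: lerD.
Qed.

Lemma half_pow_small (A d : R) : 0 <= A -> 0 < d -> exists m : nat, A * 2^-1 ^+ m <= d.
Proof.
move=> A0 dp; exists (Num.truncn (A / d)).+1.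
have h : A / d < 2 ^+ (Num.truncn (A / d)).+1.
  apply: lt_trans (truncnS_gt _) _; rewrite -natrX ltr_nat; exact: ltn_expl.
rewrite exprVn ler_pdivrMr ?exprn_gt0// mulrC -ler_pdivrMr//; exact: ltW.
Qed.

(** The residual [eval Ephi y] of the truncated series has norm at most [K * 2^-1 ^+ m * Dw i0],
    which is below [d / 2] for large [m]. *)
Lemma approx_eigenvector (d : R) : 0 < d -> exists x b,
  [/\ all (fun e => e.2 != i0) x, wnorm Dw x <= 2 * (K / c) * Dw i0 &
      forall p, S p -> `|eval pert ((1, i0) :: x) p - b * phi i0 p| <= d].
Proof.
move=> dp; have d20 : 0 < d / 2 by rewrite divr_gt0.
have [m Hm] := half_pow_small (mulr_ge0 K0 (Dw0 i0)) d20.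
have [x [y [b [xi Nx Ny H]]]] := neumann m d20.
exists x, b; split=> //.
  apply: le_trans Nx _; rewrite ler_wpM2r// ler_piMr//.
    by rewrite mulr_ge0// divr_ge0// ltW.
move=> p Sp; have := H p Sp; have := wiener_bound phi1 w1 (eval_wiener y) Sp.
move=> h1 h2; rewrite -[X in `|X|](subrK (eval Ephi y p)).
apply: le_trans (ler_normD _ _) _; rewrite [leRHS]splitr; apply: lerD => //.
apply: le_trans h1 _; apply: le_trans Hm; rewrite -mulrA ler_wpM2l// mulrC //.
Qed.

Variable V : set (T -> R).
Hypothesis V0 : V (fun _ => 0).
Hypothesis VD : forall u v, V u -> V v -> V (fun x => u x + v x).
Hypothesis VZ : forall a u, V u -> V (fun x => a * u x).
Hypothesis Vphi : forall i, V (phi i).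
Hypothesis VE : forall i, V (Ephi i).

Definition bounded_functional (Z : (T -> R) -> R) (k : R) : Prop :=
  [/\ forall u v, V u -> V v -> Z (fun x => u x + v x) = Z u + Z v,
      forall a u, V u -> Z (fun x => a * u x) = a * Z u &
      forall u M, V u -> (forall x, S x -> `|u x| <= M) -> `|Z u| <= k * M].

Lemma V_eval (h : I -> T -> R) l : (forall i, V (h i)) -> V (eval h l).
Proof.
move=> Vh; elim: l => [|e l IH].
  by rewrite (_ : eval _ _ = fun _ => 0)//; apply/funext => x; rewrite /eval big_nil.
rewrite (_ : eval _ _ = fun x => e.1 * h e.2 x + eval h l x); last by apply/funext => x; rewrite eval_cons.
by apply: VD => //; exact: VZ.
Qed.

Lemma functional_eval Z k (h : I -> T -> R) l : bounded_functional Z k -> (forall i, V (h i)) ->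
  Z (eval h l) = \sum_(e <- l) e.1 * Z (h e.2).
Proof.
move=> [ZD ZZ ZB] Vh; elim: l => [|e l IH].
  rewrite big_nil (_ : eval _ _ = fun x => 0 * (fun _ => 0) x); last first.
    by apply/funext => x; rewrite /eval big_nil mul0r.
  by rewrite ZZ// mul0r.
rewrite big_cons -IH (_ : eval _ _ = fun x => e.1 * h e.2 x + eval h l x); last by apply/funext => x; rewrite eval_cons.
by rewrite ZD ?ZZ//; [exact: VZ|exact: V_eval].
Qed.

Lemma V_sub u v : V u -> V v -> V (fun x => u x - v x).
Proof.
move=> Vu Vv; rewrite (_ : (fun _ => _) = fun x => u x + (-1) * v x); last by apply/funext => x; rewrite mulN1r.
by apply: VD => //; exact: VZ.
Qed.

Lemma functional_sub Z k u v : bounded_functional Z k -> V u -> V v -> Z (fun x => u x - v x) = Z u - Z v.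
Proof.
move=> [ZD ZZ _] Vu Vv; rewrite (_ : (fun _ => _) = fun x => u x + (-1) * v x); last by apply/funext => x; rewrite mulN1r.
by rewrite ZD ?ZZ ?mulN1r//; exact: VZ.
Qed.

Lemma Vpert i : V (pert i). Proof. by apply: V_sub => //; exact: VZ. Qed.

Lemma functional_pert Z k i : bounded_functional Z k -> Z (pert i) = Z (Ephi i) - dd i * Z (phi i).
Proof.
by move=> HZ; rewrite (functional_sub HZ)//; [case: HZ => _ -> //|exact: VZ].
Qed.

Hypothesis HE0 : forall i, wiener S phi (fun _ => 1) (Ephi i) (K * D i).

(** Uniqueness by contraction. A common bound [B] for the values at the [phi i] gives
    [|dd i| * |Z (phi i)| <= K * D i * B + e], and by the gap the better bound [B / 2 + e / c].
    Boundedness of [Z] starts the iteration; its fixed point is [2 * e / c]. *)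
Lemma functional_small Z k e : 0 <= k -> 0 <= e -> bounded_functional Z k -> Z (phi i0) = 0 ->
  (forall i, i != i0 -> `|Z (pert i)| <= e) -> forall i, `|Z (phi i)| <= 2 * e / c.
Proof.
move=> k0 e0 HZ Z0 HP.
have step B : (forall i, `|Z (phi i)| <= B) -> forall i, `|Z (phi i)| <= B / 2 + e / c.
  move=> HB i; have B0 : 0 <= B := le_trans (normr_ge0 _) (HB i).
  have ec : 0 <= e / c by rewrite divr_ge0// ltW.
  have [->|ii] := eqVneq i i0; first by rewrite Z0 normr0 addr_ge0// divr_ge0.
  have ZE : `|Z (Ephi i)| <= K * D i * B.
    apply/ler_addgt0Pr => d dp.
    have d' : 0 < d / (k + 1) by rewrite divr_gt0// ltr_wpDl.
    have [l Nl Hl] := HE0 i d'.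
    have [_ _ ZB] := HZ.
    have := ZB _ _ (V_sub (VE i) (V_eval l Vphi)) Hl; rewrite (functional_sub HZ) ?(functional_eval _ HZ)//; last exact: V_eval.
    move=> h1; rewrite -[X in `|X|](subrK (\sum_(e <- l) e.1 * Z (phi e.2))) addrC.
    apply: le_trans (ler_normD _ _) _; apply: lerD.
      apply: le_trans (ler_norm_sum _ _ _) _; apply: le_trans (_ : wnorm (fun _ => 1) l * B <= _); last by rewrite ler_wpM2r.
      by rewrite /wnorm mulr_suml; apply: ler_sum => e' _; rewrite normrM mulr1 ler_wpM2l.
    apply: le_trans h1 _; rewrite mulrCA ler_piMr//; first exact: ltW.
    by rewrite ler_pdivrMr ?mul1r ?lerDl ?ltr_wpDl.
  have h1 : `|dd i| * `|Z (phi i)| <= K * D i * B + e.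
    rewrite -normrM; have := HP i ii; rewrite (functional_pert _ HZ) => h2.
    rewrite -[X in `|X|](subKr (Z (Ephi i))); apply: le_trans (ler_normB _ _) _; exact: lerD.
  have h2 : c * D i * `|Z (phi i)| <= K * D i * B + e * D i.
    apply: le_trans (ler_wpM2r (normr_ge0 _) (gap ii)) _; apply: le_trans h1 _.
    by rewrite lerD2l ler_peMr.
  have Dp : 0 < D i := lt_le_trans ltr01 (D1 i).
  have h3 : c * `|Z (phi i)| <= K * B + e by rewrite -(ler_pM2l Dp); move: h2; lra.
  rewrite -(ler_pM2l c0) mulrDr [c * (e / c)]mulrC divfK ?gt_eqF//; apply: le_trans h3 _; rewrite lerD2r.
  by have := ler_wpM2r B0 small; lra.
have iter m i : `|Z (phi i)| <= k * 2^-1 ^+ m + 2 * e / c.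
  elim: m i => [|m IH] i.
    have [_ _ ZB] := HZ; apply: le_trans (ZB _ _ (Vphi i) (phi1 i)) _.
    by rewrite expr0 lerDl divr_ge0 ?mulr_ge0// ltW.
  apply: le_trans (step _ IH i) _; rewrite exprS le_eqVlt; apply/orP; left; apply/eqP; field.
  by rewrite gt_eqF.
move=> i; apply/ler_addgt0Pr => d dp; have [m Hm] := half_pow_small k0 dp.
by apply: le_trans (iter m i) _; rewrite addrC lerD2l.
Qed.

Variables (Lam : (T -> R) -> R) (Phi : I -> (T -> R) -> R) (k1 k2 n0 : R).
Hypothesis k1_ge0 : 0 <= k1.
Hypothesis k2_ge0 : 0 <= k2.
Hypothesis n0_gt0 : 0 < n0.
Hypothesis HLam : bounded_functional Lam k1.
Hypothesis HPhi : forall i, bounded_functional (Phi i) k2.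
Hypothesis Lam_null : forall i, Lam (pert i) = 0.
Hypothesis Phi_sym : forall i j, Phi i (pert j) = Phi j (pert i).
Hypothesis Phi_orth : forall i j, Phi i (phi j) = if i == j then n i else 0.
Hypothesis n_ge : forall i, n0 <= n i.

(** The functional represented by the combination [l] itself; symmetry lets the operator act on [l]
    instead of on the argument. *)
Let combo (l : seq (R * I)) u := \sum_(e <- l) e.1 * Phi e.2 u.

Let combo_bounded l : exists2 k, 0 <= k & bounded_functional (combo l) k.
Proof.
elim: l => [|e l [k k0 [ID IZ IB]]].
  exists 0 => //; split=> [u v Vu Vv|a u Vu|u M Vu _]; rewrite /combo !big_nil ?addr0 ?mulr0//.
  by rewrite mul0r normr0.
have [FD FZ FB] := HPhi e.2.
exists (`|e.1| * k2 + k); first by rewrite addr_ge0// mulr_ge0.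
split=> [u v Vu Vv|a u Vu|u M Vu uM].
- by move: (ID u v Vu Vv); rewrite /combo !big_cons FD// => ->; ring.
- by move: (IZ a u Vu); rewrite /combo !big_cons FZ// => ->; ring.
- move: (IB u M Vu uM); rewrite /combo big_cons => h.
  apply: le_trans (ler_normD _ _) _; rewrite mulrDl normrM -mulrA; apply: lerD => //.
  by rewrite ler_wpM2l// FB.
Qed.

(** [Lam] is integration against the eigenfunction and [Phi i] against a mode. [Lam] is compared
    with [a] times the functional of the approximate eigenvector: the difference [Z] vanishes at
    [phi i0] and is small on the other [pert i], so by [functional_small] the two have nearly the
    same coefficients. *)
Lemma eigenfunction_coefs (F : seq I) : uniq F -> i0 \notin F ->
  \sum_(i <- F) D i * w i * (`|Lam (phi i)| / n i) <= `|Lam (phi i0) / n i0| * (2 * (K / c) * (D i0 * w i0)).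
Proof.
move=> uF iF; set a := Lam (phi i0) / n i0.
have np i : 0 < n i := lt_le_trans n0_gt0 (n_ge i).
(* [Q] collects the error factors over the finite set [F]; the accuracy [d] is chosen so that the
   errors total at most [eta]. *)
pose Q := \sum_(i <- F) Dw i * (2 * (`|a| * k2) / c / n0).
have ak : 0 <= `|a| * k2 by exact: mulr_ge0.
have akc : 0 <= 2 * (`|a| * k2) / c by apply: divr_ge0; [exact: mulr_ge0|exact: ltW].
have akcn : 0 <= 2 * (`|a| * k2) / c / n0 by apply: divr_ge0 => //; exact: ltW.
have Q0 : 0 <= Q.
  by apply: sumr_ge0 => i _; exact: mulr_ge0.
apply/ler_addgt0Pr => eta eta0.
have d0 : 0 < eta / (Q + 1) by rewrite divr_gt0// ltr_wpDl.
set d := eta / (Q + 1) in d0.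
have [x [b [xi Nx Hx]]] := approx_eigenvector d0.
pose l := (1, i0) :: x.
have [k kp HC] := combo_bounded l.
pose Z u := Lam u - a * combo l u.
have HZ : bounded_functional Z (k1 + `|a| * k).
  have [LD LZ LB] := HLam; have [CD CZ CB] := HC.
  split=> [u v Vu Vv|s u Vu|u M Vu uM].
  - by rewrite /Z LD// CD//; ring.
  - by rewrite /Z LZ// CZ//; ring.
  - rewrite /Z mulrDl; apply: le_trans (ler_normB _ _) _; rewrite normrM -mulrA; apply: lerD; first exact: LB.
    by rewrite ler_wpM2l// CB.
pose X i := \sum_(e <- x | e.2 == i) e.1.
have comboE i : combo l (phi i) = (if i == i0 then n i0 else 0) + n i * X i.
  rewrite /combo big_cons /= mul1r Phi_orth eq_sym; congr (_ + _); rewrite mulr_sumr [RHS]big_mkcond /=.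
  by apply: eq_bigr => e _; rewrite Phi_orth; case: eqP => [->|]; rewrite ?mulr0// mulrC.
have X0 : X i0 = 0.
  by rewrite /X big1_seq// => e /andP[/eqP ei ex]; move/allP: xi => /(_ e ex); rewrite ei eqxx.
have Z0 : Z (phi i0) = 0.
  by rewrite /Z comboE eqxx X0 mulr0 addr0 /a divfK ?subrr// gt_eqF.
(* By symmetry [combo l (pert i)] is [Phi i] of the image of the approximate eigenvector; up to [d]
   this image is a multiple of [phi i0], which is orthogonal to [phi i]. *)
have ZP i : i != i0 -> `|Z (pert i)| <= `|a| * k2 * d.
  move=> ii; rewrite /Z Lam_null sub0r normrN normrM -mulrA ler_wpM2l//.
  have -> : combo l (pert i) = Phi i (fun p => eval pert l p - b * phi i0 p).
    rewrite (functional_sub (HPhi i)); [|exact/V_eval/Vpert|exact: VZ].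
    have [_ HZi _] := HPhi i; rewrite HZi// Phi_orth (negbTE ii) mulr0 subr0.
    by rewrite (functional_eval _ (HPhi i)); [apply: eq_bigr => e _; rewrite Phi_sym|exact: Vpert].
  have [_ _] := HPhi i; apply=> //; apply: V_sub; [exact/V_eval/Vpert|exact: VZ].
have e0 : 0 <= `|a| * k2 * d by apply: mulr_ge0 => //; exact: ltW.
have kk : 0 <= k1 + `|a| * k by rewrite addr_ge0// mulr_ge0.
have Zs := functional_small kk e0 HZ Z0 ZP.
have LamE i : i \in F -> `|Lam (phi i)| / n i <= 2 * (`|a| * k2) / c / n0 * d + `|a| * `|X i|.
  move=> ii; have inz : i != i0 by apply: contraNneq iF => <-.
  have -> : Lam (phi i) = Z (phi i) + a * (n i * X i) by rewrite /Z comboE (negbTE inz) add0r subrK.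
  rewrite ler_pdivrMr//; apply: le_trans (ler_normD _ _) _; rewrite mulrDl; apply: lerD; last first.
    by rewrite normrM [`|n i * X i|]normrM (ger0_norm (ltW (np i))) -mulrA [n i * _]mulrC.
  apply: le_trans (Zs i) _.
  rewrite (_ : 2 * (`|a| * k2 * d) / c = 2 * (`|a| * k2) / c * d); last by ring.
  rewrite (_ : _ * d * n i = 2 * (`|a| * k2) / c * d * (n i / n0)); last by ring.
  rewrite ler_peMr//; last by rewrite ler_pdivlMr// mul1r.
  by apply: mulr_ge0 => //; exact: ltW.
apply: le_trans (_ : \sum_(i <- F) (Dw i * (2 * (`|a| * k2) / c / n0) * d + `|a| * (Dw i * `|X i|)) <= _).
  rewrite [leLHS]big_seq [leRHS]big_seq; apply: ler_sum => i iF'.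
  apply: le_trans (ler_wpM2l (Dw0 i) (LamE i iF')) _.
  by rewrite mulrDr le_eqVlt; apply/orP; left; apply/eqP; ring.
rewrite big_split /= -mulr_suml -/Q -mulr_sumr addrC; apply: lerD; last first.
  rewrite /d mulrCA ler_piMr//; first exact: ltW.
  by rewrite ler_pdivrMr ?mul1r ?lerDl ?ltr_wpDl.
(* It remains to see that collecting equal indices in the list [x] does not increase its norm. *)
rewrite ler_wpM2l//; apply: le_trans Nx; rewrite /X; clear -uF Dw0.
elim: x => [|e x IH].
  by rewrite /wnorm big_nil big1// => i _; rewrite big_nil normr0 mulr0.
rewrite wnorm_cons; apply: le_trans (_ : \sum_(i <- F) ((if e.2 == i then `|e.1| * Dw i else 0) + Dw i * `|\sum_(e <- x | e.2 == i) e.1|) <= _).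
  apply: ler_sum => i _; rewrite big_cons; case: ifP => _; last by rewrite add0r.
  by rewrite [`|e.1| * _]mulrC -mulrDr ler_wpM2l// ler_normD.
rewrite big_split /=; apply: lerD => //; rewrite -big_mkcond /=.
have [eF|eF] := boolP (e.2 \in F).
  rewrite (eq_bigl (fun i => i == e.2)); last by move=> i; rewrite eq_sym.
  by rewrite (big_rem _ eF) /= eqxx big1_seq ?addr0// => i /andP[/eqP ->]; rewrite mem_rem_uniq// inE eqxx.
rewrite big1_seq; first exact: mulr_ge0 (normr_ge0 _) (Dw0 _).
by move=> i /andP[/eqP ei iF]; rewrite ei iF in eF.
Qed.

End PerturbedEigenvector.

(** * Weak derivatives on the strip *)

Section WeakDerivatives.
Context {R : realType}.
Let MR : measurableType _ := measurableTypeR R.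
Let T2 : measurableType _ := (MR * MR)%type.
Variable L : R.
Hypothesis L0 : 0 < L.
Implicit Types (u w : R * R -> R) (v : R * R).

Local Notation S := (strip L).
Local Notation mu := (@leb2 R).
Local Notation "'Int' u" := (\int[mu]_(p in S) u p) (at level 10, u at level 9).

Lemma ae_leb2_imp (P Q : R * R -> Prop) : (forall p, P p -> Q p) ->
  {ae mu, forall p, P p} -> {ae mu, forall p, Q p}.
Proof. by move=> PQ; apply: negligibleS => p /= nQ /PQ. Qed.

Lemma strip_cstrip p : S p -> cstrip L p.
Proof. by case=> /andP[h1 h2] /andP[h3 h4]; split; rewrite !ltW. Qed.

Lemma cont_bounded (h : R * R -> R) : continuous h -> exists K, forall p, cstrip L p -> `|h p| <= K.
Proof.
move=> hc; have cC : compact (`[0, L]%classic `*` `[-1, 1]%classic : set (R * R)).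
  by apply: compact_setX; exact: segment_compact.
have /compact_bounded[M [_ HM]] : compact (h @` (`[0, L]%classic `*` `[-1, 1]%classic : set (R * R))).
  by apply: continuous_compact => //; exact: continuous_subspaceT.
exists (M + 1) => p [p1 p2]; apply: (HM (M + 1)); first by rewrite ltrDl.
by exists p => //; split; rewrite /= in_itv.
Qed.

Lemma continuous_nice (h : R * R -> R) : continuous h ->
  measurable_fun (S : set T2) h /\ exists K, forall p, S p -> `|h p| <= K.
Proof.
move=> hc; split; first exact: measurable_funS (continuous_measurable2 hc).
by have [K HK] := cont_bounded hc; exists K => p /strip_cstrip; exact: HK.
Qed.

Lemma continuous_integ (h : R * R -> R) : continuous h -> integ L h.
Proof. by move=> /continuous_nice[mh [K HK]]; exact: (integ_bounded L0 mh HK). Qed.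

Lemma FTC_zero (a b : R) (F f : R -> R) : a < b -> (forall x : R, is_derive x 1 F (f x)) -> continuous f ->
  F a = 0 -> F b = 0 -> (\int[lebesgue_measure]_(x in `]a, b[) (f x)%:E = 0)%E.
Proof.
move=> ab dF cf Fa Fb.
have cF : continuous F by move=> x; apply: is_derive_continuous (dF x).
rewrite -(@integral_itv_bndoo _ a b _ true false); last first.
  apply/measurable_EFinP; apply: (measurable_funS measurableT) => //.
  exact: continuous_measurable_fun.
rewrite (continuous_FTC2 (F := F) ab) ?Fa ?Fb ?subee//.
- exact: continuous_subspaceT.
- split=> [x _||]; first exact: is_derive_ex (dF x).
    by apply: cvg_at_right_filter; exact: cF.
  by apply: cvg_at_left_filter; exact: cF.
- by move=> x _; rewrite derive1E; exact: is_derive_val (dF x).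
Qed.

Lemma line_e1 (h x y : R) : h *: e1 R + (x, y) = (h + x, y).
Proof. by apply: injective_projections; rewrite /= /GRing.scale /= ?mulr1 ?mulr0 ?add0r. Qed.

Lemma line_e2 (h x y : R) : h *: e2 R + (x, y) = (x, h + y).
Proof. by apply: injective_projections; rewrite /= /GRing.scale /= ?mulr1 ?mulr0 ?add0r. Qed.

Lemma is_derive_e1 u (x y d : R) : is_derive (x, y) (e1 R) u d -> is_derive x 1 (fun x => u (x, y)) d.
Proof.
move=> H; have -> : (fun x => u (x, y)) = fun x => u (x *: e1 R + (0, y)).
  by apply/funext => z; rewrite line_e1 addr0.
by apply: is_derive_line; rewrite line_e1 addr0.
Qed.

Lemma is_derive_e2 u (x y d : R) : is_derive (x, y) (e2 R) u d -> is_derive y 1 (fun y => u (x, y)) d.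
Proof.
move=> H; have -> : (fun y => u (x, y)) = fun y => u (y *: e2 R + (x, 0)).
  by apply/funext => z; rewrite line_e2 addr0.
by apply: is_derive_line; rewrite line_e2 addr0.
Qed.

Lemma smooth_derive_continuous u v : smooth setT u -> continuous ('D_v u).
Proof. by move=> Hu x; apply: (@Ck_continuous _ _ 0 setT) => //; apply: Ck_derive; exact: (Hu 1%N). Qed.

Lemma continuous_pair1 (u : R * R -> R) (y : R) : continuous u -> continuous (fun x => u (x, y)).
Proof.
move=> uc x; apply/cvgrPdist_lt => e e0; have /cvgrPdist_lt/(_ e e0) := uc (x, y).
move=> /(nbhs_ball_norm (x, y) _).1[d d0 Hd]; apply/(nbhs_ball_norm x _); exists d => // z zx.
by apply: Hd; rewrite prod_normE /= subrr normr0 gt_max zx d0.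
Qed.

Lemma continuous_pair2 (u : R * R -> R) (x : R) : continuous u -> continuous (fun y => u (x, y)).
Proof.
move=> uc y; apply/cvgrPdist_lt => e e0; have /cvgrPdist_lt/(_ e e0) := uc (x, y).
move=> /(nbhs_ball_norm (x, y) _).1[d d0 Hd]; apply/(nbhs_ball_norm y _); exists d => // z zx.
by apply: Hd; rewrite prod_normE /= subrr normr0 gt_max zx d0.
Qed.

Lemma continuous_mul (h k : R * R -> R) : continuous h -> continuous k -> continuous (fun p => h p * k p).
Proof. by move=> ch ck p; exact: cvgM (ch p) (ck p). Qed.

(** Fubini's theorem with the direction of differentiation as inner variable; the inner integral
    vanishes because a test function is zero outside the open strip. *)
Lemma Int_derive_test v tau : v = e1 R \/ v = e2 R -> test_function L tau -> Int ('D_v tau) = 0.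
Proof.
have h11 : (-1 : R) < 1 by lra.
move=> Hv [Ht [C [_ CS] tC]].
have cD := smooth_derive_continuous (v := v) Ht.
have out p : ~ S p -> tau p = 0 by move=> nS; apply: tC => /CS.
have iD := continuous_integ cD.
have dtau p : is_derive p v tau ('D_v tau p) by apply: (@Ck_is_derive _ _ 0 setT) => //; exact: (Ht 1%N).
have in1 (y : R) : v = e1 R -> (\int[lebesgue_measure]_(x in `]0%R, L[) ('D_v tau (x, y))%:E = 0)%E.
  move=> Hv1; apply: (@FTC_zero _ _ (fun x : R => tau (x, y)) (fun x : R => 'D_v tau (x, y))) => //.
  - by move=> x; apply: is_derive_e1; rewrite -Hv1; exact: dtau.
  - exact: (@continuous_pair1 ('D_v tau) y cD).
  - by apply: out => -[/= /andP[]]; rewrite ltxx.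
  - by apply: out => -[/= /andP[]]; rewrite ltxx.
have in2 (x : R) : v = e2 R -> (\int[lebesgue_measure]_(y in `](-1)%R, 1%R[) ('D_v tau (x, y))%:E = 0)%E.
  move=> Hv2; apply: (@FTC_zero _ _ (fun y : R => tau (x, y)) (fun y : R => 'D_v tau (x, y))) => //.
  - by move=> y; apply: is_derive_e2; rewrite -Hv2; exact: dtau.
  - exact: (@continuous_pair2 ('D_v tau) x cD).
  - by apply: out => -[/= _ /andP[]]; rewrite ltxx.
  - by apply: out => -[/= _ /andP[]]; rewrite ltxx.
have mS : measurable (S : set T2) := strip_measurable L.
suff H : (\int[mu]_(p in S) ('D_v tau p)%:E = 0)%E by rewrite /Rintegral H.
rewrite integral_mkcond.
have imf : mu.-integrable setT ((EFin \o 'D_v tau) \_ S) by apply/(integrable_mkcond _ mS).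
case: Hv => Hv.
- rewrite -(integral21_prod_meas1 imf); apply: integral0_eq => y _.
  have [y1|y1] := boolP (-1 < y < 1); last first.
    by rewrite /fubini_G; apply: integral0_eq => x _; rewrite patchE memNset// => -[_ /= y2]; move/negP: y1.
  rewrite /fubini_G (_ : (fun x => _) = (fun x => ('D_v tau (x, y))%:E) \_ (`]0, L[%classic)); last first.
    apply/funext => x; rewrite !patchE; congr (if _ then _ else _); apply/idP/idP; rewrite !inE /= in_itv /=.
      by case.
    by split.
  by rewrite -integral_mkcond; exact: in1.
- rewrite -(integral12_prod_meas1 imf); apply: integral0_eq => x _.
  have [x1|x1] := boolP (0 < x < L); last first.
    by rewrite /fubini_F; apply: integral0_eq => y _; rewrite patchE memNset// => -[/= x2 _]; move/negP: x1.
  rewrite /fubini_F (_ : (fun y => _) = (fun y => ('D_v tau (x, y))%:E) \_ (`]-1, 1[%classic)); last first.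
    apply/funext => y; rewrite !patchE; congr (if _ then _ else _); apply/idP/idP; rewrite !inE /= in_itv /=.
      by case.
    by split.
  by rewrite -integral_mkcond; exact: in2.
Qed.

Lemma smooth_weak v u : v = e1 R \/ v = e2 R -> smooth setT u -> is_weak_derivative L v u ('D_v u).
Proof.
move=> Hv Hu; have cD := smooth_derive_continuous (v := v) Hu.
have cu : continuous u by move=> x; apply: (@Ck_continuous _ _ 0 setT) => //; exact: Hu.
split.
  have [m1 [K HK]] := continuous_nice cD; exact: (bounded_L2 L0 m1 HK).
move=> phi Hphi; have [Sp [C CS pC]] := Hphi.
have Ht : test_function L (fun p => u p * phi p).
  split; first by move=> k; apply: CkM; [exact: openT|exact: Hu|exact: Sp].
  by exists C => // p /pC ->; rewrite mulr0.
have cp : continuous phi by move=> x; apply: (@Ck_continuous _ _ 0 setT) => //; exact: Sp.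
have cDp := smooth_derive_continuous (v := v) Sp.
apply/eqP; rewrite -subr_eq0 opprK addrC; apply/eqP; rewrite -Int_add; last 2 first.
- by exact: continuous_integ (continuous_mul cD cp).
- by exact: continuous_integ (continuous_mul cu cDp).
rewrite -[RHS](Int_derive_test Hv Ht); apply: Int_ext => p _.
have du : is_derive p v u ('D_v u p) by apply: (@Ck_is_derive _ _ 0 setT) => //; exact: (Hu 1%N).
have dp : is_derive p v phi ('D_v phi p) by apply: (@Ck_is_derive _ _ 0 setT) => //; exact: (Sp 1%N).
exact/esym/is_derive_val/is_derive_mul.
Qed.

Lemma smooth_W12 u : smooth setT u -> W12 L u.
Proof.
move=> Hu; have cu : continuous u by move=> x; apply: (@Ck_continuous _ _ 0 setT) => //; exact: Hu.
split.
- have [m1 [K HK]] := continuous_nice cu; exact: (bounded_L2 L0 m1 HK).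
- by exists ('D_(e1 R) u); apply: smooth_weak => //; left.
- by exists ('D_(e2 R) u); apply: smooth_weak => //; right.
Qed.

Lemma bump2_continuous m (a b c d : R) : continuous (bump2 m a b c d).
Proof. by move=> x; apply: (@Ck_continuous _ _ 0 setT) => //; exact: bump2_smooth. Qed.

Lemma bump2_le1 m (a b c d : R) p : `|bump2 m a b c d p| <= 1.
Proof.
have /andP[h1 h2] := bump_ge0_le1 m a b p.1; have /andP[h3 h4] := bump_ge0_le1 m c d p.2.
by rewrite normrM !ger0_norm// mulr_ile1.
Qed.

Lemma bump2_cvg (a b c d : R) p : a < b -> c < d ->
  bump2 m a b c d p @[m --> \oo] --> (\1_(`]a, b[%classic `*` `]c, d[%classic) p : R).
Proof.
move=> ab cd; rewrite [X in _ --> X](_ : _ = (if a < p.1 < b then 1 else 0) * (if c < p.2 < d then 1 else 0)); last first.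
  have [h1|h1] := boolP (a < p.1 < b); have [h2|h2] := boolP (c < p.2 < d); rewrite indicE.
  - by rewrite mem_set ?mulr1//; split; rewrite /= in_itv.
  - by rewrite memNset ?mulr0// => -[_]; rewrite /= in_itv /= (negbTE h2).
  - by rewrite memNset ?mul0r// => -[]; rewrite /= in_itv /= (negbTE h1).
  - by rewrite memNset ?mul0r// => -[]; rewrite /= in_itv /= (negbTE h1).
by apply: cvgM; exact: bump_cvg.
Qed.

(** The bumps are bounded by 1 and converge to indicators of rectangles, so dominated convergence
    reduces the claim to [Int_rect_null]. *)
Lemma null_of_bumps u : integ L u ->
  (forall m a b c d, 0 <= a -> a < b -> b <= L -> -1 <= c -> c < d -> d <= 1 ->
     Int (fun p => u p * bump2 m a b c d p) = 0) ->
  ae_eq_strip L u (fun _ => 0).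
Proof.
move=> iu H; apply: (Int_rect_null L0 iu) => a b c d a0 ab bL c1 cd d1.
have cv : Int (fun p => u p * bump2 m a b c d p) @[m --> \oo] -->
    Int (fun p => u p * \1_(`]a, b[%classic `*` `]c, d[%classic) p).
  apply: (@Int_dct _ _ u _ _ 1) => //.
  - by move=> m; have [] := continuous_nice (@bump2_continuous m a b c d).
  - by move=> m p _; exact: bump2_le1.
  - by move=> p _; exact: bump2_cvg.
have : Int (fun p => u p * bump2 m a b c d p) @[m --> \oo] --> (0 : R).
  by under eq_fun do rewrite H//; exact: cvg_cst.
by move=> /(cvg_unique _ cv); apply.
Qed.

Lemma cst_smooth (V : normedModType R) (c : R) : smooth (setT : set V) (fun _ => c).
Proof. by move=> k; apply: Ck_cst; exact: openT. Qed.

(** [weakD] picks an unspecified representative; this permits replacing it under integrals by an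
    explicit derivative. *)
Lemma weak_unique v u w w' : is_weak_derivative L v u w -> is_weak_derivative L v u w' -> ae_eq_strip L w w'.
Proof.
move=> [Lw Hw] [Lw' Hw']; have iw := L2_integ L0 Lw; have iw' := L2_integ L0 Lw'.
have : ae_eq_strip L (fun p => w p - w' p) (fun _ => 0).
  apply: null_of_bumps; first exact: integ_sub.
  move=> m a b c d a0 ab bL c1 cd d1.
  have Ht : test_function L (bump2 m a b c d).
    have := @bump_test R L m a b c d (fun _ => 1) a0 ab bL c1 cd d1 (cst_smooth _ _).
    by under eq_fun do rewrite mulr1.
  have [mb _] := continuous_nice (@bump2_continuous m a b c d).
  have b1 p : S p -> `|bump2 m a b c d p| <= 1 by move=> _; exact: bump2_le1.
  rewrite (Int_ext (v := fun p => w p * bump2 m a b c d p - w' p * bump2 m a b c d p)); last first.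
    by move=> p _; rewrite mulrBl.
  rewrite Int_sub; [|exact: (integ_mul iw mb b1)|exact: (integ_mul iw' mb b1)].
  by apply/eqP; rewrite subr_eq0 -eqr_opp -Hw// -Hw'//.
by apply: ae_leb2_imp => p H Sp; apply/eqP; rewrite -subr_eq0 H.
Qed.

Lemma weakD_spec v u : (exists w, is_weak_derivative L v u w) -> is_weak_derivative L v u (weakD L v u).
Proof. by move=> H; apply: (@xgetPex _ (cst 0) [set w | is_weak_derivative L v u w]). Qed.

Lemma Int_ae u w : measurable_fun (S : set T2) u -> measurable_fun (S : set T2) w -> ae_eq_strip L u w -> Int u = Int w.
Proof.
move=> mu' mw H; congr fine; apply: ae_eq_integral => //.
- exact: strip_measurable.
- exact/measurable_EFinP.
- exact/measurable_EFinP.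
- by apply: ae_leb2_imp H => p H Sp; rewrite H.
Qed.

End WeakDerivatives.

(** * Integration by parts up to the boundary *)

Section IntegrationByParts.
Context {R : realType}.
Let MR : measurableType _ := measurableTypeR R.
Let T2 : measurableType _ := (MR * MR)%type.

Lemma is_derive_cosl (l : R) k (x : R) : is_derive x 1 (cosl l k) (- (k%:R * (pi / l)) * sinl l k x).
Proof.
have E y : k%:R * (pi * y / l) = k%:R * (pi / l) * y by ring.
rewrite /sinl E mulNr (_ : cosl l k = fun y => cos (k%:R * (pi / l) * y)); last by apply/funext => y; rewrite /cosl E.
exact: is_derive_cosa.
Qed.

Lemma is_derive_sinl (l : R) k (x : R) : is_derive x 1 (sinl l k) (k%:R * (pi / l) * cosl l k x).
Proof.
have E y : k%:R * (pi * y / l) = k%:R * (pi / l) * y by ring.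
rewrite /cosl E (_ : sinl l k = fun y => sin (k%:R * (pi / l) * y)); last by apply/funext => y; rewrite /sinl E.
exact: is_derive_sina.
Qed.

Lemma is_derive_shift1 (h : R -> R) (y d : R) : is_derive (y + 1) 1 h d -> is_derive y 1 (fun y => h (y + 1)) d.
Proof.
move=> H; rewrite -[d]mulr1; apply: (@is_derive_comp1 _ _ h (fun y : R => y + 1) y 1 _ _ H).
by have := is_derive_affine 1 1 y; rewrite (_ : (fun _ => _) = fun y : R => y + 1)//; apply/funext => z; rewrite mul1r.
Qed.

Lemma sinl_cosl_Ck (l : R) j k : Ck k setT (sinl l j) /\ Ck k setT (cosl l j).
Proof.
have oT : open (setT : set R) := openT.
have lin : Ck k setT (fun x : R => j%:R * (pi * x / l)).
  apply: Ck_linear => // [|a u w]; last by rewrite [a *: u]/GRing.scale /=; ring.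
  move=> x; rewrite (_ : (fun x => _) = fun x : R => j%:R * (pi / l) * x); last by apply/funext => y; ring.
  by apply: is_derive_continuous (is_derive_lin _ x).
by split; [apply: (@Ck_comp1 _ _ _ (@sin R)) lin => // m; exact: (sin_cos_Ck m).1|
  apply: (@Ck_comp1 _ _ _ (@cos R)) lin => // m; exact: (sin_cos_Ck m).2].
Qed.

Lemma shift1_Ck (h : R -> R) : (forall l, Ck l setT h) -> forall k, Ck k setT (fun y : R => h (y + 1)).
Proof.
move=> Hh k; have oT : open (setT : set R) := openT; apply: (@Ck_comp1 _ _ _ h) => //.
by apply: CkD => //; [apply: Ck_linear => // x; exact: cvg_id|exact: Ck_cst].
Qed.

Lemma tensor_smooth (h h' : R -> R) : (forall l, Ck l setT h) -> (forall l, Ck l setT h') ->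
  smooth setT (fun p : R * R => h p.1 * h' (p.2 + 1)).
Proof.
move=> Hh Hh' k; apply: CkM; [exact: openT|exact: Ck_fstc|].
exact: (@Ck_sndc _ k (fun y => h' (y + 1)) (shift1_Ck Hh')).
Qed.

Lemma sinl_Ck (l : R) j k : Ck k setT (sinl l j). Proof. exact: (sinl_cosl_Ck l j k).1. Qed.
Lemma cosl_Ck (l : R) j k : Ck k setT (cosl l j). Proof. exact: (sinl_cosl_Ck l j k).2. Qed.

(** [sin X] is at most [X] and at most [pi - X]; these bounds, weighted with [pi - X] and [X], give
    linear decay at both ends. *)
Lemma sinl_ends (l : R) j x : 0 < l -> 0 <= x <= l -> `|sinl l j x| <= j%:R * (2 * pi / l ^+ 2) * (x * (l - x)).
Proof.
move=> l0 xl; have Xp := seg_angle l0 xl; apply: le_trans (sin_mul_le j Xp) _.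
rewrite -[leRHS]mulrA ler_wpM2l//; move: Xp; set X := pi * x / l => /andP[X0 X1].
have p0 : 0 < pi :> R := pi_gt0 R.
have s0 : 0 <= sin X by apply: sin_ge0_pi; rewrite X0.
have sX : sin X <= X by apply: le_trans (ler_norm _) _; apply: le_trans (sin_le_norm _) _; rewrite ger0_norm.
have sX' : sin X <= pi - X.
  rewrite (_ : sin X = sin (pi - X)); last by rewrite sinB sinpi cospi; ring.
  by apply: le_trans (ler_norm _) _; apply: le_trans (sin_le_norm _) _; rewrite ger0_norm// subr_ge0.
have E : 2 * pi / l ^+ 2 * (x * (l - x)) = 2 * (X * (pi - X)) / pi.
  by rewrite /X; move: p0; move: (@pi R) => P p0; field; rewrite !gt_eqF.
rewrite E ler_pdivlMr//.
have X2 : 0 <= pi - X by rewrite subr_ge0.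
have h1 := ler_wpM2l X0 sX'; have h2 := ler_wpM2l X2 sX.
rewrite [leLHS](_ : _ = X * sin X + (pi - X) * sin X); last by ring.
rewrite [leRHS](_ : _ = X * (pi - X) + (pi - X) * X); last by ring.
exact: lerD.
Qed.

(** The derivative of a function vanishing at both ends has a zero, so a constant part [c] of it is
    no larger than the rest. This will bound the contribution of modes that are constant along a
    line. *)
Lemma mvt_ends (e r : R -> R) (a b c d : R) : a < b -> (forall x, a <= x <= b -> is_derive x 1 e (r x + c)) ->
  (forall x, a <= x <= b -> `|r x| <= d) -> e a = 0 -> e b = 0 ->
  `|c| <= d /\ forall x, a <= x <= b -> `|e x| <= 2 * d * (b - a).
Proof.
move=> ab He Hr ea eb; have ba : 0 < b - a by rewrite subr_gt0.
have cd : `|c| <= d.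
  have [x xab] := mvt1 (ltW ab) He; rewrite ea eb subrr => /esym/eqP.
  rewrite mulf_eq0 [b - a == 0]gt_eqF// orbF addr_eq0 => /eqP rc.
  by rewrite -normrN -rc; exact: Hr.
split=> // x /andP[ax xb].
have [y|y /andP[ay yx]] := @mvt1 _ e (fun x => r x + c) a x ax.
  by move=> /andP[h1 h2]; apply: He; rewrite h1 (le_trans h2).
rewrite ea subr0 => ->; rewrite normrM [`|x - a|]ger0_norm ?subr_ge0//.
have yab : a <= y <= b by rewrite ay (le_trans yx).
apply: ler_pM => //; [by rewrite subr_ge0| |by rewrite lerD2r].
by apply: le_trans (ler_normD _ _) _; rewrite mulr_natl mulr2n lerD// Hr.
Qed.

Variable L : R.
Hypothesis L0 : 0 < L.
Local Notation S := (strip L).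
Local Notation mu := (@leb2 R).
Local Notation "'Int' u" := (\int[mu]_(p in S) u p) (at level 10, u at level 9).

Lemma strip_center : S (L / 2, 0).
Proof.
split; rewrite /=; first by rewrite divr_gt0//= ltr_pdivrMr// mulr_natr mulr2n ltrDl.
by rewrite oppr_lt0 ltr01.
Qed.

Lemma smooth_continuous (u : R * R -> R) : smooth setT u -> continuous u.
Proof. by move=> Hu x; apply: (@Ck_continuous _ _ 0 setT) => //; exact: Hu. Qed.

Lemma mode_smooth i : smooth setT (mode L i).
Proof. by apply: tensor_smooth => l; exact: cosl_Ck. Qed.

Lemma flat2_lin (y : R) : flat 2 y * (y + 1) <= 4.
Proof.
have [y0|y0] := leP y 0; first by rewrite /flat ltNge y0 mul0r.
have [h1 h2] := flat2_le y0; have f0 := flat_ge0 2 y.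
have [y1|y1] := leP y 1.
  by apply: le_trans (ler_pM f0 _ h1 (_ : y + 1 <= 2)) _; lra.
apply: le_trans (_ : flat 2 y * (2 * y ^+ 2) <= _); last by lra.
by apply: ler_wpM2l => //; nra.
Qed.

(** The derivative of the cut-off grows like [m], but the decay of [F] turns [m] into [m * k], and
    [flat 2 y * (y + 1)] with [y = m * k - 1] is bounded by [flat2_lin]. *)
Lemma bump_slope_le m (a b s C F : R) : a < b -> a < s < b -> `|F| <= C * ((s - a) * (b - s)) ->
  `|flat 2 (m%:R * ((s - a) * (b - s)) - 1) * (m%:R * (a + b - 2 * s)) * F|
    <= C * (b - a) * (flat 2 (m%:R * ((s - a) * (b - s)) - 1) * (m%:R * ((s - a) * (b - s)))).
Proof.
move=> ab /andP[sa sb]; set k := (s - a) * (b - s) => HF.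
have f0 := flat_ge0 2 (m%:R * k - 1).
rewrite !normrM (ger0_norm f0) normr_nat -mulrA [leRHS]mulrCA ler_wpM2l//.
rewrite [leRHS](_ : _ = m%:R * ((b - a) * (C * k))); last by ring.
rewrite -mulrA ler_wpM2l// ler_pM//.
by rewrite ler_norml; apply/andP; split; lra.
Qed.

Lemma bump_slope_cvg (a b s C F : R) : a < b -> a < s < b -> `|F| <= C * ((s - a) * (b - s)) ->
  flat 2 (m%:R * ((s - a) * (b - s)) - 1) * (m%:R * (a + b - 2 * s)) * F @[m --> \oo] --> (0 : R).
Proof.
move=> ab sab HF; have k0 : 0 < (s - a) * (b - s) by case/andP: sab => h1 h2; rewrite mulr_gt0// subr_gt0.
have C0 : 0 <= C by rewrite -(pmulr_lge0 _ k0); exact: le_trans HF.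
apply/cvgrPdist_le => e e0.
pose Q := 2 * (C * (b - a)) / e + 1.
have Q0 : 1 <= Q.
  by rewrite lerDr; apply: divr_ge0; [apply: mulr_ge0 => //; apply: mulr_ge0 => //; rewrite subr_ge0 ltW|exact: ltW].
exists (Num.truncn ((Q + 1) / ((s - a) * (b - s)))).+1 => // m /= mN.
rewrite sub0r normrN; apply: le_trans (bump_slope_le m ab sab HF) _.
move: k0 mN; set k := (s - a) * (b - s) => k0 mN.
have mk : Q + 1 <= m%:R * k.
  rewrite -ler_pdivrMr//; apply: le_trans (ltW (truncnS_gt _)) _; rewrite ler_nat; exact: mN.
set y := m%:R * k - 1; have yQ : Q <= y by rewrite /y; move: mk Q0; move: (m%:R * k) => z; lra.
have y0 : 0 < y by apply: lt_le_trans yQ; lra.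
have [_ h2] := flat2_le y0.
have -> : m%:R * k = y + 1 by rewrite /y subrK.
have f0 := flat_ge0 2 y.
have h3 : flat 2 y * (y + 1) <= 2 / y.
  rewrite ler_pdivlMr//; apply: le_trans (_ : flat 2 y * (2 * y ^+ 2) <= _); last by move: h2; clear; lra.
  rewrite -mulrA ler_wpM2l//; nra.
have D0 : 0 <= C * (b - a) by rewrite mulr_ge0// subr_ge0 ltW.
apply: le_trans (ler_wpM2l D0 h3) _.
rewrite mulrA ler_pdivrMr//.
have : Q * e <= y * e by rewrite ler_wpM2r// ltW.
rewrite /Q mulrDl divfK ?gt_eqF// mul1r => h4.
by rewrite [leRHS]mulrC; apply: le_trans h4; rewrite [leLHS]mulrC lerDl ltW.
Qed.

(** The weak derivative is tested with [F] times a cut-off tending to 1. The last two assumptions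
    give the domination and the pointwise limit of the extra term, in which the cut-off is
    differentiated. *)
Lemma ibp_test (v : R * R) (u g F : R * R -> R) (K : R) : v = e1 R \/ v = e2 R -> L2 L u ->
  is_weak_derivative L v u g -> smooth setT F ->
  (forall m p, S p -> `|'D_v (bump2 m 0 L (-1) 1) p * F p| <= K) ->
  (forall p, S p -> 'D_v (bump2 m 0 L (-1) 1) p * F p @[m --> \oo] --> (0 : R)) ->
  Int (fun p => u p * 'D_v F p) = - Int (fun p => g p * F p).
Proof.
have h11 : (-1 : R) < 1 by lra.
move=> Hv Lu [Lg Hw] HF HK Hcv; have iu := L2_integ L0 Lu; have ig := L2_integ L0 Lg.
have cF := smooth_continuous HF; have cDF := smooth_derive_continuous (v := v) HF.
pose X m := @bump2 R m 0 L (-1) 1.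
have sX m : smooth setT (X m) by move=> k; exact: bump2_smooth.
have cX m := smooth_continuous (sX m).
have cDX m := smooth_derive_continuous (v := v) (sX m).
have [KF HKF] := cont_bounded L cF; have [KD HKD] := cont_bounded L cDF.
have X1 m p : `|X m p| <= 1 := bump2_le1 m 0 L (-1) 1 p.
have Xc p : S p -> X m p @[m --> \oo] --> (1 : R).
  move=> [p1 p2]; have := @bump2_cvg R 0 L (-1) 1 p L0 h11.
  by rewrite indicE mem_set//; split; rewrite /= in_itv.
have bnd (x k K' : R) : `|x| <= 1 -> `|k| <= K' -> `|x * k| <= K'.
  move=> x1 kK; rewrite normrM; apply: le_trans kK; exact: ler_piMl.
have c1 : Int (fun p => u p * ('D_v (X m) p * F p + X m p * 'D_v F p)) @[m --> \oo] --> Int (fun p => u p * 'D_v F p).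
  apply: (@Int_dct _ _ u (fun m p => 'D_v (X m) p * F p + X m p * 'D_v F p) _ (K + KD)) => //.
  - move=> m; apply: (continuous_nice L _).1 => p.
    by apply: cvgD; [exact: (continuous_mul (cDX m) cF)|exact: (continuous_mul (cX m) cDF)].
  - move=> m p Sp; apply: le_trans (ler_normD _ _) _; apply: lerD; first exact: HK.
    by apply: bnd; [exact: X1|apply: HKD; exact: strip_cstrip].
  - move=> p Sp; rewrite -[X in _ --> X]add0r -[X in _ --> _ + X]mul1r.
    by apply: cvgD; [exact: Hcv|apply: cvgM; [exact: Xc|exact: cvg_cst]].
have c2 : Int (fun p => g p * (X m p * F p)) @[m --> \oo] --> Int (fun p => g p * F p).
  apply: (@Int_dct _ _ g (fun m p => X m p * F p) _ KF) => //.
  - by move=> m; apply: (continuous_nice L _).1; exact: continuous_mul.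
  - by move=> m p Sp; apply: bnd; [exact: X1|apply: HKF; exact: strip_cstrip].
  - move=> p Sp; rewrite -[X in _ --> X]mul1r.
    by apply: cvgM; [exact: Xc|exact: cvg_cst].
have E m : Int (fun p => u p * ('D_v (X m) p * F p + X m p * 'D_v F p)) = - Int (fun p => g p * (X m p * F p)).
  have Ht := @bump_test R L m 0 L (-1) 1 F (lexx _) L0 (lexx _) (lexx _) h11 (lexx _) HF.
  rewrite -(Hw _ Ht); apply: Int_ext => p _; congr (_ * _).
  have dX : is_derive p v (X m) ('D_v (X m) p) by apply: (@Ck_is_derive _ _ 0 setT) => //; exact: (sX m 1%N).
  have dF : is_derive p v F ('D_v F p) by apply: (@Ck_is_derive _ _ 0 setT) => //; exact: (HF 1%N).
  exact/esym/is_derive_val/is_derive_mul.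
have c3 : - Int (fun p => g p * (X m p * F p)) @[m --> \oo] --> Int (fun p => u p * 'D_v F p).
  by under eq_fun do rewrite -E.
exact: (cvg_unique _ c3 (cvgN c2)).
Qed.

Lemma ibp_s (u g F : R * R -> R) (C : R) : L2 L u -> is_weak_derivative L (e1 R) u g -> smooth setT F ->
  (forall p, S p -> `|F p| <= C * (p.1 * (L - p.1))) ->
  Int (fun p => u p * 'D_(e1 R) F p) = - Int (fun p => g p * F p).
Proof.
move=> Lu Hg HF HC.
have DE m p : 'D_(e1 R) (bump2 m 0 L (-1) 1) p =
    flat 2 (m%:R * ((p.1 - 0) * (L - p.1)) - 1) * (m%:R * (0 + L - 2 * p.1)) * bump m (-1) 1 p.2.
  have d1 : is_derive p (e1 R) (fun q : R * R => bump m 0 L q.1) (flat 2 (m%:R * ((p.1 - 0) * (L - p.1)) - 1) * (m%:R * (0 + L - 2 * p.1)) * 1).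
    exact: (is_derive_fstc (e1 R) (is_derive_bump _ _ _ _)).
  have d2 : is_derive p (e1 R) (fun q : R * R => bump m (-1) 1 q.2) (flat 2 (m%:R * ((p.2 - -1) * (1 - p.2)) - 1) * (m%:R * (-1 + 1 - 2 * p.2)) * 0).
    exact: (is_derive_sndc (e1 R) (is_derive_bump _ _ _ _)).
  by rewrite (is_derive_val (is_derive_mul d1 d2)) !mulr0 addr0 mulr1.
have B1 m p : `|bump m (-1) 1 p.2 : R| <= 1.
  by have /andP[h1 h2] := bump_ge0_le1 m (-1 : R) 1 p.2; rewrite ger0_norm.
have HC' p : S p -> `|F p| <= C * ((p.1 - 0) * (L - p.1)) by move=> Sp; rewrite subr0; exact: HC.
have C0 : 0 <= C.
  have := HC _ strip_center; rewrite /= => h; have k0 : 0 < L / 2 * (L - L / 2).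
    by apply: mulr_gt0; rewrite ?divr_gt0// subr_gt0 ltr_pdivrMr// mulr_natr mulr2n ltrDl.

  by rewrite -(pmulr_lge0 _ k0); exact: le_trans h.
apply: (@ibp_test (e1 R) u g F (C * L * 4)) => //; first by left.
- move=> m p Sp; rewrite DE mulrAC normrM; apply: le_trans (ler_piMr _ (B1 _ m p)) _ => //.
  have [s12 _] := Sp; apply: le_trans (bump_slope_le m L0 s12 (HC' p Sp)) _.
  rewrite subr0 ler_wpM2l//; first by rewrite mulr_ge0// ltW.
  by have := flat2_lin (m%:R * ((p.1 - 0) * (L - p.1)) - 1); rewrite subrK.
- move=> p Sp; have [s12 t12] := Sp.
  have c2 : bump m (-1) 1 p.2 @[m --> \oo] --> (1 : R).
    by have := @bump_cvg R (-1) 1 p.2; rewrite t12; apply; lra.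
  have H := cvgM (bump_slope_cvg L0 s12 (HC' p Sp)) c2; rewrite mul0r in H.
  by under eq_fun do rewrite DE mulrAC; exact: H.
Qed.

Lemma ibp_t (u g F : R * R -> R) (C : R) : L2 L u -> is_weak_derivative L (e2 R) u g -> smooth setT F ->
  (forall p, S p -> `|F p| <= C * ((p.2 + 1) * (1 - p.2))) ->
  Int (fun p => u p * 'D_(e2 R) F p) = - Int (fun p => g p * F p).
Proof.
have h11 : (-1 : R) < 1 by lra.
move=> Lu Hg HF HC.
have DE m p : 'D_(e2 R) (bump2 m 0 L (-1) 1) p =
    flat 2 (m%:R * ((p.2 - -1) * (1 - p.2)) - 1) * (m%:R * (-1 + 1 - 2 * p.2)) * bump m 0 L p.1.
  have d1 : is_derive p (e2 R) (fun q : R * R => bump m 0 L q.1) (flat 2 (m%:R * ((p.1 - 0) * (L - p.1)) - 1) * (m%:R * (0 + L - 2 * p.1)) * 0).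
    exact: (is_derive_fstc (e2 R) (is_derive_bump _ _ _ _)).
  have d2 : is_derive p (e2 R) (fun q : R * R => bump m (-1) 1 q.2) (flat 2 (m%:R * ((p.2 - -1) * (1 - p.2)) - 1) * (m%:R * (-1 + 1 - 2 * p.2)) * 1).
    exact: (is_derive_sndc (e2 R) (is_derive_bump _ _ _ _)).
  by rewrite (is_derive_val (is_derive_mul d1 d2)) mulr0 mul0r add0r mulr1 mulrC.
have B1 m p : `|bump m 0 L p.1 : R| <= 1.
  by have /andP[h1 h2] := bump_ge0_le1 m (0 : R) L p.1; rewrite ger0_norm.
have HC' p : S p -> `|F p| <= C * ((p.2 - -1) * (1 - p.2)) by move=> Sp; rewrite opprK; exact: HC.
have C0 : 0 <= C.
  by have := HC _ strip_center; rewrite /= add0r subr0 !mulr1; exact: le_trans.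
apply: (@ibp_test (e2 R) u g F (C * 2 * 4)) => //; first by right.
- move=> m p Sp; rewrite DE mulrAC normrM; apply: le_trans (ler_piMr _ (B1 _ m p)) _ => //.
  have [_ t12] := Sp; apply: le_trans (bump_slope_le m h11 t12 (HC' p Sp)) _.
  rewrite (_ : 1 - -1 = 2 :> R); last by ring.
  rewrite ler_wpM2l//; first by rewrite mulr_ge0.
  by have := flat2_lin (m%:R * ((p.2 - -1) * (1 - p.2)) - 1); rewrite subrK.
- move=> p Sp; have [s12 t12] := Sp.
  have c2 : bump m 0 L p.1 @[m --> \oo] --> (1 : R).
    by have := @bump_cvg R 0 L p.1; rewrite s12; apply.
  have H := cvgM (bump_slope_cvg h11 t12 (HC' p Sp)) c2; rewrite mul0r in H.
  by under eq_fun do rewrite DE mulrAC; exact: H.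
Qed.

Lemma ibp_mode_s (u g : R * R -> R) i : L2 L u -> is_weak_derivative L (e1 R) u g ->
  Int (fun p => u p * (i.1%:R * (pi / L) * mode L i p)) = - Int (fun p => g p * (sinl L i.1 p.1 * cosl 2 i.2 (p.2 + 1))).
Proof.
move=> Lu Hg; rewrite -(@ibp_s u g _ (i.1%:R * (2 * pi / L ^+ 2)) Lu Hg).
- apply: Int_ext => p _; congr (_ * _); apply/esym/is_derive_val.
  have d1 : is_derive p (e1 R) (fun q : R * R => sinl L i.1 q.1) (i.1%:R * (pi / L) * cosl L i.1 p.1 * 1).
    exact: (is_derive_fstc (e1 R) (is_derive_sinl _ _ _)).
  have d2 : is_derive p (e1 R) (fun q : R * R => cosl 2 i.2 (q.2 + 1)) (- (i.2%:R * (pi / 2)) * sinl 2 i.2 (p.2 + 1) * 0).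
    exact: (@is_derive_sndc _ (fun y => cosl 2 i.2 (y + 1)) _ (e1 R) _ (is_derive_shift1 (is_derive_cosl _ _ _))).
  by have := is_derive_mul d1 d2; rewrite !mulr0 addr0 mulr1 -mulrA.
- by apply: tensor_smooth => l; [exact: sinl_Ck|exact: cosl_Ck].
- move=> p [/andP[p1 p2] _]; rewrite normrM; apply: le_trans (ler_piMr _ (cosl_le1 _ _ _)) _ => //.
  by apply: sinl_ends => //; rewrite !ltW.
Qed.

Lemma ibp_mode_t (u g : R * R -> R) i : L2 L u -> is_weak_derivative L (e2 R) u g ->
  Int (fun p => u p * (i.2%:R * (pi / 2) * mode L i p)) = - Int (fun p => g p * (cosl L i.1 p.1 * sinl 2 i.2 (p.2 + 1))).
Proof.
move=> Lu Hg; rewrite -(@ibp_t u g _ (i.2%:R * (2 * pi / 2 ^+ 2)) Lu Hg).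
- apply: Int_ext => p _; congr (_ * _); apply/esym/is_derive_val.
  have d1 : is_derive p (e2 R) (fun q : R * R => cosl L i.1 q.1) (- (i.1%:R * (pi / L)) * sinl L i.1 p.1 * 0).
    exact: (is_derive_fstc (e2 R) (is_derive_cosl _ _ _)).
  have d2 : is_derive p (e2 R) (fun q : R * R => sinl 2 i.2 (q.2 + 1)) (i.2%:R * (pi / 2) * cosl 2 i.2 (p.2 + 1) * 1).
    exact: (@is_derive_sndc _ (fun y => sinl 2 i.2 (y + 1)) _ (e2 R) _ (is_derive_shift1 (is_derive_sinl _ _ _))).
  by have := is_derive_mul d1 d2; rewrite !mulr0 mul0r add0r mulr1 mulrCA.
- by apply: tensor_smooth => l; [exact: cosl_Ck|exact: sinl_Ck].
- move=> p [_ /andP[p1 p2]]; rewrite normrM; apply: le_trans (ler_piMl _ (cosl_le1 _ _ _)) _ => //.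
  apply: le_trans (sinl_ends _ _ _) _ => //; first by apply/andP; split; lra.
  by rewrite le_eqVlt; apply/orP; left; apply/eqP; ring.
Qed.

End IntegrationByParts.

(** * Integrals against cosine modes *)

Section ModeIntegrals.
Context {R : realType}.
Let MR : measurableType _ := measurableTypeR R.
Let T2 : measurableType _ := (MR * MR)%type.
Variable L : R.
Hypothesis L0 : 0 < L.
Local Notation S := (strip L).
Local Notation mu := (@leb2 R).
Local Notation "'Int' u" := (\int[mu]_(p in S) u p) (at level 10, u at level 9).
Implicit Types (u g h F : R * R -> R) (i : nat * nat).

(** The class of multipliers: their products with integrable functions are integrable, and all
    functions paired with the eigenfunction and its weak derivatives belong to it. *)
Definition nice u : Prop := measurable_fun (S : set T2) u /\ exists K, forall p, S p -> `|u p| <= K.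

Lemma nice_continuous u : continuous u -> nice u.
Proof. exact: continuous_nice. Qed.

Lemma nice_cst (c : R) : nice (fun _ => c).
Proof. by apply: nice_continuous => x; exact: cvg_cst. Qed.

Lemma nice_add u h : nice u -> nice h -> nice (fun p => u p + h p).
Proof.
move=> [mu' [K HK]] [mh [K' HK']]; split; first exact: measurable_funD.
by exists (K + K') => p Sp; apply: le_trans (ler_normD _ _) _; apply: lerD; [exact: HK|exact: HK'].
Qed.

Lemma nice_mul u h : nice u -> nice h -> nice (fun p => u p * h p).
Proof.
move=> [mu' [K HK]] [mh [K' HK']]; split; first exact: measurable_funM.
by exists (K * K') => p Sp; rewrite normrM; apply: ler_pM => //; [exact: HK|exact: HK'].
Qed.

Lemma nice_scale (c : R) u : nice u -> nice (fun p => c * u p).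
Proof. by move=> Hu; apply: nice_mul => //; exact: nice_cst. Qed.

Lemma nice_sub u h : nice u -> nice h -> nice (fun p => u p - h p).
Proof.
move=> Hu Hh; rewrite (_ : (fun p => _) = fun p => u p + (-1) * h p); last by apply/funext => p; rewrite mulN1r.
by apply: nice_add => //; exact: nice_scale.
Qed.

Lemma nice_integ u h : integ L u -> nice h -> integ L (fun p => u p * h p).
Proof. by move=> iu [mh [K HK]]; exact: (integ_mul iu mh HK). Qed.

Lemma nice_integ1 u : nice u -> integ L u.
Proof. by move=> [mh [K HK]]; exact: (integ_bounded L0 mh HK). Qed.

Lemma nice_L2 u : nice u -> L2 L u.
Proof. by move=> [mh [K HK]]; exact: (bounded_L2 L0 mh HK). Qed.

Lemma nice_mode i : nice (mode L i).
Proof. apply: nice_continuous; apply: smooth_continuous; exact: mode_smooth. Qed.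

Lemma nice_eval (l : seq (R * (nat * nat))) (phi : nat * nat -> R * R -> R) :
  (forall i, nice (phi i)) -> nice (eval phi l).
Proof.
move=> Hphi; elim: l => [|e l IH].
  by rewrite (_ : eval _ _ = fun _ => 0); [exact: nice_cst|apply/funext => p; rewrite /eval big_nil].
rewrite (_ : eval _ _ = fun p => e.1 * phi e.2 p + eval phi l p); last by apply/funext => p; rewrite eval_cons.
by apply: nice_add => //; exact: nice_scale.
Qed.

Lemma wiener_nice (w : nat * nat -> R) u M : (forall i, 1 <= w i) -> wiener (cstrip L) (mode L) w u M -> nice u.
Proof.
move=> w1 Hu; have W1 i p : cstrip L p -> `|mode L i p| <= 1 by move=> _; exact: mode_le1.
split; last by exists M => p /strip_cstrip; exact: (wiener_bound W1 w1 Hu).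
have d0 n : 0 < n.+1%:R^-1 :> R by rewrite invr_gt0.
have ex n : exists l, forall p, cstrip L p -> `|u p - eval (mode L) l p| <= n.+1%:R^-1.
  by have [l _ Hl] := Hu _ (d0 n); exists l.
have [l Hl] := choice ex.
apply: (@measurable_fun_cvg _ T2 R S (fun n => eval (mode L) (l n))).
  by move=> n; have [] := nice_eval (l n) nice_mode.
move=> p Sp; apply/cvgrPdist_le => e e0.
exists (Num.truncn e^-1).+1 => // n /= en.
apply: le_trans (Hl n p (strip_cstrip Sp)) _; rewrite -[leRHS]invrK lef_pV2 ?posrE ?invr_gt0//.
apply: le_trans (ltW (truncnS_gt _)) _; rewrite ler_nat; exact: leqW.
Qed.

Definition functional u h : R := Int (fun p => u p * h p).

Lemma functional_bounded u : integ L u -> bounded_functional S nice (functional u) (Int (fun p => `|u p|)).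
Proof.
move=> iu; split=> [h h' Hh Hh'|a h Hh|h M [mh _] HM].
- rewrite /functional -Int_add; [|exact: nice_integ|exact: nice_integ].
  by apply: Int_ext => p _; rewrite mulrDr.
- rewrite /functional -Int_scale; last exact: nice_integ.
  by apply: Int_ext => p _; rewrite mulrCA.
- by rewrite mulrC; exact: (Int_bound iu mh HM).
Qed.

Lemma functional_sum u (l : seq (R * (nat * nat))) (phi : nat * nat -> R * R -> R) : integ L u ->
  (forall i, nice (phi i)) -> functional u (eval phi l) = \sum_(e <- l) e.1 * functional u (phi e.2).
Proof.
move=> iu Hphi; apply: (functional_eval (nice_cst 0) nice_add nice_scale _ (functional_bounded iu)) => //.
Qed.

(** A function and its primitive have to be approximated simultaneously; [Q] allows the primitive a
    different constant. *)
Lemma ibp_limit (Q : R) u g h F : integ L u -> integ L g -> nice h -> nice F ->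
  (forall d, 0 < d -> exists h' F', [/\ nice h', nice F', (forall p, S p -> `|h p - h' p| <= d),
     (forall p, S p -> `|F p - F' p| <= Q * d) & functional u h' = - functional g F']) ->
  functional u h = - functional g F.
Proof.
move=> iu ig nh nF H; apply/eqP; rewrite -subr_eq0 opprK -normr_le0.
apply/ler_addgt0Pr => e e0; rewrite add0r.
pose B := Int (fun p => `|u p|) + Int (fun p => `|g p|) * `|Q|.
have B0 : 0 <= B by rewrite addr_ge0// ?mulr_ge0// Int_norm_ge0.
have d0 : 0 < e / (B + 1) by rewrite divr_gt0// ltr_wpDl.
have [h' [F' [nh' nF' Hh HF E]]] := H _ d0; set d := e / (B + 1) in Hh HF d0.
have fu := functional_bounded iu; have fg := functional_bounded ig.
have su := functional_sub nice_scale fu nh nh'.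
have sg := functional_sub nice_scale fg nF nF'.
have [_ _ bu] := fu; have [_ _ bg] := fg.
have h1 := bu _ _ (nice_sub nh nh') Hh; have h2 := bg _ _ (nice_sub nF nF') HF.
rewrite su in h1; rewrite sg in h2.
have -> : functional u h + functional g F = (functional u h - functional u h') + (functional g F - functional g F').
  by rewrite E; ring.
apply: le_trans (ler_normD _ _) _; apply: le_trans (lerD h1 h2) _.
apply: le_trans (_ : B * d <= _); last first.
  rewrite /d mulrCA; apply: ler_piMr; first exact: ltW.
  by rewrite ler_pdivrMr ?mul1r ?lerDl ?ltr_wpDl.
rewrite /B mulrDl lerD2l -mulrA ler_wpM2l// ?Int_norm_ge0//.
by rewrite ler_wpM2r ?ler_norm// ltW.
Qed.

Let pi_neq0 : pi != 0 :> R. Proof. by rewrite gt_eqF// pi_gt0. Qed.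
Let L_neq0 : L != 0. Proof. by rewrite gt_eqF. Qed.

Lemma sin_cos_nice j k : nice (fun p => sinl L j p.1 * cosl 2 k (p.2 + 1)).
Proof. by apply/nice_continuous/smooth_continuous/tensor_smooth => l; [exact: sinl_Ck|exact: cosl_Ck]. Qed.

Lemma cos_sin_nice j k : nice (fun p => cosl L j p.1 * sinl 2 k (p.2 + 1)).
Proof. by apply/nice_continuous/smooth_continuous/tensor_smooth => l; [exact: cosl_Ck|exact: sinl_Ck]. Qed.

Lemma sinl0 l k : sinl l k 0 = 0 :> R.
Proof. by rewrite /sinl mulr0 mul0r mulr0 sin0. Qed.

Lemma sinl_end (l : R) k : l != 0 -> sinl l k l = 0.
Proof. by move=> l0; rewrite /sinl mulfK// natpi_sin. Qed.

(* ln x p is the point p with the coordinate tr p replaced by x, and z the set of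
   modes that do not depend on this coordinate.  Their contribution c to an
   approximation of h is small because the integral of h along each line is 0. *)
Lemma ibp_W2 (w : nat * nat -> R) (M M' a b : R) u g h F (z : pred (nat * nat)) (sc : nat * nat -> R * R -> R)
    (tr : R * R -> R) (ln : R -> R * R -> R * R) : a < b -> (forall i, 1 <= w i) -> integ L u -> integ L g ->
  wiener (cstrip L) (mode L) w h M -> wiener (cstrip L) (mode L) w F M' ->
  (forall p, S p -> [/\ a <= tr p <= b, ln (tr p) p = p & forall x, a <= x <= b -> cstrip L (ln x p)]) ->
  (forall i p (x : R), z i -> mode L i (ln x p) = mode L i p) ->
  (forall i, ~~ z i -> [/\ nice (sc i), functional u (mode L i) = - functional g (sc i),
     forall p (x : R), is_derive x 1 (fun x => sc i (ln x p)) (mode L i (ln x p)) &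
     forall p, sc i (ln a p) = 0 /\ sc i (ln b p) = 0]) ->
  (forall p (x : R), S p -> a <= x <= b -> is_derive x 1 (fun x => F (ln x p)) (h (ln x p))) ->
  (forall p, S p -> F (ln a p) = 0 /\ F (ln b p) = 0) ->
  functional u h = - functional g F.
Proof.
move=> ab w1 iu ig Wh WF Hln Hz Hsc dF F0.
have nh := wiener_nice w1 Wh; have nF := wiener_nice w1 WF.
apply: (@ibp_limit (b - a) u g h F iu ig nh nF) => d d0.
have d20 : 0 < d / 2 by rewrite divr_gt0.
have [l _ Hl] := Wh _ d20.
pose l1 := [seq e <- l | ~~ z e.2].
pose sc1 i p := if z i then 0 else sc i p.
have nsc i : nice (sc1 i) by rewrite /sc1; case: (boolP (z i)) => [_|/Hsc[]//]; exact: nice_cst.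
pose c p : R := \sum_(e <- l | z e.2) e.1 * mode L e.2 p.
have evE p : eval (mode L) l p = eval (mode L) l1 p + c p.
  by rewrite /eval /l1 /c big_filter (bigID (fun e : R * (nat * nat) => z e.2)) /= addrC.
have key p : S p -> `|c p| <= d / 2 /\ forall x, a <= x <= b -> `|F (ln x p) - eval sc1 l1 (ln x p)| <= 2 * (d / 2) * (b - a).
  move=> Sp; have [_ _ cln] := Hln p Sp; have [Fa Fb] := F0 p Sp.
  have cE x : c (ln x p) = c p by rewrite /c; apply: eq_bigr => e ze; rewrite Hz.
  have sc0 x : (forall i, ~~ z i -> sc i (ln x p) = 0) -> eval sc1 l1 (ln x p) = 0.
    by move=> H; rewrite /eval /l1 big_filter big1// => e ze; rewrite /sc1 (negbTE ze) H// mulr0.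
  apply: (@mvt_ends _ (fun x => F (ln x p) - eval sc1 l1 (ln x p)) (fun x => h (ln x p) - eval (mode L) l (ln x p)) a b) => //.
  - move=> x xab; rewrite (_ : _ + c p = h (ln x p) - eval (mode L) l1 (ln x p)); last by rewrite evE cE; ring.
    apply: is_derive_sub; first exact: dF.
    rewrite /eval /l1 [X in is_derive _ _ _ X](_ : _ = \sum_(e <- [seq e <- l | ~~ z e.2]) (if z e.2 then 0 else e.1 * mode L e.2 (ln x p))); last first.
      by rewrite !big_filter; apply: eq_bigr => e /negbTE ->.
    apply: is_derive_sum_seq => e; rewrite /sc1; case: (boolP (z e.2)) => [_|/Hsc[_ _ H _]]; last exact: is_derive_scale.
    by rewrite mulr0; exact: is_derive_cst_fun.
  - by move=> x xab; apply: Hl; exact: cln.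
  - by rewrite Fa sc0 ?subr0// => i /Hsc[_ _ _ /(_ p)[]].
  - by rewrite Fb sc0 ?subr0// => i /Hsc[_ _ _ /(_ p)[]].
exists (eval (mode L) l1), (eval sc1 l1); split.
- exact/nice_eval/nice_mode.
- exact: nice_eval.
- move=> p Sp; have [c1 _] := key p Sp; have := Hl p (strip_cstrip Sp); rewrite evE => h1.
  rewrite (_ : _ - _ = h p - (eval (mode L) l1 p + c p) + c p); last by ring.
  by apply: le_trans (ler_normD _ _) _; rewrite [leRHS]splitr; exact: lerD.
- move=> p Sp; have [trp lnp _] := Hln p Sp; have [_ /(_ _ trp)] := key p Sp.
  by rewrite lnp mulrC [2 * _]mulrC divfK.
- rewrite (functional_sum _ iu); last exact: nice_mode.
  rewrite (functional_sum _ ig)// -sumrN /l1 !big_filter; apply: eq_bigr => e /[dup] ze /Hsc[_ H _ _].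
  by rewrite H mulrN (_ : sc1 e.2 = sc e.2)// /sc1 (negbTE ze).
Qed.

Lemma functional_scaled u h (c : R) : integ L u -> nice h -> functional u (fun p => c * h p) = c * functional u h.
Proof. by move=> iu nh; have [_ H _] := functional_bounded iu; exact: H. Qed.

(** Finite approximations of [h] are integrated mode by mode, with sines as primitives, which vanish
    at both ends like [F]; hence no boundary terms. *)
Lemma ibp_W2_s (w : nat * nat -> R) (M M' : R) u g h F : (forall i, 1 <= w i) ->
  L2 L u -> is_weak_derivative L (e1 R) u g ->
  wiener (cstrip L) (mode L) w h M -> wiener (cstrip L) (mode L) w F M' ->
  (forall s t, cstrip L (s, t) -> is_derive s 1 (fun s => F (s, t)) (h (s, t))) ->
  (forall t, -1 <= t <= 1 -> F (0, t) = 0 /\ F (L, t) = 0) ->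
  functional u h = - functional g F.
Proof.
move=> w1 Lu Hg Wh WF dF F0.
have iu := L2_integ L0 Lu; have ig : integ L g by case: Hg => /(L2_integ L0).
apply: (@ibp_W2 w M M' 0 L u g h F (fun i => i.1 == 0%N)
  (fun i p => (i.1%:R * (pi / L))^-1 * (sinl L i.1 p.1 * cosl 2 i.2 (p.2 + 1))) fst (fun x p => (x, p.2)) L0 w1 iu ig Wh WF).
- by move=> p /strip_cstrip[p1 p2]; rewrite -surjective_pairing; split.
- by move=> i p x /eqP i0; rewrite /mode i0 !cosl0.
- move=> i i0; have k0 : i.1%:R * (pi / L) != 0 by rewrite !mulf_neq0 ?invr_eq0 ?pnatr_eq0.
  split=> [||p x|p] /=.
  + exact: nice_scale (sin_cos_nice _ _).
  + rewrite functional_scaled//; last exact: sin_cos_nice.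
    rewrite -mulrN -[- functional _ _](ibp_mode_s L0 i Lu Hg) -[X in _ * X]/(functional u _) functional_scaled//.
      by rewrite mulKf.
    exact: nice_mode.
  + have -> : mode L i (x, p.2) = (i.1%:R * (pi / L))^-1 * ((i.1%:R * (pi / L) * cosl L i.1 x) * cosl 2 i.2 (p.2 + 1) + sinl L i.1 x * 0).
      by rewrite mulr0 addr0 -mulrA mulKf.
    exact: (is_derive_scale _ (is_derive_mul (is_derive_sinl _ _ _) (is_derive_cst_fun _ _ _))).
  + by rewrite sinl0 sinl_end// !mul0r mulr0.
- by move=> p x /strip_cstrip[_ p2] xL; apply: dF.
- by move=> p /strip_cstrip[_ p2]; exact: F0.
Qed.

Lemma ibp_W2_t (w : nat * nat -> R) (M M' : R) u g h F : (forall i, 1 <= w i) ->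
  L2 L u -> is_weak_derivative L (e2 R) u g ->
  wiener (cstrip L) (mode L) w h M -> wiener (cstrip L) (mode L) w F M' ->
  (forall s t, cstrip L (s, t) -> is_derive t 1 (fun t => F (s, t)) (h (s, t))) ->
  (forall s, 0 <= s <= L -> F (s, -1) = 0 /\ F (s, 1) = 0) ->
  functional u h = - functional g F.
Proof.
have h11 : (-1 : R) < 1 by lra.
move=> w1 Lu Hg Wh WF dF F0.
have iu := L2_integ L0 Lu; have ig : integ L g by case: Hg => /(L2_integ L0).
apply: (@ibp_W2 w M M' (-1) 1 u g h F (fun i => i.2 == 0%N)
  (fun i p => (i.2%:R * (pi / 2))^-1 * (cosl L i.1 p.1 * sinl 2 i.2 (p.2 + 1))) snd (fun x p => (p.1, x)) h11 w1 iu ig Wh WF).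
- by move=> p /strip_cstrip[p1 p2]; rewrite -surjective_pairing; split.
- by move=> i p x /eqP i0; rewrite /mode i0 !cosl0.
- move=> i i0; have k0 : i.2%:R * (pi / 2) != 0 :> R by rewrite !mulf_neq0 ?invr_eq0 ?pnatr_eq0.
  split=> [||p x|p] /=.
  + exact: nice_scale (cos_sin_nice _ _).
  + rewrite functional_scaled//; last exact: cos_sin_nice.
    rewrite -mulrN -[- functional _ _](ibp_mode_t L0 i Lu Hg) -[X in _ * X]/(functional u _) functional_scaled//.
      by rewrite mulKf.
    exact: nice_mode.
  + have -> : mode L i (p.1, x) = (i.2%:R * (pi / 2))^-1 * (cosl L i.1 p.1 * (i.2%:R * (pi / 2) * cosl 2 i.2 (x + 1))).
      by rewrite mulrCA mulKf.
    exact: (is_derive_scale _ (is_derive_scale _ (is_derive_shift1 (is_derive_sinl _ _ _)))).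
  + by rewrite addNr sinl0 (_ : 1 + 1 = 2 :> R)// sinl_end ?pnatr_eq0// !mulr0.
- by move=> p x /strip_cstrip[p1 _] xL; apply: dF.
- by move=> p /strip_cstrip[p1 _]; exact: F0.
Qed.

Lemma weak_cst (v : R * R) : v = e1 R \/ v = e2 R -> is_weak_derivative L v (fun _ => 1) (fun _ => 0).
Proof.
move=> Hv; have := smooth_weak L0 Hv (@cst_smooth R (R * R)%type 1).
rewrite (_ : 'D_v (fun _ : R * R => 1 : R) = fun _ => 0)//; apply/funext => p.
exact: is_derive_val (is_derive_cst_fun 1 p v).
Qed.

(** Integration by parts against the constant 1, whose weak derivatives are 0, shows that a nonzero
    frequency times the integral vanishes. *)
Lemma Int_mode i : Int (mode L i) = if i == (0, 0)%N then L * 2 else 0.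
Proof.
have L1 : L2 L (fun _ => 1) by exact/nice_L2/nice_cst.
have Z : Int (fun p => 0 * (sinl L i.1 p.1 * cosl 2 i.2 (p.2 + 1))) = 0.
  by rewrite (Int_ext (v := fun _ => 0)) ?Int_cst ?mul0r// => p _; rewrite mul0r.
have Z' : Int (fun p => 0 * (cosl L i.1 p.1 * sinl 2 i.2 (p.2 + 1))) = 0.
  by rewrite (Int_ext (v := fun _ => 0)) ?Int_cst ?mul0r// => p _; rewrite mul0r.
case: (eqVneq i (0, 0)%N) => [->|i0].
  rewrite (Int_ext (v := fun _ => 1)) ?Int_cst ?mul1r// => p _.
  by rewrite /mode !cosl0 mulr1.
have im := nice_integ1 (nice_mode i).
have [j0|j0] := eqVneq i.1 0%N.
  have k0 : i.2 != 0%N by apply: contra_neq i0 => k0; rewrite [i]surjective_pairing j0 k0.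
  have H : (i.2%:R * (pi / 2)) * Int (mode L i) = 0.
    rewrite -Int_scale// -[RHS]oppr0 -Z' -(ibp_mode_t L0 i L1 (weak_cst (or_intror erefl))).
    by apply: Int_ext => p _; rewrite mul1r.
  by apply/eqP; move/eqP: H; rewrite !mulf_eq0 pnatr_eq0 (negbTE k0) (negbTE pi_neq0) invr_eq0 pnatr_eq0 /=.
have H : (i.1%:R * (pi / L)) * Int (mode L i) = 0.
  rewrite -Int_scale// -[RHS]oppr0 -Z -(ibp_mode_s L0 i L1 (weak_cst (or_introl erefl))).
  by apply: Int_ext => p _; rewrite mul1r.
by apply/eqP; move/eqP: H; rewrite !mulf_eq0 pnatr_eq0 (negbTE j0) (negbTE pi_neq0) invr_eq0 (negbTE L_neq0) /=.
Qed.

Definition mode_norm i : R := functional (mode L i) (mode L i).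

Lemma Int_mode_mul i i' : functional (mode L i) (mode L i') =
  \sum_(e <- mode_mul i i') e.1 * (if e.2 == (0, 0)%N then L * 2 else 0).
Proof.
have i1 : integ L (fun _ => 1) := integ_cst L0 1.
transitivity (functional (fun _ => 1) (eval (mode L) (mode_mul i i'))).
  by apply: Int_ext => p _; rewrite mode_mulE mul1r.
rewrite (functional_sum _ i1); last exact: nice_mode.
apply: eq_bigr => e _; congr (_ * _); rewrite -Int_mode.
by apply: Int_ext => p _; rewrite mul1r.
Qed.

Lemma mode_orth i i' : functional (mode L i) (mode L i') = if i == i' then mode_norm i else 0.
Proof.
case: eqP => [->//|/eqP ii]; rewrite Int_mode_mul /mode_mul !big_cons big_nil /=.
move: ii; case: i => j k; case: i' => j' k'; rewrite !xpair_eqE /= => ii.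
by do 4 (case: ifP => [|_]; first (by move=> /andP[/eqP h1 /eqP h2]; case/negP: ii; apply/andP; split; apply/eqP; lia)); rewrite !mulr0 !addr0.
Qed.

Lemma mode_norm_ge i : L / 2 <= mode_norm i.
Proof.
rewrite /mode_norm Int_mode_mul /mode_mul !big_cons big_nil /= subnn /=.
rewrite (subnn i.2) !addn0 addr0 eqxx.
have H b : 0 <= 4^-1 * (if b then L * 2 else 0) :> R.
  by case: b; rewrite ?mulr0// mulr_ge0// ?invr_ge0// mulr_ge0// ltW.
apply: le_trans (_ : 4^-1 * (L * 2) <= _); first by rewrite le_eqVlt; apply/orP; left; apply/eqP; field.
by rewrite lerDl; apply: addr_ge0; [exact: H|apply: addr_ge0; exact: H].
Qed.

End ModeIntegrals.

(** * Rescaled slices of functions near the curve *)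

Section Slices.
Context {R : realType}.
Variables (g L : R).
Hypothesis g01 : 0 <= g < 1.
Hypothesis L0 : 0 < L.
Implicit Types (F H : 'rV[R]_2 -> R).
Local Notation W2 := (wiener (cstrip L) (mode L) (wt2 g)).

Lemma is_derive_pt0 F (s t d : R) : is_derive (pt s t) (e_ 0) F d -> is_derive s 1 (fun s => F (pt s t)) d.
Proof.
move=> /is_derive_epsP H; apply/is_derive_epsP => e /H[r r0 {}H].
exists r => // h /H; rewrite (_ : h *: e_ 0 + pt s t = pt (h *: 1 + s) t)//.
apply/rowP => i; rewrite !mxE /= [h%:A]mulr1; case: i => [[|[|//]] Hi] /=; last by rewrite mulr0 add0r.
by rewrite mulr1.
Qed.

Lemma is_derive_slice F (s t e d : R) : is_derive (pt s (e * t)) (e_ 1) F d ->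
  is_derive t 1 (fun t => F (pt s (e * t))) (e * d).
Proof.
move=> /is_derive_pt1 H; rewrite mulrC; apply: (@is_derive_comp1 _ _ (fun y : R => F (pt s y)) (fun t : R => e * t) t 1 d e H).
exact: is_derive_lin.
Qed.

Lemma tube_open b r : open (tube b r : set 'rV[R]_2).
Proof. exact: slab_open. Qed.

Lemma slab_bounded (a b r : R) (U : set 'rV[R]_2) F : (forall p, U p -> {for p, continuous F}) ->
  (forall s t, a <= s <= b -> `|t| <= r -> U (pt s t)) ->
  exists B, forall s t, a <= s <= b -> `|t| <= r -> `|F (pt s t)| <= B.
Proof.
move=> cF HU.
pose K : set 'rV[R]_2 := [set p | forall i, (if i == 0 then `[a, b]%classic else `[-r, r]%classic) (p ord0 i)].
have cK : compact K.
  apply: (@rV_compact R 2 (fun i => if i == 0 then `[a, b]%classic else `[-r, r]%classic)) => i.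
  by case: ifP => _; exact: segment_compact.
have KU p : K p -> U p.
  move=> Kp; rewrite (ptE p); have := Kp 0; have := Kp 1; rewrite /= !in_itv /= => h1 h2; apply: HU => //.
  by rewrite ler_norml.
have /compact_bounded[M [_ HM]] : compact (F @` K).
  apply: continuous_compact => //; apply: continuous_in_subspaceT => p; rewrite inE => Kp.
  exact/cF/KU.
exists (M + 1) => s t sab tr; apply: (HM (M + 1)); first by rewrite ltrDl.
exists (pt s t) => // i; rewrite mxE; case: ifP => _ /=; rewrite in_itv /= //.
by rewrite -ler_norml.
Qed.

Definition pd_iter (a b : nat) H := iter b (pd 1) (iter a (pd 0) H).

Lemma pd_iter_Ck a b m (U : set 'rV[R]_2) H : Ck (b + (a + m)) U H -> Ck m U (pd_iter a b H).
Proof.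
have iterC c k i F : Ck (c + k) U F -> Ck k U (iter c (pd i) F).
  elim: c k => [//|c IH] k /= HF; apply: Ck_derive; apply: IH.
  by rewrite addnS.
by move=> HH; apply: (iterC b); apply: (iterC a); rewrite addnCA.
Qed.

Lemma pd_iter_axis a (r : R) H : Ck a (tube L r) H -> 0 < r ->
  (forall s : R, - r < s < L + r -> H (pt s 0) = 0) ->
  forall s : R, - r < s < L + r -> iter a (pd 0) H (pt s 0) = 0.
Proof.
move=> HC r0 H0; elim: a HC => [//|a IH] HC s sr /=.
have {}IH := IH (Ck_pred HC).
have Us : tube L r (pt s 0) by rewrite /tube /= pt0 pt1 normr0.
have Ca : Ck 1 (tube L r) (iter a (pd 0) H).
  by have := @pd_iter_Ck a 0 1 (tube L r) H; rewrite add0n addn1; apply.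
have d1 := is_derive_pt0 (Ck_is_derive (e_ 0) Ca Us).
have d0 : is_derive s 1 (fun s : R => iter a (pd 0) H (pt s 0)) 0.
  apply: near_eq_is_derive (is_derive_cst_fun 0 s 1).
  near=> z; rewrite IH//.
  by apply/andP; split; near: z; case/andP: sr => h1 h2; [exact: lt_nbhsr|exact: lt_nbhsl].
by rewrite /pd -(is_derive_val d1) (is_derive_val d0).
Unshelve. all: by end_near. Qed.

(** Each derivative of the slice in [t] brings a factor [e]. If [H] vanishes on the axis, so do its
    derivatives along the axis, and the mean value theorem in [t] supplies the factor when no
    derivative in [t] is taken. *)
Lemma W2_slice (r : R) H : 0 < r -> Ck 5 (tube L r) H ->
  exists2 C, 0 <= C & forall e, 0 < e -> e <= 1 -> e <= r / 2 ->
    W2 (fun p => H (pt p.1 (e * p.2))) C /\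
    ((forall s : R, - r < s < L + r -> H (pt s 0) = 0) -> W2 (fun p => H (pt p.1 (e * p.2))) (C * e)).
Proof.
move=> r0 HC.
have [C0 HW] := W2_C22 g01 L0.
have Cab m a b : (b + (a + m) <= 5)%N -> Ck m (tube L r) (pd_iter a b H).
  by move=> le5; apply: pd_iter_Ck; exact: Ck_le HC.
have inU s t : 0 <= s <= L -> `|t| <= r / 2 -> tube L r (pt s t).
  move=> /andP[s1 s2] t1; rewrite /tube /= pt0 pt1; split; last by apply: le_lt_trans t1 _; rewrite ltr_pdivrMr// mulr_natr mulr2n ltrDl.
  by apply/andP; split; [apply: lt_le_trans s1; rewrite oppr_lt0|apply: le_lt_trans s2 _; rewrite ltrDl].
have bd a b : exists B, (a <= 2)%N -> (b <= 2)%N -> forall s t, 0 <= s <= L -> `|t| <= r / 2 -> `|pd_iter a b H (pt s t)| <= B.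
  case: (boolP (a <= 2)%N) => [a2|_]; last by exists 0.
  case: (boolP (b <= 2)%N) => [b2|_]; last by exists 0.
  have [B HB] := @slab_bounded 0 L (r / 2) (tube L r) (pd_iter a b H) (fun p => Ck_continuous (Cab 0%N a b ltac:(clear -a2 b2; lia))) inU.
  by exists B.
have [Bf HBf] := choice (fun ab : nat * nat => bd ab.1 ab.2).
pose B := \sum_(a < 3) \sum_(b < 3) `|Bf (nat_of_ord a, nat_of_ord b)|.
have HB a b s t : (a <= 2)%N -> (b <= 2)%N -> 0 <= s <= L -> `|t| <= r / 2 -> `|pd_iter a b H (pt s t)| <= B.
  move=> a2 b2 sL tr; apply: le_trans (HBf (a, b) a2 b2 s t sL tr) _.
  apply: le_trans (ler_norm _) _; rewrite /B.
  rewrite (bigD1 (Ordinal (a2 : (a < 3)%N)))//= (bigD1 (Ordinal (b2 : (b < 3)%N)))//= -addrA lerDl.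
  by rewrite addr_ge0// sumr_ge0// => i _; rewrite ?sumr_ge0.
have r20 : 0 <= r / 2 by rewrite divr_ge0// ltW.
have B0 : 0 <= B by rewrite /B sumr_ge0// => i _; rewrite sumr_ge0.
have C00 : 0 <= C0.
  pose Z (a b : nat) (s t : R) : R := if (a == 0%N) && (b == 0%N) then 1 else 0.
  have : C22_bounded L Z 1.
    move=> s t _ a a2; split=> [_|b _|b _]; rewrite /Z; first by case: a a2 => [|a] _; exact: is_derive_cst_fun.
    - by rewrite andbF; exact: is_derive_cst_fun.
    - by case: ifP; rewrite ?normr1 ?normr0.
  move=> /HW; rewrite mulr1 => /wiener_ge0; apply=> i; exact: wt2_ge0.
exists (C0 * B); first exact: mulr_ge0.
move=> e e0 e1 er.
have et t : -1 <= t <= 1 -> `|e * t| <= r / 2.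
  move=> t1; rewrite normrM (gtr0_norm e0); apply: le_trans er; apply: ler_piMr; first exact: ltW.
  by rewrite ler_norml.
pose D (a b : nat) (s t : R) := e ^+ b * pd_iter a b H (pt s (e * t)).
have DB B' : (forall a b s t, (a <= 2)%N -> (b <= 2)%N -> cstrip L (s, t) -> `|D a b s t| <= B') -> C22_bounded L D B'.
  move=> HB' s t cst a a2; have [/= sL t1] := cst; have Us := inU _ _ sL (et _ t1).
  split=> [a1|b b1|b b2]; last exact: HB'.
  - have -> : D a 0%N ^~ t = fun s => pd_iter a 0 H (pt s (e * t)) by apply/funext => z; rewrite /D expr0 mul1r.
    rewrite /D expr0 mul1r.
    apply: is_derive_pt0; rewrite /pd_iter /=.
    exact: (Ck_is_derive (e_ 0) (Cab 1%N a 0%N ltac:(clear -a1; lia)) Us).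
  - rewrite /D exprSr -mulrA; apply: is_derive_scale; apply: is_derive_slice.
    exact: (Ck_is_derive (e_ 1) (Cab 1%N a b ltac:(clear -a2 b1; lia)) Us).
split.
  apply: wiener_eq (HW D B _) => [p _|]; first by rewrite /D expr0 mul1r.
  apply: DB => a b s t a2 b2 [/= sL t1]; rewrite /D normrM normrX (gtr0_norm e0).
  apply: le_trans (ler_piMl _ _) _ => //; first by rewrite exprn_ile1// ltW.
  by apply: HB => //; exact: et.
move=> H0; rewrite -mulrA; apply: wiener_eq (HW D (B * e) _) => [p _|]; first by rewrite /D expr0 mul1r.
apply: DB => a b s t a2 b2 [/= sL t1]; rewrite /D normrM normrX (gtr0_norm e0).
case: b b2 => [|b] b2; last first.
  rewrite exprS [leRHS]mulrC -mulrA; apply: ler_wpM2l; first exact: ltW.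
  apply: le_trans (HB a b.+1 s (e * t) a2 b2 sL (et _ t1)).
  by apply: ler_piMl => //; rewrite exprn_ile1// ltW.
rewrite expr0 mul1r.
have s0 : iter a (pd 0) H (pt s 0) = 0.
  apply: (@pd_iter_axis a r H) => //; first by apply: Ck_le HC; apply: leq_trans a2 _.
  by case/andP: sL => h1 h2; apply/andP; split; [apply: lt_le_trans h1; rewrite oppr_lt0|apply: le_lt_trans h2 _; rewrite ltrDl].
have mv (t' : R) : 0 <= t' <= 1 -> is_derive (t' *: (pt s (e * t) - pt s 0) + pt s 0) (pt s (e * t) - pt s 0) (pd_iter a 0 H)
    (e * t * pd_iter a 1 H (t' *: (pt s (e * t) - pt s 0) + pt s 0)).
  move=> /andP[t'0 t'1]; have E : pt s (e * t) - pt s 0 = (e * t) *: e_ 1.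
    by apply/rowP => i; rewrite !mxE; case: i => [[|[|//]] Hi] /=; rewrite ?subrr ?mulr0 ?subr0 ?mulr1.
  rewrite E; apply: is_deriveZdir; apply: (Ck_is_derive (e_ 1) (Cab 1%N a 0%N ltac:(clear -a2; lia))).
  rewrite (_ : _ + _ = pt s (t' * (e * t))); last first.
    by apply/rowP => i; rewrite !mxE; case: i => [[|[|//]] Hi] /=; rewrite ?mulr0 ?add0r ?mulr1 ?addr0.
  apply: inU => //; rewrite normrM (ger0_norm t'0); apply: le_trans (et _ t1).
  exact: ler_piMl.
have [t' /andP[t'0 t'1]] := mvt_line (df := fun z => e * t * pd_iter a 1 H z) mv.
rewrite subrK {1}/pd_iter /= s0 subr0 => ->.
rewrite normrM [leRHS]mulrC normrM (gtr0_norm e0) -mulrA; apply: ler_wpM2l; first exact: ltW.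
apply: le_trans (ler_piMl _ _) _ => //; first by rewrite ler_norml.
rewrite (_ : t' *: _ + _ = pt s (t' * (e * t))); last first.
  by apply/rowP => i; rewrite !mxE; case: i => [[|[|//]] Hi] /=; rewrite ?subrr ?mulr0 ?add0r ?subr0 ?addr0.
apply: (HB a 1%N) => //; rewrite normrM (ger0_norm t'0); apply: le_trans (et _ t1).
exact: ler_piMl.
Qed.

End Slices.

(** * The thin operator as a perturbation of the free one *)

Section ThinOperator.
Context {R : realType}.
Let MR : measurableType _ := measurableTypeR R.
Let T2 : measurableType _ := (MR * MR)%type.
Variable L : R.
Hypothesis L0 : 0 < L.
Local Notation S := (strip L).
Local Notation mu := (@leb2 R).
Local Notation "'Int' u" := (\int[mu]_(p in S) u p) (at level 10, u at level 9).
Implicit Types (u : R * R -> R) (i : nat * nat).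
Local Notation W2 w := (wiener (cstrip L) (mode L) w).

Definition freq_s i : R := i.1%:R * (pi / L).
Definition freq_t i : R := i.2%:R * (pi / 2).
Definition mode_s i (p : R * R) : R := - freq_s i * (sinl L i.1 p.1 * cosl 2 i.2 (p.2 + 1)).
Definition mode_t i (p : R * R) : R := - freq_t i * (cosl L i.1 p.1 * sinl 2 i.2 (p.2 + 1)).

Lemma is_derive_mode_e1 i p : is_derive p (e1 R) (mode L i) (mode_s i p).
Proof.
have d1 := is_derive_fstc (e1 R) (is_derive_cosl L i.1 p.1).
have d2 : is_derive p (e1 R) (fun q : R * R => cosl 2 i.2 (q.2 + 1)) (- (i.2%:R * (pi / 2)) * sinl 2 i.2 (p.2 + 1) * 0).
  exact: (@is_derive_sndc _ (fun y => cosl 2 i.2 (y + 1)) _ (e1 R) _ (is_derive_shift1 (is_derive_cosl _ _ _))).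
by have := is_derive_mul d1 d2; rewrite /= !mulr0 addr0 mulr1 -mulrA.
Qed.

Lemma is_derive_mode_e2 i p : is_derive p (e2 R) (mode L i) (mode_t i p).
Proof.
have d1 := is_derive_fstc (e2 R) (is_derive_cosl L i.1 p.1).
have d2 : is_derive p (e2 R) (fun q : R * R => cosl 2 i.2 (q.2 + 1)) (- (i.2%:R * (pi / 2)) * sinl 2 i.2 (p.2 + 1) * 1).
  exact: (@is_derive_sndc _ (fun y => cosl 2 i.2 (y + 1)) _ (e2 R) _ (is_derive_shift1 (is_derive_cosl _ _ _))).
by have := is_derive_mul d1 d2; rewrite /= !mulr0 mul0r add0r mulr1 mulrCA.
Qed.

Lemma weak_mode_s i : is_weak_derivative L (e1 R) (mode L i) (mode_s i).
Proof.
rewrite (_ : mode_s i = 'D_(e1 R) (mode L i)); first by apply: smooth_weak => //; [left|exact: mode_smooth].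
by apply/funext => p; exact/esym/is_derive_val/is_derive_mode_e1.
Qed.

Lemma weak_mode_t i : is_weak_derivative L (e2 R) (mode L i) (mode_t i).
Proof.
rewrite (_ : mode_t i = 'D_(e2 R) (mode L i)); first by apply: smooth_weak => //; [right|exact: mode_smooth].
by apply/funext => p; exact/esym/is_derive_val/is_derive_mode_e2.
Qed.

Lemma is_derive_mode_ss i (s t : R) : is_derive s 1 (fun s => mode_s i (s, t)) (- freq_s i ^+ 2 * mode L i (s, t)).
Proof.
rewrite /mode_s /= (_ : - freq_s i ^+ 2 * _ = - freq_s i * (freq_s i * cosl L i.1 s * cosl 2 i.2 (t + 1))); last by rewrite /mode /=; ring.
apply: is_derive_scale; rewrite [X in is_derive _ _ _ X](_ : _ = freq_s i * cosl L i.1 s * cosl 2 i.2 (t + 1) + sinl L i.1 s * 0); last by rewrite mulr0 addr0.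
exact: (is_derive_mul (is_derive_sinl _ _ _) (is_derive_cst_fun _ _ _)).
Qed.

Lemma is_derive_mode_tt i (s t : R) : is_derive t 1 (fun t => mode_t i (s, t)) (- freq_t i ^+ 2 * mode L i (s, t)).
Proof.
rewrite /mode_t /= (_ : - freq_t i ^+ 2 * _ = - freq_t i * (cosl L i.1 s * (freq_t i * cosl 2 i.2 (t + 1)))); last by rewrite /mode /=; ring.
apply: is_derive_scale; apply: is_derive_scale; exact: is_derive_shift1 (is_derive_sinl _ _ _).
Qed.

Lemma mode_s_ends i t : mode_s i (0, t) = 0 /\ mode_s i (L, t) = 0.
Proof. by split; rewrite /mode_s /= ?sinl0 ?sinl_end ?gt_eqF// mul0r mulr0. Qed.

Lemma mode_t_ends i s : mode_t i (s, -1) = 0 /\ mode_t i (s, 1) = 0.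
Proof.
split; rewrite /mode_t /=; first by rewrite addNr sinl0 !mulr0.
by rewrite (_ : 1 + 1 = 2 :> R)// sinl_end ?mulr0// pnatr_eq0.
Qed.

Lemma nice_mode_s i : nice L (mode_s i). Proof. exact: nice_scale (sin_cos_nice _ _ _). Qed.
Lemma nice_mode_t i : nice L (mode_t i). Proof. exact: nice_scale (cos_sin_nice _ _ _). Qed.

Lemma W2_mode_derivatives g : 0 <= g < 1 -> exists2 C, 0 <= C & forall i,
  W2 (wt2 g) (mode_s i) (C * freq_s i ^+ 2 * wt2 g i) /\ W2 (wt2 g) (mode_t i) (C * freq_t i ^+ 2 * wt2 g i).
Proof.
move=> g01; have [C1 H1] := W2_sin_cos g01 L0; have [C2 H2] := W2_cos_sin L g01.
have p0 : 0 < pi :> R := pi_gt0 R.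
have pL : 0 < pi / L by rewrite divr_gt0.
have p2 : 0 < pi / 2 :> R by rewrite divr_gt0.
pose C := `|C1| * (pi / L)^-1 + `|C2| * (pi / 2)^-1.
have C10 : 0 <= `|C1| * (pi / L)^-1 by rewrite mulr_ge0// invr_ge0 ltW.
have C20 : 0 <= `|C2| * (pi / 2)^-1 by rewrite mulr_ge0// invr_ge0 ltW.
exists C; first exact: addr_ge0.
have aux (c a b w : R) (n : nat) : 0 < a -> 0 <= w -> b = n%:R * a ->
    `|- b| * (c * n%:R * w) <= `|c| * a^-1 * b ^+ 2 * w.
  move=> a0 w0 bE; rewrite mulrA ler_wpM2r//.
  rewrite normrN (_ : `|b| = b); last by rewrite bE ger0_norm// mulr_ge0// ltW.
  rewrite (_ : _ * b ^+ 2 = `|c| * (b * n%:R)); last first.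
    by rewrite expr2 {2}bE; field; rewrite gt_eqF.
  rewrite mulrCA; apply: ler_wpM2r; last exact: ler_norm.
  by rewrite mulr_ge0// bE mulr_ge0// ltW.
move=> i; have w0 := wt2_ge0 g01 i; split.
  apply: wiener_le (wiener_scale (- freq_s i) (H1 i.1 i.2)); rewrite -surjective_pairing.
  apply: le_trans (aux _ _ _ _ _ pL w0 erefl) _; rewrite ler_wpM2r// ler_wpM2r ?sqr_ge0//.
  by rewrite lerDl.
apply: wiener_le (wiener_scale (- freq_t i) (H2 i.1 i.2)); rewrite -surjective_pairing.
apply: le_trans (aux _ _ _ _ _ p2 w0 erefl) _; rewrite ler_wpM2r// ler_wpM2r ?sqr_ge0//.
by rewrite lerDr.
Qed.

Variables (f q qs ft : R * R -> R) (e lam lam0 : R).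
Hypothesis e0 : 0 < e.
Hypothesis e_le1 : e <= 1.
Hypothesis dq : forall s t, cstrip L (s, t) -> is_derive s 1 (fun s => q (s, t)) (qs (s, t)).
Hypothesis df : forall s t, cstrip L (s, t) -> is_derive t 1 (fun t => f (s, t)) (ft (s, t)).

(** In the application [q] is [1 / f], [qs] its derivative in [s] and [ft] the derivative of [f] in
    [t]. All of them enter through deviations from the free case, measured by the one constant
    [K]. *)
Definition thin_coefs g (K : R) : Prop :=
  [/\ W2 (wt2 g) (fun p => f p - 1) K, W2 (wt2 g) (fun p => q p - 1) K, W2 (wt2 g) qs K & W2 (wt2 g) ft K].

Definition free_eigenvalue i : R := freq_s i ^+ 2 + e ^- 2 * freq_t i ^+ 2.
Definition mode_weight i : R := 1 + free_eigenvalue i.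

Lemma mode_weight_ge1 i : 1 <= mode_weight i.
Proof. by rewrite lerDl addr_ge0 ?sqr_ge0// mulr_ge0 ?sqr_ge0// invr_ge0 exprn_ge0// ltW. Qed.

(* With P v = (q v_s)_s + e^-2 (f v_t)_t + lam f v, the image of mode i under P
   is perturbation i - (free_eigenvalue i - lam0) mode i. *)
Definition perturbation i p : R :=
  ((lam - lam0) + (lam * (f p - 1) - freq_s i ^+ 2 * (q p - 1) - e ^- 2 * freq_t i ^+ 2 * (f p - 1))) * mode L i p
  + (qs p * mode_s i p + e ^- 2 * (ft p * mode_t i p)).

Local Notation dd i := (free_eigenvalue i - lam0).

(** Every term is a small factor times a quantity of second order: squared frequencies times a
    cosine, or a first derivative of the mode, a sine, whose norm is again of the order of a squared
    frequency by [W2_mode_derivatives]. *)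
Lemma perturbation_wiener (g C K M : R) : 0 <= g < 1 -> 0 <= C ->
  (forall i, W2 (wt2 g) (mode_s i) (C * freq_s i ^+ 2 * wt2 g i) /\
             W2 (wt2 g) (mode_t i) (C * freq_t i ^+ 2 * wt2 g i)) ->
  0 <= K -> thin_coefs g K -> `|lam - lam0| <= K -> `|lam| <= M ->
  forall i, W2 (wt2 g) (perturbation i) ((1 + C) * (1 + M) * K * (mode_weight i * wt2 g i)).
Proof.
move=> g01 C0 HC K0 [Wf Wq Wqs Wft] lK lM i; have [Hs Ht] := HC i.
have w0 := wt2_ge0 g01.
have Wm := wiener_atom (cstrip L) (mode L) (wt2 g) i.
rewrite /perturbation /mode_weight /free_eigenvalue; set a := freq_s i ^+ 2 in Hs *; set b := freq_t i ^+ 2 in Ht *.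
have a0 : 0 <= a := sqr_ge0 _. have b0 : 0 <= b := sqr_ge0 _.
have ei0 : 0 <= e ^- 2 by rewrite invr_ge0 exprn_ge0// ltW.
have eb0 : 0 <= e ^- 2 * b by rewrite mulr_ge0.
have M0 : 0 <= M := le_trans (normr_ge0 _) lM.
have P1 := wiener_sub (wiener_sub (wiener_scale lam Wf) (wiener_scale a Wq)) (wiener_scale (e ^- 2 * b) Wf).
have P2 := W2_mul g01 (wiener_add (W2_cst g L (lam - lam0)) P1) Wm.
have P3 := wiener_add (W2_mul g01 Wqs Hs) (wiener_scale (e ^- 2) (W2_mul g01 Wft Ht)).
apply: wiener_le (wiener_add P2 P3).
rewrite (ger0_norm a0) (ger0_norm eb0) (ger0_norm ei0) -/a -/b.
have wi := w0 i; set w := wt2 g i in wi *.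
apply: le_trans (_ : ((K + (M * K + a * K + e ^- 2 * b * K)) * w + (K * (C * a * w) + e ^- 2 * (K * (C * b * w)))) <= _).
  rewrite lerD2r ler_wpM2r// lerD// lerD2r lerD2r ler_wpM2r//.
set X := e ^- 2 * b in eb0 *.
rewrite [leLHS](_ : _ = K * w * (1 + M + (1 + C) * (a + X))); last by rewrite /X; ring.
rewrite [leRHS](_ : _ = K * w * ((1 + C) * (1 + M) * (1 + (a + X)))); last by ring.
apply: ler_wpM2l; first exact: mulr_ge0.
have aX : 0 <= a + X by rewrite addr_ge0.
rewrite (_ : (1 + C) * (1 + M) * (1 + (a + X)) = 1 + M + (1 + C) * (a + X) + (C * (1 + M) + (1 + C) * (a + X) * M)); last by ring.
by rewrite lerDl addr_ge0// !mulr_ge0// addr_ge0.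
Qed.

Local Notation P := (pert (mode L) perturbation (fun i => dd i)).

Lemma pertE i p : P i p = (qs p * mode_s i p + q p * (- freq_s i ^+ 2 * mode L i p))
  + e ^- 2 * (ft p * mode_t i p + f p * (- freq_t i ^+ 2 * mode L i p)) + lam * (f p * mode L i p).
Proof. by rewrite /pert /perturbation /free_eigenvalue; ring. Qed.

Let g00 : 0 <= (0 : R) < 1. Proof. by rewrite lexx ltr01. Qed.
Let w01 := wt2_ge1 g00.
Variable K : R.
Hypothesis HK : thin_coefs 0 K.

Let Wf : exists M, W2 (wt2 0) f M.
Proof.
case: HK => Hf _ _ _; exists (K + `|1|); apply: wiener_eq (wiener_add Hf (W2_cst 0 L 1)) => p _.
by rewrite subrK.
Qed.

Let Wq : exists M, W2 (wt2 0) q M.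
Proof.
case: HK => _ Hq _ _; exists (K + `|1|); apply: wiener_eq (wiener_add Hq (W2_cst 0 L 1)) => p _.
by rewrite subrK.
Qed.

Let nf : nice L f. Proof. by have [M HM] := Wf; exact: wiener_nice w01 HM. Qed.
Let nq : nice L q. Proof. by have [M HM] := Wq; exact: wiener_nice w01 HM. Qed.
Let nqs : nice L qs. Proof. by case: HK => _ _ H _; exact: wiener_nice w01 H. Qed.
Let nft : nice L ft. Proof. by case: HK => _ _ _ H; exact: wiener_nice w01 H. Qed.

Lemma nice_perturbation i : nice L (perturbation i).
Proof.
have n1 := nice_cst L 1; have nm := nice_mode L i; have ns := nice_mode_s i; have nt := nice_mode_t i.
have nfm : nice L (fun p => f p - 1) by exact: nice_sub.
have nqm : nice L (fun p => q p - 1) by exact: nice_sub.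
apply: nice_add; first apply: nice_mul => //.
  by apply: nice_add; [exact: nice_cst|apply: nice_sub; [apply: nice_sub|]; exact: nice_scale].
by apply: nice_add; [exact: nice_mul|apply: nice_scale; exact: nice_mul].
Qed.

(** The operator applied to a mode is turned into the weak form of the equation for [u]; no boundary
    terms arise, as the normal derivatives of the modes vanish. *)
Lemma functional_thin u g1 g2 i : L2 L u -> is_weak_derivative L (e1 R) u g1 -> is_weak_derivative L (e2 R) u g2 ->
  functional L u (P i) = - functional L g1 (fun p => q p * mode_s i p)
    - e ^- 2 * functional L g2 (fun p => f p * mode_t i p) + lam * functional L u (fun p => f p * mode L i p).
Proof.
move=> Lu H1 H2; have iu := L2_integ L0 Lu.
have [C _ HC] := W2_mode_derivatives g00; have [Hs Ht] := HC i.
have [Mf HMf] := Wf; have [Mq HMq] := Wq; have [_ _ Hqs Hft] := HK.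
have Wm := wiener_atom (cstrip L) (mode L) (wt2 0) i.
have ns := nice_mode_s i; have nt := nice_mode_t i; have nm := nice_mode L i.
have hd1 s t : cstrip L (s, t) -> is_derive s 1 (fun s => q (s, t) * mode_s i (s, t))
    (qs (s, t) * mode_s i (s, t) + q (s, t) * (- freq_s i ^+ 2 * mode L i (s, t))).
  by move=> cst; apply: is_derive_mul; [exact: dq|exact: is_derive_mode_ss].
have he1 t : -1 <= t <= 1 -> q (0, t) * mode_s i (0, t) = 0 /\ q (L, t) * mode_s i (L, t) = 0.
  by move=> _; have [-> ->] := mode_s_ends i t; rewrite !mulr0.
have hd2 s t : cstrip L (s, t) -> is_derive t 1 (fun t => f (s, t) * mode_t i (s, t))
    (ft (s, t) * mode_t i (s, t) + f (s, t) * (- freq_t i ^+ 2 * mode L i (s, t))).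
  by move=> cst; apply: is_derive_mul; [exact: df|exact: is_derive_mode_tt].
have he2 s : 0 <= s <= L -> f (s, -1) * mode_t i (s, -1) = 0 /\ f (s, 1) * mode_t i (s, 1) = 0.
  by move=> _; have [-> ->] := mode_t_ends i s; rewrite !mulr0.
have A1 := @ibp_W2_s R L L0 (wt2 0) _ _ u g1 (fun p => qs p * mode_s i p + q p * (- freq_s i ^+ 2 * mode L i p))
  (fun p => q p * mode_s i p) w01 Lu H1 (wiener_add (W2_mul g00 Hqs Hs) (W2_mul g00 HMq (wiener_scale (- freq_s i ^+ 2) Wm))) (W2_mul g00 HMq Hs) hd1 he1.
have A2 := @ibp_W2_t R L L0 (wt2 0) _ _ u g2 (fun p => ft p * mode_t i p + f p * (- freq_t i ^+ 2 * mode L i p))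
  (fun p => f p * mode_t i p) w01 Lu H2 (wiener_add (W2_mul g00 Hft Ht) (W2_mul g00 HMf (wiener_scale (- freq_t i ^+ 2) Wm))) (W2_mul g00 HMf Ht) hd2 he2.
rewrite -A1 -[- (e ^- 2 * functional L g2 _)]mulrN -A2.
have [FD FZ _] := functional_bounded iu.
have n1 : nice L (fun p => qs p * mode_s i p + q p * (- freq_s i ^+ 2 * mode L i p)).
  by apply: nice_add; apply: nice_mul => //; exact: nice_scale.
have n2 : nice L (fun p => ft p * mode_t i p + f p * (- freq_t i ^+ 2 * mode L i p)).
  by apply: nice_add; apply: nice_mul => //; exact: nice_scale.
have n3 : nice L (fun p => f p * mode L i p) by exact: nice_mul.
rewrite -FZ// -FZ// -FD//; last exact: nice_scale.
rewrite -FD//; [|by apply: nice_add => //; exact: nice_scale|exact: nice_scale].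
by congr (functional L u _); apply/funext => p; rewrite pertE.
Qed.

Lemma thin_symmetric i l : functional L (mode L i) (P l) = functional L (mode L l) (P i).
Proof.
have Lm j : L2 L (mode L j) by exact/(nice_L2 L0)/nice_mode.
rewrite (functional_thin l (Lm i) (weak_mode_s i) (weak_mode_t i)).
rewrite (functional_thin i (Lm l) (weak_mode_s l) (weak_mode_t l)).
by congr (- _ - _ * _ + _ * _); apply: Int_ext => p _ /=; ring.
Qed.

(** The weak eigenvalue equation is tested with a mode, after [weakD] of the mode has been replaced
    by its classical derivative. [F] is the given density, and [f], [q] are the explicit functions
    that equal [F] and [1 / F] on the strip. *)
Lemma thin_null (F : R * R -> R) u i : (forall p, S p -> F p = f p) -> (forall p, S p -> (F p)^-1 = q p) ->
  Hgraph L F e u (fun p => lam * u p) -> functional L u (P i) = 0.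
Proof.
move=> Ff Fq [[Lu Hw1 Hw2] _ HF].
have H1 := weakD_spec Hw1; have H2 := weakD_spec Hw2.
have ms := mode_smooth L i; have HF1 := HF _ (smooth_W12 L0 ms).
rewrite (functional_thin i Lu H1 H2).
have D1 := weakD_spec (ex_intro _ _ (weak_mode_s i)); have D2 := weakD_spec (ex_intro _ _ (weak_mode_t i)).
have m1 : measurable_fun (S : set T2) (weakD L (e1 R) u) by case: H1 => -[].
have m2 : measurable_fun (S : set T2) (weakD L (e2 R) u) by case: H2 => -[].
have k1 : measurable_fun (S : set T2) (weakD L (e1 R) (mode L i)) by case: D1 => -[].
have k2 : measurable_fun (S : set T2) (weakD L (e2 R) (mode L i)) by case: D2 => -[].
have [mf _] := nf; have [mq _] := nq; have [mms _] := nice_mode_s i; have [mmt _] := nice_mode_t i.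
have E1 : Int (fun p => (F p)^-1 * (weakD L (e1 R) (mode L i) p * weakD L (e1 R) u p)) =
    functional L (weakD L (e1 R) u) (fun p => q p * mode_s i p).
  rewrite (Int_ext (v := fun p => q p * (weakD L (e1 R) (mode L i) p * weakD L (e1 R) u p))); last first.
    by move=> p Sp; rewrite Fq.
  apply: Int_ae; [exact: (measurable_funM mq (measurable_funM k1 m1))|exact: (measurable_funM m1 (measurable_funM mq mms))|].
  by apply: ae_leb2_imp (weak_unique L0 D1 (weak_mode_s i)) => p E Sp; rewrite E//; ring.
have E2 : Int (fun p => F p * (weakD L (e2 R) (mode L i) p * weakD L (e2 R) u p)) =
    functional L (weakD L (e2 R) u) (fun p => f p * mode_t i p).
  rewrite (Int_ext (v := fun p => f p * (weakD L (e2 R) (mode L i) p * weakD L (e2 R) u p))); last first.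
    by move=> p Sp; rewrite Ff.
  apply: Int_ae; [exact: (measurable_funM mf (measurable_funM k2 m2))|exact: (measurable_funM m2 (measurable_funM mf mmt))|].
  by apply: ae_leb2_imp (weak_unique L0 D2 (weak_mode_t i)) => p E Sp; rewrite E//; ring.
have E3 : Int (fun p => F p * (mode L i p * (lam * u p))) = lam * functional L u (fun p => f p * mode L i p).
  rewrite -Int_scale; last by apply: nice_integ; [exact: L2_integ|apply: nice_mul => //; exact: nice_mode].
  by apply: Int_ext => p Sp; rewrite Ff//; ring.
have fin (a b c a' b' c' k : R) : a = a' -> b = b' -> c = c' -> a + k * b = c -> - a' - k * b' + c' = 0.
  by move=> -> -> -> <-; ring.
exact: fin E1 E2 E3 HF1.
Qed.

(** Testing with the single mode [i0] leaves [lam - lam0] times a mass of at least [m / 2], balanced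
    by terms of size [K]. Closeness of the eigenfunction thus entails closeness of the
    eigenvalue. *)
Lemma eigenvalue_close u i0 m : L2 L u -> freq_t i0 = 0 -> lam0 = freq_s i0 ^+ 2 -> 0 <= K ->
  functional L u (P i0) = 0 -> m <= Int (fun p => u p * mode L i0 p) ->
  2 * (K * Int (fun p => `|u p|)) <= m -> 0 < m ->
  `|lam - lam0| <= 2 / m * (Int (fun p => `|u p|) * (2 * lam0 + `|freq_s i0|)) * K.
Proof.
move=> Lu ft0 l0E K0 Hn Hm HKm m0; have iu := L2_integ L0 Lu.
have [FD FZ FB] := functional_bounded iu.
have [Hf Hq Hqs _] := HK.
have bnd w p : W2 (wt2 0) w K -> S p -> `|w p| <= K by move=> Hw /strip_cstrip; exact: (W2_bound g00 Hw).
have lam00 : 0 <= lam0 by rewrite l0E sqr_ge0.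
set U := Int (fun p => `|u p|) in HKm FB *.
have U0 : 0 <= U := Int_norm_ge0 _ _.
have nm := nice_mode L i0; have ns := nice_mode_s i0.
have nfm : nice L (fun p => f p - 1) by apply: nice_sub => //; exact: nice_cst.
have nqm : nice L (fun p => q p - 1) by apply: nice_sub => //; exact: nice_cst.
pose rest p := lam0 * ((f p - 1) * mode L i0 p) + (- lam0 * ((q p - 1) * mode L i0 p) + qs p * mode_s i0 p).
pose h p := (f p - 1) * mode L i0 p.
have nh : nice L h by exact: nice_mul.
have nrest : nice L rest.
  by apply: nice_add; [apply: nice_scale; exact: nice_mul|apply: nice_add; [apply: nice_scale|]; exact: nice_mul].
have E : functional L u (P i0) = (lam - lam0) * (functional L u (mode L i0) + functional L u h) + functional L u rest.
  rewrite -FD// -FZ; last exact: nice_add.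
  rewrite -FD//; last by apply: nice_scale; exact: nice_add.
  congr (functional L u _); apply/funext => p; rewrite pertE ft0 /rest /h /mode_t ft0 l0E.
  by ring.
have ms1 p : `|mode_s i0 p| <= `|freq_s i0|.
  rewrite /mode_s normrM normrN; apply: ler_piMr => //; rewrite normrM mulr_ile1//; [exact: sinl_le1|exact: cosl_le1].
have B1 : `|functional L u h| <= U * K.
  by apply: FB => // p Sp; rewrite normrM; apply: le_trans (ler_piMr _ (mode_le1 _ _ _)) _ => //; exact: bnd Hf Sp.
have B2 : `|functional L u rest| <= U * ((2 * lam0 + `|freq_s i0|) * K).
  apply: FB => // p Sp; rewrite /rest.
  have x1 : `|(f p - 1) * mode L i0 p| <= K by rewrite normrM; apply: le_trans (ler_piMr _ (mode_le1 _ _ _)) _ => //; exact: bnd Hf Sp.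
  have x2 : `|(q p - 1) * mode L i0 p| <= K by rewrite normrM; apply: le_trans (ler_piMr _ (mode_le1 _ _ _)) _ => //; exact: bnd Hq Sp.
  have x3 : `|qs p * mode_s i0 p| <= K * `|freq_s i0|.
    by rewrite normrM; apply: ler_pM => //; exact: bnd Hqs Sp.
  rewrite (_ : _ * K = lam0 * K + (lam0 * K + K * `|freq_s i0|)); last by ring.
  apply: le_trans (ler_normD _ _) _; apply: lerD; first by rewrite normrM (ger0_norm lam00) ler_wpM2l.
  apply: le_trans (ler_normD _ _) _; apply: lerD => //.
  by rewrite normrM normrN (ger0_norm lam00) ler_wpM2l.
have X : m / 2 <= functional L u (mode L i0) + functional L u h.
  have := ler_norm (- functional L u h); rewrite normrN => h1.
  have h2 := le_trans h1 B1; have h3 : m <= functional L u (mode L i0) := Hm.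
  by rewrite ler_pdivrMr//; move: h2 h3 HKm; move: (functional L u h) (functional L u (mode L i0)) => y z; lra.
move: E; rewrite Hn => /esym/eqP; rewrite addr_eq0 => /eqP E.
have m20 : 0 < m / 2 by rewrite divr_gt0.
have : `|lam - lam0| * (m / 2) <= U * ((2 * lam0 + `|freq_s i0|) * K).
  apply: le_trans B2; rewrite -[leRHS]normrN -E normrM; apply: ler_wpM2l => //.
  exact: le_trans X (ler_norm _).
rewrite -ler_pdivlMr// => hh; apply: le_trans hh _.
by rewrite le_eqVlt; apply/orP; left; apply/eqP; field; rewrite gt_eqF.
Qed.

End ThinOperator.

(** * Absolutely convergent families *)

Section AbsoluteSums.
Context {R : realType} {I : countType}.
Implicit Types (A B : I -> R).

(** Stated through finite subfamilies, so that bounds obtained for finite sets of modes apply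
    directly. *)
Definition asum A (M : R) : Prop := forall F : seq I, uniq F -> \sum_(i <- F) `|A i| <= M.

Definition enum_upto (N : nat) : seq I := pmap (@pickle_inv I) (iota 0 N).

Definition tsum A : R := lim (\sum_(i <- enum_upto N) A i @[N --> \oo]).

Lemma asum_ge0 A M : asum A M -> 0 <= M.
Proof. by move=> /(_ [::] isT); rewrite big_nil. Qed.

Lemma enum_upto_uniq N : uniq (enum_upto N).
Proof. exact: (pmap_uniq (@pickle_invK I)) (iota_uniq _ _). Qed.

Lemma mem_enum_upto i N : (pickle i < N)%N -> i \in enum_upto N.
Proof. by move=> iN; rewrite mem_pmap -pickleK_inv map_f// mem_iota. Qed.

Lemma enum_upto_sum A N : \sum_(i <- enum_upto N) A i = \sum_(0 <= n < N) oapp A 0 (pickle_inv n).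
Proof. by rewrite big_pmap /index_iota subn0. Qed.

Lemma tsum_cvg A M : asum A M -> \sum_(i <- enum_upto N) A i @[N --> \oo] --> tsum A.
Proof.
move=> HA; suff : cvgn (series (fun n => oapp A 0 (pickle_inv n))).
  move=> H; rewrite /tsum (_ : (fun N => _) = series (fun n => oapp A 0 (pickle_inv n)))//.
  by apply/funext => N; rewrite enum_upto_sum.
apply: normed_cvg; apply: nondecreasing_is_cvgn.
  by apply: (@nondecreasing_series R (fun n => `|oapp A 0 (pickle_inv n)|) xpredT 0%N) => n _ _; exact: normr_ge0.
exists M => _ [N _ <-]; apply: le_trans (HA _ (enum_upto_uniq N)).
rewrite (enum_upto_sum (fun i => `|A i|)) /series /=.
by rewrite le_eqVlt; apply/orP; left; apply/eqP; apply: eq_bigr => n _; case: pickle_inv => //=; rewrite normr0.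
Qed.

Lemma tsum_le A M : asum A M -> `|tsum A| <= M.
Proof.
move=> HA; have H : `|\sum_(i <- enum_upto N) A i| @[N --> \oo] --> `|tsum A| by apply: cvg_norm; exact: tsum_cvg HA.
rewrite -(cvg_lim _ H)//; apply: limr_le; first by apply: cvgP H.
by apply: nearW => N; apply: le_trans (ler_norm_sum _ _ _) _; apply: HA; exact: enum_upto_uniq.
Qed.

Lemma asum_le A B (c M : R) : 0 <= c -> (forall i, `|A i| <= c * `|B i|) -> asum B M -> asum A (c * M).
Proof.
move=> c0 AB HB F uF; apply: le_trans (_ : \sum_(i <- F) c * `|B i| <= _); first exact: ler_sum.
by rewrite -mulr_sumr ler_wpM2l// HB.
Qed.

Lemma asum_lin A B (c M M' : R) : asum A M -> asum B M' -> asum (fun i => A i + c * B i) (M + `|c| * M').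
Proof.
move=> HA HB F uF; apply: le_trans (_ : \sum_(i <- F) (`|A i| + `|c| * `|B i|) <= _).
  by apply: ler_sum => i _; apply: le_trans (ler_normD _ _) _; rewrite normrM.
by rewrite big_split /= -mulr_sumr lerD ?HA// ler_wpM2l// HB.
Qed.

Lemma tsum_lin A B (c M M' : R) : asum A M -> asum B M' -> tsum (fun i => A i + c * B i) = tsum A + c * tsum B.
Proof.
move=> HA HB; have H : \sum_(i <- enum_upto N) (A i + c * B i) @[N --> \oo] --> tsum A + c * tsum B.
  rewrite (_ : (fun N => _) = fun N => \sum_(i <- enum_upto N) A i + c * \sum_(i <- enum_upto N) B i); last first.
    by apply/funext => N; rewrite big_split /= -mulr_sumr.
  by apply: cvgD; [exact: tsum_cvg HA|apply: cvgM; [exact: cvg_cst|exact: tsum_cvg HB]].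
exact: (cvg_unique _ (tsum_cvg (asum_lin c HA HB)) H).
Qed.

End AbsoluteSums.

(** * Cosine series with Hoelder continuous second derivatives *)

Section CosineSums.
Context {R : realType}.
Variables (L gm : R).
Hypothesis L0 : 0 < L.
Hypothesis gm0 : 0 < gm.
Hypothesis gm1 : gm < 1.

Lemma is_derive_scalar (f : R -> R) (x h d : R) : is_derive x 1 f d -> is_derive x h f (h * d).
Proof. by move=> /(is_deriveZdir h); rewrite [h *: 1]mulr1. Qed.

(** The [a]-th derivative of the cosine, so that all orders obey one formula. *)
Definition cosn (a : nat) (x : R) : R := cos (x + a%:R * (pi / 2)).

Lemma cosn_le1 a x : `|cosn a x| <= 1. Proof. exact: cos_max. Qed.

Lemma is_derive_cosn a (x : R) : is_derive x 1 (cosn a) (cosn a.+1 x).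
Proof.
have E : cosn a.+1 x = - sin (x + a%:R * (pi / 2)).
  by rewrite /cosn -natr1 mulrDl mul1r addrA cosDpihalf.
rewrite E -[- sin _]mulr1; apply: (@is_derive_comp1 _ _ (@cos R) (fun x => x + a%:R * (pi / 2)) x 1 _ _ (is_derive_cos _)).
by have := is_derive_affine 1 (a%:R * (pi / 2)) x; rewrite (_ : (fun _ => _) = fun x => x + a%:R * (pi / 2))//; apply/funext => y; rewrite mul1r.
Qed.

Lemma powR_ge_id (x : R) : 0 <= x -> x <= 1 -> x <= x `^ gm.
Proof.
move=> x0 x1; have [->|xn] := eqVneq x 0; first by rewrite powR_ge0.
have xp : 0 < x by rewrite lt_neqAle eq_sym xn.
by rewrite -[leLHS](powRr1 x0) ger_powR ?xp// ltW.
Qed.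

(** Interpolation between the Lipschitz bound for increments up to 1 and the trivial bound 2
    beyond. *)
Lemma cosn_holder a (x y : R) : `|cosn a x - cosn a y| <= 2 * `|x - y| `^ gm.
Proof.
have [h|h] := leP `|x - y| 1.
  apply: le_trans (cos_lip _ _) _; rewrite opprD addrACA subrr addr0.
  apply: le_trans (powR_ge_id (normr_ge0 _) h) _.
  by rewrite mulr2n mulrDl mul1r lerDl powR_ge0.
apply: le_trans (ler_normB _ _) _; apply: le_trans (lerD (cosn_le1 a x) (cosn_le1 a y)) _.
rewrite -[1 + 1]mulr1 ler_wpM2l// -[leLHS](powRr0 `|x - y|).
by apply: ler_powR; exact: ltW.
Qed.

Lemma cosn_taylor a (x h : R) : `|cosn a (x + h) - cosn a x - h * cosn a.+1 x| <= 2 * `|h| `^ gm * `|h|.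
Proof.
have [t /andP[t0 t1]] := @mvt_line R R (cosn a) (fun z => h * cosn a.+1 z) x h
  (fun t _ => is_derive_scalar h (is_derive_cosn a (t *: h + x))).
rewrite [x + h]addrC => ->; rewrite -mulrBr normrM [leRHS]mulrC ler_wpM2l//.
apply: le_trans (cosn_holder _ _ _) _; rewrite ler_wpM2l// addrK.
by apply: ge0_ler_powR; rewrite ?nnegrE// ?(ltW gm0)// -[t *: h]/(t * h) normrM (ger0_norm t0) ler_piMl.
Qed.

Lemma cosn_prod_holder a b (x y x' y' : R) :
  `|cosn a x * cosn b y - cosn a x' * cosn b y'| <= 2 * (`|x - x'| `^ gm + `|y - y'| `^ gm).
Proof.
rewrite (_ : _ - _ = (cosn a x - cosn a x') * cosn b y + cosn a x' * (cosn b y - cosn b y')); last by ring.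
apply: le_trans (ler_normD _ _) _; rewrite [leRHS]mulrDr !normrM; apply: lerD.
  by apply: le_trans (ler_piMr _ (cosn_le1 _ _)) (cosn_holder _ _ _).
by apply: le_trans (ler_piMl _ (cosn_le1 _ _)) (cosn_holder _ _ _).
Qed.

Lemma cosn_prod_taylor a b (x y dx dy : R) :
  `|cosn a (x + dx) * cosn b (y + dy) - cosn a x * cosn b y
    - dx * (cosn a.+1 x * cosn b y) - dy * (cosn a x * cosn b.+1 y)|
  <= 2 * (`|dx| `^ gm * `|dx| + `|dy| `^ gm * `|dx| + `|dy| `^ gm * `|dy|).
Proof.
rewrite (_ : _ - dy * _ = (cosn a (x + dx) - cosn a x - dx * cosn a.+1 x) * cosn b (y + dy)
   + dx * cosn a.+1 x * (cosn b (y + dy) - cosn b y)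
   + cosn a x * (cosn b (y + dy) - cosn b y - dy * cosn b.+1 y)); last by ring.
rewrite [leRHS](_ : _ = 2 * `|dx| `^ gm * `|dx| + 2 * `|dy| `^ gm * `|dx| + 2 * `|dy| `^ gm * `|dy|); last by ring.
apply: le_trans (ler_normD _ _) _; apply: lerD; last first.
  by rewrite normrM; apply: le_trans (ler_piMl _ (cosn_le1 _ _)) (cosn_taylor _ _ _).
apply: le_trans (ler_normD _ _) _; apply: lerD; rewrite normrM.
  by apply: le_trans (ler_piMr _ (cosn_le1 _ _)) (cosn_taylor _ _ _).
apply: le_trans (_ : `|dx| * `|cosn b (y + dy) - cosn b y| <= _).
  by rewrite normrM ler_wpM2r// ler_piMr// cosn_le1.
have := cosn_holder b (y + dy) y; rewrite addrAC subrr add0r => h.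
by rewrite mulrC; apply: ler_wpM2r.
Qed.

Local Notation fs i := (freq_s L i).
Local Notation ft i := (freq_t i : R).
Definition order_weight (i : nat * nat) : R := 1 + fs i ^+ 2 + ft i ^+ 2.
(** The derivative of order [a] in [s] and [b] in [t] of the mode [i]. *)
Definition mode_jet a b (p : R * R) (i : nat * nat) : R :=
  fs i ^+ a * ft i ^+ b * (cosn a (fs i * p.1) * cosn b (ft i * (p.2 + 1))).

Lemma fs_ge0 i : 0 <= fs i. Proof. by rewrite mulr_ge0// divr_ge0 ?pi_ge0 ?ltW. Qed.
Lemma ft_ge0 i : 0 <= ft i. Proof. by rewrite mulr_ge0// divr_ge0 ?pi_ge0. Qed.

Lemma freq_le_order a b i : (a + b <= 2)%N -> fs i ^+ a * ft i ^+ b <= order_weight i.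
Proof.
rewrite /order_weight; move: (fs_ge0 i) (ft_ge0 i); move: (fs i) (ft i) => x y x0 y0.
have h1 := sqr_ge0 (x - 1); have h2 := sqr_ge0 (y - 1); have h3 := sqr_ge0 (x - y).
have h4 := sqr_ge0 x; have h5 := sqr_ge0 y.
by case: a => [|[|[|a]]]; case: b => [|[|[|b]]] //= _; rewrite ?expr0 ?expr1 ?mul1r ?mulr1; nra.
Qed.

Lemma order_weight_ge0 i : 0 <= order_weight i.
Proof. by rewrite !addr_ge0 ?sqr_ge0. Qed.

Let gm01 : 0 <= gm < 1. Proof. by rewrite ltW. Qed.
Definition cs : R := (pi / L) `^ gm.
Definition ct : R := (pi / 2) `^ gm.

Let nat_wt (n : nat) (i : nat * nat) : (n <= i.1 + i.2)%N -> n%:R `^ gm <= wt2 gm i.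
Proof.
move=> ni; apply: ge0_ler_powR; rewrite ?nnegrE//; first exact: ltW.
by rewrite ler_nat; exact: leqW.
Qed.

Lemma fs_powR i (d : R) : `|fs i * d| `^ gm <= cs * `|d| `^ gm * wt2 gm i.
Proof.
rewrite normrM (ger0_norm (fs_ge0 i)) powRM ?fs_ge0// /freq_s powRM// ?divr_ge0 ?pi_ge0 ?(ltW L0)//.
rewrite -[leLHS]mulrA [leRHS]mulrC -/cs; apply: ler_wpM2r; first by rewrite mulr_ge0 ?powR_ge0.
by apply: nat_wt; exact: leq_addr.
Qed.

Lemma ft_powR i (d : R) : `|ft i * d| `^ gm <= ct * `|d| `^ gm * wt2 gm i.
Proof.
rewrite normrM (ger0_norm (ft_ge0 i)) powRM ?ft_ge0// /freq_t powRM// ?divr_ge0 ?pi_ge0//.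
rewrite -[leLHS]mulrA [leRHS]mulrC -/ct; apply: ler_wpM2r; first by rewrite mulr_ge0 ?powR_ge0.
by apply: nat_wt; exact: leq_addl.
Qed.

Variables (y : nat * nat -> R) (M : R).
Hypothesis HM : asum (fun i => y i * (order_weight i * wt2 gm i)) M.
Definition cosine_sum a b (p : R * R) : R := tsum (fun i => y i * mode_jet a b p i).
Local Notation V := cosine_sum.

Lemma cosine_asum (X : nat * nat -> R) (c : R) : 0 <= c ->
  (forall i, `|X i| <= c * (order_weight i * wt2 gm i)) -> asum (fun i => y i * X i) (c * M).
Proof.
move=> c0 HX; apply: asum_le c0 _ HM => i; rewrite !normrM mulrCA ler_wpM2l//.
apply: le_trans (HX i) _; by rewrite (ger0_norm (order_weight_ge0 i)) (ger0_norm (wt2_ge0 gm01 i)).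
Qed.

Lemma mode_jet_asum a b p : (a + b <= 2)%N -> asum (fun i => y i * mode_jet a b p i) M.
Proof.
move=> ab; rewrite -[M]mul1r; apply: cosine_asum => // i; rewrite mul1r.
have w1 := wt2_ge1 gm01 i; have o0 := order_weight_ge0 i.
rewrite /mode_jet normrM (ger0_norm (_ : 0 <= fs i ^+ a * ft i ^+ b)); last first.
  by rewrite mulr_ge0// exprn_ge0 ?fs_ge0 ?ft_ge0.
apply: ler_pM => //; first by rewrite mulr_ge0// exprn_ge0 ?fs_ge0 ?ft_ge0.
  exact: freq_le_order.
by apply: le_trans w1; rewrite normrM mulr_ile1// cosn_le1.
Qed.

Lemma cosine_sum_le a b p : (a + b <= 2)%N -> `|V a b p| <= M.
Proof. by move=> ab; apply: tsum_le; exact: mode_jet_asum. Qed.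

(** A Hoelder difference costs a frequency to the power [gm], paid for by [wt2 gm]; up to two
    derivatives are paid for by [order_weight]. *)
Lemma cosine_sum_holder a b (p q : R * R) : (a + b <= 2)%N ->
  `|V a b p - V a b q| <= 2 * (cs * `|p.1 - q.1| `^ gm + ct * `|p.2 - q.2| `^ gm) * M.
Proof.
move=> ab; rewrite -mulN1r -(tsum_lin _ (mode_jet_asum p ab) (mode_jet_asum q ab)).
rewrite (_ : (fun i => _) = fun i => y i * (mode_jet a b p i - mode_jet a b q i)); last by apply/funext => i; ring.
have c0 : 0 <= 2 * (cs * `|p.1 - q.1| `^ gm + ct * `|p.2 - q.2| `^ gm).
  by rewrite mulr_ge0// addr_ge0// mulr_ge0// powR_ge0.
apply: tsum_le; apply: cosine_asum => // i.
have F0 : 0 <= fs i ^+ a * ft i ^+ b by rewrite mulr_ge0// exprn_ge0 ?fs_ge0 ?ft_ge0.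
rewrite /mode_jet -mulrBr normrM (ger0_norm F0) mulrCA; apply: ler_pM => //; first exact: freq_le_order.
apply: le_trans (cosn_prod_holder _ _ _ _ _ _) _; rewrite -[leRHS]mulrA ler_wpM2l// mulrDl.
rewrite -!mulrBr (_ : p.2 + 1 - (q.2 + 1) = p.2 - q.2); last by ring.
by apply: lerD; [exact: fs_powR|exact: ft_powR].
Qed.

Lemma cosine_sum_continuous a b : (a + b <= 2)%N -> continuous (V a b).
Proof.
move=> ab p; apply/cvgrPdist_le => e e0.
have M0 : 0 <= M := asum_ge0 HM.
have c0 : 0 <= cs := powR_ge0 _ _. have c0' : 0 <= ct := powR_ge0 _ _.
pose C := 2 * (cs + ct) * M + 1.
have C0 : 0 < C by rewrite ltr_wpDl// !mulr_ge0// addr_ge0.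
pose r := (e / C) `^ gm^-1.
have r0 : 0 < r by rewrite powR_gt0// divr_gt0.
have rE : r `^ gm = e / C by rewrite -powRrM mulVf ?gt_eqF// powRr1// divr_ge0// ltW.
apply/(nbhs_ball_norm p _); exists r => // q qr.
apply: le_trans (cosine_sum_holder p q ab) _.
have small (d : R) : `|d| < r -> `|d| `^ gm <= e / C.
  move=> dr; rewrite -rE; apply: ge0_ler_powR; rewrite ?nnegrE//; exact: ltW.
move: qr; rewrite prod_normE gt_max /= => /andP[q1 q2].
have h1 := small _ q1; have h2 := small _ q2.
apply: le_trans (_ : 2 * (cs * (e / C) + ct * (e / C)) * M <= _).
  rewrite ler_wpM2r// ler_wpM2l//; apply: lerD; rewrite ler_wpM2l//.
    by rewrite distrC.
  by rewrite distrC.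
rewrite [leLHS](_ : _ = e * (2 * (cs + ct) * M / C)); last by move: C^-1 => z; ring.
apply: ler_piMr; first exact: ltW.
by rewrite ler_pdivrMr// mul1r /C lerDl.
Qed.

Lemma cosine_sum_derive a b (p v : R * R) : (a + b <= 1)%N ->
  is_derive p v (V a b) (v.1 * V a.+1 b p + v.2 * V a b.+1 p).
Proof.
move=> ab; have ab2 : (a + b <= 2)%N := leqW ab.
have ab10 : (a.+1 + b <= 2)%N by []. have ab01 : (a + b.+1 <= 2)%N by rewrite addnS.
have M0 : 0 <= M := asum_ge0 HM.
pose c := cs * `|v.1| `^ gm + ct * `|v.2| `^ gm.
have cv1 : 0 <= cs * `|v.1| `^ gm by rewrite mulr_ge0 ?powR_ge0.
have cv2 : 0 <= ct * `|v.2| `^ gm by rewrite mulr_ge0 ?powR_ge0.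
have c0 : 0 <= c by rewrite addr_ge0.
pose C := 2 * c * (2 * `|v.1| + `|v.2|).
have C0 : 0 <= C by rewrite mulr_ge0// ?mulr_ge0// addr_ge0// mulr_ge0.
have key (h : R) : `|V a b (h *: v + p) - V a b p - h * (v.1 * V a.+1 b p + v.2 * V a b.+1 p)| <= C * (`|h| `^ gm * `|h|) * M.
  have A0 := mode_jet_asum (h *: v + p) ab2; have A1 := mode_jet_asum p ab2.
  have A2 := mode_jet_asum p ab10; have A3 := mode_jet_asum p ab01.
  have B1 := asum_lin (-1) A0 A1; have B2 := asum_lin (- (h * v.1)) B1 A2.
  rewrite (_ : _ - _ = V a b (h *: v + p) + (-1) * V a b p + (- (h * v.1)) * V a.+1 b p + (- (h * v.2)) * V a b.+1 p); last by ring.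
  rewrite -(tsum_lin _ A0 A1) -(tsum_lin _ B1 A2) -(tsum_lin _ B2 A3).
  pose x i := fs i * p.1; pose z i := ft i * (p.2 + 1).
  pose dx i := fs i * (h * v.1); pose dz i := ft i * (h * v.2).
  pose E i := fs i ^+ a * ft i ^+ b * (cosn a (x i + dx i) * cosn b (z i + dz i) - cosn a (x i) * cosn b (z i)
    - dx i * (cosn a.+1 (x i) * cosn b (z i)) - dz i * (cosn a (x i) * cosn b.+1 (z i))).
  rewrite (_ : (fun i => _) = fun i => y i * E i); last first.
    apply/funext => i; rewrite /E /mode_jet /dx /dz /x /z.
    have p1E : (h *: v + p).1 = h * v.1 + p.1 by []. have p2E : (h *: v + p).2 = h * v.2 + p.2 by [].
    rewrite (_ : fs i * (h *: v + p).1 = fs i * p.1 + fs i * (h * v.1)); last by rewrite p1E; ring.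
    rewrite (_ : ft i * ((h *: v + p).2 + 1) = ft i * (p.2 + 1) + ft i * (h * v.2)); last by rewrite p2E; ring.
    by rewrite [fs i ^+ a.+1]exprS [ft i ^+ b.+1]exprS; ring.
  have Ch : 0 <= C * (`|h| `^ gm * `|h|) by rewrite mulr_ge0// mulr_ge0// powR_ge0.
  apply: tsum_le; apply: cosine_asum => // i.
  have F0 : 0 <= fs i ^+ a * ft i ^+ b by rewrite mulr_ge0// exprn_ge0 ?fs_ge0 ?ft_ge0.
  rewrite /E normrM (ger0_norm F0).
  apply: le_trans (ler_wpM2l F0 (cosn_prod_taylor _ _ _ _ _ _)) _.
  have w0 := wt2_ge0 gm01 i; set w := wt2 gm i in w0 *.
  pose P := c * `|h| `^ gm * w.
  have P0 : 0 <= P by rewrite !mulr_ge0 ?powR_ge0.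
  have dxP : `|dx i| `^ gm <= P.
    apply: le_trans (fs_powR _ _) _; rewrite /P ler_wpM2r// normrM powRM//.
    rewrite [leLHS](_ : _ = cs * `|v.1| `^ gm * `|h| `^ gm); last by ring.
    by rewrite ler_wpM2r ?powR_ge0// /c lerDl.
  have dzP : `|dz i| `^ gm <= P.
    apply: le_trans (ft_powR _ _) _; rewrite /P ler_wpM2r// normrM powRM//.
    rewrite [leLHS](_ : _ = ct * `|v.2| `^ gm * `|h| `^ gm); last by ring.
    by rewrite ler_wpM2r ?powR_ge0// /c lerDr.
  apply: le_trans (_ : fs i ^+ a * ft i ^+ b * (2 * (P * `|dx i| + P * `|dx i| + P * `|dz i|)) <= _).
    rewrite ler_wpM2l// ler_wpM2l//; apply: lerD; last by rewrite ler_wpM2r.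
    by apply: lerD; rewrite ler_wpM2r.
  have -> : `|dx i| = fs i * (`|h| * `|v.1|) by rewrite /dx normrM (ger0_norm (fs_ge0 i)) normrM.
  have -> : `|dz i| = ft i * (`|h| * `|v.2|) by rewrite /dz normrM (ger0_norm (ft_ge0 i)) normrM.
  rewrite [leLHS](_ : _ = 2 * P * `|h| * (2 * `|v.1| * (fs i ^+ a.+1 * ft i ^+ b) + `|v.2| * (fs i ^+ a * ft i ^+ b.+1))); last first.
    by rewrite !exprS; ring.
  rewrite [leRHS](_ : _ = 2 * P * `|h| * (2 * `|v.1| * order_weight i + `|v.2| * order_weight i)); last first.
    by rewrite /P /C; ring.
  apply: ler_wpM2l; first by rewrite mulr_ge0// mulr_ge0.
  by apply: lerD; apply: ler_wpM2l; rewrite ?mulr_ge0// freq_le_order.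
apply/is_derive_epsP => e e0; pose C1 := C * M + 1.
have C10 : 0 < C1 by rewrite ltr_wpDl// mulr_ge0.
pose r := (e / C1) `^ gm^-1.
have r0 : 0 < r by rewrite powR_gt0// divr_gt0.
have rE : r `^ gm = e / C1 by rewrite -powRrM mulVf ?gt_eqF// powRr1// divr_ge0// ltW.
exists r => // h hr; apply: le_trans (key h) _; rewrite mulrAC mulrA ler_wpM2r//.
have hg : `|h| `^ gm <= e / C1 by rewrite -rE; apply: ge0_ler_powR; rewrite ?nnegrE//; exact: ltW.
apply: le_trans (ler_wpM2l _ hg) _; first by rewrite mulr_ge0.
rewrite mulrCA ler_piMr//; first exact: ltW.
by rewrite ler_pdivrMr// mul1r /C1 lerDl.
Qed.

Lemma cosine_sum_Ck k a b : (a + b + k <= 2)%N -> Ck k setT (V a b).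
Proof.
have oT : open (setT : set (R * R)) := openT.
elim: k a b => [|k IH] a b.
  by rewrite addn0 => ab; split=> // x _; exact: cosine_sum_continuous.
rewrite addnS ltnS => abk.
have ab1 : (a + b <= 1)%N by apply: leq_trans abk; exact: leq_addr.
apply: (@Ck_intro R (R * R)%type k setT (V a b) (fun v p : R * R => v.1 * V a.+1 b p + v.2 * V a b.+1 p) oT).
- by move=> x _; apply: cosine_sum_continuous; exact: leqW.
- by move=> x v _; exact: cosine_sum_derive.
- by move=> v; apply: CkD => //; apply: CkZ => //; apply: IH; rewrite ?addSn ?addnS ?addSn.
Qed.

Lemma cosine_sum_D1 a b : (a + b <= 1)%N -> 'D_(e1 R) (V a b) = V a.+1 b.
Proof.
move=> ab; apply/funext => p; rewrite (is_derive_val (cosine_sum_derive p (e1 R) ab)) /=.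
by rewrite mul1r mul0r addr0.
Qed.

Lemma cosine_sum_D2 a b : (a + b <= 1)%N -> 'D_(e2 R) (V a b) = V a b.+1.
Proof.
move=> ab; apply/funext => p; rewrite (is_derive_val (cosine_sum_derive p (e2 R) ab)) /=.
by rewrite mul1r mul0r add0r.
Qed.

Lemma cosine_sum_sup a b : (a + b <= 2)%N -> (sup_norm L (V a b) <= M%:E)%E.
Proof.
move=> ab; apply: ge_ereal_sup => _ [p _ <-]; rewrite lee_fin; exact: cosine_sum_le.
Qed.

Lemma cosine_sum_seminorm a b : (a + b <= 2)%N -> (holder_seminorm L gm (V a b) <= (2 * (cs + ct) * M)%:E)%E.
Proof.
move=> ab; apply: ge_ereal_sup => _ [p [q [_ _ pq ->]]]; rewrite lee_fin.
set d := Num.sqrt _.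
have M0 : 0 <= M := asum_ge0 HM.
have d1 : `|p.1 - q.1| <= d by rewrite -sqrtr_sqr; apply: ler_wsqrtr; rewrite lerDl sqr_ge0.
have d2 : `|p.2 - q.2| <= d by rewrite -sqrtr_sqr; apply: ler_wsqrtr; rewrite lerDr sqr_ge0.
have d0 : 0 < d.
  rewrite sqrtr_gt0 lt_neqAle addr_ge0 ?sqr_ge0// andbT eq_sym paddr_eq0 ?sqr_ge0// !sqrf_eq0 !subr_eq0.
  apply/negP => /andP[/eqP h1 /eqP h2]; apply: pq.
  by rewrite (surjective_pairing p) (surjective_pairing q) h1 h2.
rewrite ler_pdivrMr ?powR_gt0//; apply: le_trans (cosine_sum_holder p q ab) _.
rewrite [leRHS]mulrAC ler_wpM2r// -mulrA ler_wpM2l// mulrDl.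
apply: lerD; rewrite ler_wpM2l ?powR_ge0//; apply: ge0_ler_powR; rewrite ?nnegrE//; exact: ltW.
Qed.

Let sum6 (T : Type) (h : T -> \bar R) (a b c d e g : T) :
  (\sum_(w <- [:: a; b; c; d; e; g]) h w = h a + (h b + (h c + (h d + (h e + h g)))))%E.
Proof. by rewrite !big_cons big_nil adde0. Qed.

Let sum3 (T : Type) (h : T -> \bar R) (a b c : T) : (\sum_(w <- [:: a; b; c]) h w = h a + (h b + h c))%E.
Proof. by rewrite !big_cons big_nil adde0. Qed.

Lemma C2holder_normE (u u1 u2 u11 u12 u22 : R * R -> R) : 'D_(e1 R) u = u1 -> 'D_(e2 R) u = u2 ->
  'D_(e1 R) u1 = u11 -> 'D_(e1 R) u2 = u12 -> 'D_(e2 R) u2 = u22 ->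
  C2holder_norm L gm u = (sup_norm L u + (sup_norm L u1 + (sup_norm L u2 + (sup_norm L u11 + (sup_norm L u12 + sup_norm L u22))))
    + (holder_seminorm L gm u11 + (holder_seminorm L gm u12 + holder_seminorm L gm u22)))%E.
Proof.
move=> E1 E2 E11 E12 E22; rewrite /C2holder_norm /partials1 /partials2 E1 E2 E11 E12 E22.
by congr (_ + _)%E; [exact: sum6|exact: sum3].
Qed.

Lemma cosine_sum_C2holder : (C2holder_norm L gm (V 0 0) <= ((6 + 3 * (2 * (cs + ct))) * M)%:E)%E.
Proof.
have E10 := @cosine_sum_D1 0 0 isT; have E01 := @cosine_sum_D2 0 0 isT.
have E20 := @cosine_sum_D1 1 0 isT; have E11 := @cosine_sum_D1 0 1 isT; have E02 := @cosine_sum_D2 0 1 isT.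
rewrite (C2holder_normE E10 E01 E20 E11 E02).
rewrite (_ : _ * M = (M + (M + (M + (M + (M + M))))) + (2 * (cs + ct) * M + (2 * (cs + ct) * M + 2 * (cs + ct) * M))); last by ring.
rewrite !EFinD; apply: leeD; last by do 2 (apply: leeD; first exact: cosine_sum_seminorm); exact: cosine_sum_seminorm.
by do 5 (apply: leeD; first exact: cosine_sum_sup); exact: cosine_sum_sup.
Qed.

End CosineSums.

(** * Completeness of the cosines *)

Section ModeExpansion.
Context {R : realType}.
Variable L : R.
Hypothesis L0 : 0 < L.
Local Notation S := (strip L).

Lemma smooth_C2_bounded (l : R) (h : R -> R) : 0 < l -> Ck 2 setT h -> exists B, C2_bounded l h B.
Proof.
move=> l0 Hh; have [hc _] := Hh.
have h1C : Ck 1 setT ('D_1 h) := Ck_derive (1 : R) Hh.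
have [h1c _] := h1C.
have [h2c _] : Ck 0 setT ('D_1 ('D_1 h)) := Ck_derive (1 : R) h1C.
have bnd (k : R -> R) : (forall x, setT x -> {for x, continuous k}) -> exists B, forall x, seg l x -> `|k x| <= B.
  move=> kc; have [p|B HB] := @cont_bounded R l (fun p : R * R => k p.1).
    by apply: (@continuous_comp _ _ _ fst k); [exact: cvg_fst|exact: kc].
  by exists B => x /andP[x0 xl]; apply: (HB (x, 0)); rewrite /cstrip /= x0 xl lerN10 ler01.
have [B0 H0] := bnd _ hc. have [B1 H1] := bnd _ h1c. have [B2 H2] := bnd _ h2c.
have der (k : R -> R) (x : R) : derivable k x 1 -> is_derive x 1 k ('D_1 k x) by move=> D; constructor.
exists (Num.max B0 (Num.max B1 B2)), ('D_1 h), ('D_1 ('D_1 h)) => x Sx.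
have d1 : derivable h x 1 by case: Hh => _ /(_ 1)[/(_ x Logic.I)].
have d2 : derivable ('D_1 h) x 1 by case: h1C => _ /(_ 1)[/(_ x Logic.I)].
split; [exact: der|exact: der| | |].
- by rewrite le_max H0.
- by rewrite !le_max H1 ?orbT.
- by rewrite !le_max H2 ?orbT.
Qed.

Let g00 : 0 <= (0 : R) < 1. Proof. by rewrite lexx ltr01. Qed.

Lemma bump2_wiener m (a b c d : R) : exists M, wiener (cstrip L) (mode L) (wt2 0) (bump2 m a b c d) M.
Proof.
have l2 : 0 < (2 : R) by [].
have [B1 H1] := smooth_C2_bounded L0 (bump_Ck 2 m a b).
(* The cosines in [t] are taken on [[0, 2]], hence the shift of the second bump by 1. *)
have [B2 H2] := smooth_C2_bounded l2 (bump_Ck 2 m (c + 1) (d + 1)).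
have [C1 HC1] := wiener_C2 g00 L0. have [C2 HC2] := wiener_C2 g00 l2.
exists (C1 * B1 * (C2 * B2)).
have := W2_tensor g00 (HC1 _ _ H1) (HC2 _ _ H2); apply: wiener_eq => p _.
rewrite /bump2 /bump; congr (_ * flat _ (_ * _ - _)); ring.
Qed.

Lemma mul_div_succ_le (x d : R) : 0 <= x -> 0 <= d -> x * (d / (x + 1)) <= d.
Proof.
move=> x0 d0; have x1 : 0 < x + 1 by rewrite ltr_wpDl.
by rewrite mulrCA ler_piMr// ler_pdivrMr// mul1r lerDl.
Qed.

Lemma functional_wiener0 (u h : R * R -> R) (M : R) : integ L u -> (forall i, functional L u (mode L i) = 0) ->
  wiener (cstrip L) (mode L) (wt2 0) h M -> functional L u h = 0.
Proof.
move=> Iu u0 Hh; have Nh := wiener_nice (wt2_ge1 g00) Hh.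
have [add scal bd] := functional_bounded Iu.
apply/eqP; rewrite -normr_le0; apply/ler_addgt0Pr => d d0; rewrite add0r.
have I0 : 0 <= \int[@leb2 R]_(p in S) `|u p| := Int_norm_ge0 _ _.
have I1 : 0 < \int[@leb2 R]_(p in S) `|u p| + 1 by rewrite ltr_wpDl.
have [l _ hl] := Hh _ (divr_gt0 d0 I1).
have Ne : nice L (eval (mode L) l) := nice_eval l (nice_mode L).
have E : functional L u (fun p => h p - eval (mode L) l p) = functional L u h.
  rewrite (functional_sub (nice_scale (L := L)) (functional_bounded Iu) Nh Ne).
  by rewrite (functional_sum l Iu (nice_mode L)) big1 ?subr0// => e _; rewrite u0 mulr0.
rewrite -E; apply: le_trans (bd _ _ (nice_sub Nh Ne) (fun p Sp => hl p (strip_cstrip Sp))) _.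
exact: mul_div_succ_le I0 (ltW d0).
Qed.

(** Bumps are C^2 in each variable, hence uniform limits of combinations of modes; what is
    orthogonal to all modes is orthogonal to all bumps. *)
Lemma modes_complete (u : R * R -> R) : integ L u -> (forall i, functional L u (mode L i) = 0) ->
  ae_eq_strip L u (fun _ => 0).
Proof.
move=> Iu u0; apply: null_of_bumps => // m a b c d _ _ _ _ _ _.
by have [M HM] := bump2_wiener m a b c d; exact: functional_wiener0 HM.
Qed.

Lemma mode_jetE i p : mode_jet L 0 0 p i = mode L i p.
Proof.
rewrite /mode_jet /mode /cosl /cosn !mul0r !addr0 !expr0 !mul1r /freq_s /freq_t.
by congr (cos _ * cos _); rewrite -mulrA; congr (_ * _); rewrite mulrAC.
Qed.

Variable gm : R.
Hypothesis gm0 : 0 < gm.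
Hypothesis gm1 : gm < 1.
Variables (y : nat * nat -> R) (M : R).
Hypothesis HM : asum (fun i => y i * (order_weight L i * wt2 gm i)) M.

Lemma cosine_sum_coef l : functional L (mode L l) (cosine_sum L y 0 0) = y l * mode_norm L l.
Proof.
pose w_ (n : nat) p : R := \sum_(i <- enum_upto n) y i * mode L i p.
have Em n p : w_ n p = eval (mode L) [seq (y i, i) | i <- enum_upto n] p by rewrite /w_ /eval big_map.
have Nw n : nice L (w_ n).
  by have -> : w_ n = eval (mode L) [seq (y i, i) | i <- enum_upto n] by [apply/funext]; exact: nice_eval (nice_mode L).
have A p : asum (fun i => y i * mode L i p) M.
  have := mode_jet_asum L0 gm0 gm1 HM p (isT : (0 + 0 <= 2)%N).
  by congr (asum _ _); apply/funext => i; rewrite mode_jetE.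
have lim1 := @Int_dct R L (mode L l) w_ (cosine_sum L y 0 0) M (nice_integ1 L0 (nice_mode L l)) (fun n => (Nw n).1).
have {}lim1 : functional L (mode L l) (w_ n) @[n --> \oo] --> functional L (mode L l) (cosine_sum L y 0 0).
  apply: lim1 => [n p _|p _].
    apply: le_trans (ler_norm_sum _ _ _) _; exact: A (enum_upto_uniq n).
  have := tsum_cvg (A p); rewrite /cosine_sum (_ : (fun i => y i * mode_jet L 0 0 p i) = fun i => y i * mode L i p)//.
  by apply/funext => i; rewrite mode_jetE.
apply: (cvg_unique _ lim1) => //; apply: cvg_near_cst; exists (pickle l).+1 => // n /= ln.
have -> : w_ n = eval (mode L) [seq (y i, i) | i <- enum_upto n] by apply/funext.
rewrite functional_sum//; [|exact: nice_integ1 (nice_mode L l)|exact: nice_mode].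
rewrite big_map (bigD1_seq l) ?mem_enum_upto ?enum_upto_uniq//= big1 ?addr0 => [|i il].
  by [].
by rewrite mode_orth// eq_sym (negbTE il) mulr0.
Qed.

(** [z] is merely integrable; by comparison of coefficients it acquires the regularity of the
    series. *)
Lemma mode_expansion (z : R * R -> R) : integ L z -> (forall i, functional L z (mode L i) = y i * mode_norm L i) ->
  ae_eq_strip L z (cosine_sum L y 0 0).
Proof.
move=> Iz Hz; pose V := cosine_sum L y 0 0.
have NV : nice L V by apply: nice_continuous => //; exact: (cosine_sum_continuous L0 gm0 gm1 HM).
have IV : integ L V := nice_integ1 L0 NV.
have : ae_eq_strip L (fun p => z p - V p) (fun _ => 0).
  apply: modes_complete; first exact: integ_sub.
  move=> i; rewrite /functional.
  rewrite (Int_ext (_ : forall p, S p -> _ = z p * mode L i p - V p * mode L i p)); last by move=> p _; rewrite mulrBl.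
  rewrite Int_sub; [|exact: nice_integ Iz (nice_mode L i)|exact: nice_integ IV (nice_mode L i)].
  apply/eqP; rewrite subr_eq0; apply/eqP; rewrite -[LHS]/(functional L z (mode L i)) Hz -cosine_sum_coef.
  by apply: Int_ext => // p _; rewrite mulrC.
by apply: ae_leb2_imp => p H Sp; apply/eqP; rewrite -subr_eq0; apply/eqP; exact: H.
Qed.

End ModeExpansion.

(** * Coefficients of the operator in terms of G *)

Section DensityCoefficients.
Context {R : realType}.
Variables (L rho : R) (G : 'rV[R]_2 -> R).
Hypothesis L0 : 0 < L.
Hypothesis rho0 : 0 < rho.
Hypothesis GC : Ck 6 (tube L rho) G.
Hypothesis G1 : forall s : R, - rho < s < L + rho -> G (pt s 0) = 1.

Lemma tube_half s t (r : R) : 0 < r -> - (r / 2) <= s <= L + r / 2 -> `|t| <= r / 2 -> tube L r (pt s t).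
Proof.
move=> r0 /andP[s1 s2] t1; have r2 : r / 2 < r by rewrite ltr_pdivrMr// mulr_natr mulr2n ltrDl.
rewrite /tube /= pt0 pt1; split; last exact: le_lt_trans r2.
apply/andP; split; first by apply: lt_le_trans s1; rewrite ltrN2.
by apply: le_lt_trans s2 _; rewrite ltrD2l.
Qed.

(** [G] is 1 on the axis and its derivative in the second variable is bounded on a smaller tube. *)
Lemma density_ge_half : exists2 r, 0 < r <= rho & forall p, tube L r p -> 2^-1 <= G p.
Proof.
have c1 : Ck 0 (tube L rho) (pd 1 G) by apply: Ck_derive; exact: Ck_le GC.
have [B HB] := @slab_bounded R (- (rho / 2)) (L + rho / 2) (rho / 2) (tube L rho) (pd 1 G)
  (fun p => Ck_continuous c1) (fun s t => @tube_half s t rho rho0).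
pose r := Num.min (rho / 2) (2^-1 / (`|B| + 1)).
have r0 : 0 < r by rewrite lt_min divr_gt0// divr_gt0// invr_gt0.
have rr : r <= rho / 2 by rewrite ge_min lexx.
have r2 : rho / 2 < rho by rewrite ltr_pdivrMr// mulr_natr mulr2n ltrDl.
exists r; first by rewrite r0 (le_trans rr)// ltW.
move=> p; rewrite [p]ptE /tube /= pt0 pt1; move: (p 0 0) (p 0 1) => s t [/andP[s1 s2] tr].
have sr : - (rho / 2) <= s <= L + rho / 2.
  apply/andP; split; first by apply: le_trans (ltW s1); rewrite lerN2.
  by apply: le_trans (ltW s2) _; rewrite lerD2l.
have tau (z : R) : 0 <= z <= 1 -> `|z * t| <= rho / 2.
  move=> /andP[z0 z1]; rewrite normrM (ger0_norm z0); apply: le_trans (ler_piMl _ z1) _ => //.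
  by apply: le_trans (ltW tr) rr.
have der (z : R) : 0 <= z <= 1 ->
    is_derive (z *: t + 0) t (fun x => G (pt s (1 * x))) (t * (1 * pd 1 G (pt s (1 * (z *: t + 0))))).
  move=> z01; apply: is_derive_scalar; apply: is_derive_slice.
  apply: (Ck_is_derive (e_ 1) (Ck_le (isT : (1 <= 6)%N) GC)); apply: tube_half => //.
  by rewrite mul1r addr0; exact: tau.
have [z /tau z01] := @mvt_line R R (fun x => G (pt s (1 * x))) (fun x => t * (1 * pd 1 G (pt s (1 * x)))) 0 t der.
rewrite addr0 mulr0 !mul1r addr0 G1; last first.
  by apply/andP; split; [apply: lt_trans s1; rewrite ltrN2|apply: lt_trans s2 _; rewrite ltrD2l]; apply: le_lt_trans rr r2.
move=> E; have : `|G (pt s t) - 1| <= 2^-1.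
  rewrite E normrM; apply: le_trans (_ : 2^-1 / (`|B| + 1) * `|B| <= _).
    apply: ler_pM => //; first by apply: le_trans (ltW tr) _; rewrite ge_min lexx orbT.
    by apply: le_trans (HB _ _ sr z01) (ler_norm _).
  by rewrite -mulrA ler_piMr ?invr_ge0// mulrC ler_pdivrMr// mul1r lerDl.
by rewrite ler_norml => /andP[h _]; lra.
Qed.

(** The 1 is subtracted so that the function vanishes on the axis, as the second part of [W2_slice]
    demands. *)
Definition inv_density (p : 'rV[R]_2) : R := (G p)^-1 - 1.
Definition density_slice (e : R) (p : R * R) : R := G (pt p.1 (e * p.2)).
Definition inv_slice (e : R) (p : R * R) : R := inv_density (pt p.1 (e * p.2)) + 1.
Definition inv_slice_s (e : R) (p : R * R) : R := pd 0 inv_density (pt p.1 (e * p.2)).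
Definition density_slice_t (e : R) (p : R * R) : R := e * pd 1 G (pt p.1 (e * p.2)).

Lemma inv_sliceE e p : inv_slice e p = (density_slice e p)^-1.
Proof. by rewrite /inv_slice /inv_density subrK. Qed.

Variable r : R.
Hypothesis r0 : 0 < r.
Hypothesis r_le : r <= rho.
Hypothesis Gr : forall p, tube L r p -> 2^-1 <= G p.

Let rG : Ck 6 (tube L r) G.
Proof.
apply: Ck_sub GC => p [/andP[s1 s2] t]; split; last exact: lt_le_trans r_le.
by apply/andP; split; [apply: le_lt_trans s1; rewrite lerN2|apply: lt_le_trans s2 _; rewrite lerD2l].
Qed.

Let rQ : Ck 6 (tube L r) inv_density.
Proof.
apply: CkB; [exact: tube_open| |apply: Ck_cst; exact: tube_open].
apply: Ck_inv => //; first exact: tube_open.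
by move=> p /Gr h; rewrite gt_eqF//; apply: lt_le_trans h; rewrite invr_gt0.
Qed.

Let rG1 (s : R) : - r < s < L + r -> G (pt s 0) = 1.
Proof.
move=> /andP[s1 s2]; apply: G1.
by apply/andP; split; [apply: le_lt_trans s1; rewrite lerN2|apply: lt_le_trans s2 _; rewrite lerD2l].
Qed.

Let in_tube e s t : 0 < e -> e <= r / 2 -> cstrip L (s, t) -> tube L r (pt s (e * t)).
Proof.
move=> e0 er [/= /andP[s1 s2] t1]; have r20 : 0 <= r / 2 by rewrite divr_ge0// ltW.
apply: tube_half => //.
  by apply/andP; split; [apply: le_trans s1; rewrite oppr_le0|apply: le_trans s2 _; rewrite lerDl].
rewrite normrM (gtr0_norm e0); apply: le_trans er; apply: ler_piMr; first exact: ltW.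
by rewrite ler_norml.
Qed.

Lemma is_derive_inv_slice e s t : 0 < e -> e <= r / 2 -> cstrip L (s, t) ->
  is_derive s 1 (fun s => inv_slice e (s, t)) (inv_slice_s e (s, t)).
Proof.
move=> e0 er st; rewrite -[inv_slice_s _ _]addr0; apply: is_deriveD.
by rewrite /inv_slice_s /=; apply: is_derive_pt0; exact: (Ck_is_derive (e_ 0) (Ck_le (isT : (1 <= 6)%N) rQ) (in_tube e0 er st)).
Qed.

Lemma is_derive_density_slice e s t : 0 < e -> e <= r / 2 -> cstrip L (s, t) ->
  is_derive t 1 (fun t => density_slice e (s, t)) (density_slice_t e (s, t)).
Proof.
move=> e0 er st; apply: is_derive_slice.
exact: (Ck_is_derive (e_ 1) (Ck_le (isT : (1 <= 6)%N) rG) (in_tube e0 er st)).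
Qed.

(** [G - 1], [1 / G - 1] and the derivative of the latter along the axis vanish on the axis; the
    derivative in [t] of the slice carries an explicit factor [e]. *)
Lemma thin_coefs_slice g : 0 <= g < 1 -> exists2 C, 0 <= C & forall e, 0 < e -> e <= 1 -> e <= r / 2 ->
  thin_coefs L (density_slice e) (inv_slice e) (inv_slice_s e) (density_slice_t e) g (C * e).
Proof.
move=> g01; have ot : open (tube L r : set 'rV[R]_2) := @tube_open R L r.
have H1C : Ck 5 (tube L r) (fun p => G p - 1) by apply: CkB => //; [exact: Ck_pred rG|exact: Ck_cst].
have [C1 C10 H1] := W2_slice g01 L0 r0 H1C.
have [C2 C20 H2] := W2_slice g01 L0 r0 (Ck_pred rQ).
have [C3 C30 H3] := W2_slice g01 L0 r0 (Ck_derive (e_ 0) rQ).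
have [C4 C40 H4] := W2_slice g01 L0 r0 (Ck_derive (e_ 1) rG).
have Q0 (s : R) : - r < s < L + r -> inv_density (pt s 0) = 0.
  by move=> /rG1 E; rewrite /inv_density E invr1 subrr.
exists (C1 + C2 + C3 + C4); first by rewrite !addr_ge0.
move=> e e0 e1 er; have e0' := ltW e0; split.
- have [_ h] := H1 e e0 e1 er.
  apply: wiener_le (h _); first by rewrite ler_wpM2r// -!addrA lerDl !addr_ge0.
  by move=> s /rG1 ->; rewrite subrr.
- have [_ h] := H2 e e0 e1 er.
  apply: wiener_eq (wiener_le _ (h Q0)) => [p _|]; first by rewrite /inv_slice addrK.
  by rewrite ler_wpM2r// -!addrA [leRHS]addrCA lerDl !addr_ge0.
- have [_ h] := H3 e e0 e1 er.
  apply: wiener_le (h _); first by rewrite ler_wpM2r// -addrA [leRHS]addrCA lerDl !addr_ge0.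
  exact: (@pd_iter_axis _ _ 1 r inv_density (Ck_le (isT : (1 <= 6)%N) rQ) r0 Q0).
- have [h _] := H4 e e0 e1 er.
  apply: wiener_le (wiener_scale e h); rewrite (ger0_norm e0') [leLHS]mulrC ler_wpM2r//.
  by rewrite lerDr !addr_ge0.
Qed.

End DensityCoefficients.

(** * Spectral gap and closeness in L^1 *)

Section ThinEigenfunction.
Context {R : realType}.
Variable L : R.
Hypothesis L0 : 0 < L.
Local Notation S := (strip L).
Local Notation mu := (@leb2 R).
Local Notation "'Int' u" := (\int[mu]_(p in S) u p) (at level 10, u at level 9).

Lemma L2_sqr_integ (u : R * R -> R) : L2 L u -> integ L (fun p => u p ^+ 2).
Proof. by move=> [_ H]; apply: (integ_ext (H : integ L _)) => p _; rewrite mul1r. Qed.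

Lemma nice_norm u : nice L u -> nice L (fun p => `|u p|).
Proof.
move=> [mu' [K HK]]; split; first exact: measurableT_comp.
by exists K => p Sp; rewrite normr_id HK.
Qed.

Lemma young_norm (d x : R) : 0 < d -> 0 <= d / 2 + (2 * d)^-1 * x ^+ 2 - `|x|.
Proof.
move=> d0; rewrite (_ : _ - _ = (2 * d)^-1 * (d - `|x|) ^+ 2).
  by rewrite mulr_ge0 ?sqr_ge0// invr_ge0 mulr_ge0// ltW.
by rewrite -(real_normK (num_real x)); move: `|x| => z; field; rewrite gt_eqF.
Qed.

(** The inequality |x| <= d / 2 + x^2 / (2 d) is integrated over the strip, whose area is 2 L. *)
Lemma L1_le_L2norm (u h : R * R -> R) (d : R) : L2 L u -> nice L h -> 0 < d ->
  L2norm L (fun p => u p - h p) <= d -> Int (fun p => `|u p - h p|) <= (L + 2^-1) * d.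
Proof.
move=> Hu Nh d0 Hd.
have Iu := L2_integ L0 Hu; have Iz : integ L (fun p => u p - h p) := integ_sub Iu (nice_integ1 L0 Nh).
have I2 : integ L (fun p => (u p - h p) ^+ 2).
  apply: (integ_ext (integ_add (L2_sqr_integ Hu) (integ_sub (nice_integ1 L0 (nice_mul Nh Nh)) (integ_scale 2 (nice_integ Iu Nh))))) => p _.
  by ring.
have X0 : 0 <= Int (fun p => (u p - h p) ^+ 2).
  rewrite (Int_ext (_ : forall p, S p -> _ = `|(u p - h p) ^+ 2|)); first exact: Int_norm_ge0.
  by move=> p _; rewrite ger0_norm// sqr_ge0.
have X1 : Int (fun p => (u p - h p) ^+ 2) <= d ^+ 2.
  by rewrite -(sqr_sqrtr X0) ler_sqr// ?nnegrE ?sqrtr_ge0// ltW.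
have Iw : integ L (fun p => d / 2 + (2 * d)^-1 * (u p - h p) ^+ 2) := integ_add (integ_cst L0 (d / 2)) (integ_scale _ I2).
have : 0 <= Int (fun p => (d / 2 + (2 * d)^-1 * (u p - h p) ^+ 2) - `|u p - h p|).
  rewrite (Int_ext (_ : forall p, S p -> _ = `|(d / 2 + (2 * d)^-1 * (u p - h p) ^+ 2) - `|u p - h p| |)); first exact: Int_norm_ge0.
  by move=> p _; rewrite [RHS]ger0_norm// young_norm.
rewrite Int_sub//; last exact: integ_norm.
rewrite Int_add//; [|exact: integ_cst|exact: integ_scale].
rewrite Int_cst// Int_scale// subr_ge0 => /le_trans; apply.
have : (2 * d)^-1 * Int (fun p => (u p - h p) ^+ 2) <= (2 * d)^-1 * d ^+ 2.
  by rewrite ler_wpM2l// invr_ge0 mulr_ge0// ltW.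
move=> H; apply: le_trans (lerD (lexx _) H) _.
rewrite le_eqVlt; apply/orP; left; apply/eqP; field; by rewrite gt_eqF.
Qed.

Lemma psi0_mode n p : psi0 L n p = (Num.sqrt L)^-1 * mode L (n.-1, 0%N) p.
Proof. by rewrite /psi0 /mode cosl0 mulr1 /cosl /= !mulrA. Qed.

Lemma sqr_freq_dist (j m : nat) : j != m -> (pi / L) ^+ 2 <= `|(j%:R * (pi / L)) ^+ 2 - (m%:R * (pi / L)) ^+ 2|.
Proof.
move=> jm; move: (pi / L) => a; rewrite !exprMn -mulrBl normrM [`|a ^+ 2|]ger0_norm ?sqr_ge0//.
rewrite -[leLHS]mul1r ler_wpM2r ?sqr_ge0// -!natrX.
have [h|h] := leqP (m ^ 2) (j ^ 2).
  rewrite -natrB// ger0_norm// ler1n subn_gt0 ltn_neqAle h andbT eq_sym.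
  by rewrite eqn_exp2r.
rewrite distrC -natrB ?(ltnW h)// ger0_norm// ler1n subn_gt0 //.
Qed.

Variable m : nat.
Local Notation i0 := (m, 0%N).
Definition base_eigenvalue : R := freq_s L i0 ^+ 2.
Local Notation lam0 := base_eigenvalue.

(** If X is at distance d >= (pi / L)^2 from lam0, then 1 + X <= 1 + lam0 + d, and this is at most
    ((1 + lam0) / (pi / L)^2 + 1) d. *)
Definition gap_const : R := ((1 + lam0) / (pi / L) ^+ 2 + 1)^-1.

Lemma base_eigenvalue_ge0 : 0 <= lam0. Proof. exact: sqr_ge0. Qed.

Let piL2_gt0 : 0 < (pi / L) ^+ 2. Proof. by rewrite exprn_gt0// divr_gt0 ?pi_gt0. Qed.

Lemma gap_const_gt0 : 0 < gap_const.
Proof. by rewrite invr_gt0 ltr_wpDl// divr_ge0 ?(ltW piL2_gt0)// addr_ge0 ?base_eigenvalue_ge0. Qed.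

(** For modes depending on [t] the free eigenvalue is at least (pi / (2 e))^2, which for small [e]
    exceeds lam0 + (pi / L)^2; for the others, squares of distinct integers differ by at least 1. *)
Lemma spectral_gap (e : R) i : 0 < e -> e ^+ 2 * (lam0 + (pi / L) ^+ 2) <= (pi / 2) ^+ 2 -> i != i0 ->
  gap_const * mode_weight L e i <= `|free_eigenvalue L e i - lam0|.
Proof.
move=> e0 He ii.
have far : (pi / L) ^+ 2 <= `|free_eigenvalue L e i - lam0|.
  case: i ii => j k ii; rewrite /free_eigenvalue /freq_t /base_eigenvalue /freq_s /=.
  case: k ii => [|k] ii.
    rewrite mul0r expr0n mulr0 addr0; apply: sqr_freq_dist.
    by apply: contra ii => /eqP ->.
  apply: le_trans (ler_norm _); rewrite lerBrDl.
  apply: le_trans (_ : e ^- 2 * (pi / 2) ^+ 2 <= _).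
    by rewrite ler_pdivlMl ?exprn_gt0.
  apply: le_trans (_ : e ^- 2 * (k.+1%:R * (pi / 2)) ^+ 2 <= _); last by rewrite lerDr sqr_ge0.
  rewrite ler_wpM2l ?invr_ge0 ?exprn_ge0 ?(ltW e0)//; move: (pi / 2) => b; rewrite exprMn ler_peMl ?sqr_ge0//.
  by rewrite -natrX ler1n.
rewrite /gap_const ler_pdivrMl; last by rewrite -invr_gt0 gap_const_gt0.
rewrite /mode_weight; move: far; set X := free_eigenvalue L e i; set d := `|_| => far.
have XD : X <= lam0 + d by rewrite -lerBlDl ler_norm.
apply: le_trans (lerD (lexx 1) XD) _; rewrite addrA mulrDl mul1r lerD2r.
rewrite mulrAC -mulrA ler_peMr ?addr_ge0 ?base_eigenvalue_ge0//.
by rewrite ler_pdivlMr// mul1r.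
Qed.

Lemma order_weight_le (e : R) i : 0 < e -> e <= 1 -> order_weight L i <= mode_weight L e i.
Proof.
move=> e0 e1; rewrite /order_weight /mode_weight /free_eigenvalue addrA lerD2l ler_peMl ?sqr_ge0//.
by rewrite invf_ge1 ?exprn_gt0// exprn_ile1// ltW.
Qed.

Lemma thin_coefs_le f q qs ft g (K K' : R) : K <= K' -> thin_coefs L f q qs ft g K -> thin_coefs L f q qs ft g K'.
Proof. by move=> KK [? ? ? ?]; split; apply: wiener_le KK _. Qed.

Lemma wt2_0 : wt2 0 = fun _ : nat * nat => 1 :> R.
Proof. by apply/funext => i; rewrite /wt2 /wt powRr0. Qed.

End ThinEigenfunction.

(** * Coefficient estimate for the eigenfunction *)

Section ThinEstimate.
Context {R : realType}.
Variables (L gm : R) (m : nat) (A B Cg Cz : R).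
Hypothesis L0 : 0 < L.
Hypothesis gm0 : 0 < gm.
Hypothesis gm1 : gm < 1.
Hypothesis A0 : 0 <= A.
Hypothesis B0 : 0 <= B.
Hypothesis Cg0 : 0 <= Cg.
Hypothesis Cz0 : 0 <= Cz.
Local Notation S := (strip L).
Local Notation mu := (@leb2 R).
Local Notation "'Int' u" := (\int[mu]_(p in S) u p) (at level 10, u at level 9).
Local Notation W2 w := (wiener (cstrip L) (mode L) w).
Local Notation i0 := (m, 0%N).
Local Notation lam0 := (base_eigenvalue L m).
Hypothesis HCg : forall i, W2 (wt2 gm) (mode_s L i) (Cg * freq_s L i ^+ 2 * wt2 gm i) /\
  W2 (wt2 gm) (mode_t L i) (Cg * freq_t i ^+ 2 * wt2 gm i).
Hypothesis HCz : forall i, W2 (wt2 0) (mode_s L i) (Cz * freq_s L i ^+ 2 * wt2 0 i) /\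
  W2 (wt2 0) (mode_t L i) (Cz * freq_t i ^+ 2 * wt2 0 i).

Let l1 : R := (Num.sqrt L)^-1.
(** Bound for the integral of [|psi|], from [|psi| <= |psi - base| + l1] on a strip of area
    [2 * L]. *)
Definition mass_bound : R := B + l1 * (L * 2).
(** Half of the lower bound for the pairing of [base] with its mode; the other half absorbs
    [psi - base]. *)
Definition mass_low : R := l1 * (L / 4).
Definition shift_const : R := 2 / mass_low * (mass_bound * (2 * lam0 + `|freq_s L i0|)) * A.
(** The relative size of the perturbation divided by [e]; [Cg + Cz] serves the weights with
    exponents [gm] and 0 at the same time. *)
Definition pert_const : R := (1 + (Cg + Cz)) * (1 + (lam0 + shift_const)) * (A + shift_const).
(** The first summand covers the coefficient at [i0], controlled only by the assumed closeness of
    [psi]; the second one covers all others, by [psi_coefs]. *)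
Definition coef_const : R := B / (L / 2) * (order_weight L i0 * wt2 gm i0)
  + mass_bound / (L / 2) * (2 * (pert_const / gap_const L m) * ((1 + lam0) * wt2 gm i0)).

Let l10 : 0 < l1. Proof. by rewrite invr_gt0 sqrtr_gt0. Qed.
Let U0 : 0 <= mass_bound. Proof. by rewrite addr_ge0// mulr_ge0 ?(ltW l10)// mulr_ge0// ltW. Qed.
Let m00 : 0 < mass_low. Proof. by rewrite mulr_gt0// divr_gt0. Qed.
Let K20 : 0 <= shift_const.
Proof.
rewrite mulr_ge0// mulr_ge0//; first by rewrite divr_ge0// ltW.
by rewrite mulr_ge0// addr_ge0// mulr_ge0// base_eigenvalue_ge0.
Qed.
Let K30 : 0 <= A + shift_const. Proof. exact: addr_ge0. Qed.
Let Lam0 : 0 <= lam0 + shift_const. Proof. by rewrite addr_ge0// base_eigenvalue_ge0. Qed.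
Let kap0 : 0 <= pert_const. Proof. by apply: mulr_ge0 => //; apply: mulr_ge0; apply: addr_ge0 => //; exact: addr_ge0. Qed.
Let gm01 : 0 <= gm < 1. Proof. by rewrite ltW. Qed.
Let z01 : 0 <= (0 : R) < 1. Proof. by rewrite lexx ltr01. Qed.
Let c0 : 0 < gap_const L m := gap_const_gt0 L0 m.

Variables (f q qs ft F psi : R * R -> R) (e lam : R).
Hypothesis e0 : 0 < e.
Hypothesis e1 : e <= 1.
Hypothesis dq : forall s t, cstrip L (s, t) -> is_derive s 1 (fun s => q (s, t)) (qs (s, t)).
Hypothesis df : forall s t, cstrip L (s, t) -> is_derive t 1 (fun t => f (s, t)) (ft (s, t)).
Hypothesis Hg : thin_coefs L f q qs ft gm (A * e).
Hypothesis Hz : thin_coefs L f q qs ft 0 (A * e).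
Hypothesis HF : forall p, S p -> F p = f p.
Hypothesis HFq : forall p, S p -> (F p)^-1 = q p.
Hypothesis Hpsi : Hgraph L F e psi (fun p => lam * psi p).
Let base p : R := l1 * mode L i0 p.
Hypothesis psi_close : Int (fun p => `|psi p - base p|) <= B * e.
Hypothesis s1 : B * e <= mass_low.
Hypothesis s2 : 2 * (A * e * mass_bound) <= mass_low.
Hypothesis s3 : 2 * (pert_const * e) <= gap_const L m.
Hypothesis s4 : e ^+ 2 * (lam0 + (pi / L) ^+ 2) <= (pi / 2) ^+ 2.

Let psiL2 : L2 L psi. Proof. by case: Hpsi => -[]. Qed.
Let Ipsi : integ L psi := L2_integ L0 psiL2.
Let Nbase : nice L base. Proof. by apply: nice_scale; exact: nice_mode. Qed.
Let Ibase : integ L base := nice_integ1 L0 Nbase.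
Let z p : R := psi p - base p.
Let Iz : integ L z := integ_sub Ipsi Ibase.

Let mass_le : Int (fun p => `|psi p|) <= mass_bound.
Proof.
have H : 0 <= Int (fun p => (`|z p| + l1) - `|psi p|).
  rewrite (Int_ext (_ : forall p, S p -> _ = `|(`|z p| + l1) - `|psi p| |)); first exact: Int_norm_ge0.
  move=> p _; rewrite [RHS]ger0_norm// subr_ge0 -[psi p](subrK (base p)).
  apply: le_trans (ler_normD _ _) _; rewrite lerD2l /base normrM (gtr0_norm l10).
  by rewrite ler_piMr ?(ltW l10)// mode_le1.
move: H; rewrite Int_sub; [|exact: integ_add (integ_norm Iz) (integ_cst L0 l1)|exact: integ_norm].
rewrite Int_add; [|exact: integ_norm|exact: integ_cst].
rewrite Int_cst// subr_ge0 => /le_trans; apply; rewrite lerD2r.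
by apply: le_trans psi_close _; rewrite ler_piMr.
Qed.

Let mass_ge : mass_low <= Int (fun p => psi p * mode L i0 p).
Proof.
have -> : Int (fun p => psi p * mode L i0 p) = Int (fun p => z p * mode L i0 p) + l1 * mode_norm L i0.
  rewrite (Int_ext (_ : forall p, S p -> _ = z p * mode L i0 p + l1 * (mode L i0 p * mode L i0 p))); last first.
    by move=> p _; rewrite /z /base; ring.
  have Im : integ L (fun p => mode L i0 p * mode L i0 p) := nice_integ1 L0 (nice_mul (nice_mode L i0) (nice_mode L i0)).
  rewrite Int_add; [|exact: nice_integ Iz (nice_mode L i0)|exact: integ_scale].
  by rewrite Int_scale.
have h : `|Int (fun p => z p * mode L i0 p)| <= mass_low.
  apply: le_trans s1; apply: le_trans psi_close; rewrite -[leRHS]mul1r.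
  by apply: Int_bound => //; [exact: (nice_mode L i0).1|move=> p _; exact: mode_le1].
have n1 : l1 * (L / 2) <= l1 * mode_norm L i0 by rewrite ler_wpM2l ?(ltW l10)// mode_norm_ge.
have E : l1 * (L / 2) = mass_low + mass_low by rewrite /mass_low; field.
move: h; rewrite ler_norml => /andP[h _]; rewrite E in n1.
by have := lerD h n1; rewrite addrA addNr add0r.
Qed.

Let null i : functional L psi (pert (mode L) (perturbation L f q qs ft e lam lam0)
  (fun i => free_eigenvalue L e i - lam0) i) = 0.
Proof. exact: (thin_null L0 lam0 dq df Hz i HF HFq Hpsi). Qed.

Let freq_t0 : freq_t i0 = 0 :> R. Proof. by rewrite /freq_t mul0r. Qed.

Let Ae0 : 0 <= A * e. Proof. by rewrite mulr_ge0// ltW. Qed.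

Lemma eigenvalue_shift : `|lam - lam0| <= shift_const * e.
Proof.
have small : 2 * (A * e * Int (fun p => `|psi p|)) <= mass_low.
  by apply: le_trans s2; rewrite ler_wpM2l// ler_wpM2l// mass_le.
apply: le_trans (eigenvalue_close L0 Hz psiL2 freq_t0 (erefl _) Ae0 (null i0) mass_ge small m00) _.
rewrite /shift_const -[leRHS]mulrA; apply: ler_wpM2r => //.
apply: ler_wpM2l; first by rewrite divr_ge0// ltW.
apply: ler_wpM2r; last exact: mass_le.
by rewrite addr_ge0// mulr_ge0// base_eigenvalue_ge0.
Qed.

Let dd0 : free_eigenvalue L e i0 - lam0 = 0.
Proof. by rewrite /free_eigenvalue freq_t0 expr0n mulr0 addr0 subrr. Qed.

Let K3e : 0 <= (A + shift_const) * e. Proof. by rewrite mulr_ge0// ltW. Qed.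
Let Ale : A * e <= (A + shift_const) * e. Proof. by rewrite ler_wpM2r ?(ltW e0)// lerDl. Qed.

Let shift_le : `|lam - lam0| <= (A + shift_const) * e.
Proof. by apply: le_trans eigenvalue_shift _; rewrite ler_wpM2r ?(ltW e0)// lerDr. Qed.

Let lam_le : `|lam| <= lam0 + shift_const.
Proof.
rewrite -[lam](subrK lam0) addrC; apply: le_trans (ler_normD _ _) _; apply: lerD.
  by rewrite ger0_norm// base_eigenvalue_ge0.
by apply: le_trans eigenvalue_shift _; rewrite ler_piMr.
Qed.

Let pert_le (C C' x : R) : 0 <= x -> C <= C' ->
  (1 + C) * (1 + (lam0 + shift_const)) * ((A + shift_const) * e) * x <= (1 + C') * (1 + (lam0 + shift_const)) * (A + shift_const) * e * x.
Proof.
move=> x0 CC; apply: ler_wpM2r => //; rewrite -[leRHS]mulrA; apply: ler_wpM2r => //.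
apply: ler_wpM2r; first exact: addr_ge0.
by rewrite lerD2l.
Qed.

Lemma psi_coefs (s : seq (nat * nat)) : uniq s -> i0 \notin s ->
  \sum_(i <- s) mode_weight L e i * wt2 gm i * (`|functional L psi (mode L i)| / mode_norm L i)
    <= mass_bound / (L / 2) * (2 * (pert_const / gap_const L m) * ((1 + lam0) * wt2 gm i0)) * e.
Proof.
move=> us is0.
have D1 := mode_weight_ge1 L e0.
have Dw0 g i : 0 <= g < 1 -> 0 <= mode_weight L e i * wt2 g i.
  by move=> g01; rewrite mulr_ge0 ?wt2_ge0// (le_trans ler01).
have HE i : W2 (wt2 gm) (perturbation L f q qs ft e lam lam0 i) (pert_const * e * (mode_weight L e i * wt2 gm i)).
  apply: wiener_le (perturbation_wiener e0 gm01 Cg0 HCg K3e (thin_coefs_le Ale Hg) shift_le lam_le i).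
  by apply: pert_le; [exact: Dw0|rewrite lerDl].
have HE0 i : W2 (fun _ => 1) (perturbation L f q qs ft e lam lam0 i) (pert_const * e * mode_weight L e i).
  have := perturbation_wiener e0 z01 Cz0 HCz K3e (thin_coefs_le Ale Hz) shift_le lam_le i.
  rewrite wt2_0 mulr1; apply: wiener_le.
  by apply: pert_le; [exact: le_trans ler01 (D1 i)|rewrite lerDr].
have Ke0 : 0 <= pert_const * e by apply: mulr_ge0 => //; exact: ltW.
have n0 : 0 < L / 2 by rewrite divr_gt0.
have I1 i : integ L (mode L i) := nice_integ1 L0 (nice_mode L i).
have IL : 0 <= L * 2 by rewrite mulr_ge0// ltW.
have bPhi i : bounded_functional S (nice L) (functional L (mode L i)) (L * 2).
  have [bA bS bB] := functional_bounded (I1 i); split=> // u M Nu HM.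
  have M0 : 0 <= M := le_trans (normr_ge0 _) (HM _ (strip_center L0)).
  apply: le_trans (bB u M Nu HM) _; rewrite ler_wpM2r//.
  have le1 p : S p -> `| `|mode L i p| | <= 1 by move=> _; rewrite normr_id; exact: mode_le1.
  have := le_trans (ler_norm _) (Int_bound (integ_cst L0 1) (nice_norm (nice_mode L i)).1 le1).
  rewrite mul1r (Int_ext (_ : forall p, S p -> 1 * `|mode L i p| = `|mode L i p|)); last by move=> p _; rewrite mul1r.
  by rewrite (Int_ext (_ : forall p, S p -> `|1 : R| = 1)) ?Int_cst ?mul1r// => p _; rewrite normr1.
have bcs Z k : bounded_functional S (nice L) Z k -> bounded_functional (cstrip L) (nice L) Z k.
  by move=> [bA bS bB]; split=> // u M Nu HM; apply: bB => // p /strip_cstrip; exact: HM.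
have H := @eigenfunction_coefs R _ _ (cstrip L) (mode L) (perturbation L f q qs ft e lam lam0) (wt2 gm)
  (mode_weight L e) (fun i => free_eigenvalue L e i - lam0) (mode_norm L) i0 (pert_const * e) (gap_const L m)
  (fun i p _ => mode_le1 L i p) (wt2_ge1 gm01) D1 c0 (fun i => spectral_gap L0 e0 s4) dd0 Ke0 s3 HE
  (nice L) (nice_cst L 0) (@nice_add R L) (@nice_scale R L) (nice_mode L) (nice_perturbation e lam lam0 Hz) HE0
  (functional L psi) (fun i => functional L (mode L i)) _ _ _ (Int_norm_ge0 L psi) IL n0
  (bcs _ _ (functional_bounded Ipsi)) (fun i => bcs _ _ (bPhi i)) null
  (thin_symmetric L0 e lam lam0 dq df Hz) (mode_orth L0) (mode_norm_ge L0) s us is0.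
apply: le_trans H _.
have n0' : L / 2 <= mode_norm L i0 := mode_norm_ge L0 i0.
have -> : mode_weight L e i0 = 1 + lam0.
  by rewrite /mode_weight; congr (1 + _); apply/eqP; rewrite -subr_eq0 dd0.
have w0 : 0 <= wt2 gm i0 by exact: wt2_ge0.
rewrite [leRHS](_ : _ = mass_bound / (L / 2) * (2 * (pert_const * e / gap_const L m) * ((1 + lam0) * wt2 gm i0))); last by ring.
apply: ler_wpM2r.
  apply: mulr_ge0; last by rewrite mulr_ge0// addr_ge0// base_eigenvalue_ge0.
  by apply: mulr_ge0 => //; apply: divr_ge0 => //; exact: ltW.
rewrite normrM normfV (ger0_norm (le_trans (ltW n0) n0')); apply: ler_pM => //.
- by rewrite invr_ge0 (le_trans (ltW n0)).
- apply: le_trans mass_le; rewrite -[leRHS]mul1r.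
  by apply: Int_bound => //; [exact: (nice_mode L i0).1|move=> p _; exact: mode_le1].
- by rewrite lef_pV2// posrE (lt_le_trans n0).
Qed.

Let coef i : R := functional L z (mode L i) / mode_norm L i.

Let n_gt0 i : 0 < mode_norm L i.
Proof. by apply: lt_le_trans (mode_norm_ge L0 i); rewrite divr_gt0. Qed.

(** By orthogonality the subtraction of [base] affects only the coefficient at [i0]. *)
Let coef_off i : i != i0 -> coef i = functional L psi (mode L i) / mode_norm L i.
Proof.
move=> ii; rewrite /coef; congr (_ / _).
have NM := nice_mode L.
have -> : functional L z (mode L i) = functional L psi (mode L i) - l1 * functional L (mode L i0) (mode L i).
  rewrite /functional (Int_ext (_ : forall p, S p -> _ = psi p * mode L i p - l1 * (mode L i0 p * mode L i p))); last first.
    by move=> p _; rewrite /z /base; ring.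
  have Im : integ L (fun p => mode L i0 p * mode L i p) := nice_integ1 L0 (nice_mul (NM i0) (NM i)).
  by rewrite Int_sub; [rewrite Int_scale|exact: nice_integ Ipsi (NM i)|exact: integ_scale].
by rewrite mode_orth// eq_sym (negbTE ii) mulr0 subr0.
Qed.

Let coef_at : `|coef i0| <= B / (L / 2) * e.
Proof.
rewrite /coef normrM normfV (gtr0_norm (n_gt0 _)) mulrAC.
have n0 : 0 < L / 2 by rewrite divr_gt0.
apply: ler_pM => //; first by rewrite invr_ge0 ltW.
  apply: le_trans psi_close; rewrite -[leRHS]mul1r.
  by apply: Int_bound => //; [exact: (nice_mode L i0).1|move=> p _; exact: mode_le1].
by rewrite lef_pV2// ?posrE//; exact: mode_norm_ge.
Qed.

Let term i : R := coef i * (order_weight L i * wt2 gm i).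

Let term_sum (s : seq (nat * nat)) : uniq s -> i0 \notin s ->
  \sum_(i <- s) `|term i| <= mass_bound / (L / 2) * (2 * (pert_const / gap_const L m) * ((1 + lam0) * wt2 gm i0)) * e.
Proof.
move=> us is0; apply: le_trans (psi_coefs us is0).
rewrite big_seq [leRHS]big_seq; apply: ler_sum => i si.
have ii : i != i0 by apply: contraNneq is0 => <-.
rewrite /term coef_off// !normrM normfV (gtr0_norm (n_gt0 i)) mulrC.
have w0 := wt2_ge0 gm01 i; have o0 := order_weight_ge0 L i.
rewrite (ger0_norm w0) (ger0_norm o0); apply: ler_wpM2r; first by rewrite divr_ge0// ltW.
by apply: ler_wpM2r => //; exact: order_weight_le.
Qed.

Lemma coef_asum : asum (fun i => coef i * (order_weight L i * wt2 gm i)) (coef_const * e).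
Proof.
move=> s us; rewrite -[X in X <= _]/(\sum_(i <- s) `|term i|) /coef_const mulrDl.
have h0 : `|term i0| <= B / (L / 2) * (order_weight L i0 * wt2 gm i0) * e.
  have w0 := wt2_ge0 gm01 i0; have o0 := order_weight_ge0 L i0.
  have ow : 0 <= order_weight L i0 * wt2 gm i0 by exact: mulr_ge0.
  by rewrite /term normrM (ger0_norm ow) [leRHS]mulrAC; apply: ler_wpM2r => //; exact: coef_at.
have [si|si] := boolP (i0 \in s).
  rewrite (bigD1_seq i0)//=; apply: lerD => //; rewrite -big_filter.
  by apply: term_sum; [exact: filter_uniq|rewrite mem_filter eqxx].
by apply: le_trans (term_sum us si) _; rewrite lerDr; apply: le_trans h0.
Qed.

Lemma thin_eigenfunction_estimate : exists y, asum (fun i => y i * (order_weight L i * wt2 gm i)) (coef_const * e) /\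
  ae_eq_strip L psi (fun p => base p + cosine_sum L y 0 0 p).
Proof.
exists coef; split; first exact: coef_asum.
have := mode_expansion L0 gm0 gm1 coef_asum Iz (fun i => _).
move=> /(_ ltac:(by move=> i; rewrite /coef divfK// gt_eqF)).
by apply: ae_leb2_imp => p H Sp; rewrite -H// /z addrC subrK.
Qed.

End ThinEstimate.

(** * Conclusion *)

Section Assembly.
Context {R : realType}.

Lemma at_right0P (P : R -> Prop) : (\forall e \near 0^'+, P e) -> exists2 d, 0 < d & forall e : R, 0 < e < d -> P e.
Proof.
move=> /nbhs_ballP[d d0 H]; exists d => // e /andP[e0 ed]; apply: H => //=.
by rewrite /ball /= sub0r normrN gtr0_norm.
Qed.

Lemma near_mul_le (K c : R) : 0 < c -> \forall e \near 0^'+, K * e <= c.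
Proof.
move=> c0; have d0 : 0 < c / (`|K| + 1) by rewrite divr_gt0// ltr_wpDl.
near=> e; have e0 : 0 < e by near: e; exact: nbhs_right_gt.
apply: le_trans (_ : `|K| * (c / (`|K| + 1)) <= _); last by apply: mul_div_succ_le => //; exact: ltW.
apply: le_trans (_ : `|K| * e <= _); first by rewrite ler_wpM2r ?ler_norm// ltW.
by rewrite ler_wpM2l//; near: e; exact: nbhs_right_le.
Unshelve. all: by end_near. Qed.

Lemma Ck2_closure (L : R) (u : R * R -> R) : Ck 2 setT u -> C2_closure L u.
Proof.
move=> Hu; split; first exact: Ck_sub Hu.
have cont k w : Ck k setT w -> continuous (w : R * R -> R) by move=> Hw p; exact: (Ck_continuous Hw).
have D1 v : Ck 1 setT ('D_v u) := Ck_derive v Hu.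
have D2 v v' : Ck 0 setT ('D_v ('D_v' u)) := Ck_derive v (D1 v').
move=> w wu; exists w; split=> //; apply: continuous_subspaceT.
move: wu; rewrite /partials1 /partials2 !inE.
case/or4P => [/eqP ->|/eqP ->|/eqP ->|/or3P[/eqP ->|/eqP ->|/eqP ->]].
- exact: cont Hu.
- exact: cont (D1 _).
- exact: cont (D1 _).
- exact: cont (D2 _ _).
- exact: cont (D2 _ _).
- exact: cont (D2 _ _).
Qed.

End Assembly.

Theorem mainTheorem4 (R : realType) (A : riemSurface R) (L : R)
    (Gam : R -> A) (N : R -> tvec A) (kappa : R -> R)
    (f : R -> R * R -> R) (lam : R -> nat -> R) (psi : R -> R * R -> R)
    (n : nat) :
  0 < L ->
  embedded_arclength_curve Gam 0 L ->
  unit_normal_field Gam 0 L N ->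
  curvature_along Gam 0 L N kappa ->
  (\forall eps \near 0^'+, is_jacobi_density Gam L N kappa eps (f eps)) ->
  (\forall eps \near 0^'+,
     exists2 c : R, 0 < c & forall p, strip L p -> c <= f eps p) ->
  (\forall eps \near 0^'+, eigenvalue_sequence L (f eps) eps (lam eps)) ->
  (2 <= n)%N ->
  (\forall eps \near 0^'+,
     eigenfunction L (f eps) eps (lam eps n.-1) (psi eps)) ->
  (exists M : R, \forall eps \near 0^'+,
     L2norm L (fun p => psi eps p - psi0 L n p) <= M * eps) ->
  forall gamma a : R, 0 < gamma < 1 -> a < 2^-1 ->
  exists C : R, \forall eps \near 0^'+,
    exists u : R * R -> R,
      [/\ C2_closure L u,
          ae_eq_strip L (psi eps) u &
          (C2holder_norm L gamma (fun p => (u p - psi0 L n p)%R)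
             <= (C * eps `^ ((1 - gamma) * a))%:E)%E].
Proof.
move=> L0 HG HN Hk HJ _ _ n2 Hpsi [M HM] gm a /andP[gm0 gm1] a2.
have gm01 : 0 <= gm < 1 by rewrite ltW.
have z01 : 0 <= (0 : R) < 1 by rewrite lexx ltr01.
have [d d0 Hd] := at_right0P HJ.
(* Order 6, since [W2_slice] asks for five derivatives and is applied to first derivatives of [G]
   and [1 / G]. *)
have [rho [G [rho0 GC G1 HfG]]] := global_density HG HN Hk 6 (ltW L0) d0 Hd.
have [r /andP[r0 rr] Gr] := density_ge_half rho0 GC G1.
have [A1 A10 HA1] := thin_coefs_slice L0 GC G1 r0 rr Gr gm01.
have [A2 A20 HA2] := thin_coefs_slice L0 GC G1 r0 rr Gr z01.
have [Cg Cg0 HCg] := W2_mode_derivatives L0 gm01.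
have [Cz Cz0 HCz] := W2_mode_derivatives L0 z01.
(* [A0] serves both weights. [B] converts the assumed L^2 rate into an L^1 rate by [L1_le_L2norm];
   [|M| + 1] makes it positive. *)
pose A0 := A1 + A2; pose B := (L + 2^-1) * (`|M| + 1).
have A00 : 0 <= A0 by rewrite addr_ge0.
have M1 : 0 < `|M| + 1 by rewrite ltr_wpDl.
have B0 : 0 <= B by rewrite mulr_ge0 ?(ltW M1)// addr_ge0 ?invr_ge0// ltW.
pose m := n.-1.
have low0 : 0 < mass_low L by rewrite mulr_gt0 ?invr_gt0 ?sqrtr_gt0// divr_gt0.
have gap0 := gap_const_gt0 L0 m.
pose cc := coef_const L gm m A0 B Cg Cz.
pose X := 6 + 3 * (2 * (cs L gm + ct gm)).
exists `|X * cc|.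
near=> e.
have e0 : 0 < e by near: e; exact: nbhs_right_gt.
have e1 : e <= 1 by near: e; exact: nbhs_right_le.
have er : e <= r / 2 by near: e; apply: nbhs_right_le; rewrite divr_gt0.
have erho : e < rho by near: e; exact: nbhs_right_lt.
have s1 : B * e <= mass_low L by near: e; exact: near_mul_le.
have s2 : 2 * (A0 * e * mass_bound L B) <= mass_low L.
  rewrite [leLHS](_ : _ = 2 * A0 * mass_bound L B * e); last by ring.
  by near: e; exact: near_mul_le.
have s3 : 2 * (pert_const L m A0 B Cg Cz * e) <= gap_const L m.
  by rewrite mulrA; near: e; exact: near_mul_le.
have s4 : e ^+ 2 * (base_eigenvalue L m + (pi / L) ^+ 2) <= (pi / 2) ^+ 2.
  have Y0 : 0 <= base_eigenvalue L m + (pi / L) ^+ 2 by rewrite addr_ge0 ?base_eigenvalue_ge0 ?sqr_ge0.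
  apply: le_trans (_ : (base_eigenvalue L m + (pi / L) ^+ 2) * e <= _).
    by rewrite mulrC ler_wpM2l// expr2 ler_piMr// ltW.
  by near: e; apply: near_mul_le; rewrite exprn_gt0// divr_gt0 ?pi_gt0.
have Hu : eigenfunction L (f e) e (lam e n.-1) (psi e) by near: e.
have HMe : L2norm L (fun p => psi e p - psi0 L n p) <= M * e by near: e.
have ge0 := ltW e0.
have Hf p : strip L p -> f e p = density_slice G e p.
  case: p => s t [/andP[p1 p2] p3]; apply: HfG; [by rewrite e0|by rewrite !ltW|].
  by rewrite ltr_norml.
have graph := Hu.1.
have E0 : psi0 L n = fun p => (Num.sqrt L)^-1 * mode L (m, 0%N) p by apply/funext => p; rewrite psi0_mode.
have close : \int[@leb2 R]_(p in strip L) `|psi e p - (Num.sqrt L)^-1 * mode L (m, 0%N) p| <= B * e.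
  rewrite -mulrA; apply: L1_le_L2norm => //; [by case: graph => -[]|exact: nice_scale (nice_mode _ _)|by rewrite mulr_gt0|].
  rewrite E0 in HMe; apply: le_trans HMe _; rewrite ler_wpM2r//.
  by apply: le_trans (ler_norm _) _; rewrite lerDl.
have Hfq p : strip L p -> (f e p)^-1 = inv_slice G e p by move=> Sp; rewrite inv_sliceE Hf.
have A1le : A1 * e <= A0 * e by rewrite ler_wpM2r// lerDl.
have A2le : A2 * e <= A0 * e by rewrite ler_wpM2r// lerDr.
have [y [Hy Ey]] := @thin_eigenfunction_estimate R L gm m A0 B Cg Cz L0 gm0 gm1 A00 B0 Cg0 Cz0 HCg HCz
  (density_slice G e) (inv_slice G e) (inv_slice_s G e) (density_slice_t G e) (f e) (psi e) e (lam e n.-1) e0 e1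
  (fun s t => is_derive_inv_slice GC r0 rr Gr e0 er) (fun s t => is_derive_density_slice GC r0 rr e0 er)
  (thin_coefs_le A1le (HA1 e e0 e1 er)) (thin_coefs_le A2le (HA2 e e0 e1 er))
  Hf Hfq graph close s1 s2 s3 s4.
exists (fun p => psi0 L n p + cosine_sum L y 0 0 p); split.
- apply: Ck2_closure; apply: CkD; [exact: openT| |exact: (cosine_sum_Ck L0 gm0 gm1 Hy)].
  by rewrite E0; apply: CkZ; [exact: openT|exact: mode_smooth].
- by rewrite E0.
- have -> : (fun p => (psi0 L n p + cosine_sum L y 0 0 p) - psi0 L n p) = cosine_sum L y 0 0.
    by apply/funext => p; rewrite addrAC subrr add0r.
  apply: le_trans (cosine_sum_C2holder L0 gm0 gm1 Hy) _; rewrite lee_fin mulrA.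
  apply: le_trans (_ : `|X * cc| * e <= _); first by rewrite ler_wpM2r// ler_norm.
  (* The bound obtained is of order [e]; as [e <= 1] and [(1 - gamma) * a <= 1], also for negative
     [a], it lies below the required power. *)
  rewrite ler_wpM2l// -[leLHS](powRr1 ge0); apply: ger_powR; first by rewrite e0.
  have [a0|a0] := leP a 0; first by apply: le_trans ler01; rewrite mulr_ge0_le0// subr_ge0 ltW.
  apply: mulr_ile1; [by rewrite subr_ge0 ltW|exact: ltW|by rewrite gerBl ltW|].
  by apply: le_trans (ltW a2) _; rewrite invf_le1// ler1n.
Unshelve. all: by end_near. Qed.
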